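(* Let $G$ be a countably infinite group and let $(L,\lambda)$ and $(K,\kappa)$ be standard probability spaces. If $\mathrm{H}(L,\lambda)=\mathrm{H}(K,\kappa)$, then the Bernoulli shifts $G\curvearrowright(L^G,\lambda^G)$ and $G\curvearrowright(K^G,\kappa^G)$ are isomorphic.
   Context: For a standard probability space $(L,\lambda)$ and a countable group $G$, the Bernoulli shift over $G$ with base $(L,\lambda)$ is the product probability space $(L^G,\lambda^G)$ together with the left-shift action $(g\cdot x)(t)=x(g^{-1}t)$ for $g,t\in G$, $x\in L^G$. The Shannon entropy is $\mathrm{H}(L,\lambda)=\sum_{\ell\in L}-\lambda(\ell)\log\lambda(\ell)$ if $\lambda$ has countable support (i.e. $\lambda$ is concentrated on a countable set; convention $0\log 0=0$; the value may be $+\infty$), and $\mathrm{H}(L,\lambda)=\infty$ otherwise. The equality of entropies is in $[0,\infty]$. Two probability-measure-preserving actions $G\curvearrowright(X,\mu)$ and $G\curvearrowright(Y,\nu)$ are isomorphic if there is a $G$-equivariant measure-space isomorphism $(X,\mu)\to(Y,\nu)$ (everything modulo null sets). *)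

(* Defs.v *)
From HB Require Import structures.
From mathcomp Require Import all_boot all_order all_algebra.
From mathcomp Require Import all_classical all_reals all_analysis.

Set Implicit Arguments.
Unset Strict Implicit.
Unset Printing Implicit Defensive.

Import Order.TTheory GRing.Theory Num.Theory.
Import numFieldNormedType.Exports.

Local Open Scope classical_set_scope.
Local Open Scope ring_scope.

(* Completeness is stated by hand: the library has no join of [metricType] with
   its complete uniform spaces. *)
Definition polish (R : realType) (M : metricType R) : Prop :=
  (forall F : set_system M, ProperFilter F -> cauchy F -> exists x : M, F --> x) /\
  (exists2 D : set M, countable D & dense D).

(* The measurable sets of [T] are the Borel sets of a Polish topology on [T];
   the topology is carried by a metric space in bijection with [T].  A standard
   probability space is a probability measure on such a [T]. *)
Definition standard_borel (R : realType) (d : measure_display)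
    (T : measurableType d) : Prop :=
  exists (M : metricType R) (f : T -> M),
    [/\ polish M, set_bij [set: T] [set: M] f &
        measurable = [set f @^-1` B | B in <<s (@open M) >>] :> set (set T)].

(* [ln 0 = 0] in the library, so atoms of measure zero contribute zero. *)
Definition shannon_entropy (R : realType) (d : measure_display)
    (L : measurableType d) (P : probability L R) : \bar R :=
  if `[< exists C : set L, [/\ countable C, measurable C & P C = 1%E] >]
  then (\esum_(l in [set: L]) (- (fine (P [set l]) * ln (fine (P [set l]))))%:E)%E
  else +oo%E.

Section product_space.
Variables (I : choiceType) (d : measure_display) (L : measurableType d).

Definition coordinate_sets : set (set (I -> L)) :=
  \bigcup_(i in [set: I])
    preimage_set_system [set: I -> L] (fun x => x i) measurable.

Definition power_space : measurableType coordinate_sets.-sigma :=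
  g_sigma_algebraType coordinate_sets.

Definition cylinder (s : seq I) (A : I -> set L) : set (I -> L) :=
  [set x | forall i, i \in s -> A i (x i)].

(* Finite measurable rectangles get the product of the measures of their sides.
   Together with [mu] being a measure this determines [mu]
   ([product_measure_unique]). *)
Definition is_product_measure (R : realType) (P : probability L R)
    (mu : probability power_space R) : Prop :=
  forall (s : seq I) (A : I -> set L), uniq s -> (forall i, measurable (A i)) ->
    mu (cylinder s A) = (\prod_(i <- s) fine (P (A i)))%:E.

Lemma measurable_coordinate (i : I) (B : set L) : measurable B ->
  measurable ((fun x => x i) @^-1` B : set power_space).
Proof.
move=> mB; apply: sub_sigma_algebra; exists i => //.
by exists B => //; rewrite setTI.
Qed.

Lemma measurable_cylinder (s : seq I) (A : I -> set L) :
  (forall i, measurable (A i)) -> measurable (cylinder s A : set power_space).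
Proof.
move=> mA; elim: s => [|i s IHs].
  rewrite (_ : cylinder _ _ = setT); first exact: measurableT.
  by apply/seteqP; split => x.
rewrite (_ : cylinder _ _ = (fun x => x i) @^-1` A i `&` cylinder s A).
  by apply: measurableI => //; exact: measurable_coordinate.
apply/seteqP; split => x /=.
  move=> h; split; first by apply: h; rewrite inE eqxx.
  by move=> j js; apply: h; rewrite inE js orbT.
by move=> [hi hs] j; rewrite inE => /orP[/eqP -> //|]; exact: hs.
Qed.

Lemma product_measure_unique (R : realType) (P : probability L R)
    (mu nu : probability power_space R) :
  is_product_measure P mu -> is_product_measure P nu ->
  forall E, measurable E -> mu E = nu E.
Proof.
move=> muP nuP E mE.
pose C : set (set power_space) := [set B | exists s A,
  [/\ uniq s, (forall i : I, measurable (A i)) & B = cylinder s A]].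
apply: (measure_unique C (fun=> setT)) => //.
- apply/seteqP; split.
    apply: smallest_sub; first exact: smallest_sigma_algebra.
    move=> _ [i _ [B mB <-]]; apply: sub_sigma_algebra.
    exists [:: i], (fun=> B); split=> //; rewrite setTI.
    apply/seteqP; split => x /=; first by move=> xB j; rewrite inE => /eqP ->.
    by apply; rewrite inE.
  apply: smallest_sub; first exact: sigma_algebra_measurable.
  by move=> _ [s [A [_ mA ->]]]; exact: measurable_cylinder.
- move=> _ _ [s [A [us mA ->]]] [t [B [ut mB ->]]].
  exists (undup (s ++ t)), (fun i => (if i \in s then A i else setT) `&`
                                     (if i \in t then B i else setT)).
  split; first exact: undup_uniq.
    by move=> i; apply: measurableI; case: ifP.
  apply/seteqP; split => x /=.
    by move=> [xA xB] i _; split; case: ifP => //; [exact: xA|exact: xB].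
  move=> h; split=> i ii; have := h i; rewrite mem_undup mem_cat ii ?orbT.
    by move=> /(_ isT)[].
  by move=> /(_ isT)[].
- move=> _; exists [::], (fun=> setT); split => //.
  by apply/seteqP; split.
- by apply/seteqP; split => // x _; exists 0%N.
- by move=> _ [s [A [us mA ->]]]; exact: (etrans (muP _ _ us mA) (esym (nuP _ _ us mA))).
- move=> _; exact: (le_lt_trans (probability_le1 mu measurableT) (ltry _)).
Qed.

End product_space.
Arguments power_space : clear implicits.

Section actions.
Variable G : groupType.

Record is_pmp_action (R : realType) (d : measure_display)
    (X : measurableType d) (mu : probability X R) (act : G -> X -> X) : Prop := {
  act_1 : forall x, act 1%g x = x ;
  act_M : forall g h x, act (g * h)%g x = act g (act h x) ;
  act_measurable : forall g, measurable_fun [set: X] (act g) ;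
  act_preserving : forall g A, measurable A -> mu (act g @^-1` A) = mu A }.

(* A measure-space isomorphism modulo null sets: a bimeasurable, measure
   preserving bijection between invariant conull sets; the values of [f]
   outside [X0] are irrelevant. *)
Definition pmp_isomorphic (R : realType) (d1 d2 : measure_display)
    (X : measurableType d1) (Y : measurableType d2)
    (mu : probability X R) (nu : probability Y R)
    (actX : G -> X -> X) (actY : G -> Y -> Y) : Prop :=
  exists (X0 : set X) (Y0 : set Y) (f : X -> Y),
    [/\ [/\ measurable X0, mu (~` X0) = 0%E &
            forall g x, X0 x -> X0 (actX g x)],
        [/\ measurable Y0, nu (~` Y0) = 0%E &
            forall g y, Y0 y -> Y0 (actY g y)],
        set_bij X0 Y0 f,
        [/\ measurable_fun X0 f,
            (forall A, measurable A -> A `<=` X0 -> measurable (f @` A)) &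
            forall B, measurable B -> mu (X0 `&` f @^-1` B) = nu B] &
        forall g x, X0 x -> f (actX g x) = actY g (f x)].

Definition bernoulli_shift (d : measure_display) (L : measurableType d)
    (g : G) (x : power_space G d L) : power_space G d L :=
  fun t => x (g^-1 * t)%g.

Lemma bernoulli_shift_pmp (R : realType) (d : measure_display)
    (L : measurableType d) (P : probability L R)
    (mu : probability (power_space G d L) R) :
  is_product_measure P mu -> is_pmp_action mu (@bernoulli_shift d L).
Proof.
move=> muP; have mS g : measurable_fun setT (@bernoulli_shift d L g).
  apply: (measurability (aT := power_space G d L) (rT := power_space G d L)
            (@coordinate_sets G d L)) => //.
  move=> _ [_ [i _ [B mB <-]] <-]; rewrite !setTI.
  exact: (@measurable_coordinate G d L (g^-1 * i)%g).
split => //.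
- by move=> x; apply/funext => t; rewrite /bernoulli_shift invg1 mul1g.
- by move=> g h x; apply/funext => t; rewrite /bernoulli_shift invgM mulgA.
move=> g A mA; pose f : {mfun power_space G d L >-> power_space G d L} :=
  HB.pack (@bernoulli_shift d L g) (isMeasurableFun.Build _ _ _ _ _ (mS g)).
apply: (product_measure_unique (mu := distribution mu f) _ muP mA) => s B us mB.
have ginj : injective (fun i : G => (g^-1 * i)%g) by exact: mulgI.
transitivity
    (mu (cylinder [seq (g^-1 * i)%g | i <- s] (fun i => B (g * i)%g))).
  congr (mu _); apply/seteqP; split => x /= h i.
    by move=> /mapP[j sj ->]; rewrite mulVKg; exact: h.
  by move=> si; have := h (g^-1 * i)%g (map_f _ si); rewrite mulVKg.
rewrite muP ?map_inj_uniq// big_map.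
by under eq_bigr do rewrite mulVKg.
Qed.

End actions.
Arguments bernoulli_shift : clear implicits.

(* Main.v *)
(** Two Bernoulli shifts whose bases give equal mass to a set share a factor: the
    sites where that set displays a fixed marker pattern.  Over this factor the
    cells between markers carry independent contents of equal conditional entropy.
    Optimal couplings of ever longer blocks of cells, each nearly a function, are
    refined so that their codes converge to an isomorphism over the factor.  Two
    arbitrary bases are linked by a chain of bases sharing an atom pairwise. *)
From HB Require Import structures.
Require Import Defs.
From mathcomp Require Import all_boot all_order all_algebra.
From mathcomp Require Import all_classical all_reals all_analysis.
From mathcomp Require Import measurable_realfun ring lra zify.

Set Implicit Arguments.
Unset Strict Implicit.
Unset Printing Implicit Defensive.

Import Order.TTheory GRing.Theory Num.Theory.
Import numFieldNormedType.Exports.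

Local Open Scope ring_scope.

(** Instead the marker sites are paired by measurable matchings along group elements, then the pairs
    are paired, and so on; freeness of the marker factor lets each matching exhaust almost all
    roots, and blocks become binary trees of cells. The entropy of long blocks concentrates because
    of the pairing itself: when the turn of a function comes, blocks above its average are paired
    with blocks below it, and ergodicity leaves over only blocks of one sign. A coupling becomes
    nearly functional by giving up one small subblock, whose entropy is the slack that absorbs all
    fluctuations. Codes converge because each earlier disagreement stays in the cost with weight
    [2 ^+ j] while the total cost stays below one. The scheme also requires positive content entropy
    over the markers; a third base with the same marker probability and smaller entropy certifies
    it. Producing such a base for an arbitrary event forces markers that involve at least two
    further sites. *)

Ltac seteq := apply/seteqP; split.
Notation measT := (measurable_fun setT).
Notation sdiff A B := ((A `\` B) `|` (B `\` A))%classic.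

Lemma le_of_eq disp (T : porderType disp) (x y : T) : x = y -> (x <= y)%O.
Proof. by move=> ->. Qed.

Lemma via disp (T : porderType disp) (y x z : T) : (x <= y -> y <= z -> x <= z)%O.
Proof. exact: le_trans. Qed.
Arguments via {disp T} y {x z}.

(** * Couplings of two finite laws with sparse support *)

Section finite_couplings.
Variable R : realType.

Lemma kernel_vector (I J : finType) (M : I -> J -> R) : (#|J| < #|I|)%N ->
  exists2 v : I -> R, (exists i, v i != 0) & forall j, \sum_i v i * M i j = 0.
Proof.
move=> JI; pose N : 'M[R]_(#|I|, #|J|) :=
  \matrix_(i, j) M (enum_val i) (enum_val j).
have : kermx N != 0.
  rewrite -mxrank_eq0 mxrank_ker -lt0n subn_gt0.
  exact: leq_ltn_trans (rank_leq_col _) JI.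
move=> /rowV0Pn[u /sub_kermxP uN /rV0Pn[i ui]].
exists (fun k => u 0 (enum_rank k)); first by exists (enum_val i); rewrite enum_valK.
move=> j; have := congr1 (fun w : 'rV_#|J| => w 0 (enum_rank j)) uN.
rewrite !mxE => uN0; rewrite -[RHS]uN0 (reindex_onto enum_val enum_rank) /=; last first.
  by move=> k _; rewrite enum_rankK.
apply: eq_big => [k|k _]; first by rewrite enum_valK eqxx.
by rewrite !mxE enum_valK enum_rankK.
Qed.

Lemma sum_pair (A B : finType) (f : A * B -> R) :
  \sum_p f p = \sum_a \sum_b f (a, b).
Proof. by rewrite pair_bigA; apply: eq_bigr => -[]. Qed.

Section reduction.
Variables A B : finType.
Implicit Types g c : A * B -> R.

Definition supp g := [set p | g p != 0].
Definition rsupp g := [set a | \sum_b g (a, b) != 0].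
Definition csupp g := [set b | \sum_a g (a, b) != 0].

(** A count of linear constraints: vanishing off the support, on the rows of [rsupp g] and on the
    columns of [csupp g] gives fewer equations than there are entries. In the remaining rows and
    columns [g] itself is zero, so the constraint on the support already settles them. *)
Lemma zero_marginal_direction g :
  (forall p, 0 <= g p) -> (#|rsupp g| + #|csupp g| < #|supp g|)%N ->
  exists v : A * B -> R, [/\ exists p, v p != 0, forall p, g p = 0 -> v p = 0,
    forall a, \sum_b v (a, b) = 0 & forall b, \sum_a v (a, b) = 0].
Proof.
move=> g0 lt_supp.
pose J : finType := ({p | p \notin supp g} + ({a | a \in rsupp g} + {b | b \in csupp g}))%type.
pose M (p : A * B) (j : J) : R := match j with
  | inl q => (p == val q)%:R
  | inr (inl a) => (p.1 == val a)%:R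
  | inr (inr b) => (p.2 == val b)%:R end.
have cJ : (#|J| < #|{: A * B}|)%N.
  rewrite !card_sum !card_sig.
  have -> : #|[pred p | p \notin supp g]| = #|~: supp g|.
    by apply: eq_card => p; rewrite !inE.
  have -> : #|[pred a | a \in rsupp g]| = #|rsupp g| by apply: eq_card.
  have -> : #|[pred b | b \in csupp g]| = #|csupp g| by apply: eq_card.
  by rewrite -(cardsC (supp g)) addnC ltn_add2r.
have [v v0 vM] := kernel_vector M cJ.
have vS p : g p = 0 -> v p = 0.
  move=> gp; have pS : p \notin supp g by rewrite inE gp eqxx.
  have := vM (inl (Sub p pS)); rewrite /= (bigD1 p)//= eqxx mulr1 big1 ?addr0//.
  by move=> i /negbTE ->; rewrite mulr0.
exists v; split=> //.
- move=> a; have [aS|aS] := boolP (a \in rsupp g); last first.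
    rewrite big1// => b _; apply: vS; move: aS; rewrite inE negbK => /eqP sa.
    exact: (@psumr_eq0P _ _ xpredT (fun b => g (a, b)) (fun b _ => g0 _) sa b isT).
  have := vM (inr (inl (Sub a aS))); rewrite /= => h; rewrite -[RHS]h.
  rewrite sum_pair/= (bigD1 a)//= [X in _ + X]big1 ?addr0; last first.
    by move=> i /negbTE ia; rewrite big1// => b _; rewrite ia mulr0.
  by apply: eq_bigr => b _; rewrite eqxx mulr1.
- move=> b; have [bS|bS] := boolP (b \in csupp g); last first.
    rewrite big1// => a _; apply: vS; move: bS; rewrite inE negbK => /eqP sb.
    exact: (@psumr_eq0P _ _ xpredT (fun a => g (a, b)) (fun a _ => g0 _) sb a isT).
  have := vM (inr (inr (Sub b bS))); rewrite /= => h; rewrite -[RHS]h.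
  rewrite sum_pair/=; apply: eq_bigr => a _; rewrite (bigD1 b)//= eqxx mulr1 big1 ?addr0//.
  by move=> i /negbTE ->; rewrite mulr0.
Qed.

(* A vertex of the transport polytope has at most [#|A| + #|B|] nonzero
   entries: as long as there are more, some direction keeps the marginals and
   can be followed, without increasing the cost, until an entry vanishes. *)
Lemma support_reduction g c : (forall p, 0 <= g p) ->
  exists g' : A * B -> R, [/\ forall p, 0 <= g' p,
    (forall a, \sum_b g' (a, b) = \sum_b g (a, b)) /\
    (forall b, \sum_a g' (a, b) = \sum_a g (a, b)),
    \sum_p g' p * c p <= \sum_p g p * c p,
    forall p, g p = 0 -> g' p = 0 &
    (#|supp g'| <= #|rsupp g| + #|csupp g|)%N].
Proof.
move: {2}(#|supp g|) (leqnn #|supp g|) => n; elim: n g => [|n IH] g gn g0.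
  by exists g; split=> //; move: gn; rewrite leqn0 => /eqP ->.
have [le|lt] := leqP #|supp g| (#|rsupp g| + #|csupp g|); first by exists g.
have [v0 [[p0 v0p0] v0S v0r v0c]] := zero_marginal_direction g0 lt.
wlog cv : v0 v0p0 v0S v0r v0c / \sum_p v0 p * c p <= 0 => [hw|].
  have [h|h] := leP (\sum_p v0 p * c p) 0; first exact: (hw v0).
  apply: (hw (fun p => - v0 p)).
  - by rewrite oppr_eq0.
  - by move=> p /v0S ->; rewrite oppr0.
  - by move=> a; rewrite sumrN v0r oppr0.
  - by move=> a; rewrite sumrN v0c oppr0.
  - by under eq_bigr do rewrite mulNr; rewrite sumrN oppr_le0 ltW.
(* A nonzero direction whose row sums vanish has a negative entry. *)
have [p1 p1neg] : exists p, v0 p < 0.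
  apply: contrapT => /forallNP h.
  have h' p : 0 <= v0 p by rewrite leNgt; exact/negP.
  move: p0 v0p0 => [a b] /eqP; apply.
  exact: (@psumr_eq0P _ _ xpredT (fun b => v0 (a, b)) (fun b _ => h' _) (v0r a) b isT).
(* The ratio test: the least [g p / - v0 p] over the negative entries is the longest step that keeps
   [g] nonnegative, and it makes the entry [p] vanish. *)
have [p pneg pmin] := @arg_minP _ R _ p1 (fun p => v0 p < 0) (fun p => g p / - v0 p) p1neg.
set t := g p / - v0 p in pmin.
have t0 : 0 <= t by rewrite divr_ge0// oppr_ge0 ltW.
pose g1 q := g q + t * v0 q.
have g1p : g1 p = 0.
  by rewrite /g1 /t invrN mulrN mulNr -mulrA mulVf ?mulr1 ?subrr// lt_eqF.
have g1ge q : 0 <= g1 q.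
  have [vq|vq] := ltP (v0 q) 0; last by rewrite addr_ge0// mulr_ge0.
  have := pmin q vq; rewrite ler_pdivlMr ?oppr_gt0// mulrN /g1 => h.
  by rewrite -lerBlDr sub0r.
have g1S q : g q = 0 -> g1 q = 0 by move=> gq; rewrite /g1 gq (v0S _ gq) mulr0 addr0.
have g1r a : \sum_b g1 (a, b) = \sum_b g (a, b).
  by rewrite big_split/= -mulr_sumr v0r mulr0 addr0.
have g1c b : \sum_a g1 (a, b) = \sum_a g (a, b).
  by rewrite big_split/= -mulr_sumr v0c mulr0 addr0.
have lt1 : (#|supp g1| < #|supp g|)%N.
  apply/proper_card/properP; split.
    by apply/fintype.subsetP => q; rewrite !inE; apply: contra_neq; exact: g1S.
  exists p; rewrite !inE ?g1p ?eqxx//.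
  by apply/eqP => gp; move: pneg; rewrite (v0S _ gp) ltxx.
have [g2 [g2ge [g2r g2c] g2cost g2S g2n]] := IH g1 (leq_trans lt1 gn) g1ge.
exists g2; split=> //.
- by split=> x; rewrite ?g2r ?g2c ?g1r ?g1c.
- apply: le_trans g2cost _; rewrite /g1.
  under eq_bigr do rewrite mulrDl -mulrA.
  by rewrite big_split/= -mulr_sumr gerDl mulr_ge0_le0.
- by move=> q /g1S /g2S.
- apply: leq_trans g2n _; apply: leq_add; apply/subset_leq_card/fintype.subsetP => x.
    by rewrite !inE g1r.
  by rewrite !inE g1c.
Qed.

End reduction.

(* Few [b]'s carry most of the mass of [B], and each [a] in [At] is lighter than
   [t]: a coupling with small support then has to send most of the mass of [A]
   along a function. *)
Lemma improve_coupling (A B : finType) (P : A -> R) (q : B -> R)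
    (d c : A -> B -> R) (At : {set A}) (Bt : {set B}) (t : R) (b0 : B) :
    (forall a, 0 <= P a) -> (forall b, 0 <= q b) -> (forall a b, 0 <= d a b) ->
    (forall a, P a * \sum_b q b * d a b = P a) ->
    (forall b, q b * \sum_a P a * d a b = q b) ->
    (forall a, a \in At -> P a <= t) -> 0 <= t ->
  exists (d' : A -> B -> R) (phi : A -> B),
  [/\ forall a b, 0 <= d' a b,
      (forall a, P a * \sum_b q b * d' a b = P a) /\
      (forall b, q b * \sum_a P a * d' a b = q b),
      \sum_a \sum_b P a * q b * d' a b * c a b <=
      \sum_a \sum_b P a * q b * d a b * c a b &
      \sum_a \sum_b P a * q b * d' a b * (b != phi a)%:R <=
      \sum_(a | a \notin At) P a + \sum_(b | b \notin Bt) q b + t * #|Bt|%:R].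
Proof.
move=> P0 q0 d0 dP dq At_t t0.
pose gam (p : A * B) := P p.1 * q p.2 * d p.1 p.2.
have gam0 p : 0 <= gam p by rewrite !mulr_ge0.
(* Only the part of the coupling above [Bt] is thinned; the rest is kept as it is and is paid for by
   the mass outside [Bt]. *)
pose g (p : A * B) := gam p * (p.2 \in Bt)%:R.
have g0 p : 0 <= g p by rewrite mulr_ge0.
have gamP a : \sum_b gam (a, b) = P a.
  by rewrite -[RHS]dP mulr_sumr; apply: eq_bigr => b _; rewrite /gam mulrA.
have gamq b : \sum_a gam (a, b) = q b.
  rewrite -[RHS]dq mulr_sumr; apply: eq_bigr => a _.
  by rewrite /gam /= mulrA (mulrC (q b)).
have gP a : \sum_b g (a, b) <= P a.
  rewrite -gamP; apply: ler_sum => b _; rewrite /g /=.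
  by case: (b \in Bt); rewrite ?mulr1 ?mulr0.
have [g' [g'0 [g'r g'c] g'cost g'S g'n]] :=
  support_reduction (fun p => c p.1 p.2) g0.
pose gam' p := g' p + gam p * (p.2 \notin Bt)%:R.
have gam'0 p : 0 <= gam' p by rewrite addr_ge0// mulr_ge0.
have gamE p : gam p = g p + gam p * (p.2 \notin Bt)%:R.
  by rewrite /g; case: (_ \in _); rewrite ?mulr1 ?mulr0 ?addr0 ?add0r.
have gam'P a : \sum_b gam' (a, b) = P a.
  by rewrite big_split/= g'r -big_split/= -gamP; apply: eq_bigr => b _; rewrite -gamE.
have gam'q b : \sum_a gam' (a, b) = q b.
  by rewrite big_split/= g'c -big_split/= -gamq; apply: eq_bigr => a _; rewrite -gamE.
have gam'z a b : P a * q b = 0 -> gam' (a, b) = 0.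
  move=> h; have gz : gam (a, b) = 0 by rewrite /gam h mul0r.
  by rewrite /gam' gz mul0r addr0; apply: g'S; rewrite /g gz mul0r.
pose d' a b := gam' (a, b) / (P a * q b).
have d'E a b : P a * q b * d' a b = gam' (a, b).
  have [h|h] := eqVneq (P a * q b) 0; first by rewrite h mul0r gam'z.
  by rewrite /d' mulrC divfK.
pose phi a := odflt b0 [pick b | g' (a, b) != 0].
exists d', phi; split.
- by move=> a b; rewrite divr_ge0// mulr_ge0.
- split=> [a|b].
    rewrite mulr_sumr -[RHS]gam'P; apply: eq_bigr => b _.
    by rewrite mulrA d'E.
  rewrite mulr_sumr -[RHS]gam'q; apply: eq_bigr => a _.
  by rewrite mulrA (mulrC (q b)) d'E.
- rewrite !pair_bigA/=.
  under eq_bigr => p _ do rewrite d'E -surjective_pairing /gam' mulrDl.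
  under [leRHS]eq_bigr => p _ do rewrite -/(gam p) gamE mulrDl.
  by rewrite !big_split/= lerD2r.
(* [D] collects the rows in which the thinned part is not a function. Each row of [rsupp g] has one
   support point and each row of [D] a second one, so the bound on the support leaves at most
   [#|csupp g| <= #|Bt|] rows for [D]. *)
pose D := [set a | [exists b, (g' (a, b) != 0) && (b != phi a)]].
have cD : (#|D| <= #|Bt|)%N.
  have cB : (#|csupp g| <= #|Bt|)%N.
    apply/subset_leq_card/fintype.subsetP => b; rewrite !inE; apply: contra_neqT => bB.
    by rewrite big1// => a _; rewrite /g /= (negbTE bB) mulr0.
  apply: leq_trans cB; rewrite -(leq_add2l #|rsupp g|); apply: leq_trans g'n.
  have phiS a : a \in rsupp g -> g' (a, phi a) != 0.
    rewrite inE -g'r /phi; case: pickP => //= h /eqP; case.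
    by rewrite big1// => b _; apply/eqP/negbFE; exact: h.
  pose psi a := odflt b0 [pick b | (g' (a, b) != 0) && (b != phi a)].
  have psiP a : a \in D -> (g' (a, psi a) != 0) && (psi a != phi a).
    rewrite inE /psi => /existsP[b hb]; case: pickP => //= /(_ b).
    by rewrite hb.
  rewrite -(card_imset (mem (rsupp g)) (f := fun a => (a, phi a))); last by move=> x y [].
  rewrite -(card_imset (mem D) (f := fun a => (a, psi a))); last by move=> x y [].
  rewrite -cardsUI (_ : _ :&: _ = finset.set0) ?cards0 ?addn0.
    apply/subset_leq_card/fintype.subsetP => p; rewrite !inE.
    by move=> /orP[/imsetP[a aD ->]|/imsetP[a /psiP/andP[aD _] ->]]//; exact: phiS.
  apply/finset.setP => p; rewrite !inE; apply/negbTE/negP.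
  move=> /andP[/imsetP[a aD ->]] /imsetP[a' /psiP/andP[_ a'D] [aa e]].
  by move: a'D; rewrite -e aa eqxx.
have -> : \sum_a \sum_b P a * q b * d' a b * (b != phi a)%:R =
    \sum_a \sum_b g' (a, b) * (b != phi a)%:R +
    \sum_a \sum_b gam (a, b) * (b \notin Bt)%:R * (b != phi a)%:R.
  rewrite -big_split/=; apply: eq_bigr => a _; rewrite -big_split/=.
  by apply: eq_bigr => b _; rewrite d'E /gam' mulrDl.
rewrite addrAC; apply: lerD; last first.
  rewrite exchange_big/= [leRHS]big_mkcond/=; apply: ler_sum => b _.
  case: ifPn => bB; last by rewrite big1// => a _; rewrite mulr0 mul0r.
  rewrite -gamq; apply: ler_sum => a _; rewrite mulr1.
  by case: (b != phi a); rewrite ?mulr1 ?mulr0.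
apply: (via (\sum_(a in D) P a)).
  rewrite [leRHS]big_mkcond/=; apply: ler_sum => a _.
  case: ifPn => aD.
    apply: le_trans (gP a); rewrite -g'r; apply: ler_sum => b _.
    by case: (b != phi a); rewrite ?mulr1 ?mulr0.
  rewrite big1// => b _; move: aD; rewrite inE negb_exists => /forallP/(_ b).
  by case: (b != phi a); rewrite ?mulr0// andbT negbK mulr1 => /eqP.
rewrite (bigID (mem At))/= addrC; apply: lerD.
  rewrite [leRHS]big_mkcond [leLHS]big_mkcond/=; apply: ler_sum => a _.
  by case: (a \in D) => //=; case: ifP.
apply: (via (\sum_(a in D) t)).
  rewrite [leRHS]big_mkcond [leLHS]big_mkcond/=; apply: ler_sum => a _.
  case: (a \in D) => //=; case: ifPn => //; exact: At_t.
by rewrite sumr_const -[t *+ _]mulr_natr ler_wpM2l// ler_nat.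
Qed.

End finite_couplings.

(** * Binary trees of types and of contents *)

Section trees.
Variable R : realType.

Fixpoint tree (T : Type) (n : nat) : Type :=
  if n is m.+1 then (tree T m * tree T m)%type else T.

(** The same shape as [tree], rebuilt as a [finType] so that sums over all contents make sense. *)
Fixpoint ftr (A : finType) (n : nat) : finType :=
  if n is m.+1 then ((ftr A m * ftr A m)%type : finType) else A.

(* The part of a tree of depth [d + m] outside its leftmost subtree of depth
   [m]. *)
Fixpoint ktree (B : finType) (d m : nat) : finType :=
  if d is d'.+1 then ((ktree B d' m * ftr B (d' + m))%type : finType)
  else (unit : finType).

Fixpoint ltree (T : Type) (d m : nat) : tree T (d + m) -> tree T m :=
  if d is d'.+1 then fun t => ltree (t.1 : tree T (d' + m)) else id.

Fixpoint keep (B : finType) (d m : nat) : ftr B (d + m) -> ktree B d m :=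
  if d is d'.+1 return ftr B (d + m) -> ktree B d m
  then fun b => (keep (b.1 : ftr B (d' + m)), b.2) else fun=> tt.

Fixpoint const_tree (B : finType) (b0 : B) n : ftr B n :=
  if n is m.+1 then (const_tree b0 m, const_tree b0 m) else b0.

Fixpoint unkeep (B : finType) (b0 : B) (d m : nat) : ktree B d m -> ftr B (d + m) :=
  if d is d'.+1 return ktree B d m -> ftr B (d + m)
  then fun b => (unkeep b0 (b.1 : ktree B d' m), b.2) else fun=> const_tree b0 m.

Fixpoint ftmap (A B : finType) (r : A -> B) n : ftr A n -> ftr B n :=
  if n is m.+1 return ftr A n -> ftr B n
  then fun a => (ftmap r (a.1 : ftr A m), ftmap r (a.2 : ftr A m)) else r.

Fixpoint tsum (T : Type) (h : T -> R) n : tree T n -> R :=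
  if n is m.+1 return tree T n -> R
  then fun t => tsum h (t.1 : tree T m) + tsum h (t.2 : tree T m) else h.

Fixpoint ham (B : finType) n : ftr B n -> ftr B n -> R :=
  if n is m.+1 return ftr B n -> ftr B n -> R
  then fun b b' => ham (b.1 : ftr B m) b'.1 + ham (b.2 : ftr B m) b'.2
  else fun b b' => (b != b')%:R.

Lemma ham_ge0 (B : finType) n (b b' : ftr B n) : 0 <= ham b b'.
Proof. by elim: n b b' => [//|n IH] b b' /=; rewrite addr_ge0. Qed.

Lemma ham_le (B : finType) n (b b' : ftr B n) : ham b b' <= 2 ^+ n.
Proof.
elim: n b b' => [|n IH] b b' /=; first by rewrite expr0; case: (b != b').
by rewrite exprS mulr_natl mulr2n lerD.
Qed.

Lemma ham_refl (B : finType) n (b : ftr B n) : ham b b = 0.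
Proof. by elim: n b => [|n IH] b /=; rewrite ?eqxx// !IH addr0. Qed.

(** If the kept parts agree, only the [2 ^+ m] leaves of the leftmost subtree can differ; otherwise
    all leaves may. *)
Lemma ham_unkeep (B : finType) (b0 : B) d m (bk : ktree B d m) (b : ftr B (d + m)) :
  ham (unkeep b0 bk) b <= 2 ^+ m + 2 ^+ (d + m) * (keep b != bk)%:R.
Proof.
have [<-|_] := eqVneq (keep b) bk; last first.
  by rewrite mulr1 (le_trans (ham_le _ _))// lerDr exprn_ge0.
rewrite mulr0 addr0; elim: d b {bk} => [|d IH] b /=; first exact: ham_le.
by rewrite ham_refl addr0.
Qed.

Section laws.
Variable T : Type.

Section one_law.
Variables (A : finType) (p : T -> A -> R).

Fixpoint pv n : tree T n -> ftr A n -> R :=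
  if n is m.+1 return tree T n -> ftr A n -> R
  then fun t a => pv (t.1 : tree T m) a.1 * pv (t.2 : tree T m) a.2 else p.

(** The image of [pv] under [keep], see [sum_keep]: the leftmost subtree is integrated out. *)
Fixpoint qk d m : tree T (d + m) -> ktree A d m -> R :=
  if d is d'.+1 return tree T (d + m) -> ktree A d m -> R
  then fun t b => qk (t.1 : tree T (d' + m)) b.1 * pv (t.2 : tree T (d' + m)) b.2
  else fun _ _ => 1.

Fixpoint lsum (f : T -> A -> R) n : tree T n -> ftr A n -> R :=
  if n is m.+1 return tree T n -> ftr A n -> R
  then fun t a => lsum f (t.1 : tree T m) a.1 + lsum f (t.2 : tree T m) a.2 else f.

Fixpoint klsum (f : T -> A -> R) d m : tree T (d + m) -> ktree A d m -> R :=
  if d is d'.+1 return tree T (d + m) -> ktree A d m -> R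
  then fun t b => klsum f (t.1 : tree T (d' + m)) b.1 + lsum f (t.2 : tree T (d' + m)) b.2
  else fun _ _ => 0.

Lemma sum_pf (X Y : finType) (f : X -> R) (g : Y -> R) :
  \sum_(p : X * Y) f p.1 * g p.2 = (\sum_x f x) * \sum_y g y.
Proof.
rewrite sum_pair mulr_suml; apply: eq_bigr => x _.
by rewrite mulr_sumr.
Qed.

Hypotheses (p_ge0 : forall x a, 0 <= p x a) (p_sum : forall x, \sum_a p x a = 1).

Lemma pv_ge0 n (t : tree T n) a : 0 <= pv t a.
Proof. by elim: n t a => [|n IH] t a /=; rewrite ?p_ge0// mulr_ge0. Qed.

Lemma pv_sum n (t : tree T n) : \sum_a pv t a = 1.
Proof.
elim: n t => [|n IH] t /=; first exact: p_sum.
by rewrite sum_pf !IH mulr1.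
Qed.

Lemma qk_ge0 d m (t : tree T (d + m)) b : 0 <= qk t b.
Proof. by elim: d t b => [|n IH] t b //=; rewrite mulr_ge0// pv_ge0. Qed.

Lemma sum_unit (f : unit -> R) : \sum_u f u = f tt.
Proof. by rewrite (bigD1 tt)//= big1 ?addr0// => -[]. Qed.

Lemma qk_sum d m (t : tree T (d + m)) : \sum_b qk t b = 1.
Proof.
elim: d t => [|d IH] t /=; first by rewrite sum_unit.
by rewrite sum_pf IH pv_sum mulr1.
Qed.

Lemma sum_keep d m (t : tree T (d + m)) (F : ktree A d m -> R) :
  \sum_b pv t b * F (keep b) = \sum_b qk t b * F b.
Proof.
elim: d t F => [|d IH] t F /=.
  by rewrite -mulr_suml pv_sum sum_unit.
rewrite !sum_pair/= exchange_big/= [RHS]exchange_big/=; apply: eq_bigr => y _.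
transitivity (\sum_x pv (t.1 : tree T (d + m)) x * (pv (t.2 : tree T (d + m)) y * F (keep x, y))).
  by apply: eq_bigr => x _; rewrite mulrA.
rewrite (IH t.1 (fun x => pv (t.2 : tree T (d + m)) y * F (x, y))).
by apply: eq_bigr => x _; rewrite mulrA.
Qed.

Section second_moment.
Variables (f : T -> A -> R) (V : R).
Hypotheses (f0 : forall x, \sum_a p x a * f x a = 0)
  (fV : forall x, \sum_a p x a * f x a ^+ 2 <= V).

(** Additivity of variances: the cross term factors, and each factor is centred. *)
Lemma sum_indep (X Y : finType) (P : X -> R) (Q : Y -> R) (f1 : X -> R) (f2 : Y -> R) :
  \sum_x P x = 1 -> \sum_y Q y = 1 ->
  \sum_x P x * f1 x = 0 -> \sum_y Q y * f2 y = 0 ->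
  \sum_(z : X * Y) P z.1 * Q z.2 * (f1 z.1 + f2 z.2) = 0 /\
  \sum_(z : X * Y) P z.1 * Q z.2 * (f1 z.1 + f2 z.2) ^+ 2 =
  \sum_x P x * f1 x ^+ 2 + \sum_y Q y * f2 y ^+ 2.
Proof.
move=> P1 Q1 f10 f20; split.
  transitivity (\sum_(z : X * Y) (P z.1 * f1 z.1 * Q z.2 + P z.1 * (Q z.2 * f2 z.2))).
    by apply: eq_bigr => z _; ring.
  rewrite big_split/= (sum_pf (fun x => P x * f1 x) Q).
  by rewrite (sum_pf P (fun y => Q y * f2 y)) f10 f20 mul0r mulr0 addr0.
transitivity (\sum_(z : X * Y) ((P z.1 * f1 z.1 ^+ 2) * Q z.2 +
   (P z.1 * (Q z.2 * f2 z.2 ^+ 2) + (2 * (P z.1 * f1 z.1)) * (Q z.2 * f2 z.2)))).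
  by apply: eq_bigr => z _; ring.
rewrite !big_split/= (sum_pf (fun x => P x * f1 x ^+ 2) Q).
rewrite (sum_pf P (fun y => Q y * f2 y ^+ 2)).
rewrite (sum_pf (fun x => 2 * (P x * f1 x)) (fun y => Q y * f2 y)).
by rewrite f20 P1 Q1 mulr1 mul1r mulr0 addr0.
Qed.

Lemma lsum_moments n (t : tree T n) :
  \sum_a pv t a * lsum f t a = 0 /\ \sum_a pv t a * lsum f t a ^+ 2 <= V * 2 ^+ n.
Proof.
elim: n t => [|n IH] t /=; first by rewrite expr0 mulr1 f0.
have [[IH11 IH12] [IH21 IH22]] := (IH t.1, IH t.2).
have [-> ->] := sum_indep (pv_sum _) (pv_sum _) IH11 IH21.
by split=> //; rewrite exprS mulr_natl mulr2n mulrDr lerD.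
Qed.

Lemma klsum_moments d m (t : tree T (d + m)) : 0 <= V ->
  \sum_a qk t a * klsum f t a = 0 /\ \sum_a qk t a * klsum f t a ^+ 2 <= V * 2 ^+ (d + m).
Proof.
move=> V0; elim: d t => [|d IH] t /=.
  by rewrite !sum_unit expr0n/= !mulr0; split=> //; rewrite mulr_ge0// exprn_ge0.
have [[IH11 IH12] [IH21 IH22]] := (IH t.1, @lsum_moments (d + m)%N t.2).
have [-> ->] := sum_indep (qk_sum _) (pv_sum _) IH11 IH21.
by split=> //; rewrite addSn exprS mulr_natl mulr2n mulrDr lerD.
Qed.

End second_moment.

Lemma chebyshev_sum (X : finType) (P f : X -> R) (V e : R) :
  (forall x, 0 <= P x) -> 0 < e -> \sum_x P x * f x ^+ 2 <= V ->
  \sum_(x | e < `|f x|) P x <= V / e ^+ 2.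
Proof.
move=> P0 e0 hV; rewrite ler_pdivlMr ?exprn_gt0//; apply: le_trans hV.
rewrite mulr_suml big_mkcond/=; apply: ler_sum => x _; case: ifPn => h.
  by rewrite ler_wpM2l// -[leRHS]real_normK ?num_real// ler_pXn2r ?nnegrE ?ltW// (lt_trans e0).
by rewrite mulr_ge0// sqr_ge0.
Qed.

End one_law.
End laws.
End trees.

(** * Surprisal and the number of typical contents *)

Section information.
Variable R : realType.

Lemma ln_le_subr1 (y : R) : 0 < y -> ln y <= y - 1.
Proof.
move=> y0; have {1}-> : y = 1 + (y - 1) by ring.
by apply: le_ln1Dx; lra.
Qed.

Variables (T : Type) (A : finType) (p : T -> A -> R).
Hypotheses (p_ge0 : forall x a, 0 <= p x a) (p_sum : forall x, \sum_a p x a = 1).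

Definition info x a := - ln (p x a).
Definition entl x := \sum_a p x a * info x a.

Lemma p_le1 x a : p x a <= 1.
Proof. by rewrite -(p_sum x) (bigD1 a)//= lerDl sumr_ge0. Qed.

Lemma info_ge0 x a : 0 <= info x a.
Proof. by rewrite oppr_ge0 ln_le0// p_le1. Qed.

Lemma entl_ge0 x : 0 <= entl x.
Proof. by apply: sumr_ge0 => a _; rewrite mulr_ge0// info_ge0. Qed.

Lemma pv_exp n (t : tree T n) a : 0 < pv p t a -> pv p t a = expR (- lsum info t a).
Proof.
elim: n t a => [|n IH] t a /=; first by rewrite opprK => h; rewrite lnK.
move=> h; have h1 : 0 < pv p (t.1 : tree T n) a.1.
  rewrite lt_neqAle pv_ge0// andbT; apply: contraTN h => /eqP <-.
  by rewrite mul0r ltxx.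
have h2 : 0 < pv p (t.2 : tree T n) a.2 by move: h; rewrite pmulr_rgt0.
by rewrite (IH _ _ h1) (IH _ _ h2) -expRD opprD.
Qed.

Lemma pv_le_exp n (t : tree T n) a : pv p t a <= expR (- lsum info t a).
Proof.
have := pv_ge0 p_ge0 t a; rewrite le_eqVlt => /orP[/eqP <-|/pv_exp <-//].
exact: expR_ge0.
Qed.

Lemma qk_exp d m (t : tree T (d + m)) b : 0 < qk p t b -> qk p t b = expR (- klsum info t b).
Proof.
elim: d t b => [|d IH] t b /=; first by rewrite oppr0 expR0.
move=> h; have h1 : 0 < qk p (t.1 : tree T (d + m)) b.1.
  rewrite lt_neqAle qk_ge0// andbT; apply: contraTN h => /eqP <-.
  by rewrite mul0r ltxx.
have h2 : 0 < pv p (t.2 : tree T (d + m)) b.2 by move: h; rewrite pmulr_rgt0.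
by rewrite (IH _ _ h1) (pv_exp h2) -expRD opprD.
Qed.

(** Each term satisfies [p * ln (1 / p) <= 1 - p]. What matters is a bound uniform in the type,
    hence the crude constant. *)
Lemma entl_le x : entl x <= 2 * #|A|%:R.
Proof.
rewrite mulr_natr -sumr_const; apply: ler_sum => a _; rewrite /info.
have := p_ge0 x a; rewrite le_eqVlt => /orP[/eqP <-|h]; first by rewrite mul0r.
have := @ln_le_subr1 (p x a)^-1; rewrite invr_gt0 => /(_ h).
rewrite lnV ?posrE// => h2.
apply: le_trans (_ : p x a * ((p x a)^-1 - 1) <= _); first by rewrite ler_wpM2l// ltW.
by rewrite mulrBr divff ?gt_eqF// mulr1; have := p_ge0 x a; lra.
Qed.

(** With [s = sqrt x] the left side is [4 * (s * ln s) ^ 2], and [- ln s <= 1 / s]. *)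
Lemma xln2_le (x : R) : 0 <= x -> x <= 1 -> x * ln x ^+ 2 <= 4.
Proof.
rewrite le_eqVlt => /orP[/eqP <- _|x0 x1]; first by rewrite mul0r.
have s0 : 0 < Num.sqrt x by rewrite sqrtr_gt0.
have xs : x = Num.sqrt x ^+ 2 by rewrite sqr_sqrtr// ltW.
have h1 : ln (Num.sqrt x)^-1 <= (Num.sqrt x)^-1.
  have := @ln_le_subr1 (Num.sqrt x)^-1; rewrite invr_gt0 => /(_ s0); lra.
rewrite lnV ?posrE// in h1.
have h0 : 0 <= - ln (Num.sqrt x).
  by rewrite oppr_ge0 ln_le0// -sqrtr1 ler_wsqrtr.
have -> : ln x = 2 * ln (Num.sqrt x) by rewrite {1}xs lnXn// mulr_natl.
rewrite exprMn {1}xs mulrCA -exprMn (_ : 2 ^+ 2 = 4 :> R); last by ring.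
rewrite ler_piMr// -(sqrrN (_ * _)) -mulrN expr_le1// ?mulr_ge0 ?(ltW s0)//.
by apply: le_trans (ler_wpM2l (ltW s0) h1) _; rewrite divff// gt_eqF.
Qed.

Definition cinfo x a := info x a - entl x.

Lemma cinfo_mean x : \sum_a p x a * cinfo x a = 0.
Proof.
under eq_bigr do rewrite mulrBr.
by rewrite big_split/= sumrN -mulr_suml p_sum mul1r subrr.
Qed.

(** The variance is at most the second moment, which [xln2_le] bounds termwise and uniformly in the
    type. *)
Lemma cinfo_var x : \sum_a p x a * cinfo x a ^+ 2 <= 4 * #|A|%:R.
Proof.
apply: (via (\sum_a p x a * info x a ^+ 2)).
  have -> : \sum_a p x a * cinfo x a ^+ 2 =
      \sum_a p x a * info x a ^+ 2 - entl x ^+ 2.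
    have -> : entl x ^+ 2 = \sum_a p x a * (info x a * (2 * entl x) - entl x ^+ 2).
      under eq_bigr do rewrite mulrBr mulrA.
      by rewrite big_split/= sumrN -!mulr_suml p_sum -/(entl x) ; ring.
    rewrite -sumrB; apply: eq_bigr => a _; rewrite /cinfo; ring.
  by rewrite gerBl sqr_ge0.
rewrite mulr_natr -sumr_const; apply: ler_sum => a _.
by rewrite /info sqrrN xln2_le// p_le1.
Qed.

Lemma lsum_cinfo n (t : tree T n) a : lsum cinfo t a = lsum info t a - tsum entl t.
Proof. by elim: n t a => [//|n IH] t a /=; rewrite !IH; ring. Qed.

Lemma klsum_cinfo d m (t : tree T (d + m)) a :
  klsum cinfo t a = klsum info t a - (tsum entl t - tsum entl (ltree t)).
Proof.
elim: d t a => [|d IH] t a /=; first by rewrite !subrr.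
by rewrite IH lsum_cinfo; ring.
Qed.

(** Each content counted has mass at least [expR (- s)], and the masses add up to one. *)
Lemma typical_count d m (t : tree T (d + m)) (s : R) :
  #|[set b | (0 < qk p t b) && (klsum info t b <= s)]|%:R <= expR s.
Proof.
set X := [set b | _]; rewrite -[expR s]mulr1 -[X in _ * X](qk_sum p_sum t) mulr_sumr.
apply: (via (\sum_(b in X) expR s * qk p t b)); last first.
  rewrite big_mkcond/=; apply: ler_sum => b _; case: ifP => // _.
  by rewrite mulr_ge0 ?expR_ge0// qk_ge0.
rewrite -sumr_const; apply: ler_sum => b; rewrite inE => /andP[h1 h2].
by rewrite (qk_exp h1) -expRD -[leLHS]expR0 ler_expR subr_ge0.
Qed.

End information.

(** * A nearly functional coupling on one block, from an entropy gap *)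

Section improve_tree.
Variable R : realType.
Variables (T : Type) (A B : finType) (P : T -> A -> R) (Q : T -> B -> R).
Hypotheses (P_ge0 : forall x a, 0 <= P x a) (P_sum : forall x, \sum_a P x a = 1).
Hypotheses (Q_ge0 : forall x a, 0 <= Q x a) (Q_sum : forall x, \sum_a Q x a = 1).
Variables (d m : nat) (t : tree T (d + m)) (c0 : ktree B d m).
Let S : R := 2 ^+ (d + m).
Variables (mp mq e : R).
Hypotheses (e_gt0 : 0 < e)
  (goodP : `|tsum (entl P) t - S * mp| <= e * S)
  (goodQ : `|tsum (entl Q) t - S * mq| <= e * S)
  (goodL : `|tsum (entl Q) (ltree t) - 2 ^+ m * mq| <= e * 2 ^+ m)
  (gain : 7 * e <= mq / 2 ^+ d) (mqp : mq - e <= mp).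
Variables (dn c : ftr A (d + m) -> ktree B d m -> R).
Hypotheses (dn_ge0 : forall a b, 0 <= dn a b)
  (dnP : forall a, pv P t a * \sum_b qk Q t b * dn a b = pv P t a)
  (dnQ : forall b, qk Q t b * \sum_a pv P t a * dn a b = qk Q t b).

(** A typical content of [P] has mass at most exponential in minus its entropy, and the typical kept
    contents of [Q] are at most exponentially many in theirs. Dropping the leftmost subtree lowers
    the latter exponent by about [S * mq / 2 ^+ d], at least [7 * e * S]. Of these seven units,
    three go to the deviations in [goodP], [goodQ] and [goodL], one to [mqp], two to the windows
    defining [At] and [Bt], and the last one leaves the factor [expR (- (e * S))]. *)
Lemma improve_tree : exists d' phi,
  [/\ forall a b, 0 <= d' a b,
      (forall a, pv P t a * \sum_b qk Q t b * d' a b = pv P t a) /\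
      (forall b, qk Q t b * \sum_a pv P t a * d' a b = qk Q t b),
      \sum_a \sum_b pv P t a * qk Q t b * d' a b * c a b <=
      \sum_a \sum_b pv P t a * qk Q t b * dn a b * c a b &
      \sum_a \sum_b pv P t a * qk Q t b * d' a b * (b != phi a)%:R <=
      (4 * #|A|%:R + 4 * #|B|%:R) / (e ^+ 2 * S) + (e * S)^-1].
Proof.
have S0 : 0 < S by rewrite exprn_gt0.
have eS : 0 < e * S by rewrite mulr_gt0.
pose sQ := tsum (entl Q) t - tsum (entl Q) (ltree t) + e * S.
pose At := [set a | lsum (info P) t a >= tsum (entl P) t - e * S].
pose Bt := [set b | (0 < qk Q t b) && (klsum (info Q) t b <= sQ)].
have AtP a : a \in At -> pv P t a <= expR (- (tsum (entl P) t - e * S)).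
  rewrite inE => h; apply: le_trans (pv_le_exp P_ge0 t a) _.
  by rewrite ler_expR lerN2.
have [d' [phi [h1 h2 h3 h4]]] := @improve_coupling R _ _ (pv P t) (qk Q t)
  dn c At Bt _ c0 (pv_ge0 P_ge0 t)
  (qk_ge0 Q_ge0 t) dn_ge0 dnP dnQ AtP (expR_ge0 _).
exists d', phi; split=> //; apply: le_trans h4 _.
(* The first two terms are Chebyshev bounds for the atypical contents; the last one becomes
   [(e * S)^-1] through [1 + x <= expR x]. *)
apply: (via (4 * #|A|%:R * S / (e * S) ^+ 2 + 4 * #|B|%:R * S / (e * S) ^+ 2 +
    expR (- (e * S)))); last first.
  apply: lerD.
    rewrite -mulrDl -mulrDl le_eqVlt; apply/orP; left; apply/eqP.
    by field; rewrite !gt_eqF.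
  rewrite expRN lef_pV2 ?posrE ?expR_gt0//.
  by apply: le_trans (expR_ge1Dx _); rewrite lerDr.
apply: lerD; first apply: lerD.
- have [_ hV] := lsum_moments P_sum (cinfo_mean P_sum) (cinfo_var P_ge0 P_sum) t.
  apply: le_trans (chebyshev_sum (pv_ge0 P_ge0 t) eS hV).
  rewrite [leLHS]big_mkcond [leRHS]big_mkcond/=; apply: ler_sum => a _.
  rewrite inE -ltNge lsum_cinfo; case: ifPn => h; last by case: ifP; rewrite ?pv_ge0.
  rewrite ifT//; set u := lsum _ _ _ in h *; set v := tsum _ _ in h *.
  by rewrite ltr_normr; apply/orP; right; lra.
- have V0 : (0 : R) <= 4 * #|B|%:R by rewrite mulr_ge0.
  have [_ hV] := klsum_moments Q_sum (cinfo_mean Q_sum) (cinfo_var Q_ge0 Q_sum) t V0.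
  apply: le_trans (chebyshev_sum (qk_ge0 Q_ge0 t) eS hV).
  rewrite [leLHS]big_mkcond [leRHS]big_mkcond/=; apply: ler_sum => b _.
  rewrite inE klsum_cinfo; case: ifPn => h; last by case: ifP; rewrite ?qk_ge0.
  move: h; rewrite negb_and -leNgt -ltNge => /orP[h|h].
    by case: ifP.
  rewrite ifT//; move: h; rewrite /sQ => h; set u := klsum _ _ _ in h *; set v := tsum _ t in h *.
  set w := tsum _ _ in h *.
  by rewrite ltr_normr; apply/orP; left; lra.
- apply: (via (expR (- (tsum (entl P) t - e * S)) * expR sQ)).
    by rewrite ler_wpM2l ?expR_ge0//; exact: typical_count.
  rewrite -expRD ler_expR /sQ.
  move: goodP goodQ goodL; rewrite !ler_norml => /andP[a1 _] /andP[_ a2] /andP[a3 _].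
  have Sm : S = 2 ^+ d * 2 ^+ m by rewrite /S exprD.
  have d0 : (0 : R) < 2 ^+ d by rewrite exprn_gt0.
  have m0 : (0 : R) < 2 ^+ m by rewrite exprn_gt0.
  have g1 : 7 * e * S <= mq * 2 ^+ m.
    have := ler_wpM2r (ltW S0) gain; rewrite {2}Sm (_ : mq / _ * _ = mq * 2 ^+ m)//.
    by field; rewrite gt_eqF.
  have g2 : (mq - e) * S <= mp * S by rewrite ler_wpM2r// ltW.
  have g3 : e * 2 ^+ m <= e * S.
    by rewrite ler_wpM2l ?(ltW e_gt0)// Sm ler_peMl ?(ltW m0)// exprn_ege1// ler1n.
  set tp := tsum (entl P) t in a1 *; set tq := tsum (entl Q) t in a2 *.
  set tl := tsum _ _ in a3 *.
  move: (2 ^+ m) a3 g1 g3 => M a3 g1 g3; lra.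
Qed.

End improve_tree.

(** * Couplings and costs at all depths *)

Section couplings.
Variable R : realType.

(** Recursion that starts at level [n] instead of zero. Below [n] the values are irrelevant; at [n]
    the given [x] is inserted by deciding [n = m], whence the transport along an equality. *)
Lemma extend_family (X : nat -> Type) (x0 : forall m, X m)
    (s : forall m, X m -> X m.+1) n (x : X n) :
  exists F : forall m, X m, F n = x /\ forall m, (n <= m)%N -> F m.+1 = s m (F m).
Proof.
pose F := fix F m : X m :=
  match n =P m with
  | ReflectT e => eq_rect n X x m e
  | ReflectF _ => match m return X m with 0%N => x0 0%N | k.+1 => s k (F k) end
  end.
exists F; split.
  by case: n x @F => [|n] x /=; case: eqP => // e; rewrite (eq_axiomK e).
move=> m nm /=; case: eqP => // e.
by move: nm; rewrite {1}e ltnn.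
Qed.

Lemma sum_coupled (X1 X2 Y1 Y2 : finType) (w1 f1 : X1 -> Y1 -> R) (w2 f2 : X2 -> Y2 -> R) :
  \sum_x \sum_y w1 x y = 1 -> \sum_x \sum_y w2 x y = 1 ->
  \sum_(x : X1 * X2) \sum_(y : Y1 * Y2)
    w1 x.1 y.1 * w2 x.2 y.2 * (f1 x.1 y.1 + f2 x.2 y.2) =
  \sum_x \sum_y w1 x y * f1 x y + \sum_x \sum_y w2 x y * f2 x y.
Proof.
move=> m1 m2; rewrite !pair_bigA in m1 m2 *.
transitivity (\sum_(z : (X1 * Y1) * (X2 * Y2))
   (w1 z.1.1 z.1.2 * f1 z.1.1 z.1.2 * w2 z.2.1 z.2.2 +
    w1 z.1.1 z.1.2 * (w2 z.2.1 z.2.2 * f2 z.2.1 z.2.2))).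
  rewrite (reindex (fun z : (X1 * Y1) * (X2 * Y2) =>
     ((z.1.1, z.2.1), (z.1.2, z.2.2))))/=; last first.
    exists (fun z => ((z.1.1, z.2.1), (z.1.2, z.2.2))).
      by move=> [[? ?] [? ?]].
    by move=> [[? ?] [? ?]].
  by apply: eq_bigr => -[[? ?] [? ?]] _ /=; ring.
rewrite big_split/= (sum_pf (fun p => w1 p.1 p.2 * f1 p.1 p.2) (fun p => w2 p.1 p.2)).
rewrite m2 mulr1 (sum_pf (fun p => w1 p.1 p.2) (fun p => w2 p.1 p.2 * f2 p.1 p.2)).
by rewrite m1 mul1r.
Qed.

Section coupling_def.
Variables (T : Type) (A B : finType) (P : T -> A -> R) (Q : T -> B -> R).

(** [d] is the density of the coupling relative to the product of its marginals. Densities pull back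
    along refinements of either alphabet by composition, and multiplying the marginal equations by
    the masses leaves null contents unconstrained. *)
Definition coupling n (t : tree T n) (d : ftr A n -> ftr B n -> R) :=
  [/\ forall a b, 0 <= d a b,
      forall a, pv P t a * \sum_b pv Q t b * d a b = pv P t a &
      forall b, pv Q t b * \sum_a pv P t a * d a b = pv Q t b].

Definition Exp n (t : tree T n) (d f : ftr A n -> ftr B n -> R) :=
  \sum_a \sum_b pv P t a * pv Q t b * d a b * f a b.

(** Values at every depth. Beyond some depth they are determined by the two halves: as products for
    couplings ([fam_mul]), as sums for costs ([fam_add]). *)
Definition family := forall n, tree T n -> ftr A n -> ftr B n -> R.

Definition fam_mul n (d : family) := forall m, (n <= m)%N ->
  d m.+1 = fun (t : tree T m.+1) a b => d m t.1 a.1 b.1 * d m t.2 a.2 b.2.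

Definition fam_add n (c : family) := forall m, (n <= m)%N ->
  c m.+1 = fun (t : tree T m.+1) a b => c m t.1 a.1 b.1 + c m t.2 a.2 b.2.

Hypotheses (P_ge0 : forall x a, 0 <= P x a) (P_sum : forall x, \sum_a P x a = 1).
Hypotheses (Q_ge0 : forall x a, 0 <= Q x a) (Q_sum : forall x, \sum_a Q x a = 1).

Lemma coupling_prod n (t : tree T n.+1) d1 d2 : coupling (t.1 : tree T n) d1 ->
  coupling (t.2 : tree T n) d2 ->
  coupling t (fun a b => d1 a.1 b.1 * d2 a.2 b.2).
Proof.
move=> [d10 d1P d1Q] [d20 d2P d2Q]; split=> [a b|a|b].
- by rewrite mulr_ge0.
- rewrite /= (eq_bigr (fun b => (pv Q (t.1 : tree T n) b.1 * d1 a.1 b.1) *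
      (pv Q (t.2 : tree T n) b.2 * d2 a.2 b.2))); last by move=> b _; ring.
  rewrite (sum_pf (fun b => pv Q (t.1 : tree T n) b * d1 a.1 b)
    (fun b => pv Q (t.2 : tree T n) b * d2 a.2 b)).
  by rewrite mulrACA d1P d2P.
- rewrite /= (eq_bigr (fun a => (pv P (t.1 : tree T n) a.1 * d1 a.1 b.1) *
      (pv P (t.2 : tree T n) a.2 * d2 a.2 b.2))); last by move=> a _; ring.
  rewrite (sum_pf (fun a => pv P (t.1 : tree T n) a * d1 a b.1)
    (fun a => pv P (t.2 : tree T n) a * d2 a b.2)).
  by rewrite mulrACA d1Q d2Q.
Qed.

Lemma coupling_mass n (t : tree T n) d : coupling t d ->
  \sum_a \sum_b pv P t a * pv Q t b * d a b = 1.
Proof.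
move=> [_ dP _]; rewrite -(pv_sum P_sum t); apply: eq_bigr => a _.
by rewrite -[RHS]dP mulr_sumr; apply: eq_bigr => b _; rewrite mulrA.
Qed.

Lemma Exp_ge0 n (t : tree T n) d f : (forall a b, 0 <= d a b) ->
  (forall a b, 0 <= f a b) -> 0 <= Exp t d f.
Proof.
move=> d0 f0; do 2!apply: sumr_ge0 => ? _.
by rewrite !mulr_ge0 ?pv_ge0.
Qed.

Lemma Exp_le n (t : tree T n) d f g : (forall a b, 0 <= d a b) ->
  (forall a b, f a b <= g a b) -> Exp t d f <= Exp t d g.
Proof.
move=> d0 fg; do 2!apply: ler_sum => ? _.
by rewrite ler_wpM2l// !mulr_ge0 ?pv_ge0.
Qed.

Lemma expectD n (t : tree T n) d f g :
  Exp t d (fun a b => f a b + g a b) = Exp t d f + Exp t d g.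
Proof.
rewrite -big_split/=; apply: eq_bigr => a _; rewrite -big_split/=.
by apply: eq_bigr => b _; rewrite mulrDr.
Qed.

Lemma expectZ n (t : tree T n) d k f :
  Exp t d (fun a b => k * f a b) = k * Exp t d f.
Proof.
rewrite mulr_sumr; apply: eq_bigr => a _; rewrite mulr_sumr.
by apply: eq_bigr => b _; rewrite mulrCA.
Qed.

Lemma Exp_cst n (t : tree T n) d k : coupling t d -> Exp t d (fun _ _ => k) = k.
Proof.
move=> /coupling_mass h; rewrite -[RHS]mul1r -h mulr_suml.
by apply: eq_bigr => a _; rewrite mulr_suml.
Qed.

Lemma Exp_le_cst n (t : tree T n) d f k : coupling t d ->
  (forall a b, f a b <= k) -> Exp t d f <= k.
Proof.
move=> cd fk; rewrite -[leRHS](Exp_cst k cd); apply: Exp_le => //.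
by case: cd.
Qed.

Lemma Exp_prod n (t : tree T n.+1) d1 d2 f1 f2 : coupling (t.1 : tree T n) d1 ->
  coupling (t.2 : tree T n) d2 ->
  Exp t (fun a b => d1 a.1 b.1 * d2 a.2 b.2) (fun a b => f1 a.1 b.1 + f2 a.2 b.2) =
  Exp (t.1 : tree T n) d1 f1 + Exp (t.2 : tree T n) d2 f2.
Proof.
move=> /coupling_mass m1 /coupling_mass m2; rewrite /Exp -(sum_coupled f1 f2 m1 m2).
by apply: eq_bigr => x _; apply: eq_bigr => y _ /=; ring.
Qed.

Lemma coupling_fam n (d : family) : fam_mul n d -> (forall t : tree T n, coupling t (d n t)) ->
  forall m, (n <= m)%N -> forall t : tree T m, coupling t (d m t).
Proof.
move=> dn cn; elim=> [|m IH]; first by rewrite leqn0 => /eqP <-.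
rewrite leq_eqVlt => /orP[/eqP <-//|]; rewrite ltnS => nm t.
by rewrite (dn _ nm); apply: coupling_prod; exact: IH.
Qed.

Lemma Exp_fam n (d c : family) : fam_mul n d -> fam_add n c ->
  (forall t : tree T n, coupling t (d n t)) ->
  forall m (t : tree T m.+1), (n <= m)%N ->
  Exp t (d m.+1 t) (c m.+1 t) =
  Exp (t.1 : tree T m) (d m t.1) (c m t.1) +
  Exp (t.2 : tree T m) (d m t.2) (c m t.2).
Proof.
move=> dn ca cn m t nm; rewrite (dn _ nm) (ca _ nm).
by apply: Exp_prod; exact: (coupling_fam dn cn nm).
Qed.

(* The coupling that is independent on the leftmost subtree of depth [m]. *)
Fixpoint kdens (dn : family) d m : tree T (d + m) -> ftr A (d + m) -> ktree B d m -> R :=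
  if d is d'.+1 return tree T (d + m) -> ftr A (d + m) -> ktree B d m -> R
  then fun t a b => kdens dn (t.1 : tree T (d' + m)) a.1 b.1 * dn (d' + m)%N t.2 a.2 b.2
  else fun _ _ _ => 1.

Fixpoint kcost (c : family) d m : tree T (d + m) -> ftr A (d + m) -> ktree B d m -> R :=
  if d is d'.+1 return tree T (d + m) -> ftr A (d + m) -> ktree B d m -> R
  then fun t a b => kcost c (t.1 : tree T (d' + m)) a.1 b.1 + c (d' + m)%N t.2 a.2 b.2
  else fun _ _ _ => 0.

Lemma kdens_coupling (dn : family) d m (t : tree T (d + m)) :
  (forall k (t : tree T (k + m)), coupling t (dn (k + m)%N t)) ->
  [/\ forall a b, 0 <= kdens dn t a b,
      forall a, pv P t a * \sum_b qk Q t b * kdens dn t a b = pv P t a &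
      forall b, qk Q t b * \sum_a pv P t a * kdens dn t a b = qk Q t b].
Proof.
move=> cdn; elim: d t => [|d IH] t /=.
  split=> // [a|b]; first by rewrite sum_unit !mulr1.
  by under eq_bigr do rewrite mulr1; rewrite pv_sum// mulr1.
have [d20 d2P d2Q] := cdn d t.2; have [d10 d1P d1Q] := IH t.1; split=> [a b|a|b].
- by rewrite mulr_ge0.
- rewrite (eq_bigr (fun b => (qk Q (t.1 : tree T (d + m)) b.1 * kdens dn (t.1 : tree T (d + m)) a.1 b.1) *
      (pv Q (t.2 : tree T (d + m)) b.2 * dn (d + m)%N t.2 a.2 b.2))); last by move=> b _; ring.
  rewrite (sum_pf (fun b => qk Q (t.1 : tree T (d + m)) b * kdens dn (t.1 : tree T (d + m)) a.1 b)
    (fun b => pv Q (t.2 : tree T (d + m)) b * dn (d + m)%N t.2 a.2 b)).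
  by rewrite mulrACA d1P d2P.
- rewrite (eq_bigr (fun a => (pv P (t.1 : tree T (d + m)) a.1 * kdens dn (t.1 : tree T (d + m)) a.1 b.1) *
      (pv P (t.2 : tree T (d + m)) a.2 * dn (d + m)%N t.2 a.2 b.2))); last by move=> a _; ring.
  rewrite (sum_pf (fun a => pv P (t.1 : tree T (d + m)) a * kdens dn (t.1 : tree T (d + m)) a b.1)
    (fun a => pv P (t.2 : tree T (d + m)) a * dn (d + m)%N t.2 a b.2)).
  by rewrite mulrACA d1Q d2Q.
Qed.

(** The missing leftmost subtree has nonnegative cost, and on the other subtrees [kdens] is the old
    coupling. *)
Lemma kexpect_le (dn c : family) d m (t : tree T (d + m)) :
  fam_mul m dn -> fam_add m c -> (forall t : tree T m, coupling t (dn m t)) ->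
  (forall (t : tree T m) a b, 0 <= c m t a b) ->
  \sum_a \sum_b pv P t a * qk Q t b * kdens dn t a b * kcost c t a b <=
  Exp t (dn (d + m)%N t) (c (d + m)%N t).
Proof.
move=> dnm cm cdn c0; elim: d t => [|d IH] t.
  rewrite big1; last by move=> a _; rewrite big1// => b _; rewrite /= mulr0.
  by apply: Exp_ge0 => // a b; case: (cdn t).
have cd k (t' : tree T (k + m)) : coupling t' (dn (k + m)%N t').
  by apply: (coupling_fam dnm cdn); rewrite leq_addl.
rewrite (Exp_fam dnm cm cdn) ?leq_addl//.
apply: le_trans (_ : \sum_a \sum_b pv P (t.1 : tree T (d + m)) a *
    qk Q (t.1 : tree T (d + m)) b * kdens dn (t.1 : tree T (d + m)) a b *
    kcost c (t.1 : tree T (d + m)) a b +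
    Exp (t.2 : tree T (d + m)) (dn (d + m)%N t.2) (c (d + m)%N t.2) <= _); last first.
  by rewrite lerD2r; exact: IH.
have m1 : \sum_a \sum_b pv P (t.1 : tree T (d + m)) a * qk Q (t.1 : tree T (d + m)) b *
    kdens dn (t.1 : tree T (d + m)) a b = 1.
  have [_ kP _] := @kdens_coupling dn d m t.1 cd.
  rewrite -(pv_sum P_sum (t.1 : tree T (d + m))); apply: eq_bigr => a _.
  by rewrite -[RHS]kP mulr_sumr; apply: eq_bigr => b _; rewrite mulrA.
have m2 := coupling_mass (cd d t.2).
rewrite /Exp -(sum_coupled _ _ m1 m2) /=.
apply: le_of_eq.
by apply: eq_bigr => x _; apply: eq_bigr => y _ /=; ring.
Qed.

(** Whatever its coupling, the leftmost subtree costs at most [K] per leaf. *)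
Lemma kcost_le (c : family) d m (t : tree T (d + m)) a b (K : R) :
  fam_add m c -> (forall (t : tree T m) a b, c m t a b <= K * 2 ^+ m) ->
  c (d + m)%N t a b <= K * 2 ^+ m + kcost c t a (keep b).
Proof.
move=> ca cK; elim: d t a b => [|d IH] t a b; first by rewrite addr0; exact: cK.
by have -> : c (d.+1 + m)%N = _ := ca _ (leq_addl d m); rewrite /= addrA lerD2r; exact: IH.
Qed.

End coupling_def.
End couplings.

(** * One improvement step, integrated over the roots *)

Section step.
Variable R : realType.
Variables (T : Type) (I : forall n, (tree T n -> R) -> R).

Definition bnn X (f : X -> R) := exists K, forall x, 0 <= f x <= K.

(* [I n f] stands for the integral of [f], applied to the tree of types of a
   block of depth [n], over the roots of such blocks. *)
Record root_functional : Prop := RootFunctional {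
  rf_le : forall n (f g : tree T n -> R), bnn f -> bnn g ->
    (forall t, f t <= g t) -> I f <= I g ;
  rf_add : forall n (f g : tree T n -> R), bnn f -> bnn g ->
    I (fun t => f t + g t) = I f + I g ;
  rf_scale : forall n k (f : tree T n -> R), 0 <= k -> bnn f ->
    I (fun t => k * f t) = k * I f ;
  rf_double : forall n (f : tree T n -> R), bnn f ->
    I f = I (fun t : tree T n.+1 => f t.1 + f t.2) ;
  rf_one : I (fun _ : tree T 0 => 1) <= 1 }.

(** Convergence in mean of the block averages of [h]: the functional gives depth [n] a total mass of
    at most [2 ^- n], which replaces the division by [2 ^+ n]. *)
Definition balanced (h : T -> R) (m : R) := forall e, 0 < e ->
  exists n0, forall n, (n0 <= n)%N -> I (fun t : tree T n => `|tsum h t - 2 ^+ n * m|) <= e.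

Hypothesis HI : root_functional.

Lemma bnnD X (f g : X -> R) : bnn f -> bnn g ->
  bnn (fun x => f x + g x).
Proof.
move=> [K fK] [L gL]; exists (K + L) => x.
by have := fK x; have := gL x; lra.
Qed.

Lemma bnnZ X k (f : X -> R) : 0 <= k -> bnn f ->
  bnn (fun x => k * f x).
Proof.
move=> k0 [K fK]; exists (k * K) => x.
by have /andP[? ?] := fK x; rewrite mulr_ge0// ler_wpM2l.
Qed.

Lemma bnn_cst X k : 0 <= k -> bnn (fun _ : X => k).
Proof. by move=> k0; exists k => _; rewrite k0 lexx. Qed.

Lemma rf_cst n k : 0 <= k -> I (fun _ : tree T n => k) <= k / 2 ^+ n.
Proof.
move=> k0; have one j : I (fun _ : tree T j => 1) <= 2 ^- j.
  elim: j => [|j IH]; first by rewrite expr0 invr1; exact: rf_one.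
  move: IH; rewrite (rf_double HI); last exact: bnn_cst.
  rewrite (_ : (fun _ => 1 + 1) = (fun t : tree T j.+1 => 2 * 1)); last first.
    by apply/funext => t; ring.
  rewrite (rf_scale HI)//; last exact: bnn_cst.
  rewrite exprS invfM => h; rewrite -[leLHS](mulKf (_ : 2 != 0 :> R)) ?pnatr_eq0//.
  by rewrite ler_wpM2l// invr_ge0.
rewrite (_ : (fun=> k) = (fun t : tree T n => k * 1)); last first.
  by apply/funext => t; rewrite mulr1.
by rewrite (rf_scale HI)// ?ler_wpM2l//; exact: bnn_cst.
Qed.

(** Iterated [rf_double], each time discarding the nonnegative right half. *)
Lemma rf_left d m (f : tree T m -> R) : bnn f ->
  I (fun t : tree T (d + m) => f (ltree t)) <= I f.
Proof.
move=> bf; elim: d => [|d IH]; first by [].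
have bl : bnn (fun t : tree T (d + m) => f (ltree t)).
  by case: bf => K fK; exists K => t; exact: fK.
apply: le_trans IH; rewrite (rf_double HI bl); apply: (rf_le HI).
- by case: bl => K fK; exists K => t; exact: fK.
- by apply: bnnD; case: bl => K fK; exists K => t; exact: fK.
- by move=> t; rewrite /= lerDl; case: bf => K fK; have /andP[] := fK (ltree (t.2 : tree T (d + m))).
Qed.

Section step_lemma.
Variables (A B : finType) (P : T -> A -> R) (Q : T -> B -> R) (b0 : B).
Hypotheses (P_ge0 : forall x a, 0 <= P x a) (P_sum : forall x, \sum_a P x a = 1).
Hypotheses (Q_ge0 : forall x a, 0 <= Q x a) (Q_sum : forall x, \sum_a Q x a = 1).

Lemma tsum_entl_bnd n m (Z : finType) (q : T -> Z -> R) :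
  (forall x a, 0 <= q x a) -> (forall x, \sum_a q x a = 1) ->
  bnn (fun t : tree T n => `|tsum (entl q) t - 2 ^+ n * m|).
Proof.
move=> q0 q1; exists (2 * #|Z|%:R * 2 ^+ n + `|2 ^+ n * m|) => t.
rewrite normr_ge0/=; apply: le_trans (ler_normB _ _) _; rewrite lerD2r.
elim: n t => [|n IH] t /=.
  by rewrite expr0 mulr1 ger0_norm ?entl_le// entl_ge0.
apply: le_trans (ler_normD _ _) _.
by have := IH t.1; have := IH t.2; rewrite exprS; lra.
Qed.

Lemma Exp_bnd n (d f : tree T n -> ftr A n -> ftr B n -> R) K :
  (forall t : tree T n, coupling P Q t (d t)) ->
  (forall (t : tree T n) a b, 0 <= f t a b <= K) ->
  bnn (fun t : tree T n => Exp P Q t (d t) (f t)).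
Proof.
move=> cd f0; exists K => t; apply/andP; split.
  apply: Exp_ge0 => //; first by case: (cd t).
  by move=> a b; have /andP[] := f0 t a b.
by apply: Exp_le_cst => // a b; have /andP[] := f0 t a b.
Qed.

Lemma fam_add_bnd n (c : family R T A B) K : fam_add n c ->
  (forall (t : tree T n) a b, 0 <= c n t a b <= K * 2 ^+ n) ->
  forall m, (n <= m)%N -> forall (t : tree T m) a b, 0 <= c m t a b <= K * 2 ^+ m.
Proof.
move=> ca cb; elim=> [|m IH].
  rewrite leqn0 => /eqP e; by move: cb; rewrite e.
rewrite leq_eqVlt => /orP[/eqP <-//|]; rewrite ltnS => nm t a b.
rewrite (ca _ nm); have /andP[h1 h2] := IH nm t.1 a.1 b.1.
have /andP[h3 h4] := IH nm t.2 a.2 b.2; rewrite exprS.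
by apply/andP; split; lra.
Qed.

(** Both halves of a tree contribute additively to its expected cost, so [rf_double] makes the
    integrated cost independent of the depth. *)
Lemma rf_expect n (d c : family R T A B) K : fam_mul n d -> fam_add n c ->
  (forall t : tree T n, coupling P Q t (d n t)) ->
  (forall (t : tree T n) a b, 0 <= c n t a b <= K * 2 ^+ n) ->
  forall m, (n <= m)%N ->
  I (fun t : tree T m => Exp P Q t (d m t) (c m t)) =
  I (fun t : tree T n => Exp P Q t (d n t) (c n t)).
Proof.
move=> dm ca cd cb; elim=> [|m IH]; first by rewrite leqn0 => /eqP <-.
rewrite leq_eqVlt => /orP[/eqP <-//|]; rewrite ltnS => nm.
rewrite -(IH nm) [RHS](rf_double HI); last first.
  apply: Exp_bnd; first exact: (coupling_fam dm cd nm).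
  exact: (fam_add_bnd ca cb nm).
by congr I; apply/funext => t; apply: (Exp_fam P_sum dm ca cd).
Qed.

Definition fam_map n (phi : forall n, tree T n -> ftr A n -> ftr B n) :=
  forall m, (n <= m)%N ->
  phi m.+1 = fun (t : tree T m.+1) a => (phi m t.1 a.1, phi m t.2 a.2).

Variables (mp mq e : R) (d n : nat).
Hypotheses (e_gt0 : 0 < e) (gain : 7 * e <= mq / 2 ^+ d) (mqp : mq - e <= mp)
  (balP : balanced (entl P) mp) (balQ : balanced (entl Q) mq).
Variables (dn c : family R T A B) (K : R).
Arguments dn : clear implicits.
Arguments c : clear implicits.
Hypotheses (dnm : fam_mul n dn) (cadd : fam_add n c)
  (dnc : forall t : tree T n, coupling P Q t (dn n t))
  (cK : forall (t : tree T n) a b, 0 <= c n t a b <= K * 2 ^+ n) (K0 : 0 <= K).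

(* Away from the leftmost subtree, whose share is [2 ^- d], and from unbalanced
   trees of types, the first coordinate nearly determines the second one. *)
Lemma improve_step (ep : R) : 0 < ep -> exists (N : nat) (dn' : family R T A B) phi,
  [/\ (n <= N)%N /\ fam_mul N dn', forall t : tree T N, coupling P Q t (dn' N t),
      fam_map N phi,
      I (fun t : tree T N => Exp P Q t (dn' N t) (c N t)) <=
      I (fun t : tree T n => Exp P Q t (dn n t) (c n t)) + K / 2 ^+ d &
      I (fun t : tree T N => Exp P Q t (dn' N t) (fun a b => ham R (phi N t a) b)) <=
      2 ^- d + ep].
Proof.
move=> ep0; pose Cst : R := (4 * #|A|%:R + 4 * #|B|%:R) / e ^+ 2 + e^-1.
have Cst0 : 0 <= Cst.
  apply: addr_ge0; last by rewrite invr_ge0 ltW.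
  by apply: divr_ge0; [rewrite addr_ge0// mulr_ge0|rewrite exprn_ge0// ltW].
(* [e1] makes the three Markov bounds at the end add up to [ep / 2]: the sum of their factors is
   [(2 + 2 ^+ d) / e]. *)
pose e1 := ep * e / (2 * (2 + 2 ^+ d)).
have d0 : (0 : R) < 2 ^+ d by rewrite exprn_gt0.
have e10 : 0 < e1 by rewrite divr_gt0// mulr_gt0// addr_gt0.
have [n1 bal1] := balP e10; have [n2 bal2] := balQ e10.
pose n3 := Num.bound (2 * Cst / ep).
pose m := maxn n (maxn n1 (maxn n2 n3)).
have [nm [n1m [n2m n3m]]] : (n <= m /\ n1 <= m /\ n2 <= m /\ n3 <= m)%N.
  by rewrite /m !leq_max !leqnn !orbT.
pose N := (d + m)%N; have mN : (m <= N)%N by rewrite leq_addl.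
pose S : R := 2 ^+ N; have S0 : 0 < S by rewrite exprn_gt0.
have CS : Cst / S <= ep / 2.
  rewrite ler_pdivrMr//; apply: (via (ep / 2 * n3%:R)); last first.
    apply: ler_wpM2l; first by rewrite divr_ge0// ltW.
    apply: (via N%:R); first by rewrite ler_nat (leq_trans n3m).
    by rewrite /S -natrX ler_nat ltnW// ltn_expl.
  have : 2 * Cst / ep < n3%:R by apply: archi_boundP; rewrite divr_ge0 ?mulr_ge0 ?(ltW ep0).
  by rewrite ltr_pdivrMr// => h; rewrite mulrAC ler_pdivlMr//; lra.
have nN : (n <= N)%N := leq_trans nm mN.
have dnm' : fam_mul m dn by move=> k mk; apply: dnm; exact: leq_trans mk.
have cadd' : fam_add m c by move=> k mk; apply: cadd; exact: leq_trans mk.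
have dnc' k (t : tree T k) : (m <= k)%N -> coupling P Q t (dn k t).
  by move=> mk; apply: (coupling_fam dnm dnc); exact: leq_trans mk.
have cK' := fam_add_bnd cadd cK.
pose good (t : tree T N) := [&& `|tsum (entl P) t - S * mp| <= e * S,
  `|tsum (entl Q) t - S * mq| <= e * S &
  `|tsum (entl Q) (ltree t) - 2 ^+ m * mq| <= e * 2 ^+ m].
have kb0 : ktree B d m by exact: (keep (const_tree b0 _)).
(* On a balanced tree [improve_tree] applies. On the others the old coupling is kept outside the
   leftmost subtree, with an arbitrary guess as code. *)
have step (t : tree T N) : exists x : (ftr A N -> ktree B d m -> R) * (ftr A N -> ktree B d m),
  [/\ forall a b, 0 <= x.1 a b,
      (forall a, pv P t a * \sum_b qk Q t b * x.1 a b = pv P t a) /\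
      (forall b, qk Q t b * \sum_a pv P t a * x.1 a b = qk Q t b),
      \sum_a \sum_b pv P t a * qk Q t b * x.1 a b * kcost c t a b <=
      Exp P Q t (dn N t) (c N t) &
      good t -> \sum_a \sum_b pv P t a * qk Q t b * x.1 a b * (b != x.2 a)%:R <= Cst / S].
  have kc := @kdens_coupling R T A B P Q P_sum dn d m t
    (fun k t' => dnc' _ t' (leq_addl k m)).
  have [k0 kP kQ] := kc.
  have kle := @kexpect_le R T A B P Q P_ge0 P_sum Q_ge0 dn c d m t dnm' cadd'
     (fun t' => dnc' _ t' (leqnn m)) (fun t' a b => proj1 (andP (cK' _ nm t' a b))).
  have [/and3P[g1 g2 g3]|ng] := boolP (good t).
    have [d' [phi [h1 h2 h3 h4]]] := improve_tree P_ge0 P_sum Q_ge0 Q_sum kb0 e_gt0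
      g1 g2 g3 gain mqp (kcost c t) k0 kP kQ.
    exists (d', phi); split=> //; first exact: le_trans h3 kle.
    move=> _; apply: le_trans h4 _; apply: le_of_eq.
    by rewrite /Cst -/S; field; rewrite !gt_eqF.
  by exists (kdens dn t, fun=> kb0); split.
have [x xP] := choice step.
(* The density ignores the leftmost subtree of [b]: given the rest, that subtree is drawn
   independently of [a]. *)
pose dN (t : tree T N) a b := (x t).1 a (keep b).
pose phiN (t : tree T N) a := unkeep b0 ((x t).2 a).
have [dn' [dn'N dn'm]] := @extend_family (fun k => tree T k -> ftr A k -> ftr B k -> R)
  (fun _ _ _ _ => 0) (fun k f t a b => f t.1 a.1 b.1 * f t.2 a.2 b.2) N dN.
have [phi [phiE phim]] := @extend_family (fun k => tree T k -> ftr A k -> ftr B k)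
  (fun k _ _ => const_tree b0 k) (fun k f t a => (f t.1 a.1, f t.2 a.2)) N phiN.
have cN (t : tree T N) : coupling P Q t (dN t).
  have [h1 [h2 h3] _ _] := xP t; split=> [a b|a|b]; first exact: h1.
    by rewrite (sum_keep Q_sum t (fun b => (x t).1 a b)) h2.
  rewrite /dN; have [q0|q0] := eqVneq (qk Q t (keep b)) 0.
    suff -> : pv Q t b = 0 by rewrite !mul0r.
    apply/eqP; rewrite eq_le pv_ge0// andbT -q0.
    have := sum_keep Q_sum t (fun b' => (b' == keep b)%:R).
    rewrite [in RHS](bigD1 (keep b))//= eqxx mulr1 [X in _ = _ + X]big1 ?addr0; last first.
      by move=> i /negbTE ->; rewrite mulr0.
    move=> <-; rewrite (bigD1 b)//= eqxx mulr1 lerDl.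
    by apply: sumr_ge0 => i _; rewrite mulr_ge0// pv_ge0.
  have := h3 (keep b); rewrite -[RHS]mulr1 => /(mulfI q0) ->.
  by rewrite mulr1.
have sum_keep2 (t : tree T N) (F : ftr A N -> ktree B d m -> R) :
    Exp P Q t (dN t) (fun a b => F a (keep b)) =
    \sum_a \sum_b pv P t a * qk Q t b * (x t).1 a b * F a b.
  apply: eq_bigr => a _; transitivity (\sum_b pv Q t b * (pv P t a * (x t).1 a (keep b) * F a (keep b))).
    by apply: eq_bigr => b _; rewrite /dN; ring.
  rewrite (sum_keep Q_sum t (fun b => pv P t a * (x t).1 a b * F a b)).
  by apply: eq_bigr => b _; ring.
exists N, dn', phi; rewrite dn'N phiE; split => //.
  have bE : bnn (fun t : tree T N => Exp P Q t (dn N t) (c N t)).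
    by apply: (@Exp_bnd N (dn N) (c N) (K * 2 ^+ N)) => t *; [exact: dnc'|exact: cK'].
  have bE' : bnn (fun t : tree T N => Exp P Q t (dN t) (c N t)).
    by apply: (@Exp_bnd N dN (c N) (K * 2 ^+ N)) => // t a b; exact: cK'.
  have bK : bnn (fun t : tree T N => K * 2 ^+ m).
    by apply: bnn_cst; rewrite mulr_ge0// exprn_ge0.
  rewrite -(rf_expect dnm cadd dnc cK nN).
  apply: (via (I (fun t : tree T N => Exp P Q t (dn N t) (c N t) + K * 2 ^+ m))).
    apply: (rf_le HI) => //; first exact: bnnD.
    move=> t; apply: (via (Exp P Q t (dN t) (fun a b => K * 2 ^+ m + kcost c t a (keep b)))).
      apply: Exp_le => // [a b|a b]; first by case: (cN t).
      apply: kcost_le => // t' a' b'.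
      by have /andP[] := cK' _ nm t' a' b'.
    rewrite expectD Exp_cst// addrC lerD2r sum_keep2.
    by have [] := xP t.
  rewrite (rf_add HI)// lerD2l; apply: le_trans (rf_cst N _) _.
    by rewrite mulr_ge0// exprn_ge0.
  apply: le_of_eq.
  by rewrite /N exprD; field; rewrite !gt_eqF// exprn_gt0.
pose X (t : tree T N) := `|tsum (entl P) t - S * mp|.
pose Y (t : tree T N) := `|tsum (entl Q) t - S * mq|.
pose Z (t : tree T m) := `|tsum (entl Q) t - 2 ^+ m * mq|.
have X0 t : 0 <= X t by exact: normr_ge0.
have Y0 t : 0 <= Y t by exact: normr_ge0.
have Z0 t : 0 <= Z t by exact: normr_ge0.
have bX : bnn X by exact: tsum_entl_bnd.
have bY : bnn Y by exact: tsum_entl_bnd.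
have bZ : bnn Z by exact: tsum_entl_bnd.
have bZl : bnn (fun t : tree T N => Z (ltree t)).
  by case: bZ => L ZL; exists L => t; exact: ZL.
(* On an unbalanced tree one of [X], [Y], [Z] is so large that its term alone exceeds [S], the most
   that a wrong guess can cost. Integrating this is Markov's inequality. *)
have main (t : tree T N) : Exp P Q t (dN t) (fun a b => ham R (phiN t a) b) <=
    (2 ^+ m + S * (Cst / S)) + (e^-1 * X t + (e^-1 * Y t + 2 ^+ d / e * Z (ltree t))).
  apply: (via (2 ^+ m + S * \sum_a \sum_b pv P t a * qk Q t b * (x t).1 a b * (b != (x t).2 a)%:R)).
    rewrite -(sum_keep2 _ (fun a b => (b != (x t).2 a)%:R)) -expectZ.
    rewrite -{1}(Exp_cst P_sum (2 ^+ m) (cN t)) -expectD.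
    apply: Exp_le => // [a b|a b]; first by case: (cN t).
    exact: ham_unkeep.
  have SC : 0 <= S * (Cst / S) by rewrite mulr_ge0 ?divr_ge0// ltW.
  have t0 : 0 <= e^-1 * X t by rewrite mulr_ge0// invr_ge0 ltW.
  have t1 : 0 <= e^-1 * Y t by rewrite mulr_ge0// invr_ge0 ltW.
  have t2 : 0 <= 2 ^+ d / e * Z (ltree t) by rewrite mulr_ge0// divr_ge0 ?exprn_ge0// ltW.
  have [h1 [h2 h3] _ h5] := xP t.
  have [g|ng] := boolP (good t).
    have := h5 g; move=> /(ler_wpM2l (ltW S0)); lra.
  have le1 : \sum_a \sum_b pv P t a * qk Q t b * (x t).1 a b * (b != (x t).2 a)%:R <= 1.
    rewrite -(sum_keep2 _ (fun a b => (b != (x t).2 a)%:R)).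
    by apply: Exp_le_cst => // a b; case: (_ != _).
  suff : S <= e^-1 * X t + (e^-1 * Y t + 2 ^+ d / e * Z (ltree t)).
    by move: (ler_wpM2l (ltW S0) le1); lra.
  have Sd : S = 2 ^+ d * 2 ^+ m by rewrite /S exprD.
  move: ng; rewrite !negb_and -!ltNge => /or3P[] h.
  - have : S < e^-1 * X t by rewrite mulrC ltr_pdivlMr// mulrC.
    lra.
  - have : S < e^-1 * Y t by rewrite mulrC ltr_pdivlMr// mulrC.
    lra.
  - have : S < 2 ^+ d / e * Z (ltree t).
      by rewrite Sd -mulrA ltr_pM2l// mulrC ltr_pdivlMr// mulrC.
    lra.
have iX : bnn (fun t => e^-1 * X t) by apply: bnnZ => //; rewrite invr_ge0 ltW.
have iY : bnn (fun t => e^-1 * Y t) by apply: bnnZ => //; rewrite invr_ge0 ltW.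
have iZ : bnn (fun t : tree T N => 2 ^+ d / e * Z (ltree t)).
  by apply: bnnZ => //; rewrite divr_ge0 ?exprn_ge0// ltW.
have iC : bnn (fun _ : tree T N => 2 ^+ m + S * (Cst / S)).
  by apply: bnn_cst; rewrite addr_ge0 ?exprn_ge0// mulr_ge0 ?divr_ge0// ltW.
apply: le_trans (_ : I (fun t : tree T N => (2 ^+ m + S * (Cst / S)) +
    (e^-1 * X t + (e^-1 * Y t + 2 ^+ d / e * Z (ltree t)))) <= _).
  apply: (rf_le HI) => //; last exact: (bnnD iC (bnnD iX (bnnD iY iZ))).
  exists (2 ^+ N) => t; apply/andP; split.
    by apply: Exp_ge0 => // a b; [case: (cN t)|exact: ham_ge0].
  by apply: Exp_le_cst => // a b; exact: ham_le.
have ie0 : 0 <= e^-1 by rewrite invr_ge0 ltW.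
have ide0 : 0 <= 2 ^+ d / e by rewrite mulr_ge0// ltW.
rewrite (rf_add HI iC (bnnD iX (bnnD iY iZ))) (rf_add HI iX (bnnD iY iZ)).
rewrite (rf_add HI iY iZ) (rf_scale HI ie0 bX) (rf_scale HI ie0 bY) (rf_scale HI ide0 bZl).
have l0 : I (fun _ : tree T N => 2 ^+ m + S * (Cst / S)) <= 2 ^- d + ep / 2.
  apply: le_trans (rf_cst N _) _; first by rewrite addr_ge0 ?exprn_ge0// mulr_ge0 ?divr_ge0// ltW.
  rewrite -/S mulrDl (mulrC S) mulfK ?gt_eqF//; apply: lerD => //.
  by rewrite /S /N exprD invfM mulrCA divff ?mulr1// expf_eq0 pnatr_eq0 andbF.
have l1 : I X <= e1 := bal1 N (leq_trans n1m mN).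
have l2 : I Y <= e1 := bal2 N (leq_trans n2m mN).
have l3 : I (fun t : tree T N => Z (ltree t)) <= e1.
  exact: le_trans (rf_left d bZ) (bal2 m n2m).
have l1' := ler_wpM2l ie0 l1; have l2' := ler_wpM2l ie0 l2; have l3' := ler_wpM2l ide0 l3.
have -> : 2 ^- d + ep = 2 ^- d + ep / 2 + (e^-1 * e1 + (e^-1 * e1 + 2 ^+ d / e * e1)).
  by rewrite /e1; field; rewrite !gt_eqF// addr_gt0.
by move: l0 l1' l2' l3'; lra.
Qed.

End step_lemma.
End step.

(** * Alternating refinements of the couplings *)

Section scheme.
Variable R : realType.
Variables (T : Type) (I : forall n, (tree T n -> R) -> R)
  (HI : root_functional I).

Definition law (A : finType) (P : T -> A -> R) :=
  (forall x a, 0 <= P x a) /\ (forall x, \sum_a P x a = 1).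

Definition pushes (A' A : finType) (r : A' -> A) (P' : T -> A' -> R) (P : T -> A -> R) :=
  forall x a, P x a = \sum_(a' | r a' == a) P' x a'.

Lemma pv_push (A' A : finType) (r : A' -> A) P' P n (t : tree T n) (F : ftr A n -> R) :
  pushes r P' P -> \sum_a pv P' t a * F (ftmap r a) = \sum_a pv P t a * F a.
Proof.
move=> rP; elim: n t F => [|n IH] t F /=.
  rewrite (partition_big r xpredT)//=; apply: eq_bigr => a _.
  by rewrite rP mulr_suml; apply: eq_bigr => a' /eqP <-.
rewrite !sum_pair/=.
transitivity (\sum_x pv P' (t.1 : tree T n) x * \sum_y pv P (t.2 : tree T n) y * F (ftmap r x, y)).
  apply: eq_bigr => x _; rewrite -(IH t.2 (fun y => F (ftmap r x, y))) mulr_sumr.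
  by apply: eq_bigr => y _; rewrite mulrA.
rewrite (IH t.1 (fun x => \sum_y pv P (t.2 : tree T n) y * F (x, y))).
by apply: eq_bigr => x _; rewrite mulr_sumr; apply: eq_bigr => y _; rewrite mulrA.
Qed.

Lemma pv_push0 (A' A : finType) (r : A' -> A) P' P n (t : tree T n) a :
  law P' -> pushes r P' P -> pv P t (ftmap r a) = 0 -> pv P' t a = 0.
Proof.
move=> [P'0 _] rP h; apply/eqP; rewrite eq_le pv_ge0// andbT -h.
have := pv_push t (fun b => (b == ftmap r a)%:R) rP.
rewrite [RHS](bigD1 (ftmap r a))//= eqxx mulr1 [X in _ = _ + X]big1 ?addr0; last first.
  by move=> i /negbTE ->; rewrite mulr0.
move=> <-; rewrite (bigD1 a)//= eqxx mulr1 lerDl.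
by apply: sumr_ge0 => i _; rewrite mulr_ge0// pv_ge0.
Qed.

Section states.
Variables (A B : finType) (P : T -> A -> R) (Q : T -> B -> R).

(** [c] collects the weighted errors of all codes found so far, at most [K] per leaf, and [Phi]
    bounds its integral. Controlling [c] while the coupling changes is what keeps the earlier codes
    accurate. *)
Definition state n (d c : family R T A B) (K Phi : R) :=
  [/\ fam_mul n d, forall t : tree T n, coupling P Q t (d n t), fam_add n c,
      forall (t : tree T n) a b, 0 <= c n t a b <= K * 2 ^+ n &
      I (fun t : tree T n => Exp P Q t (d n t) (c n t)) <= Phi].

End states.

Definition fam_swap A B (d : family R T A B) : family R T B A := fun n t b a => d n t a b.

Lemma Exp_swap (A B : finType) (P : T -> A -> R) (Q : T -> B -> R) n (t : tree T n) d f :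
  Exp Q P t (fun b a => d a b) (fun b a => f a b) = Exp P Q t d f.
Proof.
rewrite /Exp exchange_big/=; apply: eq_bigr => a _; apply: eq_bigr => b _.
by rewrite (mulrC (pv Q t b)).
Qed.

Lemma state_swap (A B : finType) (P : T -> A -> R) (Q : T -> B -> R) n d c K Phi :
  state P Q n d c K Phi -> state Q P n (fam_swap d) (fam_swap c) K Phi.
Proof.
move=> [h1 h2 h3 h4 h5]; split.
- by move=> m nm; rewrite /fam_swap (h1 _ nm).
- by move=> t; have [x y z] := h2 t; split; [move=> b a; exact: x|exact: z|exact: y].
- by move=> m nm; rewrite /fam_swap (h3 _ nm).
- by move=> t a b; exact: h4.
- rewrite (_ : (fun t => _) = (fun t : tree T n => Exp P Q t (d n t) (c n t)))//.
  by apply/funext => t; exact: Exp_swap.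
Qed.

Section refine.
Variables (A B A' B' : finType) (P : T -> A -> R) (Q : T -> B -> R)
  (P' : T -> A' -> R) (Q' : T -> B' -> R) (r : A' -> A) (s : B' -> B).
Hypotheses (lP' : law P') (lQ' : law Q') (rP : pushes r P' P) (sQ : pushes s Q' Q).

Definition fam_refine (d : family R T A B) : family R T A' B' :=
  fun n t a b => d n t (ftmap r a) (ftmap s b).

(** The finer letters are coupled only through their images: given these, the two sides are
    independent. *)
Lemma coupling_refine n (t : tree T n) d : coupling P Q t d ->
  coupling P' Q' t (fun a b => d (ftmap r a) (ftmap s b)).
Proof.
move=> [d0 dP dQ]; split=> [a b|a|b] //.
  rewrite (pv_push t (fun b => d (ftmap r a) b) sQ).
  have [/(pv_push0 lP' rP) ->|h] := eqVneq (pv P t (ftmap r a)) 0; first by rewrite mul0r.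
  by have := dP (ftmap r a); rewrite -[RHS]mulr1 => /(mulfI h) ->; rewrite mulr1.
rewrite (pv_push t (fun a => d a (ftmap s b)) rP).
have [/(pv_push0 lQ' sQ) ->|h] := eqVneq (pv Q t (ftmap s b)) 0; first by rewrite mul0r.
by have := dQ (ftmap s b); rewrite -[RHS]mulr1 => /(mulfI h) ->; rewrite mulr1.
Qed.

Lemma Exp_refine n (t : tree T n) d f :
  Exp P' Q' t (fun a b => d (ftmap r a) (ftmap s b)) (fun a b => f (ftmap r a) (ftmap s b)) =
  Exp P Q t d f.
Proof.
transitivity (\sum_a pv P' t a * \sum_b pv Q t b * (d (ftmap r a) b * f (ftmap r a) b)).
  apply: eq_bigr => a _; rewrite -(pv_push t (fun b => d (ftmap r a) b * f (ftmap r a) b) sQ).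
  by rewrite mulr_sumr; apply: eq_bigr => b _; ring.
rewrite (pv_push t (fun a => \sum_b pv Q t b * (d a b * f a b)) rP).
by apply: eq_bigr => a _; rewrite mulr_sumr; apply: eq_bigr => b _; ring.
Qed.

Lemma state_refine n d c K Phi : state P Q n d c K Phi ->
  state P' Q' n (fam_refine d) (fam_refine c) K Phi.
Proof.
move=> [h1 h2 h3 h4 h5]; split.
- by move=> m nm; rewrite /fam_refine (h1 _ nm).
- by move=> t; exact: coupling_refine.
- by move=> m nm; rewrite /fam_refine (h3 _ nm).
- by move=> t a b; exact: h4.
- rewrite (_ : (fun t => _) = (fun t : tree T n => Exp P Q t (d n t) (c n t)))//.
  by apply/funext => t; exact: Exp_refine.
Qed.

End refine.

Section step.
Variables (A B : finType) (P : T -> A -> R) (Q : T -> B -> R) (b0 : B).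
Hypotheses (lP : law P) (lQ : law Q).

Lemma state_step n d c K Phi (mp mq w ep : R) (D : nat) :
  state P Q n d c K Phi -> 0 <= K -> 0 < w -> 0 < ep ->
  balanced I (entl P) mp -> balanced I (entl Q) mq -> 0 < mq ->
  mq - mq / (7 * 2 ^+ D) <= mp ->
  exists N d' phi, [/\ (n <= N)%N, fam_map N phi &
    state P Q N d' (fun m t a b => c m t a b + w * ham R (phi m t a) b) (K + w)
      (Phi + K / 2 ^+ D + w * (2 ^- D + ep))].
Proof.
move: lP lQ => [P0 P1] [Q0 Q1] [dm dc ca cb cI] K0 w0 ep0 bP bQ mq0 mqp.
have D0 : (0 : R) < 2 ^+ D by rewrite exprn_gt0.
(* The tolerance [mq / (7 * 2 ^+ D)] turns the hypothesis [gain] of [improve_step] into an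
   equality. *)
have e0 : 0 < mq / (7 * 2 ^+ D) by rewrite divr_gt0// mulr_gt0.
have gain : 7 * (mq / (7 * 2 ^+ D)) <= mq / 2 ^+ D.
  by apply: le_of_eq; field; rewrite gt_eqF.
have [N [d' [phi [[nN dm'] dc' pm h1 h2]]]] := improve_step HI b0 P0 P1 Q0 Q1 e0
  gain mqp bP bQ dm ca dc cb K0 ep0.
have cb' := fam_add_bnd ca cb nN.
exists N, d', phi; split => //.
have hamb (t : tree T N) a b : 0 <= w * ham R (phi N t a) b <= w * 2 ^+ N.
  by rewrite mulr_ge0 ?ham_ge0 ?(ltW w0)//= ler_wpM2l ?(ltW w0)// ham_le.
split=> //.
- move=> m Nm; rewrite ca ?(leq_trans nN)// pm//; apply/funext => t; apply/funext => a.
  by apply/funext => b /=; ring.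
- move=> t a b; have /andP[? ?] := cb' t a b; have /andP[? ?] := hamb t a b.
  by rewrite mulrDl addr_ge0// lerD.
have b1 : bnn (fun t : tree T N => Exp P Q t (d' N t) (c N t)).
  exact: (Exp_bnd P0 P1 Q0 dc' cb').
have b2 : bnn (fun t : tree T N => Exp P Q t (d' N t) (fun a b => ham R (phi N t a) b)).
  apply: (@Exp_bnd _ _ _ _ _ _ P0 P1 Q0 N (d' N) (fun t a b => ham R (phi N t a) b) (2 ^+ N) dc').
  by move=> t a b; rewrite ham_ge0 ham_le.
rewrite (_ : (fun t => _) = (fun t : tree T N => Exp P Q t (d' N t) (c N t) +
    w * Exp P Q t (d' N t) (fun a b => ham R (phi N t a) b))); last first.
  by apply/funext => t; rewrite expectD expectZ.
rewrite (rf_add HI b1 (bnnZ (ltW w0) b2)) (rf_scale HI (ltW w0) b2).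
have h2' := ler_wpM2l (ltW w0) h2.
by move: h1 h2' cI; lra.
Qed.

End step.

(** Initial segment; the default [false] is reached only when [k] exceeds [k']. *)
Definition trunc k' k (a : k'.-tuple bool) : k.-tuple bool :=
  [tuple nth false a i | i < k].
Notation fcut := (ftmap (@trunc _ _)).

Lemma trunc_trunc k3 k2 k1 (a : k3.-tuple bool) : (k1 <= k2)%N ->
  @trunc k2 k1 (trunc k2 a) = trunc k1 a.
Proof.
move=> h; apply: eq_from_tnth => i; rewrite !tnth_mktuple.
have ik : (i < k2)%N by exact: leq_trans h.
by rewrite -[LHS]/(nth false (trunc k2 a) (Ordinal ik)) -tnth_nth tnth_mktuple.
Qed.

Lemma ftmap_comp (A B C : finType) (f : A -> B) (g : B -> C) n (a : ftr A n) :
  ftmap g (ftmap f a) = ftmap (fun x => g (f x)) a.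
Proof. by elim: n a => [//|n IH] a /=; rewrite !IH. Qed.

Lemma ftmap_trunc k3 k2 k1 n (a : ftr (k3.-tuple bool : finType) n) : (k1 <= k2)%N ->
  ftmap (@trunc k2 k1) (ftmap (@trunc k3 k2) a) = ftmap (@trunc k3 k1) a.
Proof.
move=> h; rewrite ftmap_comp; congr (ftmap _ a); apply/funext => x.
exact: trunc_trunc.
Qed.

Local Notation cell k := (k.-tuple bool : finType).
Variables (P Q : forall k, T -> cell k -> R) (mP mQ : nat -> R).
Arguments P : clear implicits.
Arguments Q : clear implicits.
Hypotheses (lP : forall k, law (P k)) (lQ : forall k, law (Q k)).
Hypotheses (cP : forall k k', (k <= k')%N -> pushes (@trunc k' k) (P k') (P k))
  (cQ : forall k k', (k <= k')%N -> pushes (@trunc k' k) (Q k') (Q k)).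
Hypotheses (bP : forall k, balanced I (entl (P k)) (mP k))
  (bQ : forall k, balanced I (entl (Q k)) (mQ k)).
Variables u v : nat -> nat.
Let D j := (2 * j + 5)%N.
Hypotheses (uv : forall j, (u j <= v j)%N) (vu : forall j, (v j <= u j.+1)%N).
Hypotheses (mQ0 : forall j, 0 < mQ (u j)) (mP0 : forall j, 0 < mP (v j))
  (gainQ : forall j, mQ (u j) - mQ (u j) / (7 * 2 ^+ D j) <= mP (v j))
  (gainP : forall j, mP (v j) - mP (v j) / (7 * 2 ^+ D j) <= mQ (u j.+1)).

Let fam k := family R T (cell k) (cell k).

(** The resolutions interleave, [u j <= v j <= u j.+1]: [v j] bits of the first side are made to
    determine [u j] bits of the second, then [u j.+1] bits of the second determine [v j] bits of the
    first. The bound [1 - 2 ^- j] keeps the total cost below one at all stages. *)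
Definition stage j (x : nat * fam (u j) * fam (u j)) :=
  state (P (u j)) (Q (u j)) x.1.1 x.1.2 x.2 (2 ^+ j.+1) (1 - 2 ^- j).

Definition stage_next j (x : nat * fam (u j) * fam (u j)) (y : nat * fam (u j.+1) * fam (u j.+1))
    (phi : forall n, tree T n -> ftr (cell (v j)) n -> ftr (cell (u j)) n)
    (psi : forall n, tree T n -> ftr (cell (u j.+1)) n -> ftr (cell (v j)) n) :=
  [/\ (x.1.1 <= y.1.1)%N, fam_map y.1.1 phi, fam_map y.1.1 psi &
    y.2 = fun m t a b => x.2 m t (fcut a) (fcut b)
      + 2 ^+ j * ham R (phi m t (fcut a)) (fcut b)
      + 2 ^+ j * ham R (psi m t b) (fcut a)].

Lemma stage_step j x : @stage j x -> exists y : nat * fam (u j.+1) * fam (u j.+1),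
  @stage j.+1 y /\ exists phi psi, @stage_next j x y phi psi.
Proof.
case: x => [[n d] c] /= hx.
have truncid k (a : cell k) : trunc k a = a.
  by apply: eq_from_tnth => i; rewrite tnth_mktuple (tnth_nth false).
have s1 := state_refine (lP (v j)) (lQ (u j)) (cP (uv j)) (cQ (leqnn (u j))) hx.
pose z k : cell k := [tuple false | i < k].
pose ep : R := (2 ^+ D j)^-1.
have ep0 : 0 < ep by rewrite invr_gt0 exprn_gt0.
have w0 : (0 : R) < 2 ^+ j by rewrite exprn_gt0.
have K0 : (0 : R) <= 2 ^+ j.+1 by rewrite exprn_ge0.
have [N1 [d1 [phi [nN1 pm1 s2]]]] := state_step (z _) (lP (v j)) (lQ (u j)) s1 K0 w0 ep0
  (@bP _) (@bQ _) (mQ0 j) (gainQ j).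
have s3 := state_swap (state_refine (lP (v j)) (lQ (u j.+1)) (cP (leqnn (v j)))
  (cQ (leq_trans (uv j) (vu j))) s2).
have K1 : (0 : R) <= 2 ^+ j.+1 + 2 ^+ j by rewrite addr_ge0// ltW.
have [N2 [d2 [psi [nN2 pm2 s4]]]] := state_step (z _) (lQ (u j.+1)) (lP (v j)) s3 K1 w0 ep0
  (@bQ _) (@bP _) (mP0 j) (gainP j).
have s5 := state_refine (lP (u j.+1)) (lQ (u j.+1)) (cP (vu j)) (cQ (leqnn (u j.+1))) (state_swap s4).
(* With [D j = 2 * j + 5] the four increments add up to [9 / 32 * 2 ^- j], within the [2 ^- j / 2]
   by which the bound on the cost grows. *)
have ez : 1 - 2 ^- j + 2 ^+ j.+1 / 2 ^+ D j + 2 ^+ j * ((2 ^+ D j)^-1 + ep) +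
  (2 ^+ j.+1 + 2 ^+ j) / 2 ^+ D j + 2 ^+ j * ((2 ^+ D j)^-1 + ep) <= 1 - (2 ^+ j.+1)^-1 :> R.
  rewrite /ep /D mul2n -addnn exprD exprD !exprS expr0.
  have e1 : 2 ^- j <= 1 :> R by rewrite invf_le1// exprn_ege1// ler1n.
  have -> : 1 - 2 ^- j + 2 * 2 ^+ j / (2 ^+ j * 2 ^+ j * (2 * (2 * (2 * (2 * (2 * 1)))))) +
    2 ^+ j * ((2 ^+ j * 2 ^+ j * (2 * (2 * (2 * (2 * (2 * 1))))))^-1 +
              (2 ^+ j * 2 ^+ j * (2 * (2 * (2 * (2 * (2 * 1))))))^-1) +
    (2 * 2 ^+ j + 2 ^+ j) / (2 ^+ j * 2 ^+ j * (2 * (2 * (2 * (2 * (2 * 1)))))) +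
    2 ^+ j * ((2 ^+ j * 2 ^+ j * (2 * (2 * (2 * (2 * (2 * 1))))))^-1 +
              (2 ^+ j * 2 ^+ j * (2 * (2 * (2 * (2 * (2 * 1))))))^-1)
    = 1 - 2 ^- j + 9 / 32 * 2 ^- j :> R by field; rewrite gt_eqF.
  rewrite invfM; have : (0 : R) < 2 ^- j by rewrite invr_gt0.
  lra.
pose c2 : fam (u j.+1) := fun m t a b => c m t (fcut a) (fcut b)
      + 2 ^+ j * ham R (phi m t (fcut a)) (fcut b)
      + 2 ^+ j * ham R (psi m t b) (fcut a).
exists (N2, fam_refine (@trunc _ _) (@trunc _ _) (fam_swap d2), c2); split; last first.
  exists phi, psi; split => //=; first exact: leq_trans nN2.
  by move=> m mN; apply: pm1; exact: leq_trans mN.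
move: s5; set cc := (X in state _ _ _ _ X _ _).
have ec : cc = c2.
  have idu k n' (a : ftr (cell k) n') : ftmap (@trunc k k) a = a.
    by elim: n' a => [|n' IH] a /=; rewrite ?truncid// !IH; case: a.
  apply/functional_extensionality_dep => m.
  apply/funext => t; apply/funext => a; apply/funext => b.
  by rewrite /cc /fam_refine /fam_swap /c2 !idu ftmap_trunc.
rewrite ec => -[h1 h2 h3 h4 h5]; split => //.
- have e : 2 ^+ j.+1 + 2 ^+ j + 2 ^+ j = 2 ^+ j.+2 :> R by rewrite !exprS; ring.
  by move=> t a b; rewrite -e; exact: h4.
- exact: le_trans h5 ez.
Qed.

Lemma stage0 : exists x : nat * fam (u 0) * fam (u 0), @stage 0 x.
Proof.
have [d [d0 dm]] := @extend_family
  (fun n => tree T n -> ftr (cell (u 0)) n -> ftr (cell (u 0)) n -> R)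
  (fun _ _ _ _ => 0) (fun k f t a b => f t.1 a.1 b.1 * f t.2 a.2 b.2) 0%N (fun _ _ _ => 1).
exists (0%N, d, fun _ _ _ _ => 0); have [[P0 P1] [Q0 Q1]] := (lP (u 0), lQ (u 0)).
split => //=.
- move=> t; rewrite d0; split=> // [a|b].
    by under eq_bigr do rewrite mulr1; rewrite (@pv_sum _ _ _ _ Q1 0 t) mulr1.
  by under eq_bigr do rewrite mulr1; rewrite (@pv_sum _ _ _ _ P1 0 t) mulr1.
- by move=> m _; apply/funext => t; apply/funext => a; apply/funext => b; rewrite addr0.
- by move=> t a b; rewrite lexx mulr_ge0// exprn_ge0.
- rewrite expr0 invr1 subrr (_ : (fun t => _) = (fun t : tree T 0 => 0 * 1)); last first.
    by apply/funext => t; rewrite mul0r /Exp big1// => a _; rewrite big1// => b _; rewrite mulr0.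
  by rewrite (rf_scale HI)// ?mul0r//; exact: bnn_cst.
Qed.

(** The error of code [j] enters the cost with weight [2 ^+ j], and the integrated cost never
    exceeds one; so under every later coupling that error is at most [2 ^- j]. *)
Lemma scheme_exists : exists (N : nat -> nat)
  (phi : forall j n, tree T n -> ftr (cell (v j)) n -> ftr (cell (u j)) n)
  (psi : forall j n, tree T n -> ftr (cell (u j.+1)) n -> ftr (cell (v j)) n)
  (d : forall j, fam (u j)),
  [/\ forall j, fam_map (N j.+1) (phi j), forall j, fam_map (N j.+1) (psi j),
      forall j n, (N j <= n)%N -> forall t : tree T n, coupling (P (u j)) (Q (u j)) t (d j n t),
      forall j i n, (j < i)%N -> (N i <= n)%N ->
        I (fun t : tree T n => Exp (P (u i)) (Q (u i)) t (d i n t)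
          (fun a b => ham R (phi j n t (fcut a)) (fcut b))) <=
        2 ^- j &
      forall j i n, (j < i)%N -> (N i <= n)%N ->
        I (fun t : tree T n => Exp (P (u i)) (Q (u i)) t (d i n t)
          (fun a b => ham R (psi j n t (fcut b)) (fcut a))) <=
        2 ^- j].
Proof.
pose X j := {x : nat * fam (u j) * fam (u j) | stage x}.
pose x0 : X 0%N := let: exist x hx := cid stage0 in exist _ x hx.
pose st := fix st j : X j := match j return X j with
  | 0%N => x0
  | i.+1 => let: exist y hy := cid (stage_step (projT2 (st i))) in exist _ y (proj1 hy)
  end.
have stP j : exists phi psi, stage_next (projT1 (st j)) (projT1 (st j.+1)) phi psi.
  by rewrite /=; case: cid => y [/= h1 h2].
pose phi j := projT1 (cid (stP j)).
have phiP j := projT2 (cid (stP j)).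
pose psi j := projT1 (cid (phiP j)).
have psiP j : stage_next (projT1 (st j)) (projT1 (st j.+1)) (phi j) (psi j) := projT2 (cid (phiP j)).
pose N j := (projT1 (st j)).1.1; pose d j := (projT1 (st j)).1.2; pose c j := (projT1 (st j)).2.
have sP j : state (P (u j)) (Q (u j)) (N j) (d j) (c j) (2 ^+ j.+1) (1 - 2 ^- j) :=
  projT2 (st j).
have Nle j : (N j <= N j.+1)%N by case: (psiP j).
have Nmono i j : (i <= j)%N -> (N i <= N j)%N.
  by elim: j => [|j IH]; [rewrite leqn0 => /eqP ->|rewrite leq_eqVlt => /orP[/eqP ->//|/IH h]; exact: leq_trans (Nle j)].
have umono i j : (i <= j)%N -> (u i <= u j)%N.
  elim: j => [|j IH]; [by rewrite leqn0 => /eqP ->|rewrite leq_eqVlt => /orP[/eqP ->//|/IH h]].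
  exact: leq_trans h (leq_trans (uv j) (vu j)).
have vmono j i : (j < i)%N -> (v j <= u i)%N.
  by move=> ji; apply: leq_trans (vu j) _; exact: umono.
have cE j n (t : tree T n) a b : c j.+1 n t a b =
    c j n t (fcut a) (fcut b)
      + 2 ^+ j * ham R (phi j n t (fcut a)) (fcut b)
      + 2 ^+ j * ham R (psi j n t b) (fcut a).
  by have [_ _ _ e] := psiP j; rewrite /c e.
have c_ge0 j n : (N j <= n)%N -> forall (t : tree T n) a b, 0 <= c j n t a b.
  move=> jn t a b; have [_ _ ca cb _] := sP j.
  by have /andP[] := fam_add_bnd ca cb jn t a b.
(* Costs are only ever added, after projection to the coarser resolution, so the penalty of code [j]
   is still a summand of [c i]. *)
have cphi j i n : (j < i)%N -> (N i <= n)%N -> forall (t : tree T n) a b,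
    2 ^+ j * ham R (phi j n t (fcut a)) (fcut b) <= c i n t a b /\
    2 ^+ j * ham R (psi j n t (fcut b)) (fcut a) <= c i n t a b.
  elim: i => // i IH; rewrite ltnS => ji Nn t a b; rewrite cE.
  have wham A (x y : ftr A n) k : 0 <= 2 ^+ k * ham R x y.
    by rewrite mulr_ge0 ?ham_ge0// exprn_ge0.
  have Nin := leq_trans (Nle i) Nn.
  move: ji; rewrite leq_eqVlt => /orP[/eqP ->|ji].
    have idu k n' (x : ftr (cell k) n') : ftmap (@trunc k k) x = x.
      elim: n' x => [|n' IH'] x /=; last by rewrite !IH'; case: x.
      by apply: eq_from_tnth => k'; rewrite tnth_mktuple (tnth_nth false).
    rewrite (idu _ _ b) -addrA; split; rewrite -[leLHS]add0r ?lerD ?c_ge0//.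
      by rewrite lerDl.
    by rewrite lerDr.
  have [h1 h2] := IH ji Nin t (fcut a) (fcut b).
  rewrite !ftmap_trunc ?vmono ?umono ?(ltnW ji)// in h1 h2.
  by rewrite -!addrA; split; rewrite -[leLHS]addr0 lerD// addr_ge0.
have cI i n : (N i <= n)%N ->
    I (fun t : tree T n => Exp (P (u i)) (Q (u i)) t (d i n t) (c i n t)) <= 1.
  move=> Nn; have [dm dc ca cb cI] := sP i.
  have [[P0 P1] [Q0 Q1]] := (lP (u i), lQ (u i)).
  rewrite (rf_expect HI P0 P1 Q0 dm ca dc cb Nn); apply: le_trans cI _.
  by rewrite gerBl invr_ge0 exprn_ge0.
have fin j i n (g : tree T n -> ftr (cell (u i)) n -> ftr (cell (u i)) n -> R) :
    (N i <= n)%N -> (forall t a b, 0 <= g t a b) -> (forall t a b, g t a b <= 2 ^+ n) ->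
    (forall t a b, 2 ^+ j * g t a b <= c i n t a b) ->
    I (fun t => Exp (P (u i)) (Q (u i)) t (d i n t) (g t)) <= 2 ^- j.
  move=> Nn g0 g1 gc; have j0 : (0 : R) < 2 ^+ j by rewrite exprn_gt0.
  have [[P0 P1] [Q0 Q1]] := (lP (u i), lQ (u i)); have [dm dc ca cb _] := sP i.
  have dcn := coupling_fam dm dc Nn.
  have bg : bnn (fun t => Exp (P (u i)) (Q (u i)) t (d i n t) (g t)).
    by apply: (Exp_bnd P0 P1 Q0 dcn (K := 2 ^+ n)) => t a b; rewrite g0 g1.
  have bc : bnn (fun t : tree T n => Exp (P (u i)) (Q (u i)) t (d i n t) (c i n t)).
    exact: (Exp_bnd P0 P1 Q0 dcn (fam_add_bnd ca cb Nn)).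
  rewrite -[leRHS]mul1r ler_pdivlMr// mulrC -(rf_scale HI (ltW j0) bg).
  apply: le_trans (cI i n Nn); apply: (rf_le HI) => //; first exact: bnnZ (ltW j0) bg.
  move=> t; rewrite -expectZ; by apply: Exp_le => // a b; case: (dcn t).
exists N, phi, psi, d; split.
- by move=> j; have [_ h _ _] := psiP j.
- by move=> j; have [_ _ h _] := psiP j.
- by move=> j n Nn; have [dm dc _ _ _] := sP j; exact: (coupling_fam dm dc Nn).
- move=> j i n ji Nn; apply: fin => // t a b; [exact: ham_ge0|exact: ham_le|].
  by have [] := cphi j i n ji Nn t a b.
- move=> j i n ji Nn; apply: fin => // t a b; [exact: ham_ge0|exact: ham_le|].
  by have [] := cphi j i n ji Nn t a b.
Qed.

End scheme.

Notation fcut := (ftmap (@trunc _ _)).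

Local Open Scope classical_set_scope.
Local Close Scope ring_scope.

Notation mbits F := (forall i, measurable [set x | F x i]).

Lemma sdiff_meas d (X : measurableType d) (A B : set X) :
  measurable A -> measurable B -> measurable (sdiff A B).
Proof. by move=> mA mB; apply: measurableU; exact: measurableD. Qed.

Lemma preim_meas d d' (X : measurableType d) (Y : measurableType d') (f : X -> Y) B :
  measT f -> measurable B -> measurable (f @^-1` B).
Proof. by move=> mf mB; rewrite -[_ @^-1` _]setTI; exact: mf. Qed.

Lemma cst_meas d (X : measurableType d) (P : Prop) : measurable [set _ : X | P].
Proof.
have [p|p] := pselect P; [rewrite (_ : [set _ | _] = setT)//|rewrite (_ : [set _ | _] = set0)//];
  by seteq.
Qed.

(** * Measurable matchings along group elements *)

Section views.
Local Open Scope group_scope.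

(* A view action moves the origin: [v h (v g x) = v (g * h) x], as for
   configurations [v g x t = x (g * t)]. *)
Record vaction (G : groupType) (R : realType) (d : measure_display)
    (X : measurableType d) (mu : probability X R) (v : G -> X -> X) : Prop := {
  view1 : forall x, v 1 x = x ;
  viewM : forall g h x, v h (v g x) = v (g * h) x ;
  view_meas : forall g, measT (v g) ;
  view_pres : forall g A, measurable A -> mu (v g @^-1` A) = mu A }.

Variables (R : realType) (G : groupType) (e : nat -> G) (eb : bijective e).

Section one_space.
Variables (d : measure_display) (X : measurableType d) (mu : probability X R)
  (v : G -> X -> X)
  (va : vaction mu v).

Lemma vpre g A : measurable A -> measurable (v g @^-1` A).
Proof. by move=> mA; rewrite -[_ @^-1` _]setTI; exact: (view_meas va). Qed.

Lemma viewVK g x : v g^-1 (v g x) = x.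
Proof. by rewrite (viewM va) mulgV (view1 va). Qed.

Lemma viewKV g x : v g (v g^-1 x) = x.
Proof. by rewrite (viewM va) mulVg (view1 va). Qed.

Lemma bigcupG (F : G -> set X) : (forall g, measurable (F g)) ->
  measurable (\bigcup_g F g).
Proof.
move=> mF; rewrite (_ : \bigcup_g F g = \bigcup_k F (e k)).
  exact: bigcupT_measurable.
have [e' ee' e'e] := eb; seteq => x [g _ Fg].
  by exists (e' g) => //; rewrite e'e.
by exists (e g).
Qed.

Lemma measure0_bigcupG (F : G -> set X) : (forall g, measurable (F g)) ->
  (forall g, mu (F g) = 0%E) -> mu (\bigcup_g F g) = 0%E.
Proof.
move=> mF F0; rewrite (_ : \bigcup_g F g = \bigcup_k F (e k)); last first.
  have [e' ee' e'e] := eb; seteq => x [g _ Fg].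
    by exists (e' g) => //; rewrite e'e.
  by exists (e g).
apply/eqP; rewrite -measure_le0.
have h := @measure_sigma_subadditive _ R X mu (\bigcup_k F (e k)) (fun k => F (e k)).
apply: le_trans (h _ _ _) _ => //; first exact: bigcupT_measurable.
by rewrite eseries0 ?lexx// => i _ _; exact: F0.
Qed.

(* [Hg g] is the set of heads matched with the tail at [g]. *)
Record matching (A : set X) (Hg : G -> set X) : Prop := {
  match_meas : forall g, measurable (Hg g) ;
  match_sub : forall g x, Hg g x -> A x /\ A (v g x) ;
  match_uniq : forall g h x, Hg g x -> Hg h x -> g = h ;
  match_tail : forall g h x, Hg g x -> ~ Hg h (v h^-1 x) ;
  match_inj : forall g h x, Hg g (v g^-1 x) -> Hg h (v h^-1 x) -> g = h }.

Definition heads (Hg : G -> set X) := \bigcup_g Hg g.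
Definition tails (Hg : G -> set X) := \bigcup_g (v g^-1 @^-1` Hg g).
Definition covered Hg := heads Hg `|` tails Hg.

Section matching_theory.
Variables (A : set X) (Hg : G -> set X)
  (HA : matching A Hg).

Lemma heads_meas : measurable (heads Hg).
Proof. exact/bigcupG/(match_meas HA). Qed.

Lemma tails_meas : measurable (tails Hg).
Proof. by apply: bigcupG => g; apply/vpre/(match_meas HA). Qed.

Lemma covered_meas : measurable (covered Hg).
Proof. exact: measurableU heads_meas tails_meas. Qed.

Lemma covered_sub : covered Hg `<=` A.
Proof.
move=> x [[g _ /(match_sub HA)[]//]|[g _ /= /(match_sub HA)[_]]].
by rewrite viewKV.
Qed.

Lemma heads_tails_disj : [disjoint heads Hg & tails Hg].
Proof.
apply/disj_setPRL => x [g _ /= xt] [h _ xh].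
exact: (match_tail HA xh xt).
Qed.

Definition partner x := if pselect (exists g, Hg g x) is left ex then projT1 (cid ex) else 1.

Lemma partnerE g x : Hg g x -> partner x = g.
Proof.
rewrite /partner; case: pselect => [ex xg|h]; last by move=> ?; case: h; exists g.
exact: (match_uniq HA (projT2 (cid ex)) xg).
Qed.

Lemma partner_heads x : heads Hg x -> Hg (partner x) x.
Proof. by move=> [g _ xg]; rewrite (partnerE xg). Qed.

Definition to_tail x := v (partner x) x.

Lemma measure_bigcupG (F : G -> set X) : (forall g, measurable (F g)) ->
  (forall g h x, F g x -> F h x -> g = h) ->
  mu (\bigcup_g F g) = (\sum_(k <oo) mu (F (e k)))%E.
Proof.
move=> mF tF; have [e' ee' e'e] := eb.
rewrite (_ : \bigcup_g F g = \bigcup_k F (e k)); last first.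
  seteq => x [g _ Fg]; last by exists (e g).
  by exists (e' g) => //; rewrite e'e.
apply: measure_semi_bigcup => //; last exact: bigcupT_measurable.
move=> i j _ _ [x [Fi Fj]]; apply: (can_inj ee'); exact: tF Fi Fj.
Qed.

Lemma match_measure E : measurable E ->
  mu (covered Hg `&` E) = (mu (heads Hg `&` E) + mu (heads Hg `&` to_tail @^-1` E))%E.
Proof.
move=> mE; have [mH mT] := (heads_meas, tails_meas).
rewrite /covered setIUl measureU; first last.
- seteq => // x [[xH _] [xT _]].
  by have /disj_setPRL/(_ x xT) := heads_tails_disj.
- exact: measurableI.
- exact: measurableI.
congr (_ + _)%E.
have -> : tails Hg `&` E = \bigcup_g (v g^-1 @^-1` (Hg g `&` v g @^-1` E)).
  seteq => x.
    by move=> [[g _ xg] Ex]; exists g => //; split => //=; rewrite viewKV.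
  move=> [g _ [xg]] /=; rewrite viewKV => Ex; split => //.
  by exists g.
have mHE g : measurable (Hg g `&` v g @^-1` E).
  by apply: measurableI; [exact: (match_meas HA)|exact: vpre].
apply: (etrans (measure_bigcupG (F := fun g => v g^-1 @^-1` (Hg g `&` v g @^-1` E)) _ _)).
- by move=> g; exact: vpre.
- by move=> g h x [xg _] [xh _]; exact: (match_inj HA xg xh).
have -> : heads Hg `&` to_tail @^-1` E = \bigcup_g (Hg g `&` v g @^-1` E).
  seteq => x.
    by move=> [xh Ex]; exists (partner x) => //; split => //; exact: partner_heads.
  move=> [g _ [xg Ex]]; split; first by exists g.
  by rewrite /= /to_tail (partnerE xg).
apply/esym; apply: (etrans (measure_bigcupG (F := fun g => Hg g `&` v g @^-1` E) _ _)) => //.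
  by move=> g h x [xg _] [xh _]; exact: (match_uniq HA xg xh).
by apply: eq_eseriesr => k _; rewrite (view_pres va).
Qed.

End matching_theory.

Lemma matching_union (A : set X) H1 H2 : matching A H1 -> matching (A `\` covered H1) H2 ->
  matching A (fun g => H1 g `|` H2 g) /\
  covered (fun g => H1 g `|` H2 g) = covered H1 `|` covered H2.
Proof.
move=> m1 m2.
have c1 g x : H1 g x -> covered H1 x by move=> h; left; exists g.
have t1 g x : H1 g (v g^-1 x) -> covered H1 x by move=> h; right; exists g.
have c2 g x : H2 g x -> ~ covered H1 x by move=> /(match_sub m2)[[_]].
have t2 g x : H2 g (v g^-1 x) -> ~ covered H1 x.
  by move=> /(match_sub m2)[_ []]; rewrite viewKV.
split; last first.
  rewrite /covered /heads /tails; seteq => x.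
    by move=> [[g _ [h|h]]|[g _ [h|h]]]; [left;left|right;left|left;right|right;right]; exists g.
  by move=> [[[g _ h]|[g _ h]]|[[g _ h]|[g _ h]]]; [left|right|left|right]; exists g => //; [left|left|right|right].
split.
- by move=> g; apply: measurableU; [exact: (match_meas m1)|exact: (match_meas m2)].
- by move=> g x [/(match_sub m1)//|/(match_sub m2)[[? _] [? _]]].
- move=> g h x [xg|xg] [xh|xh].
  + exact: (match_uniq m1 xg xh).
  + by case: (c2 _ _ xh); exact: c1 xg.
  + by case: (c2 _ _ xg); exact: c1 xh.
  + exact: (match_uniq m2 xg xh).
- move=> g h x [xg|xg] [xh|xh].
  + exact: (match_tail m1 xg xh).
  + by case: (t2 _ _ xh); exact: c1 xg.
  + by case: (c2 _ _ xg); exact: t1 xh.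
  + exact: (match_tail m2 xg xh).
- move=> g h x [xg|xg] [xh|xh].
  + exact: (match_inj m1 xg xh).
  + by case: (t2 _ _ xh); exact: t1 xg.
  + by case: (t2 _ _ xg); exact: t1 xh.
  + exact: (match_inj m2 xg xh).
Qed.

Section run.
Variables (A : set X) (gs : nat -> G) (ts : nat -> set X).
Hypotheses (mA : measurable A) (mts : forall k, measurable (ts k)).

(** Heads pass the test [ts k] and tails fail it, so all eligible pairs at displacement [gs k] are
    matched at once without using a site twice. *)
Definition run_step (B : set X) k :=
  B `&` ts k `&` v (gs k) @^-1` (B `\` ts k).

Fixpoint run_alive k := if k is j.+1 then
    run_alive j `\` (run_step (run_alive j) j `|` v (gs j)^-1 @^-1` run_step (run_alive j) j)
  else A.

Definition run_heads g := \bigcup_(k in [set k | gs k = g]) run_step (run_alive k) k.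

Lemma run_step_meas B k : measurable B -> measurable (run_step B k).
Proof.
move=> mB; apply: measurableI; first exact: measurableI.
by apply: vpre; exact: measurableD.
Qed.

Lemma run_alive_meas k : measurable (run_alive k).
Proof.
elim: k => //= k IH; have mS := run_step_meas k IH.
by apply: measurableD => //; apply: measurableU => //; exact: vpre.
Qed.

Lemma run_alive_le i j : (i <= j)%N -> run_alive j `<=` run_alive i.
Proof.
elim: j => [|j IH]; first by rewrite leqn0 => /eqP ->.
rewrite leq_eqVlt => /orP[/eqP ->//|/IH h] x [/h//].
Qed.

Let hd k := run_step (run_alive k) k.

Lemma run_hd_alive i j x : hd i x -> run_alive j x -> (j <= i)%N.
Proof.
move=> hi aj; rewrite leqNgt; apply/negP => ij.
by have /= [_] := run_alive_le ij aj; apply; left.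
Qed.

Lemma run_tl_alive i j x : hd i (v (gs i)^-1 x) -> run_alive j x -> (j <= i)%N.
Proof.
move=> hi aj; rewrite leqNgt; apply/negP => ij.
by have /= [_] := run_alive_le ij aj; apply; right.
Qed.

Lemma run_hd_sub k x : hd k x -> run_alive k x /\ run_alive k (v (gs k) x).
Proof. by move=> [[? _] [? _]]. Qed.

Lemma run_tl_sub k x : hd k (v (gs k)^-1 x) -> run_alive k x.
Proof. by move=> /run_hd_sub[_]; rewrite viewKV. Qed.

Lemma run_matching : matching A run_heads.
Proof.
split.
- move=> g; apply: bigcup_measurable => k _.
  exact/run_step_meas/run_alive_meas.
- move=> g x [k /= <-] /run_hd_sub[h1 h2].
  by split; apply: (run_alive_le (leq0n k)).
- move=> g h x [i /= <- hi] [j /= <- hj].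
  have [ai _] := run_hd_sub hi; have [aj _] := run_hd_sub hj.
  by congr gs; apply/eqP; rewrite eqn_leq (run_hd_alive hi aj) (run_hd_alive hj ai).
- move=> g h x [i /= ig hi] [j /= jh hj]; rewrite -{}jh in hj.
  have [ai _] := run_hd_sub hi; have aj := run_tl_sub hj.
  have ij : i = j by apply/eqP; rewrite eqn_leq (run_tl_alive hj ai) (run_hd_alive hi aj).
  move: hi hj; rewrite ij => -[[_ h1] _] [_ [_]] /=.
  by rewrite viewKV.
- move=> g h x [i /= ig hi] [j /= jh hj].
  rewrite -{}ig in hi *; rewrite -{}jh in hj *.
  have ai := run_tl_sub hi; have aj := run_tl_sub hj.
  by congr gs; apply/eqP; rewrite eqn_leq (run_tl_alive hi aj) (run_tl_alive hj ai).
Qed.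

(** Otherwise [x] and its translate, both alive at step [k], would have been matched there. *)
Lemma run_left k x : A x -> ~ covered run_heads x -> A (v (gs k) x) ->
  ~ covered run_heads (v (gs k) x) -> ts k x -> ts k (v (gs k) x).
Proof.
move=> Ax nx Ay ny tx; apply: contrapT => ty.
have alive z : A z -> ~ covered run_heads z -> forall j, run_alive j z.
  move=> Az nz; elim=> //= j IH; split => // -[h|h]; apply: nz.
    by left; exists (gs j) => //; exists j.
  by right; exists (gs j) => //; exists j.
apply: (nx); left; exists (gs k) => //; exists k => //.
by split; [split; [exact: alive|exact: tx]|split; [exact: alive|exact: ty]].
Qed.

End run.

End one_space.
End views.

(** * Integration over matched sites, and matchings that pair opposite signs *)

Section match_integral.
Local Open Scope group_scope.
Variables (R : realType) (G : groupType) (e : nat -> G) (eb : bijective e).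
Variables (d : measure_display) (X : measurableType d) (mu : probability X R)
  (v : G -> X -> X)
  (va : vaction mu v).

Lemma integral_view g (D : set X) (u : X -> \bar R) : measurable D ->
  measT u -> (forall x, (0 <= u x)%E) ->
  (\int[mu]_(x in v g @^-1` D) u (v g x) = \int[mu]_(x in D) u x)%E.
Proof.
move=> mD mu_ u0.
rewrite -(@ge0_integral_pushforward _ _ _ _ _ _ (view_meas va g) mu D u) //.
- by apply: eq_measure_integral => [|mv A mA _]; [exact: (view_meas va)|exact: (view_pres va)].
- exact: measurable_funTS mu_.
Qed.

Lemma integral_bigcupG (F : G -> set X) (u : X -> \bar R) :
  (forall g, measurable (F g)) -> (forall g h x, F g x -> F h x -> g = h) ->
  measT u -> (forall x, (0 <= u x)%E) ->
  (\int[mu]_(x in \bigcup_g F g) u x = \sum_(k <oo) \int[mu]_(x in F (e k)) u x)%E.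
Proof.
move=> mF tF mu_ u0; have [e' ee' e'e] := eb.
have -> : \bigcup_g F g = \bigcup_k F (e k).
  seteq => x [g _ Fg]; last by exists (e g).
  by exists (e' g) => //; rewrite e'e.
apply: ge0_integral_bigcup => //; first exact: measurable_funTS mu_.
by move=> i j _ _ [x [Fi Fj]]; apply: (can_inj ee'); exact: tF Fi Fj.
Qed.

Section matching.
Variables (A : set X) (Hg : G -> set X).
Hypotheses (HA : matching v A Hg).

(** Measurability for the discrete structure on the codomain, which suits group elements, types and
    trees of types. *)
Definition dm (X1 : Type) (f : X -> X1) := forall B, measurable (f @^-1` B).

Lemma dm_comp X1 X2 (f : X -> X1) (g : X1 -> X2) : dm f -> dm (fun x => g (f x)).
Proof. by move=> mf B; exact: (mf (g @^-1` B)). Qed.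

Lemma dm_fun d' (Z : measurableType d') (f : X -> Z) : dm f -> measT f.
Proof. by move=> mf _ B _; rewrite setTI; exact: mf. Qed.

(** Countability of the range of the first component makes the preimage a countable union. *)
Lemma dm_pair X1 X2 (n1 : nat -> X1) (f : X -> X1) (g : X -> X2) :
  (forall x, exists k, n1 k = x) -> dm f -> dm g -> dm (fun x => (f x, g x)).
Proof.
move=> n1s mf mg B.
have -> : (fun x => (f x, g x)) @^-1` B =
    \bigcup_k (f @^-1` [set n1 k] `&` g @^-1` [set z | B (n1 k, z)]).
  seteq => x /=.
    by move=> Bx; have [k fk] := n1s (f x); exists k => //; split; rewrite /= fk.
  by move=> [k _ [/= -> ]].
by apply: bigcupT_measurable => k; apply: measurableI; [exact: mf|exact: mg].
Qed.

Lemma partner_dm : dm (partner Hg).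
Proof.
move=> B; rewrite (_ : _ @^-1` B = \bigcup_g (Hg g `&` [set _ | B g]) `|`
    (~` heads Hg `&` [set _ | B 1])); last first.
  seteq => x /=.
    move=> Bx; have [[g _ xg]|nx] := pselect (heads Hg x).
      by left; exists g => //; split => //=; rewrite -(partnerE HA xg).
    right; split => //=; move: Bx; rewrite /partner; case: pselect => // ex.
    by case: nx; case: ex => g xg; exists g.
  move=> [[g _ [xg Bg]]|[nx B1]]; first by rewrite (partnerE HA xg).
  by rewrite /partner; case: pselect => // ex; case: nx; case: ex => g xg; exists g.
have cst P := @cst_meas _ X P.
apply: measurableU.
  by apply: (bigcupG eb) => g; apply: measurableI => //; exact: (match_meas HA).
by apply: measurableI => //; apply: measurableC; exact: (heads_meas eb HA).
Qed.

Lemma view_by_dm X1 (f : X -> G) (h : X -> X1) : dm f -> dm h -> dm (fun x => h (v (f x) x)).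
Proof.
move=> mf mh B; rewrite (_ : _ @^-1` B =
    \bigcup_g (f @^-1` [set g] `&` v g @^-1` (h @^-1` B))); last first.
  seteq => x /=; first by move=> Bx; exists (f x).
  by move=> [g _ [/= ->]].
apply: (bigcupG eb) => g; apply: measurableI; first exact: mf.
exact/(vpre va)/mh.
Qed.

Lemma to_tail_measT : measT (to_tail v Hg).
Proof.
move=> _ B mB; rewrite setTI (_ : _ @^-1` B =
    \bigcup_g (partner Hg @^-1` [set g] `&` v g @^-1` B)); last first.
  seteq => x /=; first by move=> Bx; exists (partner Hg x).
  by move=> [g _ [/= <-]].
apply: (bigcupG eb) => g; apply: measurableI; first exact: partner_dm.
exact: (vpre va).
Qed.

(** Almost all of [A] is covered, and each piece of the tails is a translate of a piece of the
    heads, so it carries the same measure. *)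
Lemma match_integral (u : X -> \bar R) : measurable A -> mu (A `\` covered v Hg) = 0%E ->
  measT u -> (forall x, (0 <= u x)%E) ->
  (\int[mu]_(x in A) u x =
   \int[mu]_(x in heads Hg) u x + \int[mu]_(x in heads Hg) u (to_tail v Hg x))%E.
Proof.
move=> mA A0 mu_ u0.
have [mH mT] := (heads_meas eb HA, tails_meas eb va HA).
have mC := covered_meas eb va HA.
have mfS D : measurable_fun D u by exact: measurable_funTS mu_.
rewrite (ge0_negligible_integral (N := A `\` covered v Hg))//; last exact: measurableD.
rewrite setDD setIidr; last exact: (covered_sub va HA).
rewrite /covered ge0_integral_setU//; last exact: heads_tails_disj HA.
congr (_ + _)%E.
rewrite (integral_bigcupG (F := fun g => v g^-1 @^-1` Hg g))//; first last.
- by move=> g h x; exact: (match_inj HA).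
- by move=> g; apply: (vpre va); exact: (match_meas HA).
have mtt : measT (fun x => u (to_tail v Hg x)).
  exact: (measurableT_comp mu_ to_tail_measT).
rewrite [RHS](integral_bigcupG (F := Hg))//; first last.
- by move=> g h x; exact: (match_uniq HA).
- exact: (match_meas HA).
apply: eq_eseriesr => k _; set g := e k.
have mug : measT (fun x => u (v g x)).
  exact: (measurableT_comp mu_ (view_meas va g)).
rewrite (_ : (\int[mu]_(x in v g^-1 @^-1` Hg g) u x = \int[mu]_(x in v g^-1 @^-1` Hg g) u (v g (v g^-1 x)))%E).
  rewrite (integral_view g^-1 (match_meas HA g) mug)//.
  by apply: eq_integral => x; rewrite inE => xg; rewrite /to_tail (partnerE HA xg).
by apply: eq_integral => x _; rewrite (viewKV va).
Qed.

End matching.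

Section level_matching.
Variables (tst : nat -> set X) (N0 : set X).
Hypotheses (mtst : forall i, measurable (tst i)) (mN0 : measurable N0) (N00 : mu N0 = 0%E).
Hypothesis free : forall x g, ~ N0 x -> (forall i, tst i x <-> tst i (v g x)) -> g = 1.
Hypothesis ergo : forall A B : set X, measurable A -> measurable B ->
  mu A <> 0%E -> mu B <> 0%E -> exists g, A `&` v g @^-1` B !=set0.

Definition dec2 k : nat * nat := odflt (0, 0)%N (unpickle k).

Lemma dec_pairK p : dec2 (pickle p) = p.
Proof. by rewrite /dec2 pickleK. Qed.

Variables (A S : set X).
Hypotheses (mA : measurable A) (mS : measurable S).

(** A level is matched in two rounds. The first pairs sites in [S] with sites outside it; ergodicity
    then leaves sites of one sign only. The second pairs the leftovers by means of the tests [tst],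
    which separate the points of an orbit off [N0], so that almost nothing remains. *)
Definition sign_match := run_heads v A e (fun=> S).
Definition unsigned := A `\` covered v sign_match.
Definition rest_match :=
  run_heads v unsigned (fun k => e (dec2 k).1) (fun k => tst (dec2 k).2).
Definition level_match g := sign_match g `|` rest_match g.

Lemma sign_matching : matching v A sign_match.
Proof. by apply: (run_matching va). Qed.

Lemma unsigned_meas : measurable unsigned.
Proof. by apply: measurableD => //; exact: (covered_meas eb va sign_matching). Qed.

Lemma rest_matching : matching v unsigned rest_match.
Proof. by apply: (run_matching va) => //; exact: unsigned_meas. Qed.

Lemma level_matching : matching v A level_match.
Proof. by have [] := matching_union va sign_matching rest_matching. Qed.

Lemma level_covered : covered v level_match = covered v sign_match `|` covered v rest_match.
Proof. by have [] := matching_union va sign_matching rest_matching. Qed.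

(** The translates of [B] are disjoint, equally large and infinitely many, inside a probability
    space. *)
Lemma disjoint_translates_null (B : set X) : measurable B ->
  (forall g x, B x -> B (v g x) -> g = 1) -> mu B = 0%E.
Proof.
move=> mB Bg; have [e' ee' e'e] := eb.
apply/eqP; apply: contraT => B0.
have Bpos : (0 < mu B)%E by rewrite lt0e B0 measure_ge0.
have : (mu (\bigcup_g v g @^-1` B) <= 1)%E.
  by apply: probability_le1; apply: (bigcupG eb) => g; exact: (vpre va).
rewrite (measure_bigcupG eb mu (F := fun g => v g @^-1` B)); first last.
- move=> g h x /= xg xh; have := Bg (g^-1 * h) (v g x) xg.
  by rewrite (viewM va) mulVKg => /(_ xh) e1; rewrite -[h](mulVKg g) e1 mulg1.
- by move=> g; exact: (vpre va).
have [b bE] : exists b : R, mu B = b%:E.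
  by exists (fine (mu B)); rewrite fineK// fin_num_measure.
rewrite bE lte_fin in Bpos; pose k := Num.bound b^-1.
rewrite (eq_eseriesr (g := fun=> b%:E)); last by move=> j _; rewrite (view_pres va).
have b0 n : (0 <= n)%N -> xpredT n -> (0 <= b%:E)%E by rewrite lee_fin ltW.
move=> /(le_trans (nneseries_lim_ge k b0)).
rewrite sumEFin lee_fin big_const_nat subn0 iter_addr_0 leNgt => /negP; case.
have := @archi_boundP R b^-1; rewrite invr_ge0 (ltW Bpos) => /(_ isT).
by rewrite -/k -div1r ltr_pdivrMr// mulr_natl.
Qed.

(** Two leftover sites of one orbit pass the same tests, since otherwise one of the two directions
    would have matched them; off [N0] they coincide by freeness. The leftover set thus has disjoint
    translates. *)
Lemma level_cover0 : mu (A `\` covered v level_match) = 0%E.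
Proof.
have mL : measurable (A `\` covered v level_match).
  by apply: measurableD => //; exact: (covered_meas eb va level_matching).
have mL0 : measurable ((A `\` covered v level_match) `&` N0) by exact: measurableI.
have mL1 : measurable ((A `\` covered v level_match) `\` N0) by exact: measurableD.
rewrite -(setUIDK (A `\` covered v level_match) N0) measureU//; last first.
  by seteq => // x [[_ ?] [_ ?]].
rewrite (subset_measure0 _ _ _ N00) ?add0e//.
apply: disjoint_translates_null => // g x [[Ax nx] N0x] [[Ay ny] N0y].
have unx z : A z -> ~ covered v level_match z -> unsigned z /\ ~ covered v rest_match z.
  by move=> Az; rewrite level_covered => /not_orP[? ?].
have [ux rx] := unx _ Ax nx; have [uy ry] := unx _ Ay ny.
have [e' ee' e'e] := eb.
apply: (free N0x) => i; split => h.
  have := @run_left _ _ _ v unsigned (fun k => e (dec2 k).1)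
    (fun k => tst (dec2 k).2) (pickle (e' g, i)) x ux rx.
  by rewrite dec_pairK /= e'e; apply.
have := @run_left _ _ _ v unsigned (fun k => e (dec2 k).1)
    (fun k => tst (dec2 k).2) (pickle (e' g^-1, i)) (v g x) uy ry.
by rewrite dec_pairK /= e'e (viewVK va); apply.
Qed.

(** If leftovers of both signs had positive measure, ergodicity would give a displacement leading
    from one kind to the other, and that pair would have been matched. *)
Lemma level_sign : mu (unsigned `&` S) = 0%E \/ mu (unsigned `\` S) = 0%E.
Proof.
have mU := unsigned_meas.
have [h|h] := pselect (mu (unsigned `&` S) = 0%E); first by left.
right; apply: contrapT => h'.
have m1 : measurable (unsigned `&` S) by exact: measurableI.
have m2 : measurable (unsigned `\` S) by exact: measurableD.
have [g [x [[ux Sx] [uy nSy]]]] := ergo m1 m2 h h'.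
have [e' ee' e'e] := eb; apply: nSy.
have := @run_left _ _ _ v A e (fun=> S) (e' g) x ux.1 ux.2.
by rewrite e'e; apply => //; [exact: uy.1|exact: uy.2].
Qed.

Lemma level_heads g x : level_match g x ->
  [/\ A x, A (v g x) & (S x /\ ~ S (v g x)) \/ (unsigned x /\ unsigned (v g x))].
Proof.
move=> h; have [h1 h2] := match_sub level_matching h; split => //.
move: h => [[k /= <- [[_ Sx] [_ nS]]]|h]; first by left.
by right; exact: (match_sub rest_matching h).
Qed.

End level_matching.
End match_integral.

Local Open Scope ring_scope.

Lemma meas_inh d (X : measurableType d) (A : set X) : (X -> measurable A) -> measurable A.
Proof.
have [[x _]|nx] := pselect (exists x : X, True); first exact.
by rewrite (_ : A = set0)//; seteq => // x; case: nx; exists x.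
Qed.

Lemma le_meas d (X : measurableType d) (R : realType) (mu : {measure set X -> \bar R}) A B :
  measurable A -> measurable B -> A `<=` B -> (mu A <= mu B)%E.
Proof. by move=> mA mB AB; apply: le_measure; rewrite ?inE. Qed.

(** * The levels of the hierarchy and the balance of block sums *)

Section levels.
Variables (R : realType) (G : groupType) (e : nat -> G) (eb : bijective e).
Variables (d : measure_display) (X : measurableType d) (mu : probability X R)
  (v : G -> X -> X)
  (va : vaction mu v).
Variables (tst : nat -> set X) (N0 : set X).
Hypotheses (mtst : forall i, measurable (tst i)) (mN0 : measurable N0) (N00 : mu N0 = 0%E).
Hypothesis free : forall x g, ~ N0 x -> (forall i, tst i x <-> tst i (v g x)) -> g = 1%g.
Hypothesis ergo : forall A B : set X, measurable A -> measurable B ->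
  mu A <> 0%E -> mu B <> 0%E -> exists g, A `&` v g @^-1` B !=set0.
Variables (A0 : set X) (tau : X -> nat) (hz : nat -> nat -> R).
Hypotheses (mA0 : measurable A0) (mtau : dm tau).

Lemma null_setU (A B : set X) : measurable A -> measurable B ->
  mu A = 0%E -> mu B = 0%E -> mu (A `|` B) = 0%E.
Proof. by move=> mA mB A1 B1; rewrite measureU0. Qed.

(** Level [n] balances the function [hz (turn n)]; each function gets infinitely many turns. *)
Definition turn n := (dec2 n).1.

Lemma turn_infinite j n : exists2 n', (n <= n')%N & turn n' = j.
Proof.
apply: contrapT => h.
have lt (i : nat) : (pickle (j, i) < n)%N.
  rewrite ltnNge; apply/negP => ni; apply: h; exists (pickle (j, i)) => //.
  by rewrite /turn dec_pairK.
pose f (i : 'I_n.+1) : 'I_n := Ordinal (lt i).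
have /leq_card : injective f.
  move=> i i' /(congr1 val) /= /(congr1 (@unpickle (nat * nat)%type)).
  by rewrite !pickleK => -[] /val_inj.
by rewrite !card_ord ltnn.
Qed.

Definition sign_set n (T : X -> tree nat n) := [set x | 0 < tsum (hz (turn n)) (T x)].

(** A root of the next level is a head, and its tree joins its own tree with that of its partner. *)
Fixpoint lev n : set X * (X -> tree nat n) :=
  if n is m.+1 return set X * (X -> tree nat n) then
    let A := (lev m).1 in let T := (lev m).2 in
    let Hg := level_match e v tst A (sign_set T) in
    (heads Hg, fun x => (T x, T (to_tail v Hg x)))
  else (A0, tau).

Definition Rt n := (lev n).1.
Definition Tv n := (lev n).2.
Definition Hm n := level_match e v tst (Rt n) (sign_set (Tv n)).

Lemma tree_enum n : exists f : nat -> tree nat n, forall t, exists k, f k = t.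
Proof.
elim: n => [|n [f fs]]; first by exists id => t; exists t.
exists (fun k => (f (dec2 k).1, f (dec2 k).2)) => -[t1 t2].
have [[k1 <-] [k2 <-]] := (fs t1, fs t2).
by exists (pickle (k1, k2)); rewrite dec_pairK.
Qed.

Lemma lev_meas n : measurable (Rt n) /\ dm (Tv n).
Proof.
elim: n => [//|n [mR mT]]; have mS : measurable (sign_set (Tv n)).
  exact: (mT [set t | 0 < tsum (hz (turn n)) t]).
have HA := level_matching eb va mtst mR mS.
split; first exact: (heads_meas eb HA).
have [f fs] := tree_enum n.
apply: (dm_pair fs) => //.
by apply: (view_by_dm eb va) => //; exact: (partner_dm eb HA).
Qed.

Lemma Rt_meas n : measurable (Rt n). Proof. by case: (lev_meas n). Qed.
Lemma Tv_dm n : dm (Tv n). Proof. by case: (lev_meas n). Qed.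

Lemma sgn_meas n : measurable (sign_set (Tv n)).
Proof. exact: (@Tv_dm n [set t | 0 < tsum (hz (turn n)) t]). Qed.

Lemma Hm_matching n : matching v (Rt n) (Hm n).
Proof. exact: (level_matching eb va mtst (Rt_meas n) (sgn_meas n)). Qed.

Lemma Hm_cover n : mu (Rt n `\` covered v (Hm n)) = 0%E.
Proof.
exact: (level_cover0 eb va mtst mN0 N00 free (Rt_meas n) (sgn_meas n)).
Qed.

Lemma TvS n x : Tv n.+1 x = (Tv n x, Tv n (to_tail v (Hm n) x)). Proof. by []. Qed.

Lemma null_next n E : measurable E -> mu (Rt n `&` E) = 0%E ->
  mu (Rt n.+1 `&` E) = 0%E /\ mu (Rt n.+1 `&` to_tail v (Hm n) @^-1` E) = 0%E.
Proof.
move=> mE E0; have HA := Hm_matching n; have mH := heads_meas eb HA.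
have := match_measure eb va HA mE.
have -> : mu (covered v (Hm n) `&` E) = 0%E.
  apply: (subset_measure0 _ _ _ E0).
  - by apply: measurableI => //; exact: (covered_meas eb va HA).
  - by apply: measurableI => //; exact: Rt_meas.
  - by apply: setSI; exact: (covered_sub va HA).
move=> /esym/eqP; rewrite padde_eq0 ?measure_ge0// => /andP[/eqP -> /eqP]; split => //.
Qed.

Definition Jf n (h : tree nat n -> R) := (\int[mu]_(x in Rt n) (h (Tv n x))%:E)%E.
Definition If n (h : tree nat n -> R) := fine (Jf h).

Lemma Tv_fun n (h : tree nat n -> R) : measT (fun x => (h (Tv n x))%:E).
Proof. by move=> _ B _; rewrite setTI; exact: (@Tv_dm n [set t | B (h t)%:E]). Qed.

Lemma Jf_ge0 n (h : tree nat n -> R) : (forall t, 0 <= h t) -> (0 <= Jf h)%E.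
Proof. by move=> h0; apply: integral_ge0 => x _; rewrite lee_fin. Qed.

Lemma Jf_fin n (h : tree nat n -> R) : bnn h -> Jf h \is a fin_num.
Proof.
move=> [K hK]; have h0 t : 0 <= h t by case/andP: (hK t).
rewrite ge0_fin_numE ?Jf_ge0//.
apply: (@le_lt_trans _ _ (\int[mu]_(x in Rt n) (cst K%:E x))%E).
  apply: ge0_le_integral => //; first exact: Rt_meas.
  - by move=> x _; rewrite lee_fin.
  - exact/measurable_funTS/Tv_fun.
  - by move=> x _; rewrite lee_fin; case/andP: (hK (Tv n x)).
rewrite integral_cst; last exact: Rt_meas.
apply: (@le_lt_trans _ _ (K%:E * 1)%E); last by rewrite mule1 ltry.
apply: lee_wpmul2l; last exact: (probability_le1 mu (Rt_meas n)).
by rewrite lee_fin; case/andP: (hK (Tv n point)) => ?; exact: le_trans.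
Qed.

Lemma JfE n (h : tree nat n -> R) : bnn h -> Jf h = (If h)%:E.
Proof. by move=> bh; rewrite fineK// Jf_fin. Qed.

Lemma Jf_le_ae n (f g : tree nat n -> R) : (forall t, 0 <= f t) -> (forall t, 0 <= g t) ->
  mu (Rt n `&` [set x | g (Tv n x) < f (Tv n x)]) = 0%E -> (Jf f <= Jf g)%E.
Proof.
move=> f0 g0 fg; apply: ae_ge0_le_integral => //.
- exact: Rt_meas.
- by move=> x _; rewrite lee_fin.
- exact/measurable_funTS/Tv_fun.
- by move=> x _; rewrite lee_fin.
- exact/measurable_funTS/Tv_fun.
exists (Rt n `&` [set x | g (Tv n x) < f (Tv n x)]); split => //.
  apply: measurableI; first exact: Rt_meas.
  exact: (@Tv_dm n [set t | g t < f t]).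
move=> x /= /not_implyP[Rx]; rewrite lee_fin => /negP; rewrite -ltNge.
by split.
Qed.

Lemma Jf_double n (f : tree nat n -> R) : (forall t, 0 <= f t) ->
  Jf f = Jf (fun t : tree nat n.+1 => f t.1 + f t.2).
Proof.
move=> f0; rewrite /Jf (match_integral eb va (Hm_matching n))//; first last.
- by move=> x; rewrite lee_fin.
- exact: Tv_fun.
- exact: Hm_cover.
- exact: Rt_meas.
have mtt := to_tail_measT eb va (Hm_matching n).
apply/esym; under eq_integral do rewrite TvS /= EFinD.
rewrite ge0_integralD//.
- exact: (Rt_meas n.+1).
- by move=> x _; rewrite lee_fin.
- exact/measurable_funTS/Tv_fun.
- by move=> x _; rewrite lee_fin.
- apply: measurable_funTS; apply: (measurableT_comp (f := fun x => (f (Tv n x))%:E)) => //.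
  exact: Tv_fun.
Qed.

Lemma root_functional_If : root_functional If.
Proof.
split.
- move=> n f g bf bg fg; rewrite -lee_fin -!JfE//.
  have [[K fK] [L gL]] := (bf, bg).
  apply: Jf_le_ae.
  + by move=> t; case/andP: (fK t).
  + by move=> t; case/andP: (gL t).
  rewrite (_ : _ `&` _ = set0)//; seteq => // x [_ /=].
  by rewrite ltNge fg.
- move=> n f g bf bg; apply/EFin_inj; rewrite EFinD -!JfE//; last exact: bnnD.
  have [[K fK] [L gL]] := (bf, bg).
  rewrite /Jf; under eq_integral do rewrite EFinD.
  apply: ge0_integralD => //.
  + exact: Rt_meas.
  + by move=> x _; rewrite lee_fin; case/andP: (fK (Tv n x)).
  + exact/measurable_funTS/Tv_fun.
  + by move=> x _; rewrite lee_fin; case/andP: (gL (Tv n x)).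
  + exact/measurable_funTS/Tv_fun.
- move=> n k f k0 bf; apply/EFin_inj; rewrite EFinM -!JfE//; last exact: bnnZ.
  have [K fK] := bf.
  rewrite /Jf; under eq_integral do rewrite EFinM.
  apply: ge0_integralZl_EFin => //.
  + exact: Rt_meas.
  + by move=> x _; rewrite lee_fin; case/andP: (fK (Tv n x)).
  + exact/measurable_funTS/Tv_fun.
- move=> n f [K fK]; congr fine; apply: Jf_double => t.
  by case/andP: (fK t).
- rewrite -lee_fin -JfE; last exact: bnn_cst.
  rewrite /Jf (_ : (fun x => _) = cst 1%E)// integral_cst ?mul1e; last exact: Rt_meas.
  exact: (probability_le1 mu (Rt_meas 0)).
Qed.

Section balance.
Variables (j : nat) (h : nat -> R) (m K : R).
Hypotheses (hK : forall k, 0 <= h k <= K) (m0 : 0 <= m)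
  (mE : If (n := 0) h = m * If (n := 0) (fun=> 1)) (hzE : hz j = fun k => h k - m).

Let s n x := tsum (hz j) (Tv n x).

Let within n a b := mu (Rt n `&` [set x | ~ (- a * 2 ^+ n <= s n x <= b * 2 ^+ n)]) = 0%E.

Let s_meas n (B : set R) : measurable [set x | B (s n x)].
Proof. exact: (@Tv_dm n [set t | B (tsum (hz j) t)]). Qed.

Let sS n x : s n.+1 x = s n x + s n (to_tail v (Hm n) x).
Proof. by rewrite /s TvS. Qed.

Let bad n a b := [set x | ~ (- a * 2 ^+ n <= s n x <= b * 2 ^+ n)].

Let bad_meas n a b : measurable (bad n a b).
Proof. exact: (@s_meas n [set z | ~ (- a * 2 ^+ n <= z <= b * 2 ^+ n)]). Qed.

Let next_null n (E F : set X) : measurable E -> measurable F -> mu (Rt n `&` E) = 0%E ->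
  Rt n.+1 `&` F `<=` E `|` to_tail v (Hm n) @^-1` E -> mu (Rt n.+1 `&` F) = 0%E.
Proof.
move=> mE_ mF E0 FE; have [h1 h2] := null_next mE_ E0.
have mt : measurable (to_tail v (Hm n) @^-1` E).
  by rewrite -[_ @^-1` _]setTI; exact: (to_tail_measT eb va (Hm_matching n)).
have mR := Rt_meas n.+1.
apply: (@subset_measure0 _ _ _ mu _ (Rt n.+1 `&` E `|` Rt n.+1 `&` to_tail v (Hm n) @^-1` E)).
- exact: measurableI.
- by apply: measurableU; exact: measurableI.
- by move=> x [Rx Fx]; have [Ex|Ex] := FE x (conj Rx Fx); [left|right].
by apply: null_setU => //; exact: measurableI.
Qed.

Let within_next n a b : within n a b -> within n.+1 a b.
Proof.
move=> w; apply: (next_null (bad_meas n a b)) => //; first exact: bad_meas.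
move=> x [_ /= nx]; apply: contrapT => /not_orP[/contrapT h1 /contrapT h2].
apply: nx; rewrite sS exprS; move: h1 h2 => /andP[? ?] /andP[? ?].
by apply/andP; split; lra.
Qed.

(** Pairs of opposite signs keep their sum within the old interval, which is half as wide relative
    to [2 ^+ n.+1]. By [level_sign] the other pairs all have one sign, so they can violate only one
    of the two halved bounds; the other bound improves. *)
Let within_turn n a b : turn n = j -> 0 <= a -> 0 <= b -> within n a b ->
  within n.+1 (a / 2) b \/ within n.+1 a (b / 2).
Proof.
move=> tn a0 b0 w; have aM : 0 <= a * 2 ^+ n by rewrite mulr_ge0// exprn_ge0.
have bM : 0 <= b * 2 ^+ n by rewrite mulr_ge0// exprn_ge0.
set U := unsigned e v (Rt n) (sign_set (Tv n)).
have mU : measurable U := unsigned_meas eb va (Rt_meas n) (sgn_meas n).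
have nullU Z : measurable Z -> mu Z = 0%E -> mu (Rt n `&` (bad n a b `|` Z)) = 0%E.
  move=> mZ Z0; rewrite setIUr; apply: null_setU => //.
  - by apply: measurableI; [exact: Rt_meas|exact: bad_meas].
  - by apply: measurableI; first exact: Rt_meas.
  - exact: (subset_measure0 (measurableI _ _ (Rt_meas n) mZ) mZ (@subIsetr _ _ _) Z0).
have mI := measurableI _ _ mU (sgn_meas n); have mD := measurableD mU (sgn_meas n).
have [h1|h1] := level_sign eb va ergo (Rt_meas n) (sgn_meas n).
  right; apply: (next_null (E := bad n a b `|` (U `&` sign_set (Tv n)))).
  - exact: measurableU (bad_meas n a b) mI.
  - exact: bad_meas.
  - exact: nullU.
  move=> x [xH nx]; apply: contrapT => /not_orP[/not_orP[/contrapT b1 u1] /not_orP[/contrapT b2 u2]].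
  apply: nx; have [g _ xg] := xH.
  have [_ _] := level_heads eb va mtst (Rt_meas n) (sgn_meas n) xg.
  rewrite -/(Hm n) in xg.
  have tE : to_tail v (Hm n) x = v g x by rewrite /to_tail (partnerE (Hm_matching n) xg).
  move: b1 b2 u1 u2; rewrite -tE sS exprS /U /sign_set /= tn -/(s n x) -/(s n (to_tail v (Hm n) x)).
  move=> /andP[b1 b2] /andP[b3 b4] u1 u2 [[p1 /negP]|[q1 q2]].
    by rewrite -leNgt => p2; apply/andP; split; lra.
  have : ~~ (0 < s n x) by apply/negP => p; apply: u1; split.
  have : ~~ (0 < s n (to_tail v (Hm n) x)) by apply/negP => p; apply: u2; split.
  by rewrite -!leNgt => p1 p2; apply/andP; split; lra.
left; apply: (next_null (E := bad n a b `|` (U `\` sign_set (Tv n)))).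
- exact: measurableU (bad_meas n a b) mD.
- exact: bad_meas.
- exact: nullU.
move=> x [xH nx]; apply: contrapT => /not_orP[/not_orP[/contrapT b1 u1] /not_orP[/contrapT b2 u2]].
apply: nx; have [g _ xg] := xH.
have [_ _] := level_heads eb va mtst (Rt_meas n) (sgn_meas n) xg.
rewrite -/(Hm n) in xg.
have tE : to_tail v (Hm n) x = v g x by rewrite /to_tail (partnerE (Hm_matching n) xg).
move: b1 b2 u1 u2; rewrite -tE sS exprS /U /sign_set /= tn -/(s n x) -/(s n (to_tail v (Hm n) x)).
move=> /andP[b1 b2] /andP[b3 b4] u1 u2 [[p1 /negP]|[q1 q2]].
  by rewrite -leNgt => p2; apply/andP; split; lra.
have p1 : 0 < s n x by apply: contrapT => p; apply: u1; split; [exact: q1|exact: p].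
have p2 : 0 < s n (to_tail v (Hm n) x) by apply: contrapT => p; apply: u2; split; [exact: q2|exact: p].
by apply/andP; split; lra.
Qed.

(** Each turn halves [a] or [b]. Which of the two depends on the sign left over, so only the product
    is controlled. *)
Let exists_within k : exists n a b, [/\ 0 <= a, 0 <= b, within n a b & a * b <= (K + m) ^+ 2 / 2 ^+ k].
Proof.
elim: k => [|k [n [a [b [a0 b0 w ab]]]]].
  have Km : 0 <= K + m by rewrite addr_ge0//; have /andP[k1 k2] := hK 0; exact: le_trans k1 k2.
  exists 0%N, (K + m), (K + m); split => //; last by rewrite expr0 invr1 mulr1 expr2.
  rewrite /within (_ : _ `&` _ = set0)//; seteq => // x [_] /=; apply.
  have -> : s 0 x = h (tau x) - m by rewrite /s /= hzE.
  rewrite expr0 !mulr1; have /andP[q1 q2] := hK (tau x).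
  have aux (z : R) : 0 <= z -> z <= K -> 0 <= m -> - (K + m) <= z - m <= K + m.
    by move=> z1 z2 z3; apply/andP; split; lra.
  exact: aux.
have [n' nn' tn'] := turn_infinite j n.
have w' : within n' a b.
  move: nn'; elim: (n') => [|i IH]; first by rewrite leqn0 => /eqP e0; move: w; rewrite e0.
  by rewrite leq_eqVlt => /orP[/eqP <-//|]; rewrite ltnS => /IH; exact: within_next.
have ab2 : a * b / 2 <= (K + m) ^+ 2 / 2 ^+ k.+1.
  by rewrite [2 ^+ k.+1]exprS invfM mulrCA mulrC ler_wpM2l// invr_ge0.
have [w2|w2] := within_turn tn' a0 b0 w'.
  by exists n'.+1, (a / 2), b; split => //; [rewrite divr_ge0|rewrite mulrAC].
by exists n'.+1, a, (b / 2); split => //; [rewrite divr_ge0|rewrite mulrA].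
Qed.

Let tsum_lin n (t : tree nat n) : tsum (hz j) t = tsum h t - 2 ^+ n * m.
Proof.
rewrite hzE; elim: n t => [|n IH] t /=; first by rewrite expr0 mul1r.
by rewrite !IH exprS; ring.
Qed.

Let tsum_bnd n (t : tree nat n) : 0 <= tsum h t <= K * 2 ^+ n.
Proof.
elim: n t => [|n IH] t /=; first by rewrite expr0 mulr1.
have /andP[? ?] := IH t.1; have /andP[? ?] := IH t.2.
by rewrite exprS; apply/andP; split; lra.
Qed.

Let If_tsum n : If (fun t : tree nat n => tsum h t) = If (fun _ : tree nat n => 2 ^+ n * m).
Proof.
have HI := root_functional_If.
transitivity (If (n := 0) h).
  elim: n => [//|n IH]; rewrite -IH [RHS](rf_double HI)//.
  by exists (K * 2 ^+ n) => t; exact: tsum_bnd.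
rewrite mE -(rf_scale HI m0); last exact: bnn_cst.
elim: n => [|n IH]; first by congr If; apply/funext => t; rewrite expr0 mul1r mulr1.
rewrite IH (rf_double HI); last by apply: bnn_cst; rewrite mulr_ge0// exprn_ge0.
by congr If; apply/funext => t; rewrite exprS; ring.
Qed.

(** Once [a * b] is small, one of the one-sided deviations is small. The deviation has integral
    zero, so its positive and negative parts have equal integrals and either one controls the
    absolute value. *)
Lemma balanced_level : balanced If h m.
Proof.
have HI := root_functional_If; move=> ep ep0.
have K0 : 0 <= (K + m) ^+ 2 by rewrite sqr_ge0.
(* Chosen so that [(K + m) ^+ 2 / 2 ^+ k <= (ep / 2) ^+ 2], using [k < 2 ^ k]. *)
pose k := Num.bound ((K + m) ^+ 2 / (ep / 2) ^+ 2).
have [n0 [a [b [a0 b0 w ab]]]] := exists_within k.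
have ab' : a * b <= (ep / 2) ^+ 2.
  apply: le_trans ab _; rewrite ler_pdivrMr ?exprn_gt0// mulrC.
  rewrite -ler_pdivrMr ?exprn_gt0 ?divr_gt0//.
  apply: le_trans (ltW (archi_boundP _)) _; first by rewrite divr_ge0// sqr_ge0.
  by rewrite -/k -natrX ler_nat ltnW// ltn_expl.
have ab2 : a <= ep / 2 \/ b <= ep / 2.
  apply: contrapT => /not_orP[/negP + /negP]; rewrite -!ltNge => h1 h2.
  have := ltr_pM (ltW (divr_gt0 ep0 (ltr0Sn R 1))) (ltW (divr_gt0 ep0 (ltr0Sn R 1))) h1 h2.
  by rewrite -expr2 ltNge ab'.
exists n0 => n nn0.
have {}w : within n a b.
  move: nn0; elim: n => [|i IH]; first by rewrite leqn0 => /eqP e0; move: w; rewrite e0.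
  by rewrite leq_eqVlt => /orP[/eqP <-//|]; rewrite ltnS => /IH; exact: within_next.
pose f1 (t : tree nat n) := `|tsum h t - 2 ^+ n * m|.
pose f3 (t : tree nat n) := 2 ^+ n * m.
pose pp (t : tree nat n) := Num.max (tsum h t - 2 ^+ n * m) 0.
pose pn (t : tree nat n) := Num.max (2 ^+ n * m - tsum h t) 0.
have n2m : 0 <= 2 ^+ n * m by rewrite mulr_ge0// exprn_ge0.
have b3 : bnn f3 by exact: bnn_cst.
have bs : bnn (fun t : tree nat n => tsum h t).
  by exists (K * 2 ^+ n) => t; exact: tsum_bnd.
have b1 : bnn f1.
  exists (K * 2 ^+ n + 2 ^+ n * m) => t; rewrite normr_ge0/= ler_norml.
  by have /andP[? ?] := tsum_bnd t; apply/andP; split; lra.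
have bp : bnn pp.
  exists (K * 2 ^+ n) => t; rewrite le_max lexx orbT ge_max.
  by have /andP[? ?] := tsum_bnd t; rewrite /=; apply/andP; split; lra.
have bn : bnn pn.
  exists (2 ^+ n * m) => t; rewrite le_max lexx orbT ge_max n2m andbT.
  by have /andP[? ?] := tsum_bnd t; lra.
have e1 : If f1 = 2 * If pp.
  have : If (fun t => f1 t + tsum h t) = If (fun t => 2 * pp t + f3 t).
    congr If; apply/funext => t; rewrite /f1 /pp /f3 /Num.max.
    case: ifPn => [x0|]; first by rewrite ltr0_norm//; ring.
    by rewrite -leNgt => x0; rewrite ger0_norm//; ring.
  rewrite !(rf_add HI)//; last exact: bnnZ.
  by rewrite (rf_scale HI)// If_tsum => /addIr.
have e2 : If f1 = 2 * If pn.
  have : If (fun t => f1 t + f3 t) = If (fun t => 2 * pn t + tsum h t).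
    congr If; apply/funext => t; rewrite /f1 /pn /f3 /Num.max distrC.
    case: ifPn => [x0|]; first by rewrite ltr0_norm//; ring.
    by rewrite -leNgt => x0; rewrite ger0_norm//; ring.
  rewrite !(rf_add HI)//; last exact: bnnZ.
  by rewrite (rf_scale HI)// If_tsum => /addIr.
have cb c : 0 <= c -> If (fun _ : tree nat n => c * 2 ^+ n) <= c.
  move=> c0; apply: le_trans (rf_cst HI n _) _; first by rewrite mulr_ge0// exprn_ge0.
  by rewrite mulfK// gt_eqF// exprn_gt0.
have c2n c : 0 <= c -> 0 <= c * 2 ^+ n by move=> c0; rewrite mulr_ge0// exprn_ge0.
have Ile (f : tree nat n -> R) c : bnn f -> 0 <= c ->
    (forall t, - a * 2 ^+ n <= tsum (hz j) t <= b * 2 ^+ n -> f t <= c * 2 ^+ n) -> If f <= c.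
  move=> bf c0 fc; apply: le_trans (cb c c0); rewrite -lee_fin -!JfE//; last exact/bnn_cst/c2n.
  case: bf => L fL; apply: Jf_le_ae; first by move=> t; case/andP: (fL t).
    by move=> t; exact: c2n.
  apply: (subset_measure0 _ _ _ w).
  - apply: measurableI; first exact: Rt_meas.
    exact: (@Tv_dm n [set t | c * 2 ^+ n < f t]).
  - by apply: measurableI; [exact: Rt_meas|exact: bad_meas].
  - by move=> x [Rx /= h1]; split => // /fc; rewrite leNgt h1.
rewrite -/f1; case: ab2 => h2.
  rewrite e2; have : If pn <= a; last by lra.
  apply: Ile => // t; rewrite tsum_lin => /andP[h3 _].
  by rewrite /pn ge_max c2n// andbT; lra.
rewrite e1; have : If pp <= b; last by lra.
apply: Ile => // t; rewrite tsum_lin => /andP[_ h3].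
by rewrite /pp ge_max c2n// andbT; lra.
Qed.

End balance.
End levels.

Lemma integral_finE (R : realType) d (X : measurableType d) (mu : probability X R) (B : finType) (D : set X) (f : X -> B) (h : B -> \bar R) : measurable D ->
  dm f -> (forall b, 0 <= h b)%E ->
  (\int[mu]_(x in D) h (f x) = \sum_b h b * mu (D `&` f @^-1` [set b]))%E.
Proof.
move=> mD mf h0.
transitivity (\int[mu]_(x in D) (\sum_b h b * (\1_(f @^-1` [set b]) x)%:E))%E.
  apply: eq_integral => x _; rewrite (bigD1 (f x))//= indicE mem_set//= mule1.
  rewrite big1 ?adde0// => b bf; rewrite indicE memNset ?mule0//=.
  by move=> E; rewrite E eqxx in bf.
have mi b : measurable_fun D (fun x => (\1_(f @^-1` [set b]) x)%:E : \bar R).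
  by apply/measurable_EFinP; apply: measurable_indic; exact: mf.
rewrite ge0_integral_sum//; last first.
- by move=> b x _; rewrite mule_ge0// lee_fin.
- by move=> b; apply: measurable_funeM.
apply: eq_bigr => b _; rewrite ge0_integralZl//.
by rewrite integral_indic// setIC//; exact: mf.
Qed.

(** * Block codes read over a common base *)

Section over_base.
Variables (R : realType) (G : groupType) (e : nat -> G) (eb : bijective e).
Variables (dY : measure_display) (Y : measurableType dY) (nu : probability Y R)
  (vY : G -> Y -> Y)
  (vaY : vaction nu vY).

Record hierarchy (Rt : nat -> set Y) (Tv : forall n, Y -> tree nat n)
    (Hm : nat -> G -> set Y) : Prop := {
  hier_meas : forall n, measurable (Rt n) ;
  hier_dm : forall n, dm (Tv n) ;
  hier_match : forall n, matching vY (Rt n) (Hm n) ;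
  hier_cover : forall n, nu (Rt n `\` covered vY (Hm n)) = 0%E ;
  hier_heads : forall n, Rt n.+1 = heads (Hm n) ;
  hier_types : forall n y, Tv n.+1 y = (Tv n y, Tv n (to_tail vY (Hm n) y)) }.

Variables (Rt : nat -> set Y) (Tv : forall n, Y -> tree nat n) (Hm : nat -> G -> set Y)
  (HH : hierarchy Rt Tv Hm).
Local Notation mch := (hier_match HH).
Local Notation mRt := (hier_meas HH).
Local Notation mTv := (hier_dm HH).
Local Notation hdE := (hier_heads HH).

Variables (dX : measure_display) (X : measurableType dX) (v : G -> X -> X) (M : X -> Y).
Hypotheses (mM : measT M) (Mv : forall g x, M (v g x) = vY g (M x)).
Local Notation diffs F F' := (M @^-1` Rt 0%N `&` [set x | F x <> F' x]).

Definition gp n y := partner (Hm n) y.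

(** Leads from a tail of level [n] back to its head, and is [1] elsewhere; the opposite direction is
    [gp]. *)
Definition up n y : G := if pselect (exists g, Hm n g (vY g^-1%g y)) is left ex
  then (projT1 (cid ex))^-1%g else 1%g.

Lemma up_tail n g y : Hm n g y -> up n (vY g y) = g^-1%g.
Proof.
move=> yg; rewrite /up; case: pselect => [ex|h]; last first.
  by case: h; exists g; rewrite (viewVK vaY).
congr (_^-1)%g; apply: (match_inj (mch n) (projT2 (cid ex))).
by rewrite (viewVK vaY).
Qed.

Lemma gpE n g y : Hm n g y -> gp n y = g.
Proof. exact: (partnerE (mch n)). Qed.

Lemma up_dm n : dm (up n).
Proof.
have mT g : measurable (vY g^-1%g @^-1` Hm n g).
  by apply: (vpre vaY); exact: (match_meas (mch n)).
move=> B; rewrite (_ : _ @^-1` B =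
    \bigcup_g ((vY g^-1%g @^-1` Hm n g) `&` [set _ | B g^-1%g]) `|`
    (~` tails vY (Hm n) `&` [set _ | B 1%g])); last first.
  seteq => y /=.
    have [[g _ yg]|ny] := pselect (tails vY (Hm n) y).
      move=> By; left; exists g => //; split => //=; move: By.
      by rewrite -{1}(viewKV vaY g y) (up_tail yg).
    rewrite /up; case: pselect => [ex|_ B1]; last by right.
    by case: ny; case: ex => g yg; exists g.
  move=> [[g _ [yg Bg]]|[ny B1]]; first by rewrite -(viewKV vaY g y) (up_tail yg).
  rewrite /up; case: pselect => // ex.
  by case: ny; case: ex => g yg; exists g.
have cst P := @cst_meas _ Y P.
apply: measurableU.
  by apply: (bigcupG eb) => g; apply: measurableI.
apply: measurableI => //; apply: measurableC.
exact: (tails_meas eb vaY (mch n)).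
Qed.

(** Meaningful at roots of level [n], where it lists the values of [F] on the block; elsewhere [gp]
    takes its default value. *)
Fixpoint coll (B : finType) n (F : X -> B) : X -> ftr B n :=
  if n is m.+1 return X -> ftr B n
  then fun x => (coll m F x, coll m F (v (gp m (M x)) x)) else F.

(** One level of the inverse of [coll]: a head reads the left half of the block at itself, any other
    site the right half of the block to which [up] leads. *)
Definition spread (B : finType) n (V : X -> ftr B n.+1) : X -> ftr B n :=
  fun x => if pselect (Rt n.+1 (M x)) is left _ then (V x).1
           else (V (v (up n (M x)) x)).2.

Fixpoint down (B : finType) n : (X -> ftr B n) -> X -> B :=
  if n is m.+1 return (X -> ftr B n) -> X -> B
  then fun V => down (@spread B m V) else id.

Lemma coll_map (B B' : finType) (r : B -> B') n F x :
  coll n (fun x => r (F x)) x = ftmap r (coll n F x).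
Proof. by elim: n x => [//|n IH] x /=; rewrite !IH. Qed.

(** The address of [y]: the displacement to its root of level [n], and the path from that root down
    to [y], topmost turn first. For a site missed by a matching the displacement is a default, which
    [rooted] detects. *)
Fixpoint rp n (y : Y) : G * seq bool := if n is m.+1 then
    let: (r, w) := rp m y in
    if pselect (Rt n (vY r y)) is left _ then (r, false :: w)
    else ((r * up m (vY r y))%g, true :: w)
  else (1%g, [::]).

Fixpoint leaf (B : finType) n : ftr B n -> seq bool -> B :=
  if n is m.+1 return ftr B n -> seq bool -> B
  then fun a w => leaf ((if head false w then a.2 else a.1) : ftr B m) (behead w)
  else fun a _ => a.

Definition rooted n y := Rt n (vY (rp n y).1 y).

Lemma rooted_S n y : rooted n.+1 y -> rooted n y /\
  let r := (rp n y).1 in let w := (rp n y).2 in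
  (Rt n.+1 (vY r y) /\ rp n.+1 y = (r, false :: w)) \/
  (exists h, Hm n h (vY h^-1%g (vY r y)) /\ rp n.+1 y = ((r * h^-1)%g, true :: w)).
Proof.
rewrite /rooted /=; case: (rp n y) => r w /=; case: pselect => /= [Ry _|nR].
  split; last by left.
  by move: Ry; rewrite hdE => -[g _ /(match_sub (mch n))[]].
rewrite -(viewM vaY); set z := vY r y.
have [[h hz]|nh] := pselect (exists h, Hm n h (vY h^-1%g z)).
  have -> : up n z = h^-1%g by rewrite -(up_tail hz) (viewKV vaY).
  move=> _; split; last by right; exists h.
  by have [_] := match_sub (mch n) hz; rewrite (viewKV vaY).
by rewrite /up; case: pselect => // _; rewrite (view1 vaY).
Qed.

Lemma Y_view_by_meas T (f : Y -> G) (h : Y -> T) : dm f -> dm h -> dm (fun y => h (vY (f y) y)).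
Proof. exact: (view_by_dm eb vaY). Qed.

Lemma word_enum : exists f : nat -> G * seq bool, forall p, exists k, f k = p.
Proof.
have [e' ee' e'e] := eb.
exists (fun k => (e (dec2 k).1, odflt [::] (unpickle (dec2 k).2))) => -[g w].
by exists (pickle (e' g, pickle w)); rewrite dec_pairK pickleK /= e'e.
Qed.

Lemma rp_dm n : dm (rp n).
Proof.
have [f fs] := word_enum; elim: n => [|n IH].
  by move=> B; exact: (@cst_meas _ Y (B (1%g, [::]))).
pose h z := (asbool (Rt n.+1 z), up n z).
have mh : dm h.
  apply: (dm_pair (n1 := fun k => k == 0%N)); first by case; [exists 0%N|exists 1%N].
    move=> B; rewrite (_ : _ @^-1` B = (Rt n.+1 `&` [set _ | B true]) `|`
        (~` Rt n.+1 `&` [set _ | B false])); last first.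
      seteq => y /=; first by case: asboolP; [left|right].
      by case: asboolP => ? [[]|[]].
    have cst P := @cst_meas _ Y P.
    have mR := mRt n.+1.
    by apply: measurableU; apply: measurableI => //; exact: measurableC.
  exact: up_dm.
have mz : dm (fun y => h (vY (rp n y).1 y)).
  exact: (Y_view_by_meas (dm_comp fst IH) mh).
have := dm_comp (fun z => if z.2.1 then (z.1.1, false :: z.1.2) else ((z.1.1 * z.2.2)%g, true :: z.1.2))
  (dm_pair fs IH mz).
congr dm; apply/funext => y /=; case: (rp n y) => r w /=.
by case: pselect => h1; case: asboolP.
Qed.

Lemma view_by_meas (f : Y -> G) : dm f -> measT (fun y => vY (f y) y).
Proof.
move=> mf _ B mB; rewrite setTI (_ : _ @^-1` B =
    \bigcup_g (f @^-1` [set g] `&` vY g @^-1` B)); last first.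
  seteq => x /=; first by move=> Bx; exists (f x).
  by move=> [g _ [/= <-]].
apply: (bigcupG eb) => g; apply: measurableI; first exact: mf.
exact: (vpre vaY).
Qed.

Lemma rooted_meas n : measurable (rooted n).
Proof.
have := view_by_meas (dm_comp fst (rp_dm n)) measurableT (mRt n).
by rewrite setTI.
Qed.

(** A site loses its root only where one of its translates lies in the uncovered null part of a
    level. *)
Lemma rooted_null n : nu (Rt 0 `\` rooted n) = 0%E.
Proof.
elim: n => [|n IH].
  rewrite (_ : _ `\` _ = set0) ?measure0//; seteq => // y [].
  by rewrite /rooted /= (view1 vaY).
have mC := covered_meas eb vaY (mch n).
pose Z g := vY g @^-1` (Rt n `\` covered vY (Hm n)).
have mZ g : measurable (Z g).
  apply: (vpre vaY); apply: measurableD => //; exact: mRt.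
have Z0 : nu (\bigcup_g Z g) = 0%E.
  apply: (measure0_bigcupG eb) => // g; rewrite /Z (view_pres vaY) ?(hier_cover HH)//.
  by apply: measurableD => //; exact: mRt.
have mR k : measurable (Rt 0 `\` rooted k).
  by apply: measurableD; [exact: mRt|exact: rooted_meas].
have h0 : nu ((Rt 0 `\` rooted n) `|` \bigcup_g Z g) = 0%E.
  by apply: null_setU => //; exact: (bigcupG eb).
apply: (subset_measure0 _ _ _ h0) => //.
  by apply: measurableU => //; exact: (bigcupG eb).
move=> y [Ry nr]; have [ry|] := pselect (rooted n y); last by left.
right; exists (rp n y).1 => //; split => // hc; apply: nr.
rewrite /rooted /=; move: ry hc; rewrite /rooted; case: (rp n y) => r w /= rz.
case: pselect => // nz [|[g _ /= gz]]; first by rewrite -hdE.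
have -> : up n (vY r y) = g^-1%g by rewrite -(up_tail gz) (viewKV vaY).
by rewrite -(viewM vaY) hdE; exists g.
Qed.

Fixpoint psum n (g : seq bool -> R) : R :=
  if n is m.+1 then psum m (fun w => g (false :: w)) + psum m (fun w => g (true :: w)) else g [::].

Lemma psum_ge0 n g : (forall w, 0 <= g w) -> 0 <= psum n g.
Proof. by elim: n g => [|n IH] g g0 //=; rewrite addr_ge0 ?IH. Qed.

Lemma psumZ n k g : psum n (fun w => k * g w) = k * psum n g.
Proof. by elim: n g => [//|n IH] g /=; rewrite !IH mulrDr. Qed.

Lemma psum_sum (I : finType) n (F : I -> seq bool -> R) :
  psum n (fun w => \sum_i F i w) = \sum_i psum n (F i).
Proof. by elim: n F => [//|n IH] F /=; rewrite !IH big_split. Qed.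

Lemma psum_meas n (f : Y -> seq bool -> R) :
  (forall w, measT (fun y => f y w)) ->
  measT (fun y => psum n (f y)).
Proof.
elim: n f => [|n IH] f mf /=; first exact: mf.
by apply: measurable_funD; apply: IH.
Qed.

Lemma psum_ham (B : finType) n (a b : ftr B n) :
  psum n (fun w => (leaf a w != leaf b w)%:R) = ham R a b.
Proof. by elim: n a b => [//|n IH] a b /=; rewrite -!IH. Qed.

(** Mass transport: a sum over sites, sorted by address, becomes a sum over roots of all the
    addresses below them. *)
Lemma path_integral n (f : Y -> seq bool -> R) : (forall y w, 0 <= f y w) ->
  (forall w, measT (fun y => f y w)) ->
  (\int[nu]_(y in Rt 0%N) (f (vY (rp n y).1 y) (rp n y).2)%:E =
   \int[nu]_(y in Rt n) (psum n (f y))%:E)%E.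
Proof.
elim: n f => [|n IH] f f0 mf.
  by apply: eq_integral => y _ /=; rewrite (view1 vaY).
pose f' z w := if pselect (Rt n.+1 z) is left _ then f z (false :: w)
  else f (vY (up n z) z) (true :: w).
have mf' w : measT (fun y => f' y w).
  have mR := mRt n.+1.
  have m1 := mf (false :: w).
  have m2 : measT (fun z => f (vY (up n z) z) (true :: w)).
    exact: (measurableT_comp (mf (true :: w)) (view_by_meas (up_dm n))).
  move=> _ A mA; rewrite setTI (_ : _ @^-1` A =
    (Rt n.+1 `&` (fun y => f y (false :: w)) @^-1` A) `|`
    (~` Rt n.+1 `&` (fun z => f (vY (up n z) z) (true :: w)) @^-1` A)).
    have := m1 measurableT _ mA; have := m2 measurableT _ mA; rewrite !setTI => h1 h2.
    by apply: measurableU; apply: measurableI => //; exact: measurableC.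
  seteq => z /=; rewrite /f'; case: pselect => //.
  - by left.
  - by right.
  - by move=> Rz [[]|[]].
  - by move=> Rz [[]|[]].
transitivity (\int[nu]_(y in Rt 0%N) (f' (vY (rp n y).1 y) (rp n y).2)%:E)%E.
  apply: eq_integral => y _; rewrite /f' /=; case: (rp n y) => r w /=.
  by case: pselect => //= _; rewrite (viewM vaY).
rewrite IH//; last by move=> y w; rewrite /f'; case: pselect.
have mps : measT (fun y => (psum n (f' y))%:E).
  by apply/measurable_EFinP; exact: psum_meas.
have ps0 y : (0 <= (psum n (f' y))%:E)%E.
  by rewrite lee_fin psum_ge0// => w; rewrite /f'; case: pselect.
rewrite (match_integral eb vaY (mch n) (mRt n) (hier_cover HH n) mps ps0).
rewrite -hdE -ge0_integralD//; first last.
- apply: measurable_funTS; apply: (measurableT_comp mps).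
  exact: (to_tail_measT eb vaY (mch n)).
- exact: measurable_funTS mps.
- exact: mRt.
apply: eq_integral => y; rewrite inE => Ry; have := Ry.
rewrite hdE => -[g _ yg]; rewrite -EFinD /=; congr (_ + _)%:E.
  by congr (psum n _); apply/funext => w; rewrite /f'; case: pselect.
congr (psum n _); apply/funext => w; rewrite /f' /to_tail (partnerE (mch n) yg).
case: pselect => [|_] /=; last by rewrite (up_tail yg) (viewVK vaY).
rewrite hdE => -[h _ yh].
by case: (match_tail (mch n) yh (h := g)); rewrite (viewVK vaY).
Qed.

Section one_measure.
Variable mu : probability X R.
Hypotheses (va : vaction mu v)
  (muM : forall E, measurable E -> mu (M @^-1` E) = nu E).

Lemma mMp E : measurable E -> measurable (M @^-1` E).
Proof. by move=> mE; rewrite -[_ @^-1` _]setTI; exact: mM. Qed.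

Lemma dmM T (f : Y -> T) : dm f -> dm (fun x => f (M x)).
Proof. by move=> mf B; exact: (mMp (mf B)). Qed.

Lemma coll_down (B : finType) n (V : X -> ftr B n) x : Rt n (M x) ->
  coll n (down V) x = V x.
Proof.
elim: n V x => [//|n IH] V x Rx /=; have := Rx; rewrite hdE => -[g _ xg].
have [h1 h2] := match_sub (mch n) xg.
rewrite (gpE xg) !IH ?Mv// /spread; case: pselect => //= _; case: pselect => [|_] /=.
  rewrite Mv hdE => -[h _ yh].
  by case: (match_tail (mch n) yh (h := g)); rewrite (viewVK vaY).
by rewrite Mv up_tail// (viewVK va); case: (V x).
Qed.

Lemma gp_dm n : dm (gp n).
Proof. exact: (partner_dm eb (mch n)). Qed.

Lemma ftr_surj (B : finType) n : B -> exists f : nat -> ftr B n, forall x, exists k, f k = x.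
Proof.
move=> b0; exists (fun k => nth (const_tree b0 n) (enum (ftr B n)) k) => x.
by exists (index x (enum (ftr B n))); rewrite nth_index ?mem_enum.
Qed.

Lemma coll_dm (B : finType) n (F : X -> B) : dm F -> dm (coll n F).
Proof.
move=> mF; elim: n => [//|n IH] /= A; apply: meas_inh => x; move: A.
have [f fs] := ftr_surj n (F x); apply: (dm_pair fs) => //.
by apply: (view_by_dm eb va (f := fun x => gp n (M x))) => //; exact/dmM/gp_dm.
Qed.

Lemma dm_if T (A : set X) (f g : X -> T) : measurable A -> dm f -> dm g ->
  dm (fun x => if pselect (A x) is left _ then f x else g x).
Proof.
move=> mA mf mg B; rewrite (_ : _ @^-1` B = (A `&` f @^-1` B) `|` (~` A `&` g @^-1` B)).
  by apply: measurableU; apply: measurableI => //; exact: measurableC.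
seteq => x /=; case: pselect => //.
- by left.
- by right.
- by move=> Ax [[]|[]].
- by move=> nx [[]|[]].
Qed.

Lemma down_dm (B : finType) n (V : X -> ftr B n) : dm V -> dm (down V).
Proof.
elim: n V => [//|n IH] V mV /=; apply: IH; apply: dm_if.
- exact/mMp/mRt.
- exact: (dm_comp fst mV).
- apply: (view_by_dm eb va (f := fun x => up n (M x)) (h := fun x => (V x).2)).
    exact/dmM/up_dm.
  exact: (dm_comp snd mV).
Qed.

Definition HmX n g := M @^-1` Hm n g.

Lemma matchingX n : matching v (M @^-1` Rt n) (HmX n).
Proof.
have m := mch n; split; rewrite /HmX.
- by move=> g; exact/mMp/(match_meas m).
- by move=> g x /(match_sub m); rewrite /= Mv.
- by move=> g h x /= xg /(match_uniq m xg).
- by move=> g h x /= xg; rewrite Mv => /(match_tail m xg).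
- by move=> g h x /=; rewrite !Mv => xg /(match_inj m xg).
Qed.

Lemma headsX n : heads (HmX n) = M @^-1` Rt n.+1.
Proof. by rewrite hdE; seteq => x [g _ h]; exists g. Qed.

Lemma coveredX n : mu (M @^-1` Rt n `\` covered v (HmX n)) = 0%E.
Proof.
rewrite -(hier_cover HH n) -muM; last first.
  apply: measurableD; first exact: mRt.
  exact: (covered_meas eb vaY (mch n)).
congr (mu _); rewrite /covered /heads /tails /HmX; apply/seteqP.
split => x /= [h1 h2]; split => // -[[g _ h]|[g _ h]]; apply: h2.
- by left; exists g.
- by right; exists g; rewrite //= Mv.
- by left; exists g.
- by right; exists g => //; move: h; rewrite /= Mv.
Qed.

Lemma dm_efun (T : Type) (f : X -> T) (h : T -> R) : dm f ->
  measT (fun x => (h (f x))%:E).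
Proof. by move=> mf; apply/measurable_EFinP; apply: dm_fun; exact: (dm_comp h mf). Qed.

Lemma mass_transport (B B' : finType) (F : X -> B) (F' : X -> B') (h : forall n, ftr B n -> ftr B' n -> R) :
  (forall n a b, 0 <= h n a b) ->
  (forall n a b, h n.+1 a b = h n a.1 b.1 + h n a.2 b.2) -> dm F -> dm F' -> forall n,
  (\int[mu]_(x in M @^-1` Rt 0%N) (h 0%N (F x) (F' x))%:E =
   \int[mu]_(x in M @^-1` Rt n) (h n (coll n F x) (coll n F' x))%:E)%E.
Proof.
move=> h0 hS mF mF'; elim=> [//|n ->].
have mu_ m : measT (fun x => (h m (coll m F x) (coll m F' x))%:E).
  move=> mT A mA; apply: meas_inh => x; have [f fs] := ftr_surj m (F x); move: mT A mA.
  apply: (dm_efun (fun z => h m z.1 z.2) (f := fun x => (coll m F x, coll m F' x))).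
  by apply: (dm_pair fs); exact: coll_dm.
rewrite (match_integral eb va (matchingX n))//; first last.
- by move=> x; rewrite lee_fin.
- exact: coveredX.
- exact/mMp/mRt.
rewrite headsX -ge0_integralD//; first last.
- apply: measurable_funTS; apply: (measurableT_comp (mu_ n)).
  exact: (to_tail_measT eb va (matchingX n)).
- by move=> x _; rewrite lee_fin.
- exact: measurable_funTS (mu_ n).
- by move=> x _; rewrite lee_fin.
- exact/mMp/mRt.
by apply: eq_integral => x _; rewrite -EFinD hS.
Qed.

(** [mass_transport] applied to the Hamming distance. This turns estimates on blocks into estimates
    of the measure where two codes differ, at any level [n]. *)
Lemma mt_ham (B : finType) (F F' : X -> B) n : dm F -> dm F' ->
  mu (diffs F F') =
  (\int[mu]_(x in M @^-1` Rt n) (ham R (coll n F x) (coll n F' x))%:E)%E.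
Proof.
move=> mF mF'.
rewrite -(mass_transport (h := fun n => @ham R B n))//; last by move=> *; exact: ham_ge0.
have mD : measurable [set x | F x <> F' x].
  apply: meas_inh => x; have [f fs] := ftr_surj 0 (F x).
  by have /(_ [set z | z.1 <> z.2]) := dm_pair fs mF mF'; apply.
have mR := mMp (mRt 0).
rewrite (eq_integral (fun x => (\1_[set x | F x <> F' x] x)%:E)); last first.
  move=> x _; rewrite indicE; congr (_%:R)%:E; rewrite /=; case: eqP => h /=.
    by rewrite memNset.
  by rewrite mem_set.
by rewrite integral_indic// setIC.
Qed.

Lemma leaf_rp (B : finType) n (F : X -> B) x : rooted n (M x) ->
  leaf (coll n F (v (rp n (M x)).1 x)) (rp n (M x)).2 = F x.
Proof.
elim: n => [|n IH] h; first by rewrite /= (view1 va).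
have [rn [[_ ->]|[g [hg ->]]]] := rooted_S h; first exact: IH.
rewrite /= -(viewM va) Mv -Mv.
have -> : gp n (M (v g^-1%g (v (rp n (M x)).1 x))) = g by rewrite !Mv; exact: gpE.
by rewrite (viewKV va); exact: IH.
Qed.

Lemma measure_pred (B : finType) (A : set X) (f : X -> B) (W : {set B}) : measurable A -> dm f ->
  mu (A `&` [set x | f x \in W]) = (\sum_(b in W) mu (A `&` f @^-1` [set b]))%E.
Proof.
move=> mA mf.
have mP P : measurable [set x | P (f x)] by exact: (mf (P : set B)).
elim: {W}#|W| {-2}W (erefl #|W|) => [|n IH] W.
  move/eqP; rewrite cards_eq0 => /eqP ->; rewrite big_set0 (_ : _ `&` _ = set0) ?measure0//.
  by seteq => // x [_] /=; rewrite finset.inE.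
move=> Wn; have [b bW] : exists b, b \in W by apply/finset.set0Pn; rewrite -card_gt0 Wn.
rewrite (big_setD1 b bW) /= -IH; last by move: Wn; rewrite (cardsD1 b) bW => -[].
rewrite -measureU//; first last.
- seteq => // x [[_ /= xb] [_ /=]].
  by rewrite !finset.inE xb eqxx.
- by apply: measurableI => //; exact: (mP (fun z => z \in _)).
- by apply: measurableI => //; exact: mf.
congr (mu _); seteq => x /=.
  move=> [Ax fW]; have [E|E] := eqVneq (f x) b; [by left|right].
  by rewrite !finset.inE E.
by move=> [[Ax ->]|[Ax]] //; rewrite !finset.inE => /andP[].
Qed.

(** * Conditional independence of block contents *)

Section independence.
Variables (B : finType) (F : X -> B) (p : nat -> B -> R).
Hypotheses (mF : dm F) (p_ge0 : forall t b, 0 <= p t b).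

Fixpoint ysites (A : Type) n (s : seq (G * tree nat n * A)) (y : Y) : Prop :=
  if s is i :: s' then [/\ Rt n (vY i.1.1 y), Tv n (vY i.1.1 y) = i.1.2 & ysites s' y]
  else True.

Fixpoint xsites n (s : seq (G * tree nat n * ftr B n)) (x : X) : Prop :=
  if s is i :: s' then coll n F (v i.1.1 x) = i.2 /\ xsites s' x else True.

(* Given the base point, the contents at distinct roots of level [n] are
   independent with the product laws [pv p]. *)
Definition cindep n := forall s : seq (G * tree nat n * ftr B n),
  uniq [seq i.1.1 | i <- s] -> forall E, measurable E -> E `<=` ysites s ->
  mu (M @^-1` E `&` xsites s) = (nu E * (\prod_(i <- s) pv p i.1.2 i.2)%:E)%E.

Lemma xsites_meas n s : measurable (xsites (n := n) s).
Proof.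
elim: s => [|i s IH]; first exact: measurableT.
have h := vpre va i.1.1 (coll_dm (n := n) mF [set i.2]).
rewrite (_ : xsites _ = (v i.1.1 @^-1` (coll n F @^-1` [set i.2])) `&` xsites s)//.
exact: measurableI.
Qed.

Definition pair_sites n (s : seq (G * tree nat n.+1 * ftr B n.+1)) y : seq G :=
  flatten [seq [:: i.1.1; (i.1.1 * gp n (vY i.1.1 y))%g] | i <- s].

(** Heads and tails are disjoint and each tail has one head, so splitting distinct roots yields
    distinct roots of the level below. *)
Lemma pair_sites_uniq n s y : uniq [seq i.1.1 | i <- s] -> ysites s y ->
  uniq (pair_sites (n := n) s y).
Proof.
have m := mch n.
have hd g : Rt n.+1 (vY g y) -> Hm n (gp n (vY g y)) (vY g y).
  by rewrite hdE => -[h _ yh]; rewrite (gpE yh).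
have mem (s' : seq (G * tree nat n.+1 * ftr B n.+1)) g : ysites s' y ->
    g \in pair_sites s' y -> exists2 h, h \in [seq i.1.1 | i <- s'] &
    Rt n.+1 (vY h y) /\ (g = h \/ g = h * gp n (vY h y))%g.
  elim: s' => [//|i s' IH] [Ri _ hs]; rewrite /pair_sites /= !inE.
  case/or3P => [/eqP->|/eqP->|gs]; first by exists i.1.1; rewrite ?inE ?eqxx//; split => //; left.
    by exists i.1.1; rewrite ?inE ?eqxx//; split => //; right.
  by have [h hs' Rh] := IH hs gs; exists h => //; rewrite inE hs' orbT.
have tl g h k : Hm n h (vY g y) -> Hm n k (vY (g * h)%g y) -> False.
  move=> yg; rewrite -(viewM vaY) => /(match_tail m (h := h)).
  by rewrite (viewVK vaY).
elim: s => [//|i s IH] /= /andP[nis us] [Ri _ hs]; rewrite /pair_sites /=.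
have yi := hd _ Ri; set g := i.1.1 in yi nis *; set g' := gp _ _ in yi *.
rewrite -/(pair_sites s y) IH// andbT inE negb_or; apply/andP; split.
- apply/andP; split; last first.
    apply/negP => /(mem s _ hs)[h hin [Rh [E|E]]]; first by rewrite E hin in nis.
    by move: (hd _ Rh) => yh; apply: (tl _ _ g' yh); rewrite -E.
  apply/eqP => E; apply: (tl g g' g' yi); by rewrite -E.
- apply/negP => /(mem s _ hs)[h hin [Rh [E|E]]]; have yh := hd _ Rh.
    by apply: (tl _ _ (gp n (vY h y)) yi); rewrite E.
  set h' := gp _ _ in yh E.
  have gg : g' = h'.
    apply: (match_inj m (x := vY (g * g')%g y)); first by rewrite -(viewM vaY) (viewVK vaY).
    by rewrite E -(viewM vaY) (viewVK vaY).
  by move: E; rewrite gg => /mulIg E; rewrite E hin in nis.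
Qed.

(** A root of level [n.+1] is replaced by its two constituents. The displacement between them
    depends on the base point, so [E] is cut along the countably many values of [gp]. *)
Lemma cindep_step n : cindep n -> cindep n.+1.
Proof.
move=> CI; have m := mch n; have [e' ee' e'e] := eb.
(* Roots are split one at a time: [s1] holds those still to be split, [s2] the roots of level [n]
   already obtained. *)
suff aux : forall (s1 : seq (G * tree nat n.+1 * ftr B n.+1))
    (s2 : seq (G * tree nat n * ftr B n)) E, measurable E ->
    (forall y, E y -> [/\ ysites s1 y, ysites s2 y &
      uniq ([seq i.1.1 | i <- s2] ++ pair_sites s1 y)]) ->
    mu (M @^-1` E `&` (xsites s1 `&` xsites s2)) =
    (nu E * (\prod_(i <- s1) pv p i.1.2 i.2 * \prod_(i <- s2) pv p i.1.2 i.2)%:E)%E.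
  move=> s us E mE Es; have := aux s [::] E mE; rewrite big_nil mulr1 setIT; apply.
  by move=> y Ey; split; [exact: Es|by []|apply: pair_sites_uniq => //; exact: Es].
elim=> [|[[g t] a] s1 IH] s2 E mE hE.
  rewrite big_nil mul1r setTI; have [E0|/set0P[y Ey]] := eqVneq E set0.
    by rewrite E0 preimage_set0 set0I !measure0 mul0e.
  have [_ _] := hE _ Ey; rewrite cats0 => u2.
  by apply: CI => // z Ez; have [] := hE _ Ez.
pose Ek h := E `&` (fun y => gp n (vY g y)) @^-1` [set h].
have mEk h : measurable (Ek h).
  apply: measurableI => //.
  exact: (vpre vaY g (@gp_dm n [set h])).
have EE : E = \bigcup_h Ek h.
  by seteq => [y Ey|y [h _ []]//]; exists (gp n (vY g y)).
rewrite {1 2}EE preimage_bigcup setI_bigcupl.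
have mC : measurable (xsites ((g, t, a) :: s1) `&` xsites s2).
  by apply: measurableI; exact: xsites_meas.
rewrite [LHS](measure_bigcupG eb mu
  (F := fun h => M @^-1` Ek h `&` (xsites ((g, t, a) :: s1) `&` xsites s2))); first last.
- by move=> h h' x [[_ /= <-] _] [[_ /= <-] _].
- by move=> h; apply: measurableI => //; exact: mMp.
rewrite (measure_bigcupG eb nu (F := Ek))//; last by move=> h h' x [_ /= <-] [_ /= <-].
rewrite muleC -nneseriesZl//.
apply: eq_eseriesr => k _; set h := e k.
have -> : M @^-1` Ek h `&` (xsites ((g, t, a) :: s1) `&` xsites s2) =
    M @^-1` Ek h `&` (xsites s1 `&` xsites ((g, t.1, a.1) :: ((g * h)%g, t.2, a.2) :: s2)).
  rewrite /=; seteq => x [[Ex /= gx]] [] /=; rewrite Mv gx (viewM va).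
    by move=> [<- hs1] hs2; do !split.
  by move=> hs1 [e1 [e2 hs2]]; rewrite e1 e2; do !split => //; case: (a).
rewrite IH//; last first.
  move=> y [Ey gy]; have [[Ry Ty hs1] hs2 uy] := hE _ Ey; rewrite /= in gy Ry Ty.
  have yh : Hm n h (vY g y).
    by move: Ry; rewrite hdE => -[h' _ yh']; rewrite -gy (gpE yh').
  have [R1 R2] := match_sub m yh; rewrite (viewM vaY) in R2.
  rewrite -{}Ty (hier_types HH) /= /to_tail (partnerE m yh) (viewM vaY); split => //.
  have : uniq ([:: g; (g * h)%g] ++ ([seq i.1.1 | i <- s2] ++ pair_sites s1 y)).
    by move: uy; rewrite uniq_catCA /pair_sites /= gy.
  by [].
by rewrite muleC !big_cons /=; congr (_%:E * _)%E; ring.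
Qed.

Lemma cindep_all : cindep 0 -> forall n, cindep n.
Proof. by move=> CI; elim=> // n; exact: cindep_step. Qed.

Fixpoint xsets n (s : seq (G * tree nat n * {set ftr B n})) (x : X) : Prop :=
  if s is i :: s' then coll n F (v i.1.1 x) \in i.2 /\ xsets s' x else True.

Lemma cindep_sets n (s : seq (G * tree nat n * {set ftr B n})) E :
  cindep n -> uniq [seq i.1.1 | i <- s] -> measurable E -> E `<=` ysites s ->
  mu (M @^-1` E `&` xsets s) =
  (nu E * (\prod_(i <- s) \sum_(a in i.2) pv p i.1.2 a)%:E)%E.
Proof.
move=> CI us mE Es.
suff aux : forall (s1 : seq (G * tree nat n * {set ftr B n})) (s2 : seq (G * tree nat n * ftr B n)),
    uniq ([seq i.1.1 | i <- s1] ++ [seq i.1.1 | i <- s2]) ->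
    E `<=` ysites s1 -> E `<=` ysites s2 ->
    mu (M @^-1` E `&` (xsets s1 `&` xsites s2)) =
    (nu E * ((\prod_(i <- s1) \sum_(a in i.2) pv p i.1.2 a) *
             \prod_(i <- s2) pv p i.1.2 i.2)%:E)%E.
  have := aux s [::]; rewrite cats0 big_nil mulr1 setIT; apply => //.
elim=> [|[[g t] W] s1 IH] s2; rewrite ?cat0s.
  by move=> u2 _ E2; rewrite setTI big_nil mul1r; exact: CI.
move=> u E1 E2.
have mx : measurable (xsets s1 `&` xsites s2).
  apply: measurableI; last exact: xsites_meas.
  elim: (s1) => [|i s' IH']; first exact: measurableT.
  rewrite (_ : xsets _ = (v i.1.1 @^-1` (coll n F @^-1` [set z | z \in i.2])) `&` xsets s')//.
  by apply: measurableI => //; apply: (vpre va); exact: (coll_dm mF).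
rewrite (_ : _ `&` _ = (M @^-1` E `&` (xsets s1 `&` xsites s2)) `&`
   [set x | coll n F (v g x) \in W]); last first.
  by seteq => x /=; [move=> [? [[]]]|move=> [[? []]]].
have mc : dm (fun x => coll n F (v g x)).
  by move=> A; exact: (vpre va g (coll_dm (n := n) mF A)).
rewrite measure_pred//; last by apply: measurableI => //; exact: mMp.
rewrite (eq_bigr (fun a => (nu E * (pv p t a * ((\prod_(i <- s1) \sum_(a in i.2) pv p i.1.2 a) *
             \prod_(i <- s2) pv p i.1.2 i.2))%:E)%E)); last first.
  move=> a aW; have := IH ((g, t, a) :: s2); rewrite big_cons /=.
  have -> : (M @^-1` E `&` (xsets s1 `&` xsites s2)) `&` (fun x => coll n F (v g x)) @^-1` [set a] =
    M @^-1` E `&` (xsets s1 `&` (fun x => coll n F (v g x) = a /\ xsites s2 x)).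
    by seteq => x /=; [move=> [[? []]]|move=> [? [? []]]].
  move=> ->.
  - by congr (_ * _%:E)%E; rewrite mulrCA.
  - move: u; rewrite /= cat_uniq => /andP[]; rewrite mem_cat negb_or => /andP[g1 g2] u.
    by rewrite -[g :: _]/([:: g] ++ _) uniq_catCA /= mem_cat negb_or g1 g2 cat_uniq.
  - by move=> y /E1[].
  - by move=> y Ey; have [? ? _] := E1 _ Ey; split => //; exact: E2.
rewrite -ge0_sume_distrr; last first.
  move=> a _; rewrite lee_fin !mulr_ge0 ?pv_ge0//.
    by apply: prodr_ge0 => i _; apply: sumr_ge0 => b _; exact: pv_ge0.
  by apply: prodr_ge0 => i _; exact: pv_ge0.
by rewrite sumEFin -mulr_suml big_cons /= mulrA.
Qed.

Lemma ci_integral n (h : tree nat n -> ftr B n -> R) : cindep n ->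
  (forall t a, 0 <= h t a) ->
  (\int[mu]_(x in M @^-1` Rt n) (h (Tv n (M x)) (coll n F x))%:E =
   \int[nu]_(y in Rt n) (\sum_a pv p (Tv n y) a * h (Tv n y) a)%:E)%E.
Proof.
move=> CI h0; have [f fs] := tree_enum n.
pose idx t := projT1 (cid (fs t)); have idxK t : f (idx t) = t := projT2 (cid (fs t)).
pose E k := Rt n `&` (fun y => idx (Tv n y)) @^-1` [set k].
have mE k : measurable (E k).
  apply: measurableI; first exact: mRt.
  exact: (mTv (n := n) [set t | idx t = k]).
have RE : Rt n = \bigcup_k E k.
  by seteq => [y Ry|y [k _ []]//]; exists (idx (Tv n y)).
have tE : trivIset setT E by move=> i j _ _ [y [[_ /= <-] [_ /= <-]]].
have mc := coll_dm (n := n) mF.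
have [ff ffs] := tree_enum n.
rewrite RE preimage_bigcup !ge0_integral_bigcup//; first last.
- by move=> i j _ _ [x [[_ /= <-] [_ /= <-]]].
- by move=> x _; rewrite lee_fin.
- apply: measurable_funTS; apply/measurable_EFinP; apply: dm_fun.
  exact: (dm_comp (fun z => h z.1 z.2) (dm_pair ffs (dmM (mTv (n := n))) mc)).
- by move=> k; exact: mMp.
- by move=> y _; rewrite lee_fin sumr_ge0// => a _; rewrite mulr_ge0// pv_ge0.
- apply: measurable_funTS; apply/measurable_EFinP; apply: dm_fun.
  exact: (dm_comp (fun t => \sum_a pv p t a * h t a) (mTv (n := n))).
apply: eq_eseriesr => k _; set t := f k.
have Et y : E k y -> Tv n y = t by move=> [_ /= ky]; rewrite /t -ky idxK.
rewrite (eq_integral (fun x => (h t (coll n F x))%:E)); last first.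
  by move=> x; rewrite inE => /Et ->.
rewrite (integral_finE mu (mMp (mE k)) mc (h := fun a => (h t a)%:E)); last first.
  by move=> a; rewrite lee_fin.
rewrite [RHS](eq_integral (fun=> (\sum_a pv p t a * h t a)%:E)); last first.
  by move=> y; rewrite inE => /Et ->.
rewrite integral_cst// -sumEFin ge0_sume_distrl; last first.
  by move=> a _; rewrite lee_fin mulr_ge0// pv_ge0.
apply: eq_bigr => a _.
have := CI [:: (1%g, t, a)]; rewrite big_seq1 /= => /(_ isT (E k) (mE k)).
have -> : (fun x => coll n F (v 1%g x) = a /\ True) = coll n F @^-1` [set a].
  by seteq => x /=; rewrite (view1 va); [case|].
move=> ->.
  by rewrite EFinM [(nu _ * _)%E]muleC muleA; congr (_ * _)%E; exact: muleC.
by move=> y Ey; rewrite /= (view1 vaY); split => //; [case: Ey|exact: Et].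
Qed.

End independence.

End one_measure.

(** * Limits of block codes *)

Section transfer.
Variables (c : X -> nat -> bool) (mc : mbits c).

Definition bits (F : X -> nat -> bool) k x : k.-tuple bool := [tuple F x i | i < k].

Lemma bits_trunc F k k' x : (k <= k')%N -> trunc k (bits F k' x) = bits F k x.
Proof.
move=> kk'; apply: eq_from_tnth => i; rewrite !tnth_mktuple.
have ik : (i < k')%N by exact: leq_trans kk'.
by rewrite -[LHS]/(nth false (bits F k' x) (Ordinal ik)) -tnth_nth tnth_mktuple.
Qed.

Lemma bits_dm (F : X -> nat -> bool) k : mbits F -> dm (bits F k).
Proof.
move=> mF; have mb i b : measurable [set x | F x i = b].
  case: b; first exact: mF.
  rewrite (_ : [set _ | _] = ~` [set x | F x i]); first exact: measurableC.
  by seteq => x /=; case: (F x i).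
have m1 a : measurable [set x | bits F k x = a].
  rewrite (_ : [set _ | _] = \bigcap_i (if (i < k)%N then [set x | F x i = nth false a i] else setT)).
    by apply: bigcapT_measurable => i; case: ifP.
  seteq => x /=.
    move=> <- i _; case: ifP => // ik.
    change (F x i = nth false (bits F k x) (Ordinal ik)).
    by rewrite -tnth_nth tnth_mktuple.
  move=> h; apply: eq_from_tnth => i; rewrite tnth_mktuple (tnth_nth false).
  by have := h i I; rewrite ltn_ord.
move=> B; rewrite (_ : _ @^-1` B = \bigcup_(a in B) [set x | bits F k x = a]).
  by apply: fin_bigcup_measurable => // a _; exact: m1.
seteq => x; first by move=> Bx; exists (bits F k x).
by move=> [a Ba xa]; rewrite -xa in Ba.
Qed.

Notation tup k := (k.-tuple bool : finType).
Notation cell := (bits c).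
Let cell_dm k : dm (cell k) := bits_dm mc.

Lemma coll_trunc F k k' n x : (k <= k')%N ->
  coll n (bits F k) x = ftmap (@trunc k' k) (coll n (bits F k') x).
Proof.
move=> kk'; rewrite -coll_map; congr (coll n _ x).
by apply/funext => z; rewrite bits_trunc.
Qed.

Lemma ham_ftmap (A A' : finType) (r : A -> A') n (a b : ftr A n) :
  ham R (ftmap r a) (ftmap r b) <= ham R a b.
Proof.
elim: n a b => [|n IH] a b /=; last exact: lerD.
by have [->|_] := eqVneq a b; [rewrite eqxx|case: (_ != _)].
Qed.

Lemma ham_tri (A : finType) n (a b b' : ftr A n) : ham R a b' <= ham R a b + ham R b b'.
Proof.
elim: n a b b' => [|n IH] a b b' /=; last by rewrite addrACA lerD.
have [->|_] := eqVneq a b; first by rewrite add0r.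
by case: (a != b') => /=; rewrite -?natrD ?ler_nat// ler_wpDr// ler0n.
Qed.

Lemma ham_sym (A : finType) n (a b : ftr A n) : ham R a b = ham R b a.
Proof. by elim: n a b => [|n IH] a b /=; [rewrite eq_sym|congr (_ + _)]. Qed.

(* A block map of depth [L] spreads one error over at most [2 ^ L] places. *)
Lemma ham_blocks (A A' : finType) L (phi : forall n, tree nat n -> ftr A n -> ftr A' n) n
    (t : tree nat n) (a b : ftr A n) : fam_map L phi -> (L <= n)%N ->
  ham R (phi n t a) (phi n t b) <= 2 ^+ L * ham R a b.
Proof.
move=> hphi; elim: n t a b => [|n IH] t a b.
  rewrite leqn0 => /eqP L0; rewrite L0 expr0 mul1r /=.
  by have [->|_] := eqVneq a b; [rewrite eqxx|case: (_ != _)].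
rewrite leq_eqVlt => /orP[/eqP E|]; last first.
  by rewrite ltnS => Ln; rewrite hphi// /= mulrDr lerD// IH.
have [->|ab] := eqVneq a b; first by rewrite !ham_refl mulr0.
apply: (le_trans (ham_le R (phi n.+1 t a) (phi n.+1 t b))); rewrite E ler_peMr ?exprn_ge0//.
suff H m (x y : ftr A m) : x != y -> 1 <= ham R x y by exact: H.
elim: m x y => [|m IHm] x y /=; first by move=> ->.
case: x y => x1 x2 [y1 y2] /=; rewrite xpair_eqE negb_and => /orP[/IHm h|/IHm h].
  by rewrite ler_wpDr// ham_ge0.
by rewrite ler_wpDl// ham_ge0.
Qed.

Variables (P Q : forall k, nat -> tup k -> R).
Arguments P : clear implicits.
Arguments Q : clear implicits.
Hypotheses (lP : forall k, law (P k)) (lQ : forall k, law (Q k)).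
Variables (q N : nat -> nat) (d : forall i n, tree nat n -> ftr (tup (q i)) n -> ftr (tup (q i)) n -> R).
Arguments d : clear implicits.
Hypothesis cpl : forall i n, (N i <= n)%N -> forall t : tree nat n,
  coupling (P (q i)) (Q (q i)) t (d i n t).

(** The couplings are never realized on a space; this integral over the base stands for an
    expectation under the coupling of stage [i], seen from the roots of level [n]. *)
Definition exq i n (f : tree nat n -> ftr (tup (q i)) n -> ftr (tup (q i)) n -> R) : \bar R :=
  (\int[nu]_(y in Rt n) (Exp (P (q i)) (Q (q i)) (Tv n y) (d i n (Tv n y)) (f (Tv n y)))%:E)%E.

Let ex_ge0 i n (t : tree nat n) f : (N i <= n)%N -> (forall a b, 0 <= f a b) ->
  0 <= Exp (P (q i)) (Q (q i)) t (d i n t) f.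
Proof.
move=> Nn f0; have [[P0 _] [Q0 _]] := (lP (q i), lQ (q i)).
by apply: Exp_ge0 => //; have [] := cpl Nn t.
Qed.

Let ex_meas n (h : tree nat n -> R) : measurable_fun (Rt n) (fun y => (h (Tv n y))%:E).
Proof.
apply: measurable_funTS; apply/measurable_EFinP; apply: dm_fun.
exact: (dm_comp h (mTv (n := n))).
Qed.

Lemma exq_tri i n k (f g h : tree nat n -> ftr (tup (q i)) n -> ftr (tup (q i)) n -> R) :
  (N i <= n)%N -> 0 <= k -> (forall t a b, 0 <= f t a b) -> (forall t a b, 0 <= g t a b) ->
  (forall t a b, 0 <= h t a b) -> (forall t a b, f t a b <= g t a b + k * h t a b) ->
  (exq f <= exq g + k%:E * exq h)%E.
Proof.
move=> Nn k0 f0 g0 h0 fgh; have mR := mRt n.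
have [[P0 _] [Q0 _]] := (lP (q i), lQ (q i)).
rewrite /exq -ge0_integralZl_EFin//; first last.
- exact: (ex_meas (fun t => Exp (P (q i)) (Q (q i)) t (d i n t) (h t))).
- by move=> y _; rewrite lee_fin ex_ge0.
rewrite -ge0_integralD//; first last.
- apply: measurable_funeM.
  exact: (ex_meas (fun t => Exp (P (q i)) (Q (q i)) t (d i n t) (h t))).
- by move=> y _; rewrite mule_ge0// lee_fin ex_ge0.
- exact: (ex_meas (fun t => Exp (P (q i)) (Q (q i)) t (d i n t) (g t))).
- by move=> y _; rewrite lee_fin ex_ge0.
apply: ge0_le_integral => //.
- by move=> y _; rewrite lee_fin ex_ge0.
- exact: (ex_meas (fun t => Exp (P (q i)) (Q (q i)) t (d i n t) (f t))).
- apply: emeasurable_funD; last apply: measurable_funeM.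
    exact: (ex_meas (fun t => Exp (P (q i)) (Q (q i)) t (d i n t) (g t))).
  exact: (ex_meas (fun t => Exp (P (q i)) (Q (q i)) t (d i n t) (h t))).
move=> y _; rewrite -EFinM -EFinD lee_fin -expectZ -expectD.
by apply: Exp_le => // t; have [] := cpl Nn (Tv n y).
Qed.

Variable mu : probability X R.
Hypotheses (va : vaction mu v)
  (muM : forall E, measurable E -> mu (M @^-1` E) = nu E).
Hypothesis CIP : forall k, cindep mu (cell k) (P k) 0.

(** A function of the first content alone sees only the first marginal, which is the law of the
    contents under [mu]. *)
Lemma integral_exq i n (f : tree nat n -> ftr (tup (q i)) n -> R) : (N i <= n)%N ->
  (forall t a, 0 <= f t a) ->
  (\int[mu]_(x in M @^-1` Rt n) (f (Tv n (M x)) (coll n (cell (q i)) x))%:E =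
   exq (fun t a _ => f t a))%E.
Proof.
move=> Nn f0; have [P0 P1] := lP (q i).
have CI : cindep mu (cell (q i)) (P (q i)) n.
  by apply: cindep_all; [exact: va|exact: cell_dm|exact: CIP].
rewrite (ci_integral va (cell_dm (k := q i)) P0 CI f0).
apply: eq_integral => y _; congr (_%:E); apply: eq_bigr => a _.
have [_ dP _] := cpl Nn (Tv n y).
rewrite -[in LHS]dP -mulrA mulr_suml mulr_sumr; apply: eq_bigr => b _.
by rewrite !mulrA.
Qed.

Lemma neq_meas (B : finType) (F F' : X -> B) : dm F -> dm F' ->
  measurable (diffs F F').
Proof.
move=> mF mF'; apply: measurableI; first exact/mMp/mRt.
rewrite (_ : [set _ | _] = \bigcup_(a in [set: B]) (F @^-1` [set a] `&` F' @^-1` [set b | a <> b])).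
  by apply: fin_bigcup_measurable => // a _; apply: measurableI; [exact: mF|exact: mF'].
by seteq => [x /= h|x [a _ [/= ->]]//]; exists (F x).
Qed.

Lemma neq_le (B : finType) (F F' F'' : X -> B) : dm F -> dm F' -> dm F'' ->
  (mu (diffs F F'') <=
   mu (diffs F F') +
   mu (diffs F' F''))%E.
Proof.
move=> m1 m2 m3; apply: le_trans _ (measureU2 mu (neq_meas m1 m2) (neq_meas m2 m3)).
apply: le_meas; [exact: neq_meas| |].
  by apply: measurableU; exact: neq_meas.
move=> x [Rx /= nx]; have [E|E] := pselect (F x = F' x); [right|left] => //.
by split => //=; rewrite -E.
Qed.

Section one_map.
Variables (A A' : finType) (l : nat) (phi : forall n, tree nat n -> ftr A n -> ftr A' n)
  (hphi : fam_map l phi).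

(** The block code [phi] is evaluated at the roots of level [l] and read back at each site; by
    [coll_app] it acts blockwise at all higher levels too. *)
Definition app (C : X -> A) : X -> A' :=
  down (fun x => phi (Tv l (M x)) (coll l C x)).

Lemma app_dm C : dm C -> dm (app C).
Proof.
move=> mC; apply: (down_dm va); have [ff ffs] := tree_enum l.
exact: (dm_comp (fun z => phi z.1 z.2)
  (dm_pair ffs (dmM (mTv (n := l))) (coll_dm va (n := l) mC))).
Qed.

Lemma coll_app C n x : (l <= n)%N -> Rt n (M x) ->
  coll n (app C) x = phi (Tv n (M x)) (coll n C x).
Proof.
have base m y : m = l -> Rt m (M y) -> coll m (app C) y = phi (Tv m (M y)) (coll m C y).
  by move=> ->; exact: (coll_down va).
elim: n x => [|n IH] x; first by rewrite leqn0 => /eqP l0; exact: base.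
rewrite leq_eqVlt => /orP[/eqP E|]; first exact: base.
rewrite ltnS => Ln Rx; have := Rx; rewrite hdE => -[g _ xg].
have [h1 h2] := match_sub (mch n) xg.
by rewrite (hier_types HH) (hphi Ln) /= (gpE xg) !IH ?Mv// /to_tail (partnerE (mch n) xg).
Qed.

(** [ham_blocks], integrated over the roots by means of [mt_ham]. *)
Lemma app_lip C C' : dm C -> dm C' ->
  (mu (diffs (app C) (app C')) <=
   (2 ^+ l)%:E * mu (diffs C C'))%E.
Proof.
move=> mC mC'; have [mA mA'] := (app_dm mC, app_dm mC').
have mR := mMp (mRt l).
have mh (B : finType) (F F' : X -> B) : dm F -> dm F' ->
    measurable_fun (M @^-1` Rt l) (fun x => (ham R (coll l F x) (coll l F' x))%:E).
  move=> mF mF'; apply: measurable_funTS.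
  move=> mT A0 mA0; apply: meas_inh => x; have [f fs] := ftr_surj l (F x); move: mT A0 mA0.
  apply: (dm_efun (fun z => ham R z.1 z.2) (f := fun x => (coll l F x, coll l F' x))).
  by apply: (dm_pair fs); [exact: (coll_dm va (n := l) mF)|exact: (coll_dm va (n := l) mF')].
rewrite (mt_ham va muM l mA mA') (mt_ham va muM l mC mC').
rewrite -ge0_integralZl_EFin ?exprn_ge0//; last 2 first.
- by move=> x _; rewrite lee_fin ham_ge0.
- exact: mh.
apply: ge0_le_integral => //.
- by move=> x _; rewrite lee_fin ham_ge0.
- exact: mh.
- by apply: measurable_funeM; exact: mh.
by move=> x Rx; rewrite -EFinM lee_fin !coll_app//; exact: ham_blocks.
Qed.

End one_map.

Section side.
Variables (w t L : nat -> nat)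
  (phi : forall j n, tree nat n -> ftr (tup (w j)) n -> ftr (tup (t j)) n).
Arguments phi : clear implicits.
Hypotheses (wq : forall j i, (j < i)%N -> (w j <= q i)%N)
  (tq : forall j i, (j < i)%N -> (t j <= q i)%N)
  (tS : forall j, (t j <= t j.+1)%N) (t_ge : forall j, (j <= t j)%N)
  (hphi : forall j, fam_map (L j) (phi j))
  (cost : forall j i n, (j < i)%N -> (N i <= n)%N ->
    (exq (i := i) (n := n) (fun tr a b => ham R (phi j n tr (fcut a))
       (fcut b)) <= (2 ^- j)%:E)%E).

Definition out j : X -> tup (t j) := app (L j) (phi j) (cell (w j)).

Lemma out_dm j : dm (out j). Proof. exact/app_dm/cell_dm. Qed.

(** Under the coupling of stage [j.+2] the codes [j] and [j.+1] both approximate the second content,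
    hence each other. The resulting comparison involves the first content only, so it holds under
    [mu]. *)
Lemma out_step j : (mu (M @^-1` Rt 0 `&` [set x | out j x <> trunc (t j) (out j.+1 x)]) <=
  (2 * 2 ^- j)%:E)%E.
Proof.
have [[P0 P1] [Q0 Q1]] := (lP (q j.+2), lQ (q j.+2)).
pose n := maxn (N j.+2) (maxn (L j) (L j.+1)).
have Nn : (N j.+2 <= n)%N by rewrite leq_maxl.
have Ln : (L j <= n)%N by rewrite /n leq_max leq_maxl orbT.
have LSn : (L j.+1 <= n)%N by rewrite /n leq_max leq_maxr orbT.
rewrite (mt_ham va muM n (@out_dm j) (dm_comp (@trunc _ _) (@out_dm j.+1))).
pose f tr (a : ftr (tup (q j.+2)) n) := ham R (phi j n tr (fcut a))
   (ftmap (@trunc _ (t j)) (phi j.+1 n tr (fcut a))).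
rewrite (eq_integral (fun x => (f (Tv n (M x)) (coll n (cell (q j.+2)) x))%:E)); last first.
  move=> x; rewrite inE => Rx; rewrite coll_map !(coll_app (hphi (j := _)))// /f.
  by rewrite -!coll_trunc// wq.
rewrite integral_exq//; last by move=> *; exact: ham_ge0.
have h2 : (2 * 2 ^- j : R) = 2 ^- j + 1 * 2 ^- j by ring.
rewrite h2 EFinD EFinM.
pose g tr (a : ftr (tup (q j.+2)) n) (b : ftr (tup (q j.+2)) n) :=
  ham R (phi j n tr (fcut a)) (fcut b).
pose h tr (a : ftr (tup (q j.+2)) n) (b : ftr (tup (q j.+2)) n) :=
  ham R (phi j.+1 n tr (fcut a)) (fcut b).
apply: (via (exq g + 1%:E * exq h)%E).
  apply: exq_tri => //; try by move=> *; exact: ham_ge0.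
  move=> tr a b; rewrite mul1r; apply: le_trans (ham_tri _ (fcut b) _) _.
  apply: lerD; first exact: lexx.
  by rewrite ham_sym -(ftmap_trunc b (tS j)); exact: ham_ftmap.
rewrite !mul1e; apply: leeD; first exact: cost.
apply: (le_trans (cost _ _)) => //.
by rewrite lee_fin lef_pV2 ?posrE ?exprn_gt0// ler_eXn2l// ltr1n.
Qed.

(** The limit inferior of the output bits, hence defined everywhere, and [false] at sites that root
    no cell. *)
Definition lim_out x i : bool :=
  asbool (Rt 0 (M x) /\ exists j0, forall j, (j0 <= j)%N -> nth false (out j x) i).

Lemma lim_out_meas i : measurable [set x | lim_out x i].
Proof.
rewrite (_ : [set _ | _] = M @^-1` Rt 0 `&` \bigcup_j0 \bigcap_j
    (if (j0 <= j)%N then out j @^-1` [set z | nth false z i] else setT)).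
  apply: measurableI; first exact/mMp/mRt.
  apply: bigcupT_measurable => j0; apply: bigcapT_measurable => j.
  by case: ifP => // _; exact: out_dm.
seteq => x /=; first move=> /asboolP[Rx [j0 h]].
  by split => //; exists j0 => // j _; case: ifP => // /h.
move=> [Rx [j0 _ h]]; apply/asboolP; split => //; exists j0 => j jj.
by have := h j I; rewrite jj.
Qed.

(** Outside the later exceptional sets the outputs extend one another, so the limit extends [out j];
    the measures of these sets are bounded by a geometric series of sum [4 * 2 ^- j]. *)
Lemma lim_out_close j : (mu (diffs (out j) (bits lim_out (t j))) <=
  (4 * 2 ^- j)%:E)%E.
Proof.
pose A l := M @^-1` Rt 0 `&` [set x | out l x <> trunc (t l) (out l.+1 x)].
have mA l : measurable (A l) := neq_meas (@out_dm l) (dm_comp (@trunc _ _) (@out_dm l.+1)).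
have sub : diffs (out j) (bits lim_out (t j)) `<=` \bigcup_l A (j + l)%N.
  move=> x [Rx] /= nx; apply: contrapT => nA; apply: nx.
  have st l : out (j + l)%N x = trunc _ (out (j + l).+1 x).
    by apply: contrapT => h; apply: nA; exists l.
  have le l : (t j <= t (j + l))%N.
    by elim: l => [|l IH]; rewrite ?addn0// addnS (leq_trans IH).
  have tr l : out j x = trunc _ (out (j + l)%N x).
    elim: l => [|l IH]; last by rewrite IH st addnS trunc_trunc.
    rewrite addn0; apply: eq_from_tnth => i; by rewrite tnth_mktuple (tnth_nth false).
  apply: eq_from_tnth => i; rewrite tnth_mktuple.
  have nt l : (j <= l)%N -> nth false (out l x) i = tnth (out j x) i.
    by move=> /subnKC <-; rewrite (tr (l - j)%N) tnth_mktuple.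
  apply/idP/idP => [h|/asboolP[_ [j0 h]]].
    by apply/asboolP; split => //; exists j => l jl; rewrite nt.
  by rewrite -(nt _ (leq_maxl j j0)); apply: h; exact: leq_maxr.
have mD := neq_meas (@out_dm j) (bits_dm (k := t j) lim_out_meas).
apply: le_trans (measure_sigma_subadditive mu _ _ sub) _ => //.
apply: lime_le; first by apply: is_cvg_nneseries => *; exact: measure_ge0.
near=> m; apply: (via (\sum_(0 <= l < m) (2 * 2 ^- (j + l))%:E)%E).
  by apply: lee_sum => l _; exact: out_step.
rewrite sumEFin lee_fin -mulr_sumr; under eq_bigr do rewrite exprD invfM.
rewrite -mulr_sumr (_ : 4 * 2 ^- j = 2 * (2 ^- j * 2) :> R); last by ring.
rewrite ler_wpM2l// ler_wpM2l ?invr_ge0 ?exprn_ge0//.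
suff : \sum_(0 <= l < m) (2 ^+ l)^-1 = 2 - 2 * 2 ^- m :> R.
  by move=> ->; rewrite gerBl mulr_ge0// invr_ge0 exprn_ge0.
elim: (m) => [|m' IH]; first by rewrite big_geq// expr0 invr1; ring.
rewrite big_nat_recr//= IH exprS invfM; field; rewrite expf_neq0//.
Unshelve. all: by end_near. Qed.

Section inverse.
Variables (w' t' L' : nat -> nat)
  (psi : forall j n, tree nat n -> ftr (tup (w' j)) n -> ftr (tup (t' j)) n).
Arguments psi : clear implicits.
Hypotheses (w't : forall j i, (j < i)%N -> (w' j <= t i)%N)
  (t'q : forall j i, (j < i)%N -> (t' j <= q i)%N)
  (hpsi : forall j, fam_map (L' j) (psi j))
  (cost' : forall j i n, (j < i)%N -> (N i <= n)%N ->
    (exq (i := i) (n := n) (fun tr a b => ham R (psi j n tr (fcut b))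
       (fcut a)) <= (2 ^- j)%:E)%E).

(** Replacing the limit by [out i] costs [4 * K * 2 ^- i], because the code [psi j] is
    [K]-Lipschitz. Under the coupling of stage [i.+1], replacing [out i] by the second content costs
    another [K * 2 ^- i], and then [psi j] recovers the first content up to [2 ^- j]. Now [i] tends
    to infinity while [j], and with it [K], stays fixed. *)
Lemma inv_close j : (mu (diffs (app (L' j) (psi j) (bits lim_out (w' j))) (cell (t' j))) <= (2 ^- j)%:E)%E.
Proof.
have mtr i : dm (fun x => trunc (w' j) (out i x)) := dm_comp (@trunc _ _) (@out_dm i).
have mli k : dm (bits lim_out k) := bits_dm lim_out_meas.
set K := 2 ^+ L' j : R.
have main i : (j < i)%N -> (mu (diffs (app (L' j) (psi j) (bits lim_out (w' j))) (cell (t' j))) <=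
    (2 ^- j + 5 * K * 2 ^- i)%:E)%E.
  move=> ji; have mA := app_dm (L' j) (psi j).
  apply: (le_trans (neq_le (mA _ (mli _)) (mA _ (mtr i)) (@cell_dm (t' j)))).
  rewrite (_ : 2 ^- j + 5 * K * 2 ^- i =
     K * (4 * 2 ^- i) + (2 ^- j + K * 2 ^- i)); last by ring.
  rewrite EFinD; apply: leeD.
    apply: (le_trans (app_lip (hpsi (j := j)) (mli _) (mtr i))).
    rewrite EFinM lee_pmul2l ?lte_fin ?exprn_gt0//.
    apply: (le_trans _ (lim_out_close i)).
    apply: le_meas; [exact: (neq_meas (mli _) (mtr i))|exact: (neq_meas (@out_dm i) (mli _))|].
    move=> x [Rx /= nx]; split => //= E; apply: nx.
    by rewrite E bits_trunc// w't.
  pose n := maxn (N i.+1) (maxn (L i) (L' j)).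
  have Nn : (N i.+1 <= n)%N by rewrite leq_maxl.
  have Ln : (L i <= n)%N by rewrite /n leq_max leq_maxl orbT.
  have L'n : (L' j <= n)%N by rewrite /n leq_max leq_maxr orbT.
  rewrite (mt_ham va muM n (mA _ (mtr i)) (@cell_dm (t' j))).
  pose f tr (a : ftr (tup (q i.+1)) n) := ham R
    (psi j n tr (ftmap (@trunc _ (w' j)) (phi i n tr (fcut a))))
    (ftmap (@trunc _ (t' j)) a).
  rewrite (eq_integral (fun x => (f (Tv n (M x)) (coll n (cell (q i.+1)) x))%:E)); last first.
    move=> x; rewrite inE => Rx; rewrite (coll_app (hpsi (j := j)))// coll_map.
    have ji' : (j < i.+1)%N by exact: ltnW.
    by rewrite (coll_app (hphi (j := _)))// /f -(@coll_trunc c (w i)) ?wq// -(@coll_trunc c (t' j)) ?t'q.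
  rewrite integral_exq//; last by move=> *; exact: ham_ge0.
  pose g tr (a : ftr (tup (q i.+1)) n) (b : ftr (tup (q i.+1)) n) :=
    ham R (psi j n tr (fcut b)) (fcut a).
  pose h tr (a : ftr (tup (q i.+1)) n) (b : ftr (tup (q i.+1)) n) :=
    ham R (phi i n tr (fcut a)) (fcut b).
  apply: (via (exq g + K%:E * exq h)%E).
    apply: exq_tri => //; try by move=> *; exact: ham_ge0.
      by rewrite exprn_ge0.
    move=> tr a b; apply: le_trans (ham_tri _ (psi j n tr (fcut b)) _) _.
    rewrite addrC; apply: lerD; first exact: lexx.
    apply: (le_trans (ham_blocks _ _ _ (hpsi (j := j)) L'n)); rewrite ler_wpM2l ?exprn_ge0//.
    by rewrite -(ftmap_trunc b (w't ji)); exact: ham_ftmap.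
  rewrite EFinD EFinM; apply: leeD; first by apply: cost' => //; exact: ltnW.
  by rewrite lee_pmul2l ?lte_fin ?exprn_gt0//; exact: cost.
apply/lee_addgt0Pr => ep ep0.
have [i [ji iep]] : exists i, (j < i)%N /\ 5 * K * 2 ^- i <= ep.
  have K0 : 0 < K by rewrite exprn_gt0.
  pose b := Num.bound (5 * K / ep); exists (maxn j.+1 b); split; first by rewrite leq_max leqnn.
  rewrite ler_pdivrMr ?exprn_gt0// [ep * _]mulrC -ler_pdivrMr//.
  apply: (le_trans (ltW (archi_boundP _))); first by rewrite divr_ge0 ?mulr_ge0// ltW.
  rewrite -natrX ler_nat; apply: (leq_trans _ (ltnW (ltn_expl _ _))) => //.
  exact: leq_maxr.
by apply: (le_trans (main i ji)); rewrite -EFinD lee_fin lerD2l.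
Qed.

End inverse.

(** * The law of the limit code *)

Section limit_law.
Variable mu' : probability X R.
Hypotheses (va' : vaction mu' v)
  (mu'M : forall E, measurable E -> mu' (M @^-1` E) = nu E)
  (CIQ : forall k, cindep mu' (cell k) (Q k) 0).

Definition pat (B : finType) (F : X -> B) (s : seq (G * B)) : set X :=
  [set x | all (fun i => F (v i.1 x) == i.2) s].

Lemma pat_meas (B : finType) (F : X -> B) s : dm F -> measurable (pat F s).
Proof.
move=> mF; elim: s => [|i s IH]; first by rewrite (_ : pat _ _ = setT)//; seteq.
rewrite (_ : pat _ _ = (v i.1 @^-1` (F @^-1` [set i.2])) `&` pat F s); last first.
  seteq => x; rewrite /pat /=; first by move=> /andP[/eqP].
  by move=> [-> ->]; rewrite eqxx.
by apply: measurableI => //; apply: (vpre va); exact: mF.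
Qed.

Lemma xsets_map (B : finType) (F : X -> B) n (hs : seq G) tau (W : G -> {set ftr B n}) x :
  xsets F [seq (h, tau h, W h) | h <- hs] x <-> forall h, h \in hs -> coll n F (v h x) \in W h.
Proof.
elim: hs => [|h hs IH] /=; first by split.
rewrite IH; split => [[h1 h2] g|H]; first by rewrite inE => /orP[/eqP ->//|/h2].
by split=> [|g gh]; apply: H; rewrite inE ?eqxx// gh orbT.
Qed.

Lemma ysites_map (A : Type) n (hs : seq G) tau (W : G -> A) y :
  (forall h, h \in hs -> Rt n (vY h y) /\ Tv n (vY h y) = tau h) ->
  ysites (n := n) [seq (h, tau h, W h) | h <- hs] y.
Proof.
elim: hs => [//|h hs IH] H /=; have [] := H h; first by rewrite inE eqxx.
by move=> ? ?; split => //; apply: IH => g gh; apply: H; rewrite inE gh orbT.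
Qed.

(** Factors are exchanged one at a time; all of them lie in the unit interval. *)
Lemma prod_le_add (I : Type) (r : seq I) (u u' dl : I -> R) :
  (forall i, 0 <= u i <= 1) -> (forall i, 0 <= u' i <= 1) -> (forall i, 0 <= dl i) ->
  (forall i, u i <= u' i + dl i) ->
  \prod_(i <- r) u i <= \prod_(i <- r) u' i + \sum_(i <- r) dl i.
Proof.
move=> u01 u'01 d0 ud; elim: r => [|i r IH]; rewrite ?big_nil ?addr0// !big_cons.
have p01 (w0 : I -> R) : (forall i, 0 <= w0 i <= 1) -> 0 <= \prod_(i <- r) w0 i <= 1.
  move=> h; rewrite prodr_ge0/=; last by move=> z _; case/andP: (h z).
  elim: r {IH} => [|i' r IH]; rewrite ?big_nil// big_cons.
  by rewrite mulr_ile1 ?prodr_ge0//; [case/andP: (h i')|move=> k _; case/andP: (h k)|case/andP: (h i')].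
set U := \prod_(i <- r) u i in IH *; set U' := \prod_(i <- r) u' i in IH *.
set Dl := \sum_(i <- r) dl i in IH *.
have Dl0 : 0 <= Dl by exact: sumr_ge0.
have /andP[U0 U1] := p01 u u01; have /andP[U'0 U'1] := p01 u' u'01.
have /andP[a0 a1] := u01 i; have h1 := ud i; have h2 := d0 i.
apply: (via (u i * (U' + Dl))); first by rewrite ler_wpM2l.
apply: (via (u i * U' + Dl)); first by rewrite mulrDr lerD2l ler_piMl.
rewrite addrA lerD2r; apply: (via ((u' i + dl i) * U')); first by rewrite ler_wpM2r.
by rewrite mulrDl lerD2l ler_piMr.
Qed.

Section one_stage.
Variables (j k : nat) (s : seq (G * tup k))
  (kt : (k <= t j)%N).

Let n := maxn (N j.+1) (L j).
Let Nn : (N j.+1 <= n)%N. Proof. exact: leq_maxl. Qed.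
Let Ln : (L j <= n)%N. Proof. exact: leq_maxr. Qed.
Let kq : (k <= q j.+1)%N. Proof. by rewrite (leq_trans kt)// tq. Qed.

Local Notation blk := (ftr (tup (q j.+1)) n).
Local Notation cq := (cell (q j.+1)).
Local Notation Pq := (P (q j.+1)).
Local Notation Qq := (Q (q j.+1)).
Definition psi1 (tr : tree nat n) (a : blk) : ftr (tup k) n :=
  ftmap (@trunc _ k) (phi j n tr (fcut a)).
Definition psi2 (b : blk) : ftr (tup k) n := ftmap (@trunc _ k) b.
(** The probability, under the coupling of stage [j.+1], that code and target differ at the leaf
    with address [p] of a block of type [tr]. *)
Definition costw (tr : tree nat n) (p : seq bool) : R :=
  Exp Pq Qq tr (d j.+1 n tr)
    (fun a b => (leaf (psi1 tr a) p != leaf (psi2 b) p)%:R).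
Definition costY y := costw (Tv n (vY (rp n y).1 y)) (rp n y).2.

Let F1 x := trunc k (out j x).

Let costw_ge0 tr p : 0 <= costw tr p.
Proof. by apply: ex_ge0 => // *; case: (_ != _). Qed.

Lemma coll_F1 x : Rt n (M x) -> coll n F1 x = psi1 (Tv n (M x)) (coll n cq x).
Proof.
by move=> Rx; rewrite coll_map (coll_app (hphi (j := _)))// /psi1 -(@coll_trunc c (w j)) ?wq.
Qed.

Lemma coll_cell x : coll n (cell k) x = psi2 (coll n cq x).
Proof. by rewrite /psi2 -coll_trunc. Qed.

(** On [D] the types and addresses of the sites in [s] are fixed. Under either measure the pattern
    then has a probability that is a product over the roots involved, and the coupling compares the
    two products root by root. *)
Lemma piece_law y0 D : measurable D ->
  (forall y i, D y -> i \in s -> [/\ rooted n (vY i.1 y), rp n (vY i.1 y) = rp n (vY i.1 y0) &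
     Tv n (vY (i.1 * (rp n (vY i.1 y0)).1)%g y) = Tv n (vY (i.1 * (rp n (vY i.1 y0)).1)%g y0)]) ->
  let err := (\sum_(i <- s) nu D * (costY (vY i.1 y0))%:E)%E in
  (mu (M @^-1` D `&` pat F1 s) <= mu' (M @^-1` D `&` pat (cell k) s) + err)%E /\
  (mu' (M @^-1` D `&` pat (cell k) s) <= mu (M @^-1` D `&` pat F1 s) + err)%E.
Proof.
move=> mD hD err.
pose root g := (g * (rp n (vY g y0)).1)%g; pose pos g := (rp n (vY g y0)).2.
pose tau h := Tv n (vY h y0).
(* Several sites may lie in one block, so the pattern is grouped by root: [W1 h] and [W2 h] below
   are the conditions it imposes on the block at [h]. *)
pose hs := undup [seq root i.1 | i <- s].
have uhs : uniq hs by exact: undup_uniq.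
have inhs i : i \in s -> root i.1 \in hs by move=> si; rewrite mem_undup (map_f (fun i => root i.1)).
pose Wd (ps : tree nat n -> blk -> ftr (tup k) n) h : {set blk} :=
  [set a | all (fun i => (root i.1 == h) ==> (leaf (ps (tau h) a) (pos i.1) == i.2)) s]%SET.
pose W1 := Wd psi1; pose W2 := Wd (fun=> psi2).
have Dsites (W : G -> {set blk}) : D `<=` ysites [seq (h, tau h, W h) | h <- hs].
  move=> y Dy; apply: ysites_map => h; rewrite mem_undup => /mapP[i si ->].
  have [ry rpy Ty] := hD y i Dy si; split => //.
  by move: ry; rewrite /rooted rpy (viewM vaY).
have hsE (W : G -> {set blk}) :
    uniq [seq i.1.1 | i <- [seq (h, tau h, W h) | h <- hs]].
  by rewrite -map_comp (eq_map (g := id)) ?map_id.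
have [[P0 P1] [Q0 Q1]] := (lP (q j.+1), lQ (q j.+1)).
have CI1 : cindep mu cq Pq n.
  by apply: cindep_all; [exact: va|exact: cell_dm|exact: CIP].
have CI2 : cindep mu' cq Qq n.
  by apply: cindep_all; [exact: va'|exact: cell_dm|exact: CIQ].
have readF (B : finType) (F : X -> B) i x : D (M x) -> i \in s ->
    F (v i.1 x) = leaf (coll n F (v (root i.1) x)) (pos i.1).
  move=> Dx si; have [ry rpy _] := hD _ i Dx si; rewrite -Mv in ry rpy.
  by rewrite -(leaf_rp va F ry) rpy (viewM va).
have patE F ps : (forall i x, D (M x) -> i \in s -> F (v i.1 x) =
      leaf (ps (tau (root i.1)) (coll n cq (v (root i.1) x))) (pos i.1)) ->
    M @^-1` D `&` pat F s = M @^-1` D `&` xsets cq [seq (h, tau h, Wd ps h) | h <- hs].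
  move=> rd; seteq => x [Dx hx]; split => //.
    apply/xsets_map => h hh; rewrite finset.inE; apply/allP => i si; apply/implyP => /eqP <-.
    by rewrite -rd//; exact: (allP hx).
  apply/allP => i si; rewrite rd//.
  by move/xsets_map: hx => /(_ _ (inhs i si)); rewrite finset.inE => /allP/(_ i si); rewrite eqxx.
have e1 : M @^-1` D `&` pat F1 s = M @^-1` D `&` xsets cq [seq (h, tau h, W1 h) | h <- hs].
  apply: (patE F1 psi1) => i x Dx si; rewrite (readF _ F1)// coll_F1 ?Mv.
    by have [_ _ ->] := hD _ i Dx si.
  by have [+ rpy _] := hD _ i Dx si; rewrite /rooted rpy (viewM vaY).
have e2 : M @^-1` D `&` pat (cell k) s = M @^-1` D `&` xsets cq [seq (h, tau h, W2 h) | h <- hs].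
  by apply: (patE (cell k) (fun=> psi2)) => i x Dx si; rewrite (readF _ (cell k))// coll_cell.
rewrite e1 e2 (cindep_sets va (@cell_dm _) P0 CI1 (hsE _) mD (Dsites _)).
rewrite (cindep_sets va' (@cell_dm _) Q0 CI2 (hsE _) mD (Dsites _)) !big_map /=.
pose u h := \sum_(a in W1 h) pv Pq (tau h) a.
pose u' h := \sum_(b in W2 h) pv Qq (tau h) b.
pose dl h := \sum_(i <- s | root i.1 == h) costw (tau h) (pos i.1).
have dl0 h : 0 <= dl h by apply: sumr_ge0.
have in01 (A : finType) (f : A -> R) (W : {set A}) : (forall a, 0 <= f a) -> \sum_a f a = 1 ->
    0 <= \sum_(a in W) f a <= 1.
  move=> f0 f1; rewrite sumr_ge0//= -f1 [leRHS](bigID (fun a => a \in W))/= lerDl.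
  exact: sumr_ge0.
have u01 h : 0 <= u h <= 1 by apply: in01; [move=> a; exact: pv_ge0|exact: pv_sum].
have u'01 h : 0 <= u' h <= 1 by apply: in01; [move=> a; exact: pv_ge0|exact: pv_sum].
have cu := cpl Nn.
have uE h : u h = Exp Pq Qq (tau h) (d j.+1 n (tau h)) (fun a _ => (a \in W1 h)%:R).
  have [_ dP _] := cu (tau h); rewrite /u /Exp big_mkcond /=; apply: eq_bigr => a _.
  rewrite -mulr_suml; under eq_bigr do rewrite -mulrA; rewrite -mulr_sumr dP.
  by case: (a \in _); rewrite ?mulr1 ?mulr0.
have u'E h : u' h = Exp Pq Qq (tau h) (d j.+1 n (tau h)) (fun _ b => (b \in W2 h)%:R).
  have [_ _ dQ] := cu (tau h); rewrite /u' /Exp exchange_big big_mkcond /=; apply: eq_bigr => b _.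
  rewrite -mulr_suml; under eq_bigr do rewrite [pv _ _ _ * _]mulrC -mulrA.
  by rewrite -mulr_sumr dQ; case: (b \in _); rewrite ?mulr1 ?mulr0.
have dlE h : dl h = Exp Pq Qq (tau h) (d j.+1 n (tau h))
    (fun a b => \sum_(i <- s | root i.1 == h) (leaf (psi1 (tau h) a) (pos i.1) != leaf (psi2 b) (pos i.1))%:R).
  rewrite /dl /costw /Exp exchange_big /=; apply: eq_bigr => a _.
  by rewrite exchange_big /=; apply: eq_bigr => b _; rewrite mulr_sumr.
have d0 h : forall a b, 0 <= d j.+1 n (tau h) a b by have [] := cu (tau h).
have ind (p1 p2 : bool) (X0 : R) : 0 <= X0 -> (p1 -> ~~ p2 -> 1 <= X0) -> p1%:R <= p2%:R + X0.
  case: p1; case: p2 => X00 H; rewrite ?add0r//; [by rewrite lerDl|exact: H|by rewrite ler_wpDl].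
have neq1 h a b i0 : i0 \in s -> root i0.1 == h ->
    leaf (psi1 (tau h) a) (pos i0.1) != leaf (psi2 b) (pos i0.1) ->
    1 <= \sum_(i <- s | root i.1 == h) (leaf (psi1 (tau h) a) (pos i.1) != leaf (psi2 b) (pos i.1))%:R :> R.
  move=> si ri ne; rewrite (big_rem i0)//= ri ne lerDl.
  by apply: sumr_ge0 => ? _; exact: ler0n.
have s0 h a b : 0 <= \sum_(i <- s | root i.1 == h)
    (leaf (psi1 (tau h) a) (pos i.1) != leaf (psi2 b) (pos i.1))%:R :> R.
  by apply: sumr_ge0 => ? _; exact: ler0n.
have uu' h : u h <= u' h + dl h.
  rewrite uE u'E dlE -expectD; apply: Exp_le => // a b; apply: ind => // aW.
  rewrite finset.inE => /allPn[i si]; rewrite negb_imply => /andP[ri nb].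
  apply: (neq1 h a b i) => //; move: aW; rewrite finset.inE => /allP/(_ i si).
  by rewrite ri /= => /eqP ->; rewrite eq_sym.
have u'u h : u' h <= u h + dl h.
  rewrite uE u'E dlE -expectD; apply: Exp_le => // a b; apply: ind => // bW.
  rewrite finset.inE => /allPn[i si]; rewrite negb_imply => /andP[ri na].
  apply: (neq1 h a b i) => //; move: bW; rewrite finset.inE => /allP/(_ i si).
  by rewrite ri /= => /eqP ->.
have errE : err = (nu D * (\sum_(h <- hs) dl h)%:E)%E.
  rewrite /err -ge0_sume_distrr; last by move=> *; rewrite lee_fin; exact: costw_ge0.
  rewrite sumEFin; congr (_ * _%:E)%E; rewrite /dl [RHS](exchange_big_dep predT)//=.
  rewrite [LHS]big_seq [RHS]big_seq; apply: eq_bigr => i si.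
  rewrite big_mkcond (bigD1_seq (root i.1))//=; last exact: inhs.
  rewrite eqxx big1 ?addr0; first by rewrite /costY (viewM vaY).
  by move=> h hn; rewrite eq_sym (negbTE hn).
have sd0 : 0 <= \sum_(h <- hs) dl h by apply: sumr_ge0.
have pu0 : 0 <= \prod_(h <- hs) u h by apply: prodr_ge0 => h _; case/andP: (u01 h).
have pu'0 : 0 <= \prod_(h <- hs) u' h by apply: prodr_ge0 => h _; case/andP: (u'01 h).
rewrite errE -!ge0_muleDr ?lee_fin// -!EFinD.
by split; apply: lee_pmul => //; rewrite ?lee_fin//; exact: prod_le_add.
Qed.

(** A countable code for types and addresses, along which an event is cut into pieces to which
    [piece_law] applies. *)
Lemma conf_code : exists kappa : Y -> nat, dm kappa /\
  forall y y0, kappa y = kappa y0 -> forall i, i \in s ->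
    rp n (vY i.1 y) = rp n (vY i.1 y0) /\
    Tv n (vY (i.1 * (rp n (vY i.1 y0)).1)%g y) = Tv n (vY (i.1 * (rp n (vY i.1 y0)).1)%g y0).
Proof.
have inv T (f : nat -> T) : (forall x, exists m, f m = x) -> exists g, cancel g f.
  by move=> fs; exists (fun x => projT1 (cid (fs x))) => x; exact: (projT2 (cid (fs x))).
have [f1 fs1] := word_enum; have [g1 gK1] := inv _ _ fs1.
have [f2 fs2] := tree_enum n; have [g2 gK2] := inv _ _ fs2.
have idS : forall x : nat, exists m, id m = x by move=> x; exists x.
have prS (x : nat * nat) : exists m, dec2 m = x by exists (pickle x); exact: dec_pairK.
have m1 : dm (fun y => g1 (rp n y)) := dm_comp g1 (@rp_dm n).
have m2 : dm (fun y => g2 (Tv n (vY (rp n y).1 y))).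
  exact: (dm_comp g2 (Y_view_by_meas (dm_comp fst (@rp_dm n)) (mTv (n := n)))).
pose z y := (g1 (rp n y), g2 (Tv n (vY (rp n y).1 y))).
have mz g : dm (fun y => z (vY g y)).
  by move=> B; exact: (vpre vaY g (dm_pair idS m1 m2 B)).
elim: s => [|i s' [kp [mkp kpP]]].
  by exists (fun=> 0%N); split => // B; exact: (@cst_meas _ Y (B 0%N)).
exists (fun y => pickle (z (vY i.1 y), kp y)); split.
  exact: (dm_comp (fun p => pickle p) (dm_pair prS (mz i.1) mkp)).
move=> y y0 /(pcan_inj pickleK)[/(can_inj gK1) e1 /(can_inj gK2) e2 /kpP h] i'.
rewrite inE => /orP[/eqP ->|/h//]; split => //.
by rewrite -!(viewM vaY) -{1}e1.
Qed.

Let H y := \sum_(i <- s) costY (vY i.1 y).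

Let costY_dm : dm costY.
Proof.
apply: (dm_comp (fun p => costw p.1 p.2.2) (f := fun y => (Tv n (vY (rp n y).1 y), rp n y))).
have [f2 fs2] := tree_enum n; apply: (dm_pair fs2) => //; last exact: rp_dm.
exact: (Y_view_by_meas (dm_comp fst (@rp_dm n)) (mTv (n := n))).
Qed.

Let costY_meas g : measT (fun y => (costY (vY g y))%:E).
Proof.
apply/measurable_EFinP; apply: dm_fun => B.
exact: (vpre vaY g (costY_dm B)).
Qed.

Let costY_ge0 y : 0 <= costY y. Proof. exact: costw_ge0. Qed.

(** [path_integral] turns the sum over sites into the mean Hamming distance at the roots, which is
    the cost controlled by the scheme. *)
Lemma costY_total : (\int[nu]_(y in Rt 0%N) (costY y)%:E <= (2 ^- j)%:E)%E.
Proof.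
rewrite /costY (path_integral n (f := fun y p => costw (Tv n y) p))//; last first.
  by move=> p; apply: dm_fun; exact: (dm_comp (fun tr => costw tr p) (mTv (n := n))).
apply: (le_trans _ (cost (ltnSn j) Nn)).
rewrite (_ : (\int[nu]_(y in _) _)%E = exq (fun tr a b => ham R (psi1 tr a) (psi2 b))); last first.
  apply: eq_integral => y _; congr _%:E; rewrite /costw /Exp psum_sum; apply: eq_bigr => a _.
  by rewrite psum_sum; apply: eq_bigr => b _; rewrite psumZ psum_ham.
pose g tr (a : blk) (b : blk) :=
  ham R (phi j n tr (fcut a)) (fcut b).
apply: (via (exq g + 0%:E * exq g)%E); last by rewrite mul0e adde0.
apply: exq_tri => //; try by move=> *; exact: ham_ge0.
move=> tr a b; rewrite mul0r addr0 /psi2 -(ftmap_trunc b kt); exact: ham_ftmap.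
Qed.

(** Summing [piece_law] over the pieces bounds the error by [size s] integrals of [costY], each at
    most [2 ^- j] by invariance. The sites without a root of level [n] form a null set. *)
Lemma stage_law E : measurable E -> (forall y i, E y -> i \in s -> Rt 0 (vY i.1 y)) ->
  let err := ((size s)%:R * 2 ^- j)%:E in
  (mu (M @^-1` E `&` pat F1 s) <= mu' (M @^-1` E `&` pat (cell k) s) + err)%E /\
  (mu' (M @^-1` E `&` pat (cell k) s) <= mu (M @^-1` E `&` pat F1 s) + err)%E.
Proof.
move=> mE ER err; have [kp [mkp kpP]] := conf_code.
pose Good : set Y := [set y | forall i, i \in s -> rooted n (vY i.1 y)].
have mGood : measurable Good.
  rewrite /Good; elim: (s) => [|i s' IH].
    by rewrite (_ : [set _ | _] = setT)//; seteq.
  rewrite (_ : [set _ | _] = (vY i.1 @^-1` rooted n) `&` [set y | forall i, i \in s' -> rooted n (vY i.1 y)]).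
    by apply: measurableI => //; apply: (vpre vaY); exact: rooted_meas.
  seteq => y /= h.
    by split => [|i' si']; apply: h; rewrite inE ?eqxx// si' orbT.
  by move=> i'; rewrite inE => /orP[/eqP ->|]; [case: h|case: h => _; apply].
pose Eg := E `&` Good; have mEg : measurable Eg by exact: measurableI.
pose D m := Eg `&` kp @^-1` [set m].
have mD m : measurable (D m) by apply: measurableI => //; exact: mkp.
have EgD : Eg = \bigcup_m D m.
  by seteq => [y Ey|y [m _ []]//]; exists (kp y).
have tD : trivIset setT D by move=> m m' _ _ [y [[_ /= <-] [_ /= <-]]].
have m1 := pat_meas s (dm_comp (@trunc _ k) (@out_dm j)).
have m2 := pat_meas s (@cell_dm k).
have mH : measT (fun y => (H y)%:E).
  rewrite /H; under eq_fun do rewrite -sumEFin.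
  by apply: emeasurable_sum => i; exact: costY_meas.
have H0 y : (0 <= (H y)%:E)%E by rewrite lee_fin sumr_ge0.
have piece m : (mu (M @^-1` D m `&` pat F1 s) <=
      mu' (M @^-1` D m `&` pat (cell k) s) + \int[nu]_(y in D m) (H y)%:E)%E /\
    (mu' (M @^-1` D m `&` pat (cell k) s) <=
      mu (M @^-1` D m `&` pat F1 s) + \int[nu]_(y in D m) (H y)%:E)%E.
  have [->|/set0P[y0 Dy0]] := eqVneq (D m) set0.
    by rewrite preimage_set0 !set0I !measure0 integral_set0 adde0.
  have Dc y : D m y -> kp y = kp y0 by move: Dy0 => [_ /= ->] [_ /= ->].
  have hD y i : D m y -> i \in s -> [/\ rooted n (vY i.1 y), rp n (vY i.1 y) = rp n (vY i.1 y0) &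
     Tv n (vY (i.1 * (rp n (vY i.1 y0)).1)%g y) = Tv n (vY (i.1 * (rp n (vY i.1 y0)).1)%g y0)].
    move=> Dy si; have [? ?] := kpP _ _ (Dc _ Dy) i si; split => //.
    by case: Dy => -[_ gy] _; exact: gy.
  rewrite (_ : (\int[nu]_(y in D m) _)%E = (\sum_(i <- s) nu (D m) * (costY (vY i.1 y0))%:E)%E).
    exact: (piece_law (mD m) hD).
  rewrite -ge0_sume_distrr; last by move=> *; rewrite lee_fin.
  rewrite (eq_integral (fun=> (H y0)%:E)); last first.
    move=> y; rewrite inE => Dy; congr _%:E; rewrite /H [LHS]big_seq [RHS]big_seq.
    apply: eq_bigr => i si; have [_ e1 e2] := hD _ _ Dy si.
    by rewrite /costY !(viewM vaY) e1 e2.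
  by rewrite integral_cst// muleC sumEFin.
have sumD (m0 : probability X R) (C : set X) : measurable C ->
    (\sum_(m <oo) m0 (M @^-1` D m `&` C) = m0 (M @^-1` Eg `&` C))%E.
  move=> mC; rewrite EgD preimage_bigcup setI_bigcupl; apply/esym.
  apply: measure_semi_bigcup.
  - by move=> m; apply: measurableI => //; exact: mMp.
  - by move=> m m' _ _ [x [[[_ /= <-] _] [[_ /= <-] _]]].
  - by apply: bigcupT_measurable => m; apply: measurableI => //; exact: mMp.
have sumH : (\sum_(m <oo) \int[nu]_(y in D m) (H y)%:E <= err)%E.
  rewrite -ge0_integral_bigcup//; last exact: measurable_funTS mH.
  rewrite -EgD /H; under eq_integral do rewrite -sumEFin.
  rewrite ge0_integral_sum//.
  apply: (via (\sum_(i <- s) (2 ^- j)%:E)%E); last first.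
    by rewrite sumEFin lee_fin big_const_seq count_predT iter_addr addr0 mulr_natl.
  rewrite big_seq [leRHS]big_seq; apply: lee_sum => i si.
  have mR := mRt 0.
  apply: (le_trans _ costY_total).
  rewrite -(integral_view vaY i.1 mR)//; last first.
    by apply/measurable_EFinP; apply: dm_fun; exact: costY_dm.
  apply: ge0_subset_integral => //.
  - exact: (vpre vaY).
  - by apply: measurable_funTS; exact: costY_meas.
  - by move=> y _; rewrite lee_fin; exact: costY_ge0.
  - by move=> y [Ey _]; exact: ER si.
  - by move=> i; apply: measurable_funTS; exact: costY_meas.
  - by move=> i y _; rewrite lee_fin; exact: costY_ge0.
pose Z : set Y := \bigcup_g (vY g @^-1` (Rt 0 `\` rooted n)).
have mRr : measurable (Rt 0 `\` rooted n).
  by apply: measurableD; [exact: mRt|exact: rooted_meas].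
have mZg g : measurable (vY g @^-1` (Rt 0 `\` rooted n)) by exact: (vpre vaY).
have mZ : measurable Z by exact: (bigcupG eb).
have Z0 : nu Z = 0%E.
  apply: (measure0_bigcupG eb) => // g.
  by rewrite (view_pres vaY)// rooted_null.
have EEg (m0 : probability X R) (C : set X) : (forall E, measurable E -> m0 (M @^-1` E) = nu E) ->
    measurable C -> m0 (M @^-1` E `&` C) = m0 (M @^-1` Eg `&` C).
  move=> m0M mC.
  have mEC : measurable (M @^-1` E `&` C) by apply: measurableI => //; exact: mMp.
  have mEgC : measurable (M @^-1` Eg `&` C) by apply: measurableI => //; exact: mMp.
  have mMZ : measurable (M @^-1` Z) by exact: mMp.
  apply/eqP; rewrite eq_le; apply/andP; split; last first.
    by apply: le_meas => // x [[Ex _] Cx].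
  apply: (via (m0 (M @^-1` Eg `&` C) + m0 (M @^-1` Z))%E); last first.
    by rewrite m0M// Z0 adde0.
  apply: (le_trans _ (measureU2 m0 mEgC mMZ)).
  apply: le_meas => //; first exact: measurableU.
  move=> x [Ex Cx]; have [gx|gx] := pselect (Good (M x)); [left|right] => //.
  have [i /not_implyP[si ri]] : exists i, ~ (i \in s -> rooted n (vY i.1 (M x))) by exact/existsNP.
  by exists i.1 => //; split => //=; exact: ER si.
have nn (m0 : probability X R) (C : set X) : (forall m, (0 <= m0 (M @^-1` D m `&` C))%E).
  by move=> m; exact: measure_ge0.
have H0i m : (0 <= \int[nu]_(y in D m) (H y)%:E)%E by apply: integral_ge0.
rewrite !EEg// -!sumD//; split.
- apply: (via (\sum_(m <oo) (mu' (M @^-1` D m `&` pat (cell k) s) + \int[nu]_(y in D m) (H y)%:E))%E).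
    by apply: lee_nneseries => m *; [exact: measure_ge0|case: (piece m)].
  by rewrite nneseriesD//; exact: leeD.
- apply: (via (\sum_(m <oo) (mu (M @^-1` D m `&` pat F1 s) + \int[nu]_(y in D m) (H y)%:E))%E).
    by apply: lee_nneseries => m *; [exact: measure_ge0|case: (piece m)].
  by rewrite nneseriesD//; exact: leeD.
Qed.

End one_stage.

Lemma pat_close (B : finType) (F F' : X -> B) (E : set Y) (s : seq (G * B)) (b : R) : dm F -> dm F' ->
  measurable E -> (forall y i, E y -> i \in s -> Rt 0 (vY i.1 y)) ->
  (mu (diffs F F') <= b%:E)%E ->
  (mu (M @^-1` E `&` pat F s) <= mu (M @^-1` E `&` pat F' s) + ((size s)%:R * b)%:E)%E.
Proof.
move=> mF mF' mE ER hb; set Bd := diffs F F' in hb.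
have mBd : measurable Bd by exact: neq_meas.
pose U := fix U (r : seq (G * B)) := if r is i :: r' then v i.1 @^-1` Bd `|` U r' else set0.
have mU r : measurable (U r).
  by elim: r => [|i r IH] //=; apply: measurableU => //; exact: (vpre va).
have Ub r : (mu (U r) <= ((size r)%:R * b)%:E)%E.
  elim: r => [|i r IH] /=; first by rewrite measure0 mul0r.
  apply: (le_trans (measureU2 mu (vpre va i.1 mBd) (mU r))).
  have -> : ((size r).+1%:R * b)%:E = (b%:E + ((size r)%:R * b)%:E)%E.
    by rewrite -EFinD -natr1; congr _%:E; ring.
  apply: leeD => //; apply: le_trans hb; apply: le_of_eq.
  exact: (view_pres va i.1 mBd).
have inU r x i : i \in r -> Bd (v i.1 x) -> U r x.
  elim: r => [//|i' r IH] /=; rewrite inE => /orP[/eqP <-|ir] h; first by left.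
  by right; exact: IH.
have mEF (F0 : X -> B) : dm F0 -> measurable (M @^-1` E `&` pat F0 s).
  by move=> mF0; apply: measurableI; [exact: mMp|exact: pat_meas].
apply: (via (mu (M @^-1` E `&` pat F' s) + mu (U s))%E); last exact: leeD.
apply: (le_trans _ (measureU2 mu (mEF _ mF') (mU s))).
apply: le_meas; [exact: mEF|by apply: measurableU => //; exact: mEF|].
move=> x [Ex px]; have [p'|/negP/allPn[i si /eqP ni]] := pselect (pat F' s x); first by left.
right; apply: (inU _ _ i si); split; first by rewrite /= Mv; exact: ER si.
by move=> /= E'; apply: ni; rewrite -E'; apply/eqP; exact: (allP px).
Qed.

(** Per site, [stage_law] contributes [2 ^- j] and the passage from [out j] to the limit
    [4 * 2 ^- j], whence the factor 5. The two probabilities compared do not depend on [j], which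
    may grow. *)
Lemma limit_law k (s : seq (G * tup k)) E : measurable E ->
  (forall y i, E y -> i \in s -> Rt 0 (vY i.1 y)) ->
  mu (M @^-1` E `&` pat (bits lim_out k) s) = mu' (M @^-1` E `&` pat (cell k) s).
Proof.
move=> mE ER.
have mli : dm (bits lim_out k) := bits_dm lim_out_meas.
have bound j : (k <= j)%N ->
    (mu (M @^-1` E `&` pat (bits lim_out k) s) <= mu' (M @^-1` E `&` pat (cell k) s) +
      ((size s)%:R * 5 * 2 ^- j)%:E)%E /\
    (mu' (M @^-1` E `&` pat (cell k) s) <= mu (M @^-1` E `&` pat (bits lim_out k) s) +
      ((size s)%:R * 5 * 2 ^- j)%:E)%E.
  move=> kj; have kt : (k <= t j)%N by exact: leq_trans (t_ge j).
  have mF1 : dm (fun x => trunc k (out j x)) := dm_comp (@trunc _ k) (@out_dm j).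
  have sub : [set x | bits lim_out k x <> trunc k (out j x)] `<=` [set x | out j x <> bits lim_out (t j) x].
    by move=> x /= nx E'; apply: nx; rewrite E' bits_trunc.
  have b1 : (mu (M @^-1` Rt 0 `&` [set x | bits lim_out k x <> trunc k (out j x)]) <= (4 * 2 ^- j)%:E)%E.
    apply: (le_trans _ (lim_out_close j)); apply: le_meas.
    - exact: (neq_meas mli mF1).
    - exact: (neq_meas (@out_dm j) (bits_dm lim_out_meas)).
    - by move=> x [Rx nx]; split => //; exact: sub.
  have b2 : (mu (M @^-1` Rt 0 `&` [set x | trunc k (out j x) <> bits lim_out k x]) <= (4 * 2 ^- j)%:E)%E.
    apply: le_trans b1; rewrite (_ : [set x | bits _ _ _ <> _] = [set x | trunc k (out j x) <> bits lim_out k x])//.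
    by seteq => x /= h1 h2; apply: h1.
  have [s1 s2] := stage_law kt mE ER.
  have p1 := pat_close mli mF1 mE ER b1; have p2 := pat_close mF1 mli mE ER b2.
  have -> : ((size s)%:R * 5 * 2 ^- j)%:E = ((size s)%:R * 2 ^- j)%:E +
     ((size s)%:R * (4 * 2 ^- j))%:E :> \bar R by rewrite -EFinD; congr _%:E; ring.
  split.
    by apply: (le_trans p1); rewrite addeA; apply: leeD.
  by apply: (le_trans s2); rewrite [(((size s)%:R * 2 ^- j)%:E + _)%E]addeC addeA; apply: leeD.
have small (ep : R) : 0 < ep -> exists2 j, (k <= j)%N & (size s)%:R * 5 * 2 ^- j <= ep.
  move=> ep0; pose b := Num.bound ((size s)%:R * 5 / ep); exists (maxn k b); first exact: leq_maxl.
  rewrite ler_pdivrMr ?exprn_gt0// [ep * _]mulrC -ler_pdivrMr//.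
  apply: (le_trans (ltW (archi_boundP _))); first by rewrite divr_ge0 ?mulr_ge0 ?(ltW ep0).
  rewrite -natrX ler_nat; apply: (leq_trans _ (ltnW (ltn_expl _ _))) => //.
  exact: leq_maxr.
apply/eqP; rewrite eq_le; apply/andP; split; apply/lee_addgt0Pr => ep ep0.
  have [j kj je] := small _ ep0; have [h _] := bound j kj.
  by apply: (le_trans h); rewrite leeD2l// lee_fin.
have [j kj je] := small _ ep0; have [_ h] := bound j kj.
by apply: (le_trans h); rewrite leeD2l// lee_fin.
Qed.

End limit_law.

End side.

End transfer.

End over_base.

(** * Measures on product spaces *)

Section power_measures.
Variables (I : choiceType) (d : measure_display) (L : measurableType d).

Lemma power_meas d' (X : measurableType d') (F : X -> power_space I d L) :
  (forall i, measT (fun x => F x i)) -> measT F.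
Proof.
move=> mF; apply: (measurability (rT := power_space I d L) (@coordinate_sets I d L)) => //.
move=> _ [_ [i _ [B mB <-]] <-]; rewrite !setTI.
by have := mF i measurableT B mB; rewrite setTI.
Qed.

Lemma cmeas i : measT (fun x : power_space I d L => x i).
Proof. by move=> _ B mB; rewrite setTI; exact: measurable_coordinate. Qed.

Lemma power_measure_unique (R : realType)
    (m1 m2 : {measure set (power_space I d L) -> \bar R}) : (m1 setT < +oo)%E ->
  (forall (s : seq I) (A : I -> set L), uniq s -> (forall i, measurable (A i)) ->
    m1 (cylinder s A) = m2 (cylinder s A)) ->
  forall E, measurable E -> m1 E = m2 E.
Proof.
move=> m1fin m12 E mE.
pose C : set (set (power_space I d L)) := [set B | exists s A,
  [/\ uniq s, (forall i : I, measurable (A i)) & B = cylinder s A]].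
apply: (measure_unique C (fun=> setT)) => //.
- seteq.
    apply: smallest_sub; first exact: smallest_sigma_algebra.
    move=> _ [i _ [B mB <-]]; apply: sub_sigma_algebra.
    exists [:: i], (fun=> B); split=> //; rewrite setTI.
    by seteq => x /=; [move=> xB j; rewrite inE => /eqP ->|apply; rewrite inE].
  apply: smallest_sub; first exact: sigma_algebra_measurable.
  by move=> _ [s [A [_ mA ->]]]; exact: measurable_cylinder.
- move=> _ _ [s [A [us mA ->]]] [t [B [ut mB ->]]].
  exists (undup (s ++ t)), (fun i => (if i \in s then A i else setT) `&`
                                     (if i \in t then B i else setT)).
  split; [exact: undup_uniq|by move=> i; apply: measurableI; case: ifP|].
  seteq => x /=.
    by move=> [xA xB] i _; split; case: ifP => //; [exact: xA|exact: xB].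
  move=> h; split=> i ii; have := h i; rewrite mem_undup mem_cat ii ?orbT.
    by move=> /(_ isT)[].
  by move=> /(_ isT)[].
- by move=> _; exists [::], (fun=> setT); split => //; seteq.
- by seteq => // x _; exists 0%N.
- by move=> _ [s [A [us mA ->]]]; exact: m12.
Qed.

End power_measures.

(** * Isomorphisms up to null sets *)

Section ae_isomorphisms.
Variables (R : realType) (G : groupType) (e : nat -> G) (eb : bijective e).

(** Both maps are total and equivariant everywhere; only the fact that they are mutually inverse is
    up to null sets. In this form isomorphisms compose without tracking domains. *)
Record ae_iso (d1 d2 : measure_display) (X : measurableType d1) (Y : measurableType d2)
    (mu : probability X R) (nu : probability Y R) (vX : G -> X -> X) (vY : G -> Y -> Y)
    (f : X -> Y) (f' : Y -> X) : Prop := {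
  iso_meas : measT f ;
  iso_measV : measT f' ;
  iso_equiv : forall g x, f (vX g x) = vY g (f x) ;
  iso_equivV : forall g y, f' (vY g y) = vX g (f' y) ;
  iso_law : forall B, measurable B -> mu (f @^-1` B) = nu B ;
  iso_lawV : forall B, measurable B -> nu (f' @^-1` B) = mu B ;
  iso_can : mu.-negligible [set x | f' (f x) <> x] ;
  iso_canV : nu.-negligible [set y | f (f' y) <> y] }.

Section two.
Variables (d1 d2 : measure_display) (X : measurableType d1) (Y : measurableType d2)
    (mu : probability X R) (nu : probability Y R) (vX : G -> X -> X) (vY : G -> Y -> Y).

Lemma ae_iso_sym f f' : ae_iso mu nu vX vY f f' -> ae_iso nu mu vY vX f' f.
Proof. by case=> *; split. Qed.

Lemma ae_iso_trans d3 (Z : measurableType d3) (rho : probability Z R)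
    (vZ : G -> Z -> Z) f f' h h' : ae_iso mu nu vX vY f f' -> ae_iso nu rho vY vZ h h' ->
  ae_iso mu rho vX vZ (h \o f) (f' \o h').
Proof.
move=> [f1 f2 f3 f4 f5 f6 f7 f8] [h1 h2 h3 h4 h5 h6 h7 h8].
split => /=.
- exact: measurableT_comp.
- exact: measurableT_comp.
- by move=> g x; rewrite f3 h3.
- by move=> g x; rewrite h4 f4.
- by move=> B mB; rewrite comp_preimage f5 ?h5//; exact: preim_meas.
- by move=> B mB; rewrite comp_preimage h6 ?f6//; exact: preim_meas.
- have [N [mN N0 sN]] := h7.
  have nl : mu.-negligible (f @^-1` [set y | h' (h y) <> y]).
    exists (f @^-1` N); split; [exact: preim_meas|exact: (etrans (f5 _ mN) N0)|by move=> x; exact: sN].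
  apply: (negligibleS _ (negligibleU f7 nl)).
  move=> x /= nx; have [E|E] := pselect (h' (h (f x)) = f x); last by right.
  by left => /=; move: nx; rewrite E.
- have [N [mN N0 sN]] := f8.
  have nl : rho.-negligible (h' @^-1` [set y | f (f' y) <> y]).
    exists (h' @^-1` N); split; [exact: preim_meas|exact: (etrans (h6 _ mN) N0)|by move=> x; exact: sN].
  apply: (negligibleS _ (negligibleU h8 nl)).
  move=> x /= nx; have [E|E] := pselect (f (f' (h' x)) = h' x); last by right.
  by left => /=; move: nx; rewrite E.
Qed.

(** All translates of the bad sets are removed, which are countably many null sets. Each side also
    loses the preimage of the other side's bad set, so that [f] and [f'] map the remaining sets into
    each other. *)
Lemma ae_iso_pmp (actX : G -> X -> X) (actY : G -> Y -> Y) f f' :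
  vaction mu vX -> vaction nu vY ->
  (forall g x, actX g x = vX g^-1%g x) -> (forall g y, actY g y = vY g^-1%g y) ->
  ae_iso mu nu vX vY f f' -> pmp_isomorphic mu nu actX actY.
Proof.
move=> vaX vaY aX aY [f1 f2 f3 f4 f5 f6 [N [mN N0 sN]] [K [mK K0 sK]]].
pose Nx := N `|` f @^-1` K; pose Ny := K `|` f' @^-1` N.
have mNx : measurable Nx by apply: measurableU => //; exact: preim_meas.
have mNy : measurable Ny by apply: measurableU => //; exact: preim_meas.
have Nx0 : mu Nx = 0%E by apply: null_setU; rewrite ?f5//; exact: preim_meas.
have Ny0 : nu Ny = 0%E by apply: null_setU; rewrite ?f6//; exact: preim_meas.
pose X0 := ~` \bigcup_g (vX g @^-1` Nx); pose Y0 := ~` \bigcup_g (vY g @^-1` Ny).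
have good x : X0 x -> f' (f x) = x.
  move=> xX; apply: contrapT => h; apply: xX; exists 1%g => //=; rewrite (view1 vaX).
  by left; exact: sN.
have goodV y : Y0 y -> f (f' y) = y.
  move=> yY; apply: contrapT => h; apply: yY; exists 1%g => //=; rewrite (view1 vaY).
  by left; exact: sK.
have fX x : X0 x -> Y0 (f x).
  move=> xX [g _ [h|h]]; apply: xX; exists g => //=; first by right; rewrite /= f3.
  move: h; rewrite /= -f3 => h; left; apply: contrapT => nN.
  have E : f' (f (vX g x)) = vX g x by apply: contrapT => /sN.
  by rewrite E in h.
have fY y : Y0 y -> X0 (f' y).
  move=> yY [g _ [h|h]]; apply: yY; exists g => //=; first by right; rewrite /= f4.
  move: h; rewrite /= -f4 => h; left; apply: contrapT => nK.
  have E : f (f' (vY g y)) = vY g y by apply: contrapT => /sK.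
  by rewrite E in h.
have mX0 : measurable X0.
  by apply: measurableC; apply: (bigcupG eb) => g; exact: (vpre vaX).
have mY0 : measurable Y0.
  by apply: measurableC; apply: (bigcupG eb) => g; exact: (vpre vaY).
have muX0 : mu (~` X0) = 0%E.
  rewrite /X0 setCK; apply: (measure0_bigcupG eb) => g.
    exact: (vpre vaX).
  by rewrite (view_pres vaX).
have nuY0 : nu (~` Y0) = 0%E.
  rewrite /Y0 setCK; apply: (measure0_bigcupG eb) => g.
    exact: (vpre vaY).
  by rewrite (view_pres vaY).
exists X0, Y0, f; split.
- split => // g x xX [h _ /= xh]; apply: xX; exists (g^-1 * h)%g => //=.
  by move: xh; rewrite aX (viewM vaX).
- split => // g y yY [h _ /= yh]; apply: yY; exists (g^-1 * h)%g => //=.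
  by move: yh; rewrite aY (viewM vaY).
- split; first by move=> x; exact: fX.
    by move=> x x'; rewrite !inE => hx hx' E; rewrite -(good x)// -(good x')// E.
  by move=> y hy; exists (f' y); [exact: fY|exact: goodV].
- split; first exact: measurable_funTS.
    move=> A mA AX; rewrite (_ : f @` A = Y0 `&` f' @^-1` A).
      by apply: measurableI => //; exact: preim_meas.
    seteq => [_ [x Ax <-]|y [hy /= Ay]].
      by split; [exact/fX/AX|rewrite /= good//; exact: AX].
    by exists (f' y) => //; exact: goodV.
  move=> B mB; rewrite -(f5 B mB); apply/eqP; rewrite eq_le; apply/andP.
  have mB' : measurable (f @^-1` B) by exact: preim_meas.
  split; first by apply: le_meas => //; exact: measurableI.
  apply: (via (mu (X0 `&` f @^-1` B) + mu (~` X0))%E); last by rewrite muX0 adde0.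
  have mXB : measurable (X0 `&` f @^-1` B) by exact: measurableI.
  apply: (le_trans _ (measureU2 mu mXB (measurableC mX0))).
  apply: le_meas => //; first by apply: measurableU => //; exact: measurableC.
  by move=> x Bx; have [?|?] := pselect (X0 x); [left|right].
- by move=> g x _; rewrite aX aY f3.
Qed.

End two.
End ae_isomorphisms.

(** * The space of codes: marks together with content bits *)

Section codes.
Variables (R : realType) (G : groupType) (e : nat -> G) (eb : bijective e).

Definition pats := power_space G _ bool.
(** Coordinate [(g, 0)] is the mark at [g], coordinate [(g, i.+1)] the content bit [i] of the cell
    rooted at [g]. *)
Definition codes := power_space (G * nat)%type _ bool.
Definition pview (g : G) (y : pats) : pats := fun t => y (g * t)%g.
Definition cview (g : G) (w : codes) : codes := fun p => w ((g * p.1)%g, p.2).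
Definition cbase (w : codes) : pats := fun g => w (g, 0%N).

Lemma bool_meas d (X : measurableType d) (b : X -> bool) :
  measurable [set x | b x] -> measT b.
Proof.
move=> mb; apply: (measurable_fun_bool true); rewrite setTI.
by congr measurable: mb; seteq => x /=; case: (b x).
Qed.

Lemma code_bit_meas p : measurable [set w : codes | w p].
Proof.
have mt : measurable [set true] by [].
have := @cmeas _ _ bool p measurableT [set true] mt.
rewrite setTI; congr measurable; by seteq => w /=; case: (w p).
Qed.

Lemma cbase_meas : measT cbase.
Proof. by apply: power_meas => g; exact: (@cmeas _ _ bool (g, 0%N)). Qed.

Variables (A0 : set pats) (mA0 : measurable A0).

(** Bits stored at a site that roots no cell are ignored; the points fixed by [enc cbit] are those
    in which all such bits vanish. *)
Definition cbit (w : codes) i : bool := w (1%g, i.+1) && asbool (A0 (cbase w)).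

Lemma cbit_meas i : measurable [set w | cbit w i].
Proof.
rewrite (_ : [set _ | _] = [set w : codes | w (1%g, i.+1)] `&` cbase @^-1` A0).
  apply: measurableI; first exact: code_bit_meas.
  by apply: preim_meas => //; exact: cbase_meas.
by seteq => w /=; rewrite /cbit; [move=> /andP[-> /asboolP]|move=> [-> /asboolP ->]].
Qed.

Definition enc (F : codes -> nat -> bool) (w : codes) : codes :=
  fun p => if p.2 is i.+1 then F (cview p.1 w) i else w p.

Lemma cview1 w : cview 1%g w = w.
Proof. by apply/funext => -[g i]; rewrite /cview /= mul1g. Qed.

Lemma cviewM g h w : cview h (cview g w) = cview (g * h)%g w.
Proof. by apply/funext => -[k i]; rewrite /cview /= mulgA. Qed.

Lemma cview_meas g : measT (cview g).
Proof. by apply: power_meas => p; exact: (@cmeas _ _ bool). Qed.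

Lemma enc_view F g w : enc F (cview g w) = cview g (enc F w).
Proof.
by apply/funext => -[h [|i]] //; rewrite /enc /= cviewM.
Qed.

Lemma encbase F w : cbase (enc F w) = cbase w. Proof. by []. Qed.

Lemma enc_meas (F : codes -> nat -> bool) : (forall i, measurable [set w | F w i]) -> measT (enc F).
Proof.
move=> mF; apply: power_meas => -[g [|i]]; rewrite /enc /=.
  exact: (@cmeas _ _ bool).
apply: bool_meas; have := cview_meas g measurableT (mF i).
by rewrite setTI.
Qed.

Lemma cbit_encode (F : codes -> nat -> bool) w i : (forall w i, F w i -> A0 (cbase w)) -> cbit (enc F w) i = F w i.
Proof.
move=> hF; rewrite /cbit encbase /enc /= cview1.
by case E: (F w i) => //=; apply/asboolP; exact: hF E.
Qed.

Section transfer_code.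
Variables (nu : probability pats R)
  (vaY : vaction nu pview).
Variables (Rt : nat -> set pats) (Tv : forall n, pats -> tree nat n)
  (Hm : nat -> G -> set pats).
Hypotheses (HH : hierarchy nu pview Rt Tv Hm) (RtA : Rt 0%N = A0).
Variables (P Q : forall k, nat -> (k.-tuple bool : finType) -> R).
Arguments P : clear implicits.
Arguments Q : clear implicits.
Hypotheses (lP : forall k, law (P k)) (lQ : forall k, law (Q k)).
Variables (q N : nat -> nat)
  (d : forall i n, tree nat n -> ftr ((q i).-tuple bool : finType) n ->
    ftr ((q i).-tuple bool : finType) n -> R).
Arguments d : clear implicits.
Hypothesis cpl : forall i n, (N i <= n)%N -> forall t : tree nat n,
  coupling (P (q i)) (Q (q i)) t (d i n t).
Variables (mu mu' : probability codes R).
Hypotheses (va : vaction mu cview) (va' : vaction mu' cview)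
  (muM : forall E, measurable E -> mu (cbase @^-1` E) = nu E)
  (mu'M : forall E, measurable E -> mu' (cbase @^-1` E) = nu E)
  (CIP : forall k, cindep nu pview Rt Tv Hm cview cbase mu (bits cbit k) (P k) 0)
  (CIQ : forall k, cindep nu pview Rt Tv Hm cview cbase mu' (bits cbit k) (Q k) 0)
  (mu'_canon : mu'.-negligible [set w | enc cbit w <> w]).
Variables (w t L : nat -> nat) (phi : forall j n, tree nat n ->
    ftr ((w j).-tuple bool : finType) n -> ftr ((t j).-tuple bool : finType) n).
Arguments phi : clear implicits.
Hypotheses (wq : forall j i, (j < i)%N -> (w j <= q i)%N)
  (tq : forall j i, (j < i)%N -> (t j <= q i)%N)
  (tS : forall j, (t j <= t j.+1)%N) (t_ge : forall j, (j <= t j)%N)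
  (hphi : forall j, fam_map (L j) (phi j))
  (cost : forall j i n, (j < i)%N -> (N i <= n)%N ->
    (exq nu Rt Tv P Q d (i := i) (n := n) (fun tr a b => ham R (phi j n tr (fcut a))
       (fcut b)) <= (2 ^- j)%:E)%E).

Definition code_lim := lim_out pview Rt Tv Hm cview cbase cbit L phi.

Lemma code_lim_meas i : measurable [set w | code_lim w i].
Proof. exact: (lim_out_meas eb vaY HH cbase_meas cbit_meas va). Qed.

Lemma code_lim_site x i : code_lim x i -> A0 (cbase x).
Proof. by move=> /asboolP[]; rewrite RtA. Qed.

Definition transfer := enc code_lim.

Lemma transfer_meas : measT transfer.
Proof. by apply: enc_meas; exact: code_lim_meas. Qed.

Definition bit_event (F : codes -> nat -> bool) (r : seq (G * nat * pred bool)) : set codes :=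
  [set x | all (fun i => i.2 (F (cview i.1.1 x) i.1.2)) r].

Lemma bit_event_meas (F : codes -> nat -> bool) r : mbits F -> measurable (bit_event F r).
Proof.
move=> mF; elim: r => [|i r IH].
  by rewrite (_ : bit_event _ _ = setT)//; seteq.
rewrite (_ : bit_event _ _ = [set x | i.2 (F (cview i.1.1 x) i.1.2)] `&` bit_event F r).
  apply: measurableI => //.
  have h1 : measurable [set x | F (cview i.1.1 x) i.1.2].
    by have := cview_meas i.1.1 measurableT (mF i.1.2); rewrite setTI.
  have := bool_meas h1 measurableT (_ : measurable [set b | i.2 b]); rewrite setTI; exact.
by seteq => x; rewrite /bit_event /=; [move=> /andP[]|move=> [-> ->]].
Qed.

Lemma site_split (m0 : probability codes R) E g C : measurable E -> measurable C ->
  m0 (cbase @^-1` E `&` C) =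
  (m0 (cbase @^-1` (E `&` pview g @^-1` A0) `&` C) +
   m0 (cbase @^-1` (E `&` ~` (pview g @^-1` A0)) `&` C))%E.
Proof.
move=> mE mC; have mg : measurable (pview g @^-1` A0) by exact: (vpre vaY).
have mb B := preim_meas (B := B) cbase_meas.
rewrite -measureU.
- congr (m0 _); seteq => x /=.
    by move=> [Ex Cx]; have [?|?] := pselect (A0 (pview g (cbase x))); [left|right].
  by move=> [[[]]|[[]]].
- by apply: measurableI => //; apply: mb; exact: measurableI.
- by apply: measurableI => //; apply: mb; apply: measurableI => //; exact: measurableC.
- by seteq => // x [[[_ h1] _] [[_ h2] _]].
Qed.

(** [limit_law] concerns patterns at roots. A bit at an arbitrary site is handled by splitting on
    whether the site is a root: if not, the bit is [false] on both sides; if so, the event is a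
    finite union of patterns, which join the list [s]. *)
Lemma bit_event_law k (r : seq (G * nat * pred bool)) E (s : seq (G * (k.-tuple bool : finType))) :
  all (fun i => (i.1.2 < k)%N) r -> measurable E ->
  (forall y i, E y -> i \in s -> A0 (pview i.1 y)) ->
  mu (cbase @^-1` E `&` (bit_event code_lim r `&` pat cview (bits code_lim k) s)) =
  mu' (cbase @^-1` E `&` (bit_event cbit r `&` pat cview (bits cbit k) s)).
Proof.
move=> rk mE; elim: r rk E mE s => [_ E mE s Es|[[g i] b] r IH /= /andP[ik rk] E mE s Es].
  have e0 F : bit_event F [::] = setT by seteq.
  rewrite !e0 !setTI /code_lim.
  apply: (limit_law eb vaY HH cbase_meas (M := cbase) _ cbit_meas lP lQ cpl va muM CIP
    wq tq tS t_ge hphi cost va' mu'M CIQ mE) => //.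
  by move=> y i Ey si; rewrite RtA; exact: Es si.
have mg : measurable (pview g @^-1` A0) by exact: (vpre vaY).
have mB (F : codes -> nat -> bool) r' : mbits F ->
    measurable (bit_event F r' `&` pat cview (bits F k) s).
  move=> mF; apply: measurableI; first exact: bit_event_meas.
  by apply: (pat_meas va); exact: bits_dm.
have mlim := code_lim_meas.
rewrite (site_split mu g mE (mB code_lim ((g, i, b) :: r) mlim)).
rewrite (site_split mu' g mE (mB cbit ((g, i, b) :: r) cbit_meas)).
congr (_ + _)%E; last first.
  set E0 := E `&` ~` _; have mE0 : measurable E0 by apply: measurableI => //; exact: measurableC.
  have E0s y i' : E0 y -> i' \in s -> A0 (pview i'.1 y) by move=> [Ey _]; exact: Es.
  have off (F : codes -> nat -> bool) : (forall x i, F x i -> A0 (cbase x)) ->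
      cbase @^-1` E0 `&` (bit_event F ((g, i, b) :: r) `&` pat cview (bits F k) s) =
      if b false then cbase @^-1` E0 `&` (bit_event F r `&` pat cview (bits F k) s) else set0.
    move=> hF; have F0 x : E0 (cbase x) -> F (cview g x) i = false.
      by move=> [_ nA]; apply/negP => /hF.
    case: ifP => bf; seteq => x //.
    - by move=> [E0x [/andP[_ ?] ?]].
    - by move=> [E0x [? ?]]; split => //; split => //; apply/andP; rewrite /= F0.
    - by move=> [E0x [/andP[]]] /=; rewrite F0// bf.
  rewrite !off; last exact: code_lim_site; last by move=> x i' /andP[_ /asboolP].
  by case: ifP => _; [exact: IH|rewrite !measure0].
set E1 := E `&` _; have mE1 : measurable E1 by exact: measurableI.
pose W : {set k.-tuple bool} := [set a | b (nth false (a : k.-tuple bool) i)]%SET.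
have mcut (F : codes -> nat -> bool) : mbits F ->
    dm (fun x => bits F k (cview g x)).
  by move=> mF B; exact: (vpre va g (bits_dm (k := k) mF B)).
have cut F : cbase @^-1` E1 `&` (bit_event F ((g, i, b) :: r) `&` pat cview (bits F k) s) =
   (cbase @^-1` E1 `&` (bit_event F r `&` pat cview (bits F k) s)) `&`
   [set x | bits F k (cview g x) \in W].
  have nb x : nth false (bits F k (cview g x)) i = F (cview g x) i.
    by rewrite -[i in LHS]/(val (Ordinal ik)) -tnth_nth tnth_mktuple.
  seteq => x.
    by move=> [E1x [/andP[bx ?] ?]]; split => //; rewrite /= finset.inE nb.
  by move=> [[E1x [? ?]]]; rewrite /= finset.inE nb => bx; split => //; split => //; apply/andP.
have mb B := preim_meas (B := B) cbase_meas.
rewrite !cut !measure_pred//; last 4 first.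
- by apply: measurableI; [exact: mb|apply: mB; exact: cbit_meas].
- by apply: mcut; exact: cbit_meas.
- by apply: measurableI; [exact: mb|exact: mB].
- exact: mcut.
apply: eq_bigr => a _.
have add F : (cbase @^-1` E1 `&` (bit_event F r `&` pat cview (bits F k) s)) `&`
    (fun x => bits F k (cview g x)) @^-1` [set a] =
    cbase @^-1` E1 `&` (bit_event F r `&` pat cview (bits F k) ((g, a) :: s)).
  seteq => x; rewrite /pat /=.
    by move=> [[? [? ?]] ->]; rewrite eqxx.
  by move=> [? [? /andP[/eqP]]].
rewrite !add; apply: IH => // y i' [Ey Ay]; rewrite inE => /orP[/eqP ->//|]; exact: Es.
Qed.

Lemma transfer_law E : measurable E -> mu (transfer @^-1` E) = mu' E.
Proof.
move=> mE.
pose f : {mfun codes >-> codes} :=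
  HB.pack transfer (isMeasurableFun.Build _ _ _ _ _ transfer_meas).
apply: (power_measure_unique (m1 := distribution mu f) (m2 := mu') _ _ mE) => [|s A us mA].
  exact: (le_lt_trans (probability_le1 (distribution mu f) measurableT) (ltry _)).
(* Conditions on marks are collected in [E0], those on content bits in [r]; a mark coordinate leaves
   a vacuous predicate in [r]. *)
pose r := [seq (p.1, p.2.-1, (fun b => (p.2 != 0%N) ==> asbool (A p b)) : pred bool) | p <- s].
pose k := (\max_(p <- s) p.2).+1.
pose E0 : set pats := [set y | forall p, p \in s -> p.2 = 0%N -> A p (y p.1)].
have mE0 : measurable E0.
  rewrite /E0; elim: (s) => [|p s' IH].
    by rewrite (_ : [set _ | _] = setT)//; seteq.
  rewrite (_ : [set _ | _] = (if p.2 == 0%N then (fun y : pats => y p.1) @^-1` A p else setT) `&`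
     [set y | forall p, p \in s' -> p.2 = 0%N -> A p (y p.1)]).
    apply: measurableI => //; case: ifP => // _.
    by have := cmeas p.1 measurableT (mA p); rewrite setTI.
  seteq => y /= h.
    split; first by case: eqP => // p0; apply: h; rewrite ?inE ?eqxx.
    by move=> p' ps; apply: h; rewrite inE ps orbT.
  move=> p'; rewrite inE => /orP[/eqP ->|]; last by case: h => _; apply.
  by move=> p0; case: h; rewrite p0.
have cyl F : enc F @^-1` cylinder s A =
    cbase @^-1` E0 `&` (bit_event F r `&` pat cview (bits F k) [::]).
  seteq => x /=.
    move=> h; split; [|split] => //.
      by move=> p ps p0; have := h p ps; rewrite /enc p0 /cbase [p]surjective_pairing p0.
    apply/allP => _ /mapP[p ps ->] /=; apply/implyP => p0; apply/asboolP.
    by have := h p ps; rewrite /enc; case: (p.2) p0.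
  move=> [h1 [h2 _]] p ps; rewrite /enc; case E' : p.2 => [|i].
    by have := h1 p ps E'; rewrite /cbase -{1}E' -surjective_pairing.
  have := allP h2 _ (map_f _ ps); rewrite /= E' /= => /asboolP.
  by [].
have rk : all (fun i => (i.1.2 < k)%N) r.
  apply/allP => _ /mapP[p ps ->] /=; rewrite ltnS (leq_trans (leq_pred _))//.
  exact: (@leq_bigmax_seq _ s xpredT (fun p : G * nat => p.2) p ps isT).
transitivity (mu' (enc cbit @^-1` cylinder s A)).
  rewrite [LHS]/(mu (transfer @^-1` cylinder s A)) !cyl.
  exact: bit_event_law.
have mC : measurable (cylinder s A : set codes) by exact: measurable_cylinder.
have mEC : measurable (enc cbit @^-1` cylinder s A).
  by rewrite -[_ @^-1` _]setTI; apply: enc_meas => //; exact: cbit_meas.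
have [N0 [mN0 N00 sN0]] := mu'_canon.
have agree x : ~ N0 x -> enc cbit x = x by move=> nx; apply: contrapT => h; exact/nx/sN0.
have half (C D : set codes) : measurable C -> measurable D -> C `<=` D `|` N0 -> (mu' C <= mu' D)%E.
  move=> mC' mD CD; apply: (via (mu' D + mu' N0)%E); last by rewrite N00 adde0.
  apply: (le_trans _ (measureU2 mu' mD mN0)); apply: le_meas => //.
  exact: measurableU.
apply/eqP; rewrite eq_le; apply/andP; split; apply: half => // x Cx.
  by have [?|nx] := pselect (N0 x); [right|left; move: Cx; rewrite /= agree].
by have [?|nx] := pselect (N0 x); [right|left; rewrite /= agree].
Qed.

Section inverse_code.
Variables (w' t' L' : nat -> nat) (psi : forall j n, tree nat n ->
    ftr ((w' j).-tuple bool : finType) n -> ftr ((t' j).-tuple bool : finType) n).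
Arguments psi : clear implicits.
Hypotheses (w't : forall j i, (j < i)%N -> (w' j <= t i)%N)
  (t'q : forall j i, (j < i)%N -> (t' j <= q i)%N) (t'_ge : forall j, (j <= t' j)%N)
  (hpsi : forall j, fam_map (L' j) (psi j))
  (cost' : forall j i n, (j < i)%N -> (N i <= n)%N ->
    (exq nu Rt Tv P Q d (i := i) (n := n) (fun tr a b => ham R (psi j n tr (fcut b))
       (fcut a)) <= (2 ^- j)%:E)%E).
Hypothesis mu_canon : mu.-negligible [set w | enc cbit w <> w].

Let lim' := lim_out pview Rt Tv Hm cview cbase cbit L' psi.
Let rec j := app pview Rt Tv Hm cview cbase (L' j) (psi j) (bits code_lim (w' j)).

Lemma coll_encode (B : finType) n (C : codes -> B) F x :
  coll Hm cview cbase n C (enc F x) = coll Hm cview cbase n (fun z => C (enc F z)) x.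
Proof.
by elim: n x => [//|n IH] x /=; rewrite -enc_view !IH encbase.
Qed.

Lemma down_encode (B : finType) n (V : codes -> ftr B n) F x :
  down pview Rt Hm cview cbase V (enc F x) =
  down pview Rt Hm cview cbase (fun z => V (enc F z)) x.
Proof.
elim: n V x => [//|n IH] V x /=; rewrite IH; congr (down _ _ _ _ _ _ _).
by apply/funext => z; rewrite /spread encbase -enc_view.
Qed.

(** Borel-Cantelli: the errors of [inv_close] are summable, so at almost every point the recovered
    bits are eventually correct. Running the inverse codes on the encoded point amounts to running
    them on the limit bits, since [enc] leaves the base unchanged. *)
Lemma transfer_inverse : mu.-negligible [set x | enc lim' (transfer x) <> x].
Proof.
pose bad j := cbase @^-1` A0 `&` [set x | rec j x <> bits cbit (t' j) x].
have rec_dm j : dm (rec j).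
  by apply: (app_dm eb vaY HH cbase_meas va); apply: bits_dm; exact: code_lim_meas.
have mbad j : measurable (bad j).
  rewrite /bad -RtA; apply: (neq_meas HH cbase_meas) => //; apply: bits_dm; exact: cbit_meas.
have bad_le j : (mu (bad j) <= (2 ^- j)%:E)%E.
  rewrite /bad -RtA.
  exact: (inv_close eb vaY HH cbase_meas _ cbit_meas lP lQ cpl va muM CIP
    wq tS hphi cost w't t'q hpsi cost').
have bad_ls : mu (lim_sup_set bad) = 0%E.
  apply: lim_sup_set_cvg0 => //.
  have h := @epsilon_trick0 R 2 xpredT (ler0n _ 2).
  apply: (le_lt_trans _ (le_lt_trans h (ltry 2))); apply: lee_nneseries => [j *|j _].
    exact: measure_ge0.
  apply: (le_trans (bad_le j)); rewrite lee_fin natrX exprS invfM mulrA divff ?mul1r//.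
have [N0 [mN0 N00 sN0]] := mu_canon.
have mls : measurable (lim_sup_set bad).
  by apply: bigcap_measurable => // n0 _; apply: bigcup_measurable => j _.
pose Z := \bigcup_g (cview g @^-1` lim_sup_set bad).
have mZ : measurable Z by apply: (bigcupG eb) => g; exact: (vpre va).
have Z0 : mu Z = 0%E.
  apply: (measure0_bigcupG eb) => g; first exact: (vpre va).
  exact: (etrans (view_pres va g mls)).
exists (N0 `|` Z); split; [exact: measurableU|exact: null_setU|].
move=> x nx; apply: contrapT => /not_orP[nN nZ]; apply: nx => /=.
have cx : enc cbit x = x by apply: contrapT => h; exact/nN/sN0.
apply/funext => -[g [|i]] //; rewrite -[in RHS]cx /enc /=.
rewrite -enc_view -/transfer; set z := cview g x.
have outE j : out pview Rt Tv Hm cview cbase cbit L' psi j (enc code_lim z) = rec j z.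
  rewrite /out /rec /app down_encode; congr (down _ _ _ _ _ _ z); apply/funext => u.
  rewrite encbase coll_encode; congr (psi _ _ _ _); congr (coll _ _ _ _ _ _).
  apply/funext => u'; apply: eq_from_tnth => i'; rewrite !tnth_mktuple.
  by apply: cbit_encode => ? ?; exact: code_lim_site.
have nls : ~ lim_sup_set bad z by move=> h; apply: nZ; exists g.
have [n0 hn0] : exists n0, forall j, (n0 <= j)%N -> ~ bad j z.
  apply: contrapT => h; apply: nls => n0 _; apply: contrapT => h'.
  by apply: h; exists n0 => j n0j bj; apply: h'; exists j.
rewrite /lim' /lim_out RtA encbase.
have [Az|nAz] := pselect (A0 (cbase z)); last first.
  rewrite /cbit; case: asboolP => [[]//|_]; apply/esym/negbTE; rewrite negb_and.
  by apply/orP; right; apply/asboolPn.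
have good j : (maxn n0 i.+1 <= j)%N ->
    nth false (out pview Rt Tv Hm cview cbase cbit L' psi j (enc code_lim z)) i = cbit z i.
  rewrite geq_max => /andP[nj ij]; rewrite outE.
  have -> : rec j z = bits cbit (t' j) z by apply: contrapT => h; apply: (hn0 j nj).
  have it : (i < t' j)%N by apply: (leq_trans ij); exact: t'_ge.
  by rewrite -[i in LHS]/(val (Ordinal it)) -tnth_nth tnth_mktuple.
apply/asboolP/idP => [[_ [j0 h]]|ci].
  by rewrite -(good (maxn j0 (maxn n0 i.+1))) ?leq_maxr//; apply: h; exact: leq_maxl.
by split => //; exists (maxn n0 i.+1) => j /good ->.
Qed.

End inverse_code.
End transfer_code.

End codes.

(** * Isomorphism of two coded systems over the same base *)

Section code_iso.
Variables (R : realType) (G : groupType) (e : nat -> G) (eb : bijective e).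
Variables (nu : probability (pats G) R) (vaY : vaction nu (@pview G)).
Variable N0 : set (pats G).
Hypotheses (mN0 : measurable N0) (N00 : nu N0 = 0%E).
Hypothesis free : forall y g, ~ N0 y -> pview g y = y -> g = 1%g.
Hypothesis ergo : forall A B : set (pats G), measurable A -> measurable B ->
  nu A <> 0%E -> nu B <> 0%E -> exists g, A `&` pview g @^-1` B !=set0.
Variables (A0 : set (pats G)) (tau : pats G -> nat).
Hypotheses (mA0 : measurable A0) (A00 : nu A0 <> 0%E) (mtau : dm tau).

Notation tup k := (k.-tuple bool : finType).
Notation laws := (forall k, nat -> tup k -> R).

(* [P k t] is the law of the first [k] cont bits of a cell of type [t]. *)
Record coded_system (mu : probability (codes G) R) (P : laws) : Prop := {
  cs_view : vaction mu (@cview G) ;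
  cs_base : forall E, measurable E -> mu (@cbase G @^-1` E) = nu E ;
  cs_canon : mu.-negligible [set w | enc (cbit A0) w <> w] ;
  cs_law : forall k, law (P k) ;
  cs_push : forall k k', (k <= k')%N -> pushes (@trunc k' k) (P k') (P k) ;
  cs_indep : forall k (s : seq (G * nat * tup k)), uniq [seq i.1.1 | i <- s] ->
    forall E, measurable E -> (forall y i, E y -> i \in s ->
      A0 (pview i.1.1 y) /\ tau (pview i.1.1 y) = i.1.2) ->
    mu (@cbase G @^-1` E `&`
        [set w | all (fun i => bits (cbit A0) k (cview i.1.1 w) == i.2) s]) =
    (nu E * (\prod_(i <- s) P k i.1.2 i.2)%:E)%E }.

Definition ent (P : laws) k : R := fine (\int[nu]_(y in A0) (entl (P k) (tau y))%:E)%E.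

(** The image of a letter has at least the mass of the letter, hence at most its surprisal. *)
Lemma entl_push (A' A : finType) (r : A' -> A) (P' : nat -> A' -> R) (P : nat -> A -> R) x :
  law P' -> pushes r P' P -> entl P x <= entl P' x.
Proof.
move=> [P'0 P'1] pr; rewrite /entl.
have -> : \sum_a P x a * (- ln (P x a)) = \sum_a' P' x a' * (- ln (P x (r a'))).
  rewrite (partition_big r predT)//=; apply: eq_bigr => a _.
  rewrite [in LHS]pr mulr_suml; apply: eq_bigr => a' /eqP <-.
  by rewrite -pr.
apply: ler_sum => a' _; have := P'0 x a'; rewrite le_eqVlt => /orP[/eqP <-|p0].
  by rewrite !mul0r.
rewrite ler_pM2l// lerN2 ler_ln ?posrE//.
  by rewrite pr (bigD1 a')//= lerDl sumr_ge0.
by rewrite pr (bigD1 a')//= ltr_pwDl// sumr_ge0.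
Qed.

Variables (mu mu' : probability (codes G) R) (P Q : laws).
Arguments P : clear implicits.
Arguments Q : clear implicits.
Hypotheses (CP : coded_system mu P) (CQ : coded_system mu' Q).
Hypotheses (entPQ : forall k ep, 0 < ep -> exists k', ent P k - ep <= ent Q k')
  (entQP : forall k ep, 0 < ep -> exists k', ent Q k - ep <= ent P k')
  (ent_pos : exists k, 0 < ent P k).

Let tst i : set (pats G) := [set y | y (e i)].

Let mtst i : measurable (tst i).
Proof.
have mt : measurable [set true] by [].
have := @cmeas G _ bool (e i) measurableT [set true] mt.
by rewrite setTI; congr measurable; seteq => y /=; rewrite /tst /=; case: (y (e i)).
Qed.

Let free' : forall x g, ~ N0 x -> (forall i, tst i x <-> tst i (pview g x)) -> g = 1%g.
Proof.
move=> y g ny h; apply: (free ny); apply/funext => t.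
have [e' ee' e'e] := eb; have := h (e' t); rewrite /tst /= e'e.
by case: (y t); case: (pview g y t) => // -[h1 h2]; [have := h1 isT|have := h2 isT].
Qed.

Let mE (S : laws) k := ent S k / fine (nu A0).
(** Even indices belong to [P], odd ones to [Q], at resolution [j./2]: a single hierarchy has to
    balance the entropies of both systems at all resolutions. *)
Let hz j : nat -> R := if odd j then (fun x => entl (Q j./2) x - mE Q j./2)
  else (fun x => entl (P j./2) x - mE P j./2).

Let Rt := Rt e (@pview G) tst A0 tau hz.
Let Tv := Tv e (@pview G) tst A0 tau hz.
Let Hm := Hm e (@pview G) tst A0 tau hz.
Let Iq := If e nu (@pview G) tst A0 tau hz.

Let HH : hierarchy nu (@pview G) Rt Tv Hm.
Proof.
split => //.
- exact: (Rt_meas eb vaY mtst hz mA0 mtau).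
- exact: (Tv_dm eb vaY mtst hz mA0 mtau).
- exact: (Hm_matching eb vaY mtst hz mA0 mtau).
- exact: (Hm_cover eb vaY mtst mN0 N00 free' hz mA0 mtau).
Qed.

Let HI : root_functional Iq.
Proof. exact: (root_functional_If eb vaY mtst mN0 N00 free' hz mA0 mtau). Qed.

Let a0 : 0 < fine (nu A0).
Proof.
rewrite fine_gt0// lt_neqAle eq_sym measure_ge0 andbT.
apply/andP; split; first exact/eqP.
by rewrite (le_lt_trans (probability_le1 nu mA0))// ltry.
Qed.

Let If1 : Iq (n := 0) (fun=> 1) = fine (nu A0).
Proof. by rewrite /Iq /If /Jf integral_cst//= ?mul1e//; exact: mA0. Qed.

Let entl_bnd (S : laws) k : (forall k, law (S k)) -> forall x, 0 <= entl (S k) x <= 2 * #|tup k|%:R.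
Proof. by move=> lS x; have [h0 h1] := lS k; rewrite entl_ge0//= entl_le. Qed.

Let ent_balanced (S : laws) j k : (forall k, law (S k)) -> hz j = (fun x => entl (S k) x - mE S k) ->
  balanced Iq (entl (S k)) (mE S k).
Proof.
move=> lS hzj; apply: (balanced_level eb vaY mtst mN0 N00 free' ergo mA0 mtau (entl_bnd k lS) _ _ hzj).
  rewrite divr_ge0 ?(ltW a0)// /ent fine_ge0// integral_ge0// => y _.
  by rewrite lee_fin; case/andP: (entl_bnd k lS (tau y)).
by rewrite [X in _ * X]If1 /mE divfK ?gt_eqF.
Qed.

Let ent_mono (S : laws) k k' : (forall k, law (S k)) ->
  (forall k k', (k <= k')%N -> pushes (@trunc k' k) (S k') (S k)) -> (k <= k')%N -> ent S k <= ent S k'.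
Proof.
move=> lS pS kk'; apply: (rf_le HI (n := 0) (f := entl (S k)) (g := entl (S k'))).
- by exists (2 * #|tup k|%:R) => x; exact: entl_bnd.
- by exists (2 * #|tup k'|%:R) => x; exact: entl_bnd.
- by move=> x; apply: (entl_push x (lS k')); exact: pS.
Qed.

Lemma exq_swap (q : nat -> nat) (d : forall i n, tree nat n -> ftr (tup (q i)) n -> ftr (tup (q i)) n -> R)
    i n f :
  exq nu Rt Tv Q P (fun i n t b a => d i n t a b) (i := i) (n := n) (fun t b a => f t a b) =
  exq nu Rt Tv P Q d (i := i) (n := n) f.
Proof.
apply: eq_integral => y _; congr _%:E; rewrite /Exp exchange_big /=.
by apply: eq_bigr => a _; apply: eq_bigr => b _; rewrite [pv (Q _) _ _ * _]mulrC.
Qed.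

(** The hypotheses on [ent] give both sequences of entropies the same supremum, possibly infinite.
    Resolutions [u] and [v] can then be chosen alternately so that each entropy nearly reaches the
    preceding one, as [scheme_exists] requires. The limits of the codes in the two directions are
    inverse to each other almost everywhere. *)
Theorem code_iso : exists f f', ae_iso mu mu' (@cview G) (@cview G) f f'.
Proof.
have [lP pP] := (cs_law CP, cs_push CP); have [lQ pQ] := (cs_law CQ, cs_push CQ).
have balP k : balanced Iq (entl (P k)) (mE P k).
  by apply: (@ent_balanced P k.*2) => //; rewrite /hz odd_double doubleK.
have balQ k : balanced Iq (entl (Q k)) (mE Q k).
  by apply: (@ent_balanced Q k.*2.+1) => //; rewrite /hz /= odd_double /= uphalf_double.
have moP := ent_mono lP pP; have moQ := ent_mono lQ pQ.
have [k0 k0P] := ent_pos.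
have [k1 k1Q] : exists k, 0 < ent Q k.
  have h2 : 0 < ent P k0 / 2 by rewrite divr_gt0.
  have [k hk] := entPQ k0 h2; exists k; apply: lt_le_trans hk.
  by rewrite subr_gt0 ltr_pdivrMr// ltr_pMr// ltr1n.
pose eps (x : R) j := x / (7 * 2 ^+ (2 * j + 5)).
have eps0 x j : 0 < x -> 0 < eps x j.
  by move=> x0; rewrite divr_gt0// mulr_gt0// exprn_gt0.
(* The inequality is claimed only for [u] beyond [k1], where the entropy and hence the tolerance
   [eps] are positive; otherwise any [v] serves. *)
have nv u j : exists v, [/\ (u <= v)%N, (k0 <= v)%N & (k1 <= u)%N -> ent Q u - eps (ent Q u) j <= ent P v].
  have [ku|ku] := boolP (k1 <= u)%N; last by exists (maxn u k0); rewrite leq_maxl leq_maxr.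
  have q0 : 0 < ent Q u by exact: lt_le_trans (moQ _ _ ku).
  have [v hv] := entQP u (eps0 _ j q0); exists (maxn v (maxn u k0)).
  by rewrite !leq_max !leqnn !orbT; split => // _; apply: (le_trans hv); apply: moP; exact: leq_maxl.
have nu' v j : exists u, [/\ (v < u)%N, (k1 <= u)%N & (k0 <= v)%N -> ent P v - eps (ent P v) j <= ent Q u].
  have [kv|kv] := boolP (k0 <= v)%N; last by exists (maxn v.+1 k1); rewrite leq_maxl leq_maxr.
  have p0 : 0 < ent P v by exact: lt_le_trans (moP _ _ kv).
  have [u hu] := entPQ v (eps0 _ j p0); exists (maxn u (maxn v.+1 k1)).
  by rewrite !leq_max !leqnn !orbT; split => // _; apply: (le_trans hu); apply: moQ; exact: leq_maxl.
pose vf u j := projT1 (cid (nv u j)); pose uf v j := projT1 (cid (nu' v j)).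
pose u := fix u j := if j is j'.+1 then uf (vf (u j') j') j' else k1.
pose v j := vf (u j) j.
have ku j : (k1 <= u j)%N by case: j => //= j; have [] := projT2 (cid (nu' (v j) j)).
have uv j : (u j <= v j)%N by have [] := projT2 (cid (nv (u j) j)).
have kv j : (k0 <= v j)%N by have [] := projT2 (cid (nv (u j) j)).
have vu j : (v j < u j.+1)%N by have [] := projT2 (cid (nu' (v j) j)).
have uS j : (u j < u j.+1)%N by exact: leq_ltn_trans (uv j) (vu j).
have u_ge j : (j <= u j)%N by elim: j => // j IH; exact: leq_ltn_trans IH (uS j).
have u_mono i j : (i <= j)%N -> (u i <= u j)%N.
  elim: j => [|j IH]; first by rewrite leqn0 => /eqP ->.
  rewrite leq_eqVlt => /orP[/eqP ->//|]; rewrite ltnS => /IH h.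
  exact: leq_trans h (ltnW (uS j)).
have vu_lt i j : (i < j)%N -> (v i <= u j)%N by move=> ij; exact: leq_trans (ltnW (vu i)) (u_mono _ _ ij).
have Qu j : 0 < mE Q (u j) by rewrite divr_gt0//; exact: lt_le_trans (moQ _ _ (ku j)).
have Pv j : 0 < mE P (v j) by rewrite divr_gt0//; exact: lt_le_trans (moP _ _ (kv j)).
have epsM x j : eps x j / fine (nu A0) = eps (x / fine (nu A0)) j by rewrite /eps mulrAC.
have gQ j : mE Q (u j) - mE Q (u j) / (7 * 2 ^+ (2 * j + 5)) <= mE P (v j).
  rewrite -/(eps (mE Q (u j)) j) -epsM -mulrBl ler_pM2r ?invr_gt0//.
  by have [_ _] := projT2 (cid (nv (u j) j)); apply; exact: ku.
have gP j : mE P (v j) - mE P (v j) / (7 * 2 ^+ (2 * j + 5)) <= mE Q (u j.+1).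
  rewrite -/(eps (mE P (v j)) j) -epsM -mulrBl ler_pM2r ?invr_gt0//.
  by have [_ _] := projT2 (cid (nu' (v j) j)); apply; exact: kv.
have [N [phi [psi [d [hphi hpsi cpl cphi cpsi]]]]] :=
  scheme_exists HI lP lQ pP pQ balP balQ uv (fun j => ltnW (vu j)) Qu Pv gQ gP.
have ci (m : probability (codes G) R) (S : laws) : coded_system m S -> forall k,
    cindep nu (@pview G) Rt Tv Hm (@cview G) (@cbase G) m (bits (cbit A0) k) (S k) 0.
  move=> CS k s us E mE' Es.
  have Es' y (i : G * nat * tup k) : E y -> i \in (s : seq (G * nat * tup k)) ->
      A0 (pview i.1.1 y) /\ tau (pview i.1.1 y) = i.1.2.
    move=> /Es; elim: (s) => [//|i' s' IH] /= [h1 h2 h3]; rewrite inE => /orP[/eqP ->//|]; exact: IH.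
  rewrite -(cs_indep CS us mE' Es'); congr (m (_ `&` _)); apply/seteqP.
  split => x /=; elim: (s) => [//|i s' IH] /=; first by move=> [-> /IH ->]; rewrite eqxx.
  by move=> /andP[/eqP -> /IH].
have exqE i n (f : tree nat n -> ftr (tup (u i)) n -> ftr (tup (u i)) n -> R) (b : R) :
    (N i <= n)%N -> (forall t a b, 0 <= f t a b <= 2 ^+ n) ->
    Iq (fun t : tree nat n => Exp (P (u i)) (Q (u i)) t (d i n t) (f t)) <= b ->
    (exq nu Rt Tv P Q d f <= b%:E)%E.
  move=> Nn fb hb; have [[P0 P1] [Q0 Q1]] := (lP (u i), lQ (u i)).
  have := @JfE _ _ _ eb _ _ _ _ vaY _ mtst _ _ hz mA0 mtau n
    (fun t => Exp (P (u i)) (Q (u i)) t (d i n t) (f t)).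
  rewrite /Jf /exq => ->; first by rewrite lee_fin.
  exists (2 ^+ n) => t; apply/andP; split.
    apply: Exp_ge0 => //; first by have [] := cpl i n Nn t.
    by move=> a b'; case/andP: (fb t a b').
  apply: Exp_le_cst => //; first exact: (cpl i n Nn t).
  by move=> a b'; case/andP: (fb t a b').
have costP j i n : (j < i)%N -> (N i <= n)%N -> (exq nu Rt Tv P Q d (i := i) (n := n)
    (fun tr a b => ham R (phi j n tr (fcut a)) (fcut b)) <= (2 ^- j)%:E)%E.
  by move=> ji Nn; apply: exqE => //; [move=> *; rewrite ham_ge0 ham_le|exact: cphi].
have costQ j i n : (j < i)%N -> (N i <= n)%N -> (exq nu Rt Tv P Q d (i := i) (n := n)
    (fun tr a b => ham R (psi j n tr (fcut b)) (fcut a)) <= (2 ^- j)%:E)%E.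
  by move=> ji Nn; apply: exqE => //; [move=> *; rewrite ham_ge0 ham_le|exact: cpsi].
(* The reverse direction uses the same couplings with the two sides exchanged. *)
pose d' i n (t : tree nat n) (b a : ftr (tup (u i)) n) := d i n t a b.
have cpl' i n : (N i <= n)%N -> forall t : tree nat n, coupling (Q (u i)) (P (u i)) t (d' i n t).
  move=> Nn t; have [h1 h2 h3] := cpl i n Nn t.
  by split; [move=> b a; exact: h1|exact: h3|exact: h2].
have costP' j i n : (j < i)%N -> (N i <= n)%N -> (exq nu Rt Tv Q P d' (i := i) (n := n)
    (fun tr b a => ham R (phi j n tr (fcut a)) (fcut b)) <= (2 ^- j)%:E)%E.
  by move=> ji Nn; rewrite exq_swap; exact: costP.
have costQ' j i n : (j < i)%N -> (N i <= n)%N -> (exq nu Rt Tv Q P d' (i := i) (n := n)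
    (fun tr b a => ham R (psi j n tr (fcut b)) (fcut a)) <= (2 ^- j)%:E)%E.
  by move=> ji Nn; rewrite exq_swap; exact: costQ.
have [va va'] := (cs_view CP, cs_view CQ).
have RtA : Rt 0%N = A0 by [].
exists (transfer A0 Rt Tv Hm (fun j => N j.+1) phi), (transfer A0 Rt Tv Hm (fun j => N j.+1) psi).
have uu : forall j i, (j < i)%N -> (u j <= u i)%N by move=> j i ji; exact: u_mono (ltnW ji).
have uSu : forall j i, (j < i)%N -> (u j.+1 <= u i)%N by move=> j i ji; exact: u_mono.
have usS : forall j, (u j <= u j.+1)%N by move=> j; exact: ltnW.
have vvS : forall j, (v j <= v j.+1)%N by move=> j; apply: leq_trans (uv j.+1); exact: ltnW.
have v_ge : forall j, (j <= v j)%N by move=> j; exact: leq_trans (u_ge j) (uv j).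
have vv : forall j i, (j < i)%N -> (v j <= v i)%N by move=> j i ji; exact: leq_trans (vu_lt _ _ ji) (uv i).
split.
- exact: (transfer_meas eb mA0 vaY HH va).
- exact: (transfer_meas eb mA0 vaY HH va).
- by move=> g x; exact: enc_view.
- by move=> g x; exact: enc_view.
- exact: (transfer_law eb mA0 vaY HH RtA lP lQ cpl va va' (cs_base CP) (cs_base CQ) (ci _ _ CP) (ci _ _ CQ)
    (cs_canon CQ) (w := v) (t := u) vu_lt uu usS u_ge hphi costP).
- exact: (transfer_law eb mA0 vaY HH RtA lQ lP cpl' va' va (cs_base CQ) (cs_base CP) (ci _ _ CQ) (ci _ _ CP)
    (cs_canon CP) (w := fun j => u j.+1) (t := v) uSu vu_lt vvS v_ge hpsi costQ').
- exact: (transfer_inverse eb mA0 vaY HH RtA lP lQ cpl va (cs_base CP) (ci _ _ CP)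
    (w := v) (t := u) vu_lt usS hphi costP (w' := fun j => u j.+1) (t' := v) uSu vu_lt v_ge hpsi costQ (cs_canon CP)).
- exact: (transfer_inverse eb mA0 vaY HH RtA lQ lP cpl' va' (cs_base CQ) (ci _ _ CQ)
    (w := fun j => u j.+1) (t := v) uSu vvS hpsi costQ' (w' := v) (t' := u) vv uu u_ge hphi costP' (cs_canon CQ)).
Qed.

End code_iso.

(** * Independence and mixing for Bernoulli shifts *)

Section bernoulli.
Variables (R : realType) (G : groupType) (e : nat -> G) (eb : bijective e).
Variables (dL : measure_display) (L : measurableType dL) (la : probability L R).
Notation X := (power_space G dL L).
Variables (m : probability X R) (mP : is_product_measure la m).

(** The Bernoulli shift by the inverse of [g]: it moves the origin to [g]. *)
Definition vshift (g : G) (x : X) : X := fun t => x (g * t)%g.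

Lemma shift_action : vaction m vshift.
Proof.
have [h1 hM hm hp] := bernoulli_shift_pmp mP.
have E g : vshift g = bernoulli_shift G dL L g^-1%g.
  by apply/funext => x; apply/funext => t; rewrite /vshift /bernoulli_shift invgK.
split.
- by move=> x; apply/funext => t; rewrite /vshift mul1g.
- by move=> g h x; apply/funext => t; rewrite /vshift mulgA.
- by move=> g; rewrite E; exact: hm.
- by move=> g A mA; rewrite E; exact: hp.
Qed.

Lemma coord_preimage t B : measurable B -> measurable [set x : X | B (x t)].
Proof. exact: measurable_coordinate. Qed.

Definition splice (S : pred G) (x x' : X) : X := fun t => if S t then x t else x' t.

Lemma splice_meas S : measT (fun z : X * X => splice S z.1 z.2).
Proof.
apply: power_meas => t; rewrite /splice; case: (S t).
  exact: (measurableT_comp (@cmeas G _ L t) measurable_fst).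
exact: (measurableT_comp (@cmeas G _ L t) measurable_snd).
Qed.

(* Coordinates in [S] and outside of [S] may be drawn from independent copies. *)
Lemma splice_law S E : measurable E -> (m \x m)%E ((fun z => splice S z.1 z.2) @^-1` E) = m E.
Proof.
move=> mE.
pose f : {mfun (X * X)%type >-> X} :=
  HB.pack (fun z : X * X => splice S z.1 z.2) (isMeasurableFun.Build _ _ _ _ _ (@splice_meas S)).
apply/esym; apply: (power_measure_unique (m1 := m) (m2 := pushforward (m \x m)%E f) _ _ mE).
  exact: (le_lt_trans (probability_le1 m measurableT) (ltry _)).
move=> s A us mA; change (m (cylinder s A) = (m \x m)%E (f @^-1` cylinder s A)).
rewrite (_ : f @^-1` _ = cylinder [seq t <- s | S t] A `*` cylinder [seq t <- s | ~~ S t] A).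
  rewrite product_measure1E; [|exact: measurable_cylinder..].
  have q s' : uniq s' -> m (cylinder s' A) = (\prod_(t <- s') fine (la (A t)))%:E.
    by move=> us'; exact: mP.
  apply: (etrans (q s us)); apply/esym; apply: (etrans (congr2 (fun a b => (a * b)%E)
    (q _ (filter_uniq S us)) (q _ (filter_uniq (predC S) us)))).
  by rewrite -EFinM !big_filter [in RHS](bigID S).
seteq => -[x x'] /=; rewrite /cylinder /splice /=.
  move=> h; split => t /=; rewrite mem_filter => /andP[St ts]; have := h t ts; first by rewrite St.
  by rewrite (negbTE St).
move=> [h1 h2] t ts; case: ifP => St; first by apply: h1; rewrite mem_filter St.
by apply: h2; rewrite mem_filter St.
Qed.

Definition depends (S : pred G) (A : set X) :=
  forall x x', (forall t, S t -> x t = x' t) -> A x -> A x'.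

Lemma depends_splice1 S A x x' : depends S A -> A (splice S x x') <-> A x.
Proof. by move=> dA; split; apply: dA => t St; rewrite /splice St. Qed.

Lemma depends_splice2 S A x x' : depends (predC S) A -> A (splice S x x') <-> A x'.
Proof. by move=> dA; split; apply: dA => t /negbTE St; rewrite /splice St. Qed.

Lemma indep_sets S A B : measurable A -> measurable B -> depends S A -> depends (predC S) B ->
  m (A `&` B) = (m A * m B)%E.
Proof.
move=> mA mB dA dB; rewrite -(splice_law S (measurableI _ _ mA mB)) -product_measure1E//.
congr ((m \x m)%E _); seteq => -[x x'] /= [h1 h2]; split => //=.
- exact/(depends_splice1 x x' dA).
- exact/(depends_splice2 x x' dB).
- exact/(depends_splice1 x x' dA).
- exact/(depends_splice2 x x' dB).
Qed.

(* [V] describes the contents on [S]; an event [A] inside [V] that ignores these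
   contents as long as they stay in [V] is independent of them given [V]. *)
Lemma resample S V A B : measurable V -> measurable A -> measurable B ->
  depends S V -> depends S B -> A `<=` V ->
  (forall x x', (forall t, ~~ S t -> x t = x' t) -> V x -> V x' -> A x -> A x') ->
  (m (A `&` B) * m V = m A * m (V `&` B))%E.
Proof.
move=> mV mA mB dV dB AV hA; have [V0|/set0P[z0 Vz0]] := eqVneq V set0.
  have A0 : A = set0 by seteq => // x /AV; rewrite V0.
  by rewrite A0 V0 !set0I measure0 mul0e.
pose A' : set X := [set x | A (splice S z0 x)].
have mA' : measurable A'.
  have m1 : measT (fun x : X => splice S z0 x).
    apply: power_meas => t; rewrite /splice; case: (S t); first exact: measurable_cst.
    exact: (@cmeas G _ L t).
  by have := m1 measurableT _ mA; rewrite setTI.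
have key x x' : A (splice S x x') <-> V x /\ A' x'.
  have off (z z' : X) t : ~~ S t -> splice S z x' t = splice S z' x' t by rewrite /splice => /negbTE ->.
  split => [h|[Vx h]].
    split; first by apply/(depends_splice1 x x' dV); exact: AV.
    apply: (hA (splice S x x')) => //; [exact: off|exact: AV|].
    exact/(depends_splice1 z0 x' dV).
  apply: (hA (splice S z0 x')) => //; first exact: off.
    exact/(depends_splice1 z0 x' dV).
  exact/(depends_splice1 x x' dV).
have e1 : m A = (m V * m A')%E.
  rewrite -(splice_law S mA) -product_measure1E//; congr ((m \x m)%E _).
  by seteq => -[x x'] /=; [move=> /key|move=> /key].
have e2 : m (A `&` B) = (m (V `&` B) * m A')%E.
  rewrite -(splice_law S (measurableI _ _ mA mB)) -product_measure1E//; last exact: measurableI.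
  congr ((m \x m)%E _); seteq => -[x x'] /=.
    by move=> [/key[? ?] /(depends_splice1 x x' dB)].
  by move=> [[? ?] ?]; split; [exact/key|exact/(depends_splice1 x x' dB)].
by rewrite e1 e2 -muleA [(m A' * _)%E]muleC [RHS]muleC.
Qed.

Definition finitary (S : seq G) (A : set X) := depends (fun t => t \in S) A.

(** The approximable sets contain the coordinate events and form a sigma-algebra. *)
Lemma finitary_approx (A : set X) : measurable A -> forall ep : R, 0 < ep ->
  exists (S : seq G) (A' : set X), [/\ measurable A', finitary S A' &
    (m (sdiff A A') <= ep%:E)%E].
Proof.
pose D : set (set X) := [set A | measurable A /\ (forall ep : R, 0 < ep ->
  exists (S : seq G) (A' : set X), [/\ measurable A', finitary S A' &
    (m (sdiff A A') <= ep%:E)%E])].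
suff sub : @measurable _ X `<=` D by move=> mA; have [] := sub A mA.
apply: smallest_sub; last first.
  move=> _ [t _ [B mB <-]]; rewrite setTI; have mt := coord_preimage t mB; split => // ep ep0.
  exists [:: t], [set x : X | B (x t)]; split => //.
    by move=> x x' h /=; rewrite h ?mem_head.
  by rewrite !setDv setU0 measure0 lee_fin ltW.
have fU S1 S2 A1 A2 : finitary S1 A1 -> finitary S2 A2 -> finitary (S1 ++ S2) (A1 `|` A2).
  move=> f1 f2 x x' h [/f1 h1|/f2 h2]; [left; apply: h1|right; apply: h2] => t ts;
    by apply: h; rewrite mem_cat ts ?orbT.
have DU A1 A2 : D A1 -> D A2 -> D (A1 `|` A2).
  move=> [m1 h1] [m2 h2]; split; first exact: measurableU.
  move=> ep ep0; have e2 : 0 < ep / 2 by rewrite divr_gt0.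
  have [S1 [B1 [mB1 f1 b1]]] := h1 _ e2; have [S2 [B2 [mB2 f2 b2]]] := h2 _ e2.
  exists (S1 ++ S2), (B1 `|` B2); split; [exact: measurableU|exact: fU|].
  rewrite [ep]splitr EFinD; apply: le_trans (leeD b1 b2).
  apply: (le_trans _ (measureU2 m (sdiff_meas m1 mB1) (sdiff_meas m2 mB2))).
  apply: le_meas; [by apply: sdiff_meas; exact: measurableU|by apply: measurableU; exact: sdiff_meas|].
  move=> x [[[a|a] n]|[[a|a] n]].
  - by left; left; split => // b; apply: n; left.
  - by right; left; split => // b; apply: n; right.
  - by left; right; split => // b; apply: n; left.
  - by right; right; split => // b; apply: n; right.
split.
- split => // ep ep0; exists [::], set0; split => //.
  by rewrite set0D setU0 measure0 lee_fin ltW.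
- move=> C [mC hA]; rewrite setTD; split; first exact: measurableC.
  move=> ep /hA[S [A' [mA' fA' h]]]; exists S, (~` A'); split; first exact: measurableC.
    by move=> x x' xx' nA Ax'; apply: nA; apply: fA' Ax' => t ts; rewrite xx'.
  apply: le_trans h; apply: le_meas; [|exact: sdiff_meas|].
    by apply: sdiff_meas; exact: measurableC.
  move=> x [[nA nn]|[nA nn]]; [right|left]; split => //.
    by apply: contrapT => h; exact: nn.
  by apply: contrapT => h; exact: nn.
- move=> F0 DF0; pose F : nat -> set X := F0; have DF : forall k, D (F k) := DF0.
  change (D (\bigcup_k F k)); have mF k : measurable (F k) by have [] := DF k.
  have mU : measurable (\bigcup_k F k) by exact: bigcupT_measurable.
  split => // ep ep0; have e2 : 0 < ep / 2 by rewrite divr_gt0.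
  (* A countable union is replaced by a finite one, at the expense of half of the error. *)
  pose Bn n := \big[setU/set0]_(k < n) F k.
  have DB n : D (Bn n).
    elim: n => [|n IH]; rewrite /Bn ?big_ord0 ?big_ord_recr /=; last by apply: DU.
    split => // ep' ep'0; exists [::], set0; split => //.
    by rewrite set0D setU0 measure0 lee_fin ltW.
  have cv : m (Bn n) @[n --> \oo] --> m (\bigcup_n Bn n).
    apply: nondecreasing_cvg_mu; first by move=> n; have [] := DB n.
      by apply: bigcupT_measurable => n; have [] := DB n.
    by move=> n n' nn'; apply/subsetPset; exact: subset_bigsetU.
  have BU : \bigcup_n Bn n = \bigcup_k F k.
    seteq => x [n _].
      by rewrite /Bn -bigcup_mkord => -[k _ Fk]; exists k.
    by move=> Fn; exists n.+1 => //; rewrite /Bn big_ord_recr; right.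
  have [n hn] : exists n, (m (\bigcup_k F k `\` Bn n) <= (ep / 2)%:E)%E.
    have fin B : measurable B -> m B \is a fin_num by move=> mB; exact: fin_num_measure.
    have := cv; rewrite BU -(fineK (fin _ mU)) => /fine_cvgP[_ /cvgrPdist_le/(_ _ e2)[n _ hn]].
    exists n; have mBn : measurable (Bn n) by have [] := DB n.
    have sBn : Bn n `<=` \bigcup_k F k by rewrite -BU => x Bx; exists n.
    rewrite measureD// ?(setIidr sBn); last exact: (le_lt_trans (probability_le1 m mU) (ltry _)).
    rewrite [leLHS](_ : _ = (fine (m (\bigcup_k F k)) - fine (m (Bn n)))%:E).
      rewrite lee_fin.
      by apply: le_trans (hn n (leqnn n)); exact: ler_norm.
    by rewrite EFinB !fineK//; exact: fin.
  have [mBn hB] := DB n; have [S [A' [mA' fA' h]]] := hB _ e2.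
  exists S, A'; split => //; rewrite [ep]splitr EFinD; apply: le_trans (leeD hn h).
  have mUB : measurable (\bigcup_k F k `\` Bn n) by exact: measurableD.
  apply: (le_trans _ (measureU2 m mUB (sdiff_meas mBn mA'))).
  apply: le_meas; [exact: sdiff_meas|by apply: measurableU => //; exact: sdiff_meas|].
  have sBn : Bn n `<=` \bigcup_k F k by rewrite -BU => x Bx; exists n.
  move=> x [[Ux nA]|[Ax nU]]; last by right; right; split => // b; apply: nU; exact: sBn.
  by have [Bx|nB] := pselect (Bn n x); [right; left|left].
Qed.

Lemma avoid_seq (S : seq G) : exists g, g \notin S.
Proof.
have [e' ee' e'e] := eb; apply: contrapT => h.
have all n : e n \in S by apply/negPn/negP => hn; apply: h; exists (e n).
have := @uniq_leq_size _ [seq e i | i <- iota 0 (size S).+1] S.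
rewrite size_map size_iota ltnn => H; suff : false by [].
apply: H; first by rewrite map_inj_uniq ?iota_uniq//; exact: can_inj ee'.
by move=> _ /mapP[i _ ->].
Qed.

Lemma separate (S T : seq G) : exists g : G, forall s t, s \in S -> t \in T -> s <> (g * t)%g.
Proof.
have [g hg] := avoid_seq [seq (s * t^-1)%g | s <- S, t <- T].
exists g => s t sS tT E; move/negP: hg; apply; apply/allpairsP; exists (s, t); split => //=.
by rewrite E mulgK.
Qed.

(** Both sets are approximated by finitary ones, and since [G] is infinite some translation makes
    their supports disjoint, hence the sets independent. *)
Lemma shift_mixing A B : measurable A -> measurable B -> m A <> 0%E -> m B <> 0%E ->
  exists g, A `&` vshift g @^-1` B !=set0.
Proof.
move=> mA mB A0 B0.
have fin C : measurable C -> m C \is a fin_num by move=> mC; exact: fin_num_measure.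
pose a := fine (m A); pose b := fine (m B).
have pos C : measurable C -> m C <> 0%E -> 0 < fine (m C).
  move=> mC C0; rewrite fine_gt0// lt_neqAle measure_ge0 andbT eq_sym; apply/andP; split; first exact/eqP.
  exact: (le_lt_trans (probability_le1 m mC) (ltry _)).
have a0 : 0 < a := pos _ mA A0; have b0 : 0 < b := pos _ mB B0.
have le1 C : measurable C -> fine (m C) <= 1.
  by move=> mC; rewrite -lee_fin fineK ?fin//; exact: probability_le1.
have a1 : a <= 1 := le1 _ mA; have b1 : b <= 1 := le1 _ mB.
(* With this [ep] the approximations keep [7 / 8] of each measure, so their independent intersection
   has measure at least [49 / 64 * (a * b)]; if the original sets did not meet, it would be at most
   [2 * ep], a quarter of [a * b]. *)
pose ep := a * b / 8; have ep0 : 0 < ep by rewrite divr_gt0// mulr_gt0.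
have [S [A' [mA' fA' hA]]] := finitary_approx mA ep0.
have [T [B' [mB' fB' hB]]] := finitary_approx mB ep0.
have [g hg] := separate S T; exists g; apply: contrapT => h.
have va := shift_action.
have mgB : measurable (vshift g @^-1` B) := vpre va g mB.
have mgB' : measurable (vshift g @^-1` B') := vpre va g mB'.
have ind : m (A' `&` vshift g @^-1` B') = (m A' * m B')%E.
  rewrite (indep_sets (S := fun t => t \in S) mA' mgB' fA') ?(view_pres va)//.
  move=> x x' xx'; apply: fB' => t tT; rewrite /vshift xx'//= .
  by apply/negP => sS; exact: (hg _ _ sS tT).
have small : (m (A' `&` vshift g @^-1` B') <= (ep + ep)%:E)%E.
  have mgD : measurable (vshift g @^-1` (sdiff B B')) := vpre va g (sdiff_meas mB mB').
  rewrite EFinD; apply: (via (m (sdiff A A') + m (vshift g @^-1` (sdiff B B')))%E).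
    apply: (le_trans _ (measureU2 m (sdiff_meas mA mA') mgD)).
    apply: le_meas; [exact: measurableI|by apply: measurableU => //; exact: sdiff_meas|].
    move=> x [Ax Bx]; have [AA|nA] := pselect (A x); last by left; right.
    by right; right; split => // BB; apply: h; exists x.
  by apply: leeD => //; rewrite (view_pres va)//; exact: sdiff_meas.
have near C C' : measurable C -> measurable C' -> (m (sdiff C C') <= ep%:E)%E ->
    fine (m C) <= fine (m C') + ep.
  move=> mC mC' hC; rewrite -lee_fin EFinD !fineK ?fin//.
  apply: (via (m C' + m (sdiff C C'))%E); last exact: leeD.
  apply: (le_trans _ (measureU2 m mC' (sdiff_meas mC mC'))).
  apply: le_meas => //; first by apply: measurableU => //; exact: sdiff_meas.
  by move=> x Cx; have [?|?] := pselect (C' x); [left|right; left].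
have nA := near _ _ mA mA' hA; have nB := near _ _ mB mB' hB.
move: small; rewrite ind -(fineK (fin _ mA')) -(fineK (fin _ mB')) -EFinM lee_fin.
have A'0 : 0 <= fine (m A') by exact: fine_ge0.
have B'0 : 0 <= fine (m B') by exact: fine_ge0.
move: nA nB A'0 B'0; rewrite -/a -/b; move: (fine (m A')) (fine (m B')) => u w nA nB u0 w0.
apply/negP; rewrite -ltNge /ep in nA nB *.
have ab : a * b <= a by rewrite ler_piMr// ltW.
have ab' : a * b <= b by rewrite ler_piMl// ltW.
have hu : a * (7 / 8) <= u by lra.
have hw : b * (7 / 8) <= w by lra.
have : (a * (7 / 8)) * (b * (7 / 8)) <= u * w.
  by apply: ler_pM => //; rewrite mulr_ge0// ltW.
have abp : 0 < a * b by exact: mulr_gt0.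
rewrite mulrACA; move: abp; move: (a * b) (u * w) => p r p0; lra.
Qed.

End bernoulli.

(** * Marker patterns and their law *)

Section markers.
Variables (R : realType) (G : groupType) (e : nat -> G) (eb : bijective e).
Variable W : seq G.
Hypotheses (W1 : 1%g \notin W) (Wu : uniq W).

Definition win t : seq G := [seq (t * w)%g | w <- 1%g :: W].
Definition meets t u := has (fun g => g \in win u) (win t).

Hypothesis W_meets : forall t u, meets t u -> t <> u -> u \in win t \/ t \in win u.

Lemma win_uniq t : uniq (win t).
Proof. by rewrite map_inj_uniq /= ?W1//; exact: mulgI. Qed.

Lemma win_self t : t \in win t. Proof. by rewrite inE mulg1 eqxx. Qed.

Lemma win_mem t w : w \in W -> (t * w)%g \in win t.
Proof. by move=> wW; rewrite inE map_f ?orbT. Qed.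

Section one_base.
Variables (dL : measure_display) (L : measurableType dL) (la : probability L R).
Notation X := (power_space G dL L).
Variables (m : probability X R) (mP : is_product_measure la m).
Variables S0 S1 : set L.
Hypotheses (mS0 : measurable S0) (mS1 : measurable S1) (S01 : S0 `&` S1 = set0).

Definition mark (x : X) : pats G :=
  fun t => asbool (S0 (x t) /\ forall w, w \in W -> S1 (x (t * w)%g)).

Lemma mark_view g x : mark (vshift g x) = pview g (mark x).
Proof.
apply/funext => t; rewrite /mark /pview /vshift; congr asbool; apply/propext.
by split => -[h0 h1]; split => // w /h1; rewrite mulgA.
Qed.

Lemma mark_cylinder t : [set x : X | mark x t] =
  cylinder (win t) (fun g => if g == t then S0 else S1).
Proof.
seteq => x; rewrite /mark /cylinder /=.
  move=> /asboolP[h0 h1] g; rewrite inE mulg1 => /orP[/eqP ->|]; first by rewrite eqxx.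
  move=> /mapP[w wW ->]; rewrite -{2}[t]mulg1 (inj_eq (mulgI t)).
  by case: eqP => [E|_]; [by move: W1; rewrite -E wW|exact: h1].
move=> h; apply/asboolP; split.
  by have := h t; rewrite inE mulg1 eqxx; apply.
move=> w wW; have := h (t * w)%g; rewrite inE map_f ?orbT// -{2}[t]mulg1 (inj_eq (mulgI t)).
by case: eqP => [E|_]; [by move: W1; rewrite -E wW|apply].
Qed.

Lemma mark_meas1 t : measurable [set x : X | mark x t].
Proof. by rewrite mark_cylinder; apply: measurable_cylinder => g; case: ifP. Qed.

Lemma mark_meas : measT mark.
Proof. by apply: power_meas => t; apply: bool_meas; exact: mark_meas1. Qed.

(** By [W_meets] one of the two sites would have to show both [S0] and [S1]. *)
Lemma mark_excl x t u : meets t u -> t <> u -> ~~ (mark x t && mark x u).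
Proof.
move=> tu ntu; apply/negP => /andP[/asboolP[t0 t1] /asboolP[u0 u1]].
have S01x l : S0 l -> S1 l -> False by move=> h0 h1; have : (S0 `&` S1) l by []; rewrite S01.
have [] := W_meets tu ntu; rewrite inE mulg1 => /orP[/eqP E|/mapP[w wW E]].
- by rewrite E in ntu.
- by apply: (S01x (x u)) => //; rewrite E; exact: t1.
- by rewrite E in ntu.
- by apply: (S01x (x t)) => //; rewrite E; exact: u1.
Qed.

Definition alpha : R := fine (la S0) * fine (la S1) ^+ size W.

Lemma prod_const (I : Type) (r : seq I) (c : R) : \prod_(i <- r) c = c ^+ size r.
Proof. by elim: r => [|i r IH]; rewrite ?big_nil ?expr0// big_cons IH exprS. Qed.

Definition apart (s : seq G) := all (fun t => all (fun u => (t != u) ==> ~~ meets t u) s) s.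

(** Marks with meeting windows exclude each other and marks with disjoint windows are independent,
    so joint probabilities depend on the base through [alpha] alone. *)
Lemma marks_measure s : uniq s ->
  m [set x | forall t, t \in s -> mark x t] = (if apart s then alpha ^+ size s else 0)%:E.
Proof.
move=> us; case: ifP => [ap|/negP/negP/allPn[t ts /allPn[u us']]]; last first.
  rewrite negb_imply negbK => /andP[/eqP tu mtu].
  rewrite (_ : [set x | _] = set0) ?measure0//; seteq => // x h.
  by have := mark_excl x mtu tu; rewrite !h.
have apP t u : t \in s -> u \in s -> t != u -> forall g, g \in win t -> g \notin win u.
  move=> ts us' tu g gt; apply/negP => gu; have /allP/(_ _ us') := allP ap _ ts.
  by rewrite tu /= => /hasPn/(_ g gt); rewrite gu.
pose A g := if g \in s then S0 else S1.
rewrite (_ : [set x | _] = cylinder (flatten [seq win t | t <- s]) A); last first.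
  have tS t w : t \in s -> w \in W -> (t * w)%g \notin s.
    move=> ts wW; apply/negP => tws.
    have ne : t != (t * w)%g.
      by rewrite -{1}[t]mulg1 (inj_eq (mulgI t)); apply: contra W1 => /eqP ->.
    by have := apP _ _ ts tws ne _ (win_mem t wW); rewrite win_self.
  seteq => x h.
    move=> g /flattenP[_ /mapP[t ts ->]]; rewrite inE mulg1 /A => /orP[/eqP ->|/mapP[w wW ->]].
      by rewrite ts; have /asboolP[] := h t ts.
    by rewrite (negbTE (tS _ _ ts wW)); have /asboolP[_] := h t ts; apply.
  move=> t ts; apply/asboolP; split.
    have := h t; rewrite /A ts; apply; apply/flattenP; exists (win t); first exact: map_f.
    by rewrite inE mulg1 eqxx.
  move=> w wW; have := h (t * w)%g; rewrite /A (negbTE (tS _ _ ts wW)); apply.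
  apply/flattenP; exists (win t); first exact: map_f.
  by rewrite inE map_f ?orbT.
have uf : uniq (flatten [seq win t | t <- s]).
  elim: s us ap apP {A} => [//|t s IH] /= /andP[ts us] _ apP.
  change (uniq (win t ++ flatten [seq win t | t <- s])).
  rewrite cat_uniq win_uniq IH//; last first.
  - by move=> t' u' t's u's; apply: apP; rewrite inE ?t's ?u's orbT.
  - apply/allP => t' t's; apply/allP => u' u's; apply/implyP => ne; apply/hasPn => g gt.
    by apply: (apP t' u') => //; rewrite inE ?t's ?u's orbT.
  rewrite andbT andTb; apply/hasPn => g /flattenP[_ /mapP[u us' ->] gu].
  apply: (apP u t) => //; rewrite ?inE ?us' ?eqxx ?orbT//.
  by apply: contraNneq ts => <-.
have mA g : measurable (A g) by rewrite /A; case: ifP.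
apply: (etrans (mP uf mA)); congr _%:E.
rewrite big_flatten big_map /= -prod_const.
rewrite big_seq [RHS]big_seq; apply: eq_bigr => t ts.
rewrite big_cons mulg1 big_map /A ts /alpha; congr (_ * _).
rewrite -prod_const big_seq [RHS]big_seq; apply: eq_bigr => w wW.
suff -> : (t * w)%g \in s = false by [].
apply/negbTE/negP => tws; have ne : t != (t * w)%g.
  by rewrite -{1}[t]mulg1 (inj_eq (mulgI t)); apply: contra W1 => /eqP ->.
by have := apP _ _ ts tws ne _ (win_mem t wW); rewrite win_self.
Qed.

End one_base.

Section two_bases.
Variables (dL dK : measure_display) (L : measurableType dL) (K : measurableType dK)
  (la : probability L R) (kappa : probability K R)
  (m : probability (power_space G dL L) R) (n : probability (power_space G dK K) R).
Hypotheses (mP : is_product_measure la m) (nP : is_product_measure kappa n).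
Variables (S0 S1 : set L) (T0 T1 : set K).
Hypotheses (mS0 : measurable S0) (mS1 : measurable S1) (S01 : S0 `&` S1 = set0)
  (mT0 : measurable T0) (mT1 : measurable T1) (T01 : T0 `&` T1 = set0).
Hypothesis same : alpha la S0 S1 = alpha kappa T0 T1.

(** The events that all sites of a finite set are marked generate the sigma-algebra and are closed
    under intersection, and [marks_measure] computes them from [alpha]. *)
Lemma marks_same_law E : measurable E ->
  m (mark S0 S1 @^-1` E) = n (mark T0 T1 @^-1` E).
Proof.
move=> mE.
pose f : {mfun power_space G dL L >-> pats G} :=
  HB.pack (mark S0 S1) (isMeasurableFun.Build _ _ _ _ _ (mark_meas mS0 mS1)).
pose h : {mfun power_space G dK K >-> pats G} :=
  HB.pack (mark T0 T1) (isMeasurableFun.Build _ _ _ _ _ (mark_meas mT0 mT1)).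
pose C : set (set (pats G)) := [set B | exists s : seq G,
  uniq s /\ B = [set y : pats G | forall t, t \in s -> y t]].
have bitm t : measurable [set y : pats G | y t].
  have mt : measurable [set true] by [].
  have := @cmeas G _ bool t measurableT [set true] mt.
  by rewrite setTI; congr measurable; seteq => y /=; case: (y t).
have mC (s : seq G) : measurable [set y : pats G | forall t, t \in s -> y t].
  elim: s => [|t s IH].
    by rewrite (_ : [set y | _] = setT)//; seteq.
  rewrite (_ : [set y | _] = [set y : pats G | y t] `&`
    [set y : pats G | forall t, t \in s -> y t]); first exact: measurableI.
  seteq => y /= hy.
    by split => [|u us]; apply: hy; rewrite inE ?eqxx// us orbT.
  by move=> u; rewrite inE => /orP[/eqP ->|]; case: hy => // _; apply.
change (distribution m f E = distribution n h E).
apply: (measure_unique C (fun=> setT)) => //.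
- seteq; last first.
    apply: smallest_sub; first exact: sigma_algebra_measurable.
    by move=> _ [s [_ ->]].
  apply: smallest_sub; first exact: smallest_sigma_algebra.
  move=> _ [t _ [B mB <-]]; rewrite setTI.
  have CT : <<s C >> [set y : pats G | y t].
    apply: sub_sigma_algebra; exists [:: t]; split => //.
    by seteq => y /=; [move=> yt u; rewrite inE => /eqP ->|apply; rewrite inE].
  have [sT sC sU] := smallest_sigma_algebra setT C.
  have cases : B = setT \/ B = set0 \/ B = [set true] \/ B = [set false].
    have [bt|bt] := pselect (B true); have [bf|bf] := pselect (B false).
    - by left; seteq => // -[].
    - by right; right; left; seteq => -[].
    - by right; right; right; seteq => -[].
    - by right; left; seteq => -[].
  have [->|[->|[->|->]]] := cases.
  + by have := sC _ sT; rewrite setTD setC0 preimage_setT.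
  + by rewrite preimage_set0.
  + by congr (<<s C >>) : CT; seteq => y /=; case: (y t).
  + have := sC _ CT; congr (<<s C >>); seteq => y /=; rewrite /setD /=.
      by move=> [_]; case: (y t).
    by move=> ->; split.
- move=> _ _ [s [us ->]] [t [ut ->]]; exists (undup (s ++ t)); split; first exact: undup_uniq.
  seteq => y /=.
    by move=> [h1 h2] u; rewrite mem_undup mem_cat => /orP[/h1|/h2].
  by move=> hy; split => u ut'; apply: hy; rewrite mem_undup mem_cat ut' ?orbT.
- by move=> _; exists [::]; split => //; seteq.
- by seteq => // y _; exists 0%N.
- move=> _ [s [us ->]].
  have e1 := marks_measure mP mS0 mS1 S01 us; have e2 := marks_measure nP mT0 mT1 T01 us.
  by apply: (etrans e1); rewrite same; exact: esym e2.
- by move=> _; exact: (le_lt_trans (probability_le1 (distribution m f) measurableT) (ltry _)).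
Qed.

End two_bases.

(** * Freeness and ergodicity of the marker factor *)

Section freeness.
Variables (dL : measure_display) (L : measurableType dL) (la : probability L R).
Notation X := (power_space G dL L).
Variables (m : probability X R) (mP : is_product_measure la m).
Variables S0 S1 : set L.
Hypotheses (mS0 : measurable S0) (mS1 : measurable S1) (S01 : S0 `&` S1 = set0).
Hypothesis a01 : 0 < alpha la S0 S1 < 1.
Local Notation al := (alpha la S0 S1).
Local Notation mark := (mark S0 S1).

Definition mark_mfun : {mfun X >-> pats G} :=
  HB.pack mark (isMeasurableFun.Build _ _ _ _ _ (mark_meas mS0 mS1)).

Definition mark_law : probability (pats G) R := distribution m mark_mfun.

Lemma mark_lawE E : mark_law E = m (mark @^-1` E). Proof. by []. Qed.

Lemma mark_preimage E : measurable E -> measurable (mark @^-1` E).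
Proof. by move=> mE; rewrite -[_ @^-1` _]setTI; exact: (mark_meas mS0 mS1). Qed.

Lemma mark_law_action : vaction mark_law (@pview G).
Proof.
split.
- by move=> y; apply/funext => t; rewrite /pview mul1g.
- by move=> g h y; apply/funext => t; rewrite /pview mulgA.
- by move=> g; apply: power_meas => t; exact: (@cmeas _ _ bool).
move=> g E mE; rewrite !mark_lawE -(view_pres (shift_action mP) g (mark_preimage mE)).
by congr (m _); seteq => x /=; rewrite mark_view.
Qed.

Lemma mark_law_ergodic (A B : set (pats G)) : measurable A -> measurable B ->
  mark_law A <> 0%E -> mark_law B <> 0%E -> exists g, A `&` pview g @^-1` B !=set0.
Proof.
move=> mA mB A0 B0.
have [g [x [Ax Bx]]] := shift_mixing eb mP (mark_preimage mA) (mark_preimage mB) A0 B0.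
by exists g, (mark x); split => //; rewrite /= -mark_view.
Qed.

Lemma mark_finitary t : finitary (win t) [set x : X | mark x t].
Proof.
move=> x x' xx' /asboolP[h0 h1]; apply/asboolP; split; first by rewrite -xx'// win_self.
by move=> w wW; rewrite -xx'; [exact: h1|exact: win_mem].
Qed.

Definition agree t u : set X := [set x | mark x t = mark x u].

Lemma agree_meas t u : measurable (agree t u).
Proof.
have m1 := mark_meas1 mS0 mS1 t; have m2 := mark_meas1 mS0 mS1 u.
rewrite (_ : agree t u = ([set x : X | mark x t] `&` [set x : X | mark x u]) `|`
  (~` [set x : X | mark x t] `&` ~` [set x : X | mark x u])).
  by apply: measurableU; apply: measurableI => //; exact: measurableC.
seteq => x; rewrite /agree /=; case: (mark x t); case: (mark x u) => //.
- by left.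
- by right.
- by move=> [[]|[]].
- by move=> [[]|[]].
Qed.

(** The event that [t] is marked and [u] is not excludes agreement, and its probability is at least
    [al - al ^ 2]. *)
Lemma agree_le t u : t <> u -> (m (agree t u) <= (1 - al * (1 - al))%:E)%E.
Proof.
move=> tu; have mA := agree_meas t u.
have m1 := mark_meas1 mS0 mS1 t; have m2 := mark_meas1 mS0 mS1 u.
have e1 : m [set x | mark x t] = al%:E.
  have := marks_measure mP mS0 mS1 S01 (s := [:: t]) isT; rewrite /apart /= eqxx /= expr1 => <-.
  by congr (m _); seteq => x /=; [move=> xt v; rewrite inE => /eqP ->|apply; rewrite inE].
have e2 : (m ([set x | mark x t] `&` [set x | mark x u]) <= (al ^+ 2)%:E)%E.
  have us : uniq [:: t; u] by rewrite /= inE andbT; exact/eqP.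
  have := marks_measure mP mS0 mS1 S01 us.
  rewrite (_ : [set x | _] = [set x | mark x t] `&` [set x | mark x u]).
    by move=> ->; case: ifP => _; rewrite ?lexx// lee_fin sqr_ge0.
  seteq => x /= h.
    by split; apply: h; rewrite !inE eqxx ?orbT.
  case: h => h1 h2 v; rewrite inE => /orP[/eqP E|]; first by rewrite E; exact: h1.
  by rewrite inE => /eqP E; rewrite E; exact: h2.
have e3 : (m (agree t u) + m ([set x | mark x t] `\` [set x | mark x u]) <= 1)%E.
  rewrite -measureU//; last 2 first.
  - exact: measurableD.
  - by seteq => // x [] /= -> [].
  by apply: probability_le1; apply: measurableU => //; exact: measurableD.
have fin C : measurable C -> m C \is a fin_num by move=> mC; exact: fin_num_measure.
have mI : measurable ([set x | mark x t] `&` [set x | mark x u]) by exact: measurableI.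
have mD : measurable ([set x | mark x t] `\` [set x | mark x u]) by exact: measurableD.
have e4 : m [set x | mark x t] = (m ([set x | mark x t] `\` [set x | mark x u]) +
    m ([set x | mark x t] `&` [set x | mark x u]))%E by exact: measureDI.
pose a := fine (m (agree t u)).
pose b := fine (m ([set x | mark x t] `\` [set x | mark x u])).
pose c := fine (m ([set x | mark x t] `&` [set x | mark x u])).
have ea : m (agree t u) = a%:E by rewrite /a fineK//; exact: fin.
have ebc : m ([set x | mark x t] `\` [set x | mark x u]) = b%:E by rewrite /b fineK//; exact: fin.
have ec : m ([set x | mark x t] `&` [set x | mark x u]) = c%:E by rewrite /c fineK//; exact: fin.
have i1 : al = b + c by apply: EFin_inj; rewrite EFinD -ebc -ec -e4 e1.
have i2 : c <= al ^+ 2 by rewrite -lee_fin -ec.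
have i3 : a + b <= 1 by rewrite -lee_fin EFinD -ea -ebc.
rewrite [leLHS]ea lee_fin; move: i1 i2 i3; rewrite expr2; move: al => z; move=> -> i2 i3; lra.
Qed.

(** The marks at [t] and [g * t] are compared for sites [t] whose windows avoid everything used
    before; the comparisons are independent, and each succeeds with probability at most [c < 1]. *)
Lemma fixed_null g : g <> 1%g -> m [set x | forall t, mark x t = mark x (g * t)%g] = 0%E.
Proof.
move=> g1; set c := 1 - al * (1 - al).
have /andP[al0 al1] := a01.
have c01 : 0 <= c < 1.
  by rewrite /c; move: al al0 al1 => z z0 z1; apply/andP; split; nra.
have mF : measurable [set x | forall t, mark x t = mark x (g * t)%g].
  rewrite (_ : [set x | _] = ~` \bigcup_t (~` agree t (g * t)%g)).
    apply: measurableC; apply: (bigcupG eb) => t.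
    by apply: measurableC; exact: agree_meas.
  seteq => x /=; first by move=> h [t _]; apply; exact: h.
  by move=> h t; apply: contrapT => n; apply: h; exists t.
have step N : exists (S : seq G) (B : set X), [/\ measurable B, finitary S B,
    [set x | forall t, mark x t = mark x (g * t)%g] `<=` B & (m B <= (c ^+ N)%:E)%E].
  elim: N => [|N [S [B [mB fB sB hB]]]].
    by exists [::], setT; split => //; rewrite probability_setT.
  (* The list consists of the finitely many [t] for which the window at [t] or at [g * t] would meet
     [S]. *)
  have [t ht] := avoid_seq eb ([seq (s * w^-1)%g | s <- S, w <- 1%g :: W] ++
    [seq (g^-1 * (s * w^-1))%g | s <- S, w <- 1%g :: W]).
  move: ht; rewrite mem_cat negb_or => /andP[h1 h2].
  have off u : u \in win t ++ win (g * t)%g -> u \notin S.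
    rewrite mem_cat => /orP[/mapP[w wW ->]|/mapP[w wW ->]]; apply/negP => uS.
      by move/negP: h1; apply; apply/allpairsP; exists ((t * w)%g, w); rewrite /= mulgK.
    move/negP: h2; apply; apply/allpairsP; exists ((g * t * w)%g, w); split => //=.
    by rewrite mulgK mulKg.
  exists (S ++ (win t ++ win (g * t)%g)), (B `&` agree t (g * t)%g); split.
  - by apply: measurableI => //; exact: agree_meas.
  - move=> x x' xx' [Bx ax]; split.
      by apply: fB Bx => u uS; apply: xx'; rewrite mem_cat uS.
    have mk u : u = t \/ u = (g * t)%g -> mark x u = mark x' u.
      move=> hu; apply/idP/idP; apply: mark_finitary => v vw; [|apply/esym]; apply: xx';
        by case: hu => E; rewrite !mem_cat -E vw ?orbT.
    by rewrite /agree /= -mk ?ax -?mk//; [right|left].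
  - by move=> x h; split; [exact: sB|exact: h].
  have dB : depends (predC (fun u => u \in S)) (agree t (g * t)%g).
    move=> x x' xx'; rewrite /agree /=.
    have mk u : u = t \/ u = (g * t)%g -> mark x u = mark x' u.
      move=> hu; apply/idP/idP; apply: mark_finitary => v vw; [|apply/esym]; apply: xx';
        by apply: off; case: hu => E; rewrite mem_cat -E vw ?orbT.
    by rewrite -!mk//; [right|left].
  rewrite (indep_sets mP mB (agree_meas _ _) fB dB) exprSr EFinM.
  apply: lee_pmul => //; apply: agree_le => E; apply: g1.
  by apply: (mulIg t); rewrite mul1g -E.
set F := [set x | _] in mF step *.
have fF : m F \is a fin_num by exact: fin_num_measure.
apply/eqP; rewrite -measure_le0; apply/lee_addgt0Pr => ep ep0; rewrite add0e.
have /andP[c0 c1] := c01.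
have /cvgrPdist_le/(_ _ ep0)[N _ hN] : (GRing.exp c : R^nat) @ \oo --> (0 : R).
  by apply: cvg_expr; rewrite ger0_norm.
have [S [B [mB _ sB hB]]] := step N.
apply: (via (m B)); first by apply: le_meas.
apply: (le_trans hB); rewrite lee_fin; have := hN N (leqnn N).
by rewrite sub0r normrN ger0_norm// exprn_ge0.
Qed.

Definition periodic : set (pats G) :=
  \bigcup_g (if g == 1%g then set0 else [set y | pview g y = y]).

Lemma bit_meas t : measurable [set y : pats G | y t].
Proof.
have mt : measurable [set true] by [].
have := @cmeas G _ bool t measurableT [set true] mt.
by rewrite setTI; congr measurable; seteq => y /=; case: (y t).
Qed.

Lemma fixed_meas g : measurable [set y : pats G | pview g y = y].
Proof.
have mb b t : measurable [set y : pats G | y t = b].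
  case: b; first exact: bit_meas.
  rewrite (_ : [set y | _] = ~` [set y : pats G | y t]); first by apply: measurableC; exact: bit_meas.
  by seteq => y /=; case: (y t).
rewrite (_ : [set y | _] = ~` \bigcup_t (~` (([set y : pats G | y t = true] `&` [set y : pats G | y (g * t)%g = true]) `|`
   ([set y : pats G | y t = false] `&` [set y : pats G | y (g * t)%g = false])))).
  apply: measurableC; apply: (bigcupG eb) => t; apply: measurableC.
  by apply: measurableU; apply: measurableI; exact: mb.
seteq => y /=.
  move=> E [t _]; apply; have := congr1 (fun f => f t) E; rewrite /pview /= => ->.
  by case: (y t); [left|right].
move=> h; apply/funext => t; apply: contrapT => n; apply: h; exists t => // -[[h1 h2]|[h1 h2]]; apply: n.
  by rewrite /pview h1 h2.
by rewrite /pview h1 h2.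
Qed.

Lemma periodic_meas : measurable periodic.
Proof. by apply: (bigcupG eb) => g; case: ifP => // _; exact: fixed_meas. Qed.

Lemma periodic_null : mark_law periodic = 0%E.
Proof.
apply: (measure0_bigcupG eb) => g; case: eqP => // g1; first exact: fixed_meas.
rewrite mark_lawE -[RHS](fixed_null g1); congr (m _); seteq => x /=.
  by move=> E t; have := congr1 (fun f => f t) E.
by move=> h; apply/funext => t; rewrite /pview -h.
Qed.

Lemma free_off_periodic y g : ~ periodic y -> pview g y = y -> g = 1%g.
Proof.
move=> ny gy; apply: contrapT => g1; apply: ny; exists g => //.
by case: eqP.
Qed.

End freeness.
End markers.

(** * Surprisal with infinite values *)

Section surprisal.
Variable R : realType.

(** [- ln r] with value [+oo] at zero, where [ln] vanishes by convention; points of mass zero must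
    count as infinitely surprising. *)
Definition nl (r : R) : \bar R := if r == 0 then +oo%E else (- ln r)%:E.

Lemma nl_ge0 (r : R) : r <= 1 -> (0 <= nl r)%E.
Proof. by move=> r1; rewrite /nl; case: ifP => // _; rewrite lee_fin oppr_ge0 ln_le0. Qed.

Lemma nlM (r s : R) : 0 <= r -> 0 <= s -> nl (r * s) = (nl r + nl s)%E.
Proof.
move=> r0 s0; rewrite /nl mulf_eq0; have [->|rn] /= := eqVneq r 0; first by case: ifP.
have [_|sn] //= := eqVneq s 0.
have rp : 0 < r by rewrite lt_neqAle eq_sym rn.
have sp : 0 < s by rewrite lt_neqAle eq_sym sn.
by rewrite lnM ?posrE// opprD EFinD.
Qed.

Lemma nl_prod (I : Type) (s : seq I) (F : I -> R) : (forall i, 0 <= F i) ->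
  nl (\prod_(i <- s) F i) = (\sum_(i <- s) nl (F i))%E.
Proof.
move=> F0; elim: s => [|i s IH]; first by rewrite !big_nil /nl oner_eq0 ln1 oppr0.
by rewrite !big_cons nlM ?IH ?prodr_ge0.
Qed.

Lemma le_nl (r s : R) : 0 <= r -> r <= s -> (nl s <= nl r)%E.
Proof.
move=> r0 rs; rewrite /nl; have [_|rn] := eqVneq r 0; first by rewrite leey.
have rp : 0 < r by rewrite lt_neqAle eq_sym rn.
have sp : 0 < s by exact: lt_le_trans rs.
by rewrite gt_eqF// lee_fin lerN2 ler_ln ?posrE.
Qed.

Lemma nl_cvg (u : nat -> R) (r : R) : 0 <= r -> (forall n, r <= u n) -> u @ \oo --> r ->
  (fun n => nl (u n)) @ \oo --> nl r.
Proof.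
move=> r0 ru cu; have [re|rn] := eqVneq r 0; last first.
  have rp : 0 < r by rewrite lt_neqAle eq_sym rn.
  have -> : (fun n => nl (u n)) = (fun n => (- ln (u n))%:E).
    by apply/funext => n; rewrite /nl gt_eqF//; exact: lt_le_trans (ru n).
  rewrite /nl (negbTE rn); apply: cvg_EFin; first exact: nearW.
  by apply: (@cvgN _ R^o); apply: (cvg_comp _ _ cu); exact: continuous_ln.
rewrite {2}/nl re eqxx; apply/cvgeyPge => A.
have : \forall n \near \oo, u n < expR (- A) by apply: cvgr_lt cu _ _; rewrite re expR_gt0.
apply: filterS => n un; rewrite /nl; case: eqVneq => [_|u0]; first exact: leey.
have up : 0 < u n by rewrite lt_neqAle eq_sym u0 -re ru.
by rewrite lee_fin lerNr -[leRHS]expRK ler_ln ?posrE ?expR_gt0// ltW.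
Qed.

Variables (d : measure_display) (X : measurableType d) (mu : probability X R).

Variables (A : set X) (F : X -> nat -> bool).
Hypotheses (mA : measurable A) (mF : mbits F).

Let same k x : set X := A `&` [set x' | bits F k x' = bits F k x].

Let msame k x : measurable (same k x).
Proof. by apply: measurableI => //; exact: (bits_dm (k := k) mF [set bits F k x]). Qed.

Let same_mono k k' x : (k <= k')%N -> same k' x `<=` same k x.
Proof. by move=> kk' x' [Ax' /= E]; split => //=; rewrite -!(bits_trunc F _ kk') E. Qed.

Let same_lim x : \bigcap_k same k x = A `&` [set x' | F x' = F x].
Proof.
seteq => x' /= h.
  split; first by have [] := h 0%N I.
  apply/funext => i; have [_ /= E] := h i.+1 I.
  by have := congr1 (fun t => tnth t ord_max) E; rewrite !tnth_mktuple.
by move=> k _; split; [have [] := h|apply: eq_from_tnth => i; rewrite !tnth_mktuple h.2].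
Qed.

Lemma info_mono k k' x : (k <= k')%N ->
  (nl (fine (mu (A `&` [set x' | bits F k x' = bits F k x]))) <=
   nl (fine (mu (A `&` [set x' | bits F k' x' = bits F k' x]))))%E.
Proof.
move=> kk'; apply: le_nl; first exact: fine_ge0.
by apply: fine_le; [exact: fin_num_measure (msame _ _)..|apply: le_meas; [exact: msame..|exact: same_mono]].
Qed.

(** The cylinders fixed by the first [k] bits decrease to the set where all bits agree; the rest is
    continuity from above and [nl_cvg]. *)
Lemma info_lim x :
  (fun k => nl (fine (mu (A `&` [set x' | bits F k x' = bits F k x])))) @ \oo -->
  nl (fine (mu (A `&` [set x' | F x' = F x]))).
Proof.
have mI : measurable (\bigcap_k same k x) by exact: bigcapT_measurable.
rewrite -same_lim; apply: nl_cvg; first exact: fine_ge0.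
  move=> k; apply: fine_le; [exact: fin_num_measure|exact: fin_num_measure (msame _ _)|].
  by apply: le_meas => //; [exact: msame|move=> x' /(_ k I)].
apply: fine_cvg; rewrite fineK ?fin_num_measure//.
apply: (nonincreasing_cvg_mu (F := same^~ x)) => //.
  exact: (le_lt_trans (probability_le1 mu (msame _ _)) (ltry _)).
by move=> k k' kk'; apply/subsetPset; exact: same_mono.
Qed.

End surprisal.

(** * Bases coded by sequences of bits *)

Section coded_bases.
Variables (d : measure_display) (L : measurableType d).

(** Countably many measurable bits that separate points, with a decoder. Measurability of [dec] is
    stated along measurable families of bits, which spares a sigma-algebra on bit sequences. *)
Record coded_base (b : L -> nat -> bool) (dec : (nat -> bool) -> L) : Prop := {
  cb_meas : forall i, measurable [set l | b l i] ;
  cb_dec : forall d' (X : measurableType d') (F : X -> nat -> bool),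
    mbits F -> measT (fun x => dec (F x)) ;
  cb_can : forall l, dec (b l) = l }.

End coded_bases.

(** * Cells, their contents, and the entropy these carry *)

Section cells.
Variables (R : realType) (G : groupType) (e : nat -> G) (eb : bijective e).

Lemma code_fix_meas (f : codes G -> codes G) :
  measT f -> measurable [set w | f w <> w].
Proof.
move=> mf; have [e' eK e'K] := eb.
pose p n := (e (dec2 n).1, (dec2 n).2) : (G * nat)%type.
rewrite (_ : [set w | _] = \bigcup_n [set w | f w (p n) != w (p n)]).
  apply: bigcupT_measurable => n.
  have m1 : measurable [set w : codes G | f w (p n)].
    by have := measurableT_comp (@cmeas _ _ bool (p n)) mf; move=> /(_ measurableT [set true]); rewrite setTI; apply.
  have m2 : measurable [set w : codes G | w (p n)].
    by have := @cmeas _ _ bool (p n); move=> /(_ measurableT [set true]); rewrite setTI; apply.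
  rewrite (_ : [set w | _] = ([set w : codes G | f w (p n)] `\` [set w : codes G | w (p n)]) `|`
      ([set w : codes G | w (p n)] `\` [set w : codes G | f w (p n)])).
    by apply: measurableU; exact: measurableD.
  seteq => w /=; case: (f w (p n)); case: (w (p n)) => //=; [by left|by right|by case => -[]..].
seteq => [w fw|w [n _ /= /eqP h] E]; last by apply: h; rewrite E.
apply: contrapT => h; apply: fw; apply/funext => -[g i].
have := e'K g => <-; apply: contrapT => /eqP hn; apply: h.
by exists (pickle (e' g, i)) => //=; rewrite /p dec_pairK.
Qed.

(* Cells [g * D (tau (g . y))] are rooted at the points [g] with [A0 (g . y)];
   [U t] is the part of a pattern that a cell of type [t] controls. *)
Record cell_scheme (A0 : set (pats G)) (tau : pats G -> nat)
    (D : nat -> seq G) (U : nat -> set (pats G)) : Prop := {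
  sch_A0 : measurable A0 ;
  sch_tau : dm tau ;
  sch_U : forall t, measurable (U t) ;
  sch_uniq : forall t, uniq (D t) ;
  sch_type : forall y, A0 y -> U (tau y) y ;
  sch_disj : forall y g g' w w', A0 (pview g y) -> A0 (pview g' y) ->
    w \in D (tau (pview g y)) -> w' \in D (tau (pview g' y)) ->
    (g * w = g' * w')%g -> g = g' }.

Variables (A0 : set (pats G)) (tau : pats G -> nat)
    (D : nat -> seq G) (U : nat -> set (pats G))
  (sch : cell_scheme A0 tau D U).

Variables (dL : measure_display) (L : measurableType dL) (la : probability L R).
Notation X := (power_space G dL L).
Variables (m : probability X R) (mP : is_product_measure la m).
Variables (b : L -> nat -> bool) (dec : (nat -> bool) -> L)
  (cb : coded_base b dec).
Variable mk : X -> pats G.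
Hypotheses (mk_meas : measT mk)
  (mk_view : forall g x, mk (vshift g x) = pview g (mk x)).
Variables (nu : probability (pats G) R) (nuE : forall E, measurable E -> m (mk @^-1` E) = nu E).
Hypotheses (dep : forall t, depends (fun w => w \in D t) (mk @^-1` U t))
  (resamp : forall x x', A0 (mk x) -> (forall t, t \notin D (tau (mk x)) -> x t = x' t) ->
     U (tau (mk x)) (mk x') -> mk x' = mk x).

Let va : vaction m (@vshift G dL L) := shift_action mP.

Let mkp E : measurable E -> measurable (mk @^-1` E).
Proof. by move=> mE; rewrite -[_ @^-1` _]setTI; exact: mk_meas. Qed.

(** The index [i] encodes a position in the list [D t] and a bit of the letter there; beyond the
    list the bit is [false]. *)
Definition cont t (x : X) (i : nat) : bool :=
  ((dec2 i).1 < size (D t))%N && b (x (nth 1%g (D t) (dec2 i).1)) (dec2 i).2.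

Lemma cont_meas t i : measurable [set x | cont t x i].
Proof.
rewrite /cont; case: (_ < _)%N => /=; last first.
  by rewrite (_ : [set x | _] = set0)//; seteq.
exact: (coord_preimage (nth 1%g (D t) (dec2 i).1) (cb_meas cb (dec2 i).2)).
Qed.

Lemma cont_dep t x x' : (forall w, w \in D t -> x w = x' w) -> cont t x = cont t x'.
Proof.
move=> h; apply/funext => i; rewrite /cont; case: ltnP => //= it.
by rewrite h// mem_nth.
Qed.

Lemma cont_inj t x x' : cont t x = cont t x' -> forall w, w \in D t -> x w = x' w.
Proof.
move=> h w wD; rewrite -(cb_can cb (x w)) -(cb_can cb (x' w)); congr dec; apply/funext => j.
have := congr1 (fun f => f (pickle (index w (D t), j))) h.
by rewrite /cont dec_pairK /= index_mem wD nth_index.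
Qed.

Definition cell_bits (x : X) i : bool := asbool (A0 (mk x)) && cont (tau (mk x)) x i.

Lemma cell_bits_meas i : measurable [set x | cell_bits x i].
Proof.
rewrite (_ : [set x | _] = mk @^-1` A0 `&` \bigcup_t (mk @^-1` (tau @^-1` [set t]) `&` [set x | cont t x i])).
  apply: measurableI; first by apply: mkp; exact: (sch_A0 sch).
  apply: bigcupT_measurable => t; apply: measurableI; last exact: cont_meas.
  by apply: mkp; exact: (sch_tau sch).
seteq => x /=; rewrite /cell_bits.
  by move=> /andP[/asboolP Ax cx]; split => //; exists (tau (mk x)).
by move=> [Ax [t _ [/= <- cx]]]; apply/andP; split => //; exact/asboolP.
Qed.

Definition code (x : X) : codes G :=
  fun p => if p.2 is i.+1 then cell_bits (vshift p.1 x) i else mk x p.1.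

Lemma code_meas : measT code.
Proof.
apply: power_meas => -[g [|i]]; rewrite /code /=.
  exact: (measurableT_comp (@cmeas _ _ bool g) mk_meas).
apply: bool_meas; have := view_meas va g measurableT (cell_bits_meas i).
by rewrite setTI.
Qed.

Lemma cbase_code x : cbase (code x) = mk x. Proof. by []. Qed.

Lemma code_view g x : code (vshift g x) = cview g (code x).
Proof.
apply/funext => -[h [|i]]; rewrite /code /cview /=; first by rewrite mk_view.
by rewrite (viewM va).
Qed.

Lemma cbit_code x i : cbit A0 (code x) i = cell_bits x i.
Proof.
rewrite /cbit cbase_code /code /= (view1 va) /cell_bits.
by case: (asbool _); rewrite ?andbT ?andbF.
Qed.

Definition code_mfun : {mfun X >-> codes G} :=
  HB.pack code (isMeasurableFun.Build _ _ _ _ _ code_meas).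
Definition code_law : probability (codes G) R := distribution m code_mfun.

Let fin C : measurable C -> m C \is a fin_num. Proof. exact: fin_num_measure. Qed.

Notation tup k := (k.-tuple bool : finType).

Definition pU t : R := fine (m (mk @^-1` U t)).
Definition cyl k t (a : tup k) : R := fine (m (mk @^-1` U t `&` [set x | bits (cont t) k x = a])).
(** The conditional law of the content bits given [U t]. When [U t] is null it is a point mass
    instead, so that it remains a law and is compatible with truncation. *)
Definition claw k (t : nat) (a : tup k) : R :=
  if pU t == 0 then (a == [tuple false | _ < k])%:R else cyl t a / pU t.

Let mUc k t (a : tup k) : measurable (mk @^-1` U t `&` [set x | bits (cont t) k x = a]).
Proof.
apply: measurableI; first by apply: mkp; exact: (sch_U sch).
exact: (bits_dm (k := k) (cont_meas t) [set a]).
Qed.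

Lemma cyl_sum k t : \sum_(a : tup k) cyl t a = pU t.
Proof.
have mU := mkp (sch_U sch t).
apply: EFin_inj; rewrite -sumEFin /pU fineK ?fin//.
have := measure_pred m (A := mk @^-1` U t) [set: tup k]%SET mU (bits_dm (k := k) (cont_meas t)).
rewrite (_ : _ `&` _ = mk @^-1` U t); last first.
  by seteq => x /=; [case|move=> h; split => //; rewrite finset.inE].
move=> ->; apply: eq_big => [a|a _]; first by rewrite finset.inE.
by rewrite /cyl fineK//; apply: fin; exact: mUc.
Qed.

Lemma cyl_ge0 k t (a : tup k) : 0 <= cyl t a. Proof. exact: fine_ge0. Qed.

Lemma pU_ge0 t : 0 <= pU t. Proof. exact: fine_ge0. Qed.

Lemma claw_law k : law (@claw k).
Proof.
split=> [t a|t]; rewrite /claw.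
  by case: ifP => _; rewrite ?ler0n// divr_ge0 ?cyl_ge0 ?pU_ge0.
have [p0|p0] := eqVneq (pU t) 0; last first.
  by under eq_bigr do rewrite ?(negbTE p0); rewrite -mulr_suml cyl_sum divff.
under eq_bigr do rewrite ?p0 ?eqxx.
by rewrite (bigD1 [tuple false | _ < k])//= eqxx big1 ?addr0// => a /negbTE ->.
Qed.

Lemma claw_push k k' : (k <= k')%N -> pushes (@trunc k' k) (@claw k') (@claw k).
Proof.
move=> kk' t a; rewrite /claw; case: ifPn => p0.
  have tf : trunc k [tuple false | _ < k'] = [tuple false | _ < k].
    apply: eq_from_tnth => i; rewrite !tnth_mktuple.
    have ik : (i < k')%N by exact: leq_trans kk'.
    by rewrite -[LHS]/(nth false [tuple false | _ < k'] (Ordinal ik)) -tnth_nth tnth_mktuple.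
  have [->|na] := eqVneq a [tuple false | _ < k].
    rewrite (bigD1 [tuple false | _ < k'])/=; last by rewrite tf.
    by rewrite eqxx big1 ?addr0// => a' /andP[_ /negbTE ->].
  by rewrite big1// => a' /eqP ta; case: eqP => // E; rewrite -ta E tf eqxx in na.
rewrite -mulr_suml; congr (_ / _); apply: EFin_inj; rewrite -sumEFin.
have mU := mkp (sch_U sch t).
have := measure_pred m (A := mk @^-1` U t) [set a' : tup k' | trunc k a' == a]%SET mU
  (bits_dm (k := k') (cont_meas t)).
rewrite /cyl fineK; last by apply: fin; exact: mUc.
rewrite (_ : _ `&` [set x | _ \in _] = mk @^-1` U t `&` [set x | bits (cont t) k x = a]); last first.
  seteq => x [Ux /=]; rewrite finset.inE -(bits_trunc (cont t) x kk') => h; split => //=.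
    exact/eqP.
  by rewrite ?finset.inE; apply/eqP.
move=> ->; apply: eq_big => [a'|a' _]; first by rewrite finset.inE.
by rewrite fineK//; apply: fin; exact: mUc.
Qed.

(** Cells are split off one at a time. By [resamp] the letters of a cell can be replaced by any
    others compatible with [U t] without changing the marks, and by [sch_disj] the other cells are
    untouched; [resample] then yields the factor. *)
Lemma code_law_indep k (s : seq (G * nat * tup k)) : uniq [seq i.1.1 | i <- s] ->
    forall E, measurable E -> (forall y i, E y -> i \in s ->
      A0 (pview i.1.1 y) /\ tau (pview i.1.1 y) = i.1.2) ->
  code_law (@cbase G @^-1` E `&`
        [set w | all (fun i => bits (cbit A0) k (cview i.1.1 w) == i.2) s]) =
    (nu E * (\prod_(i <- s) claw i.1.2 i.2)%:E)%E.
Proof.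
move=> us E mE Es.
pose B (i : G * nat * tup k) := [set x : X | bits (cont i.1.2) k (vshift i.1.1 x) = i.2].
have mB i : measurable (B i).
  exact: (vpre va i.1.1 (bits_dm (k := k) (cont_meas i.1.2) [set i.2])).
pose Rs := fix Rs (r : seq (G * nat * tup k)) : set X := if r is i :: r' then Rs r' `&` B i else mk @^-1` E.
have mRs r : measurable (Rs r) by elim: r => [|i r IH] /=; [exact: mkp|exact: measurableI].
have RsE r x : Rs r x -> E (mk x) by elim: r => [//|i r IH] /= [/IH].
have -> : code_law (@cbase G @^-1` E `&`
    [set w | all (fun i => bits (cbit A0) k (cview i.1.1 w) == i.2) s]) = m (Rs s).
  rewrite -[LHS]/(m (code @^-1` _)); congr (m _).
  have eqb x i : E (mk x) -> i \in s -> bits (cbit A0) k (cview i.1.1 (code x)) =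
      bits (cont i.1.2) k (vshift i.1.1 x).
    move=> Ex si; have [h1 h2] := Es _ _ Ex si.
    apply: eq_from_tnth => j; rewrite !tnth_mktuple -code_view cbit_code /cell_bits mk_view h2.
    by rewrite (asboolT h1).
  have sub r x : {subset r <= s} -> (Rs r x <-> E (mk x) /\ all (fun i => bits (cbit A0) k (cview i.1.1 (code x)) == i.2) r).
    elim: r => [|i r IH] rs /=; first by split => [?|[]].
    have rs' : {subset r <= s} by move=> j jr; apply: rs; rewrite inE jr orbT.
    have is_ : i \in s by apply: rs; rewrite mem_head.
    rewrite (IH rs'); split => [[[Ex h] Bi]|[Ex /andP[/eqP hi h]]].
      by split => //; rewrite h andbT eqb//; exact/eqP.
    by split => //; rewrite /B /= -eqb.
  have ss : {subset s <= s} by [].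
  seteq => x; first by move=> h; exact: (sub s x ss).2.
  by move=> /(sub s x ss).1.
have main r : {subset r <= s} -> uniq [seq i.1.1 | i <- r] ->
    m (Rs r) = (nu E * (\prod_(i <- r) claw i.1.2 i.2)%:E)%E; last exact: main.
elim: r => [_ _|[[g t] a] r IH rs /= /andP[gr ur]]; first by rewrite big_nil mule1 /= nuE.
have rs' : {subset r <= s} by move=> j jr; apply: rs; rewrite inE jr orbT.
have is_ : (g, t, a) \in s by apply: rs; rewrite mem_head.
pose S : pred G := fun u => u \in [seq (g * w)%g | w <- D t].
pose V := vshift g @^-1` (mk @^-1` U t).
have mV : measurable V := vpre va g (mkp (sch_U sch t)).
have dV : depends S V.
  move=> x x' xx'; apply: dep => w wD; rewrite /vshift; apply: xx'.
  by rewrite /S map_f.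
have dB : depends S (B (g, t, a)).
  move=> x x' xx'; rewrite /B /= => <-; apply: eq_from_tnth => j; rewrite !tnth_mktuple.
  have := @cont_dep t (vshift g x') (vshift g x); move=> -> // w wD.
  by rewrite /vshift xx'// /S map_f.
have EV x : E (mk x) -> V x.
  move=> /Es/(_ is_)[/= h1 h2]; rewrite /V /= mk_view -h2; exact: (sch_type sch).
have RV : Rs r `<=` V by move=> x /RsE; exact: EV.
have hR x x' : (forall u, ~~ S u -> x u = x' u) -> V x -> V x' -> Rs r x -> Rs r x'.
  move=> xx' Vx Vx' Rx; have Ex := RsE _ _ Rx; have [/= h1 h2] := Es _ _ Ex is_.
  have emk : mk x' = mk x.
    rewrite -(viewVK va g x') -[in RHS](viewVK va g x) !mk_view; congr (pview _ _).
    rewrite -!mk_view; apply: resamp; rewrite mk_view ?h2//.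
      move=> u uD; rewrite /vshift; apply: xx'; apply/negP => /mapP[w wD /mulgI E'].
      by rewrite E' wD in uD.
  elim: (r) rs' gr Rx => [_ _ |i r' IHr rs'' gr' /= [Rx Bi]] /=; first by rewrite emk.
  split.
    apply: IHr => //; first by move=> j jr; apply: rs''; rewrite inE jr orbT.
    by move: gr'; rewrite inE negb_or => /andP[].
  have si : i \in s by apply: rs''; rewrite mem_head.
  have [h3 h4] := Es _ _ Ex si.
  rewrite /B /= -Bi; apply: eq_from_tnth => j; rewrite !tnth_mktuple.
  have := @cont_dep i.1.2 (vshift i.1.1 x') (vshift i.1.1 x); move=> -> // w wD.
  apply/esym; rewrite /vshift; apply: xx'.
  apply/negP => /mapP[w' w'D E']; move: gr'; rewrite inE negb_or => /andP[/eqP + _]; apply.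
  by apply/esym; apply: (sch_disj sch h3 h1 _ _ E'); rewrite ?h4 ?h2.
have := resample mP mV (mRs r) (mB (g, t, a)) dV dB RV hR.
have mVE : m V = (pU t)%:E by rewrite (view_pres va g (mkp (sch_U sch t))) /pU fineK// fin//; apply: mkp; exact: (sch_U sch).
rewrite mVE.
have -> : m (V `&` B (g, t, a)) = (cyl t a)%:E.
  have := view_pres va g (mUc t a); rewrite /cyl fineK; last by apply: fin; exact: mUc.
  by [].
rewrite IH// big_cons /=.
have [p0|p0] := eqVneq (pU t) 0.
  move=> _; have nu0 : nu E = 0%E.
    apply/eqP; rewrite eq_le measure_ge0 andbT -nuE//.
    apply: (via (m V)); first by apply: le_meas => //; exact: mkp.
    by rewrite mVE p0.
  rewrite nu0 mul0e; apply/eqP; rewrite -measure_le0.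
  rewrite -[leRHS]nu0 -nuE//; apply: le_meas; [exact: (mRs ((g, t, a) :: r))|exact: mkp|].
  by move=> x [/RsE].
have mfin : m (Rs ((g, t, a) :: r)) \is a fin_num by apply: fin; exact: (mRs ((g, t, a) :: r)).
have nfin : nu E \is a fin_num by exact: fin_num_measure.
rewrite /claw (negbTE p0) -(fineK nfin) -[m (Rs r `&` _)](fineK mfin) -!EFinM => -[h]; congr _%:E.
by apply: (mulIf p0); rewrite h; field.
Qed.

Lemma code_law_coded : coded_system nu A0 tau code_law claw.
Proof.
have lE C : code_law C = m (code @^-1` C) by [].
split.
- split.
  + exact: cview1.
  + exact: cviewM.
  + exact: cview_meas.
  + move=> g C mC; have mCc : measurable (code @^-1` C).
      by rewrite -[_ @^-1` _]setTI; exact: code_meas.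
    rewrite !lE -(view_pres va g mCc); congr (m _).
    by seteq => x /=; rewrite code_view.
- by move=> E mE; rewrite lE -nuE.
- pose N := [set w | enc (cbit A0) w <> w].
  have mN : measurable N.
    by apply: code_fix_meas; apply: enc_meas => i; apply: cbit_meas; exact: sch_A0 sch.
  exists N; split => //; rewrite lE (_ : _ @^-1` _ = set0) ?measure0//.
  seteq => x //=; apply; apply/funext => -[g [|i]] //.
  by rewrite /enc /= -code_view cbit_code.
- exact: claw_law.
- exact: claw_push.
- exact: code_law_indep.
Qed.

Hypothesis vaY : vaction nu (@pview G).

(** The origin lies in the cell rooted at [g^-1], at relative position [g]. *)
Definition covers (g : G) : set (pats G) :=
  [set y | A0 (pview g^-1 y) /\ g \in D (tau (pview g^-1 y))].
Definition uncovered : set (pats G) := ~` \bigcup_g covers g.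

Lemma covers_meas g : measurable (covers g).
Proof.
have := vpre vaY g^-1%g (measurableI _ _ (sch_A0 sch) (sch_tau sch [set t | g \in D t])).
by congr measurable; seteq.
Qed.

Lemma uncovered_meas : measurable uncovered.
Proof. by apply: measurableC; apply: (bigcupG eb) => g; exact: covers_meas. Qed.

Hypothesis cover0 : nu uncovered = 0%E.

Definition letter_bit (z : codes G) (i : nat) : bool :=
  asbool (exists g, covers g (cbase z) /\
    z (g^-1%g, (pickle (index g (D (tau (pview g^-1 (cbase z)))), i)).+1)).

Lemma letter_bit_meas i : measurable [set z | letter_bit z i].
Proof.
rewrite (_ : [set z | _] = \bigcup_g \bigcup_t (@cbase G @^-1` (covers g `&` pview g^-1 @^-1` (tau @^-1` [set t]))
    `&` [set z : codes G | z (g^-1%g, (pickle (index g (D t), i)).+1)])).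
  apply: (bigcupG eb) => g; apply: bigcupT_measurable => t; apply: measurableI.
    rewrite -[_ @^-1` _]setTI; apply: cbase_meas => //; apply: measurableI; first exact: covers_meas.
    exact: (vpre vaY g^-1%g (sch_tau sch [set t])).
  exact: code_bit_meas.
seteq => z /=; rewrite /letter_bit.
  by move=> /asboolP[g [cg zg]]; exists g => //; exists (tau (pview g^-1 (cbase z))).
by move=> [g _ [t _ [[cg /= <-] zg]]]; apply/asboolP; exists g.
Qed.

Lemma code_covers x g i : covers g (mk x) ->
  code x (g^-1%g, (pickle (index g (D (tau (pview g^-1 (mk x)))), i)).+1) = b (x 1%g) i.
Proof.
move=> [h1 h2]; rewrite /code [(_, _).2]/= [(_, _).1]/= /cell_bits mk_view (asboolT h1) /cont dec_pairK /=.
by rewrite index_mem h2 nth_index// /vshift mulVg.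
Qed.

Lemma letter_code x : ~ uncovered (mk x) -> letter_bit (code x) = b (x 1%g).
Proof.
move=> /contrapT[g _ cg]; apply/funext => i; rewrite /letter_bit; apply/asboolP/idP.
  by move=> [h [ch]]; rewrite cbase_code code_covers.
by move=> bi; exists g; rewrite cbase_code code_covers.
Qed.

Definition decode (z : codes G) : X := fun t => dec (letter_bit (cview t z)).

Lemma decode_meas : measT decode.
Proof.
apply: power_meas => t; apply: (cb_dec cb) => i.
by have := cview_meas t measurableT (letter_bit_meas i); rewrite setTI.
Qed.

Definition undecodable : set X := \bigcup_t (vshift t @^-1` (mk @^-1` uncovered)).

Lemma undecodable_meas : measurable undecodable.
Proof.
by apply: (bigcupG eb) => t; apply: (vpre va); apply: mkp; exact: uncovered_meas.
Qed.

Lemma undecodable_null : m undecodable = 0%E.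
Proof.
have mU := mkp uncovered_meas.
apply: (measure0_bigcupG eb) => t; first exact: (vpre va).
by rewrite (view_pres va t mU) (nuE uncovered_meas).
Qed.

Lemma decode_code x : ~ undecodable x -> decode (code x) = x.
Proof.
move=> ux; apply/funext => t; rewrite /decode -code_view letter_code; last first.
  by move=> h; apply: ux; exists t.
by rewrite (cb_can cb) /vshift mulg1.
Qed.

Lemma code_ae_iso : ae_iso m code_law (@vshift G dL L) (@cview G) code decode.
Proof.
have mdc : measT (code \o decode) by exact: measurableT_comp code_meas decode_meas.
have mc C := preim_meas (B := C) code_meas; have md B := preim_meas (B := B) decode_meas.
have lE C : code_law C = m (code @^-1` C) by [].
have mU := undecodable_meas; have U0 := undecodable_null.
split.
- exact: code_meas.
- exact: decode_meas.
- exact: code_view.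
- by move=> g z; apply/funext => t; rewrite /decode /vshift cviewM.
- by [].
- move=> B mB; have mBd := mc _ (md _ mB).
  apply: (etrans (esym (measureU0 mBd mU U0))); apply: (etrans _ (measureU0 mB mU U0)).
  congr (m _); seteq => x h; have [ux|ux] := pselect (undecodable x); try by right.
    by case: h => // h; left; move: h; rewrite /= decode_code.
  by case: h => // h; left; rewrite /= decode_code.
- by exists undecodable; split => // x h; apply: contrapT => ux; apply: h; exact: decode_code.
have mN := code_fix_meas mdc; exists [set z | code (decode z) <> z]; split => //.
apply/eqP; rewrite eq_le measure_ge0 andbT lE -U0; apply: le_meas => //; first exact: mc.
by move=> x /= h; apply: contrapT => ux; apply: h; rewrite decode_code.
Qed.

Lemma singleton_meas l : measurable [set l : L].
Proof.
rewrite (_ : [set l] = \bigcap_i [set l' | b l' i = b l i]).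
  apply: bigcapT_measurable => i; case: (b l i); first exact: (cb_meas cb).
  have := measurableC (cb_meas cb i); congr measurable.
  by seteq => l' /=; case: (b l' i).
seteq => l' /=; first by move=> ->.
by move=> h; rewrite -(cb_can cb l) -(cb_can cb l'); congr dec; apply/funext => i; exact: h.
Qed.

Lemma cell_dm k T (h : nat -> tup k -> T) :
  dm (fun x => h (tau (mk x)) (bits (cont (tau (mk x))) k x)).
Proof.
move=> B; rewrite (_ : _ @^-1` B = \bigcup_t (mk @^-1` (tau @^-1` [set t]) `&`
    [set x | B (h t (bits (cont t) k x))])).
  apply: bigcupT_measurable => t; apply: measurableI; first by apply: mkp; exact: (sch_tau sch).
  exact: (bits_dm (k := k) (cont_meas t) (fun a => B (h t a))).
seteq => x /=; first by move=> h1; exists (tau (mk x)).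
by move=> [t _ [/= <-]].
Qed.

Let C t : set X := mk @^-1` (A0 `&` tau @^-1` [set t]).

Let mC t : measurable (C t).
Proof. by apply: mkp; apply: measurableI; [exact: (sch_A0 sch)|exact: (sch_tau sch)]. Qed.

Let CU t : C t `<=` mk @^-1` U t.
Proof. by move=> x [Ax /= tx]; rewrite /= -tx; exact: (sch_type sch). Qed.

(** Rooting a cell of type [t] says more than [U t], but by [resamp] the additional information
    ignores the letters of the cell, so the conditional law is the same. *)
Lemma cell_cond k t (a : tup k) :
  (m (C t `&` [set x | bits (cont t) k x = a]) * (pU t)%:E = m (C t) * (cyl t a)%:E)%E.
Proof.
have mU := mkp (sch_U sch t).
have mB : measurable [set x | bits (cont t) k x = a].
  exact: (bits_dm (k := k) (cont_meas t) [set a]).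
have dB : depends (fun w => w \in D t) [set x | bits (cont t) k x = a].
  move=> x x' xx' /= <-; apply: eq_from_tnth => j; rewrite !tnth_mktuple.
  by rewrite (@cont_dep t x' x)// => w wD; rewrite xx'.
have hA x x' : (forall u, ~~ (u \in D t) -> x u = x' u) -> (mk @^-1` U t) x -> (mk @^-1` U t) x' -> C t x -> C t x'.
  move=> xx' Vx Vx' [Ax /= tx]; rewrite /C /=; suff -> : mk x' = mk x by [].
  by apply: resamp => //; rewrite tx.
have := resample mP mU (mC t) mB (@dep t) dB (@CU t) hA.
by rewrite /pU /cyl !fineK ?fin//; exact: mUc.
Qed.

Lemma cyl_le1 k t (a : tup k) : cyl t a <= 1.
Proof. by rewrite -lee_fin /cyl fineK; [apply: probability_le1; exact: mUc|apply: fin; exact: mUc]. Qed.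

Lemma pU_le1 t : pU t <= 1.
Proof.
have mU := mkp (sch_U sch t).
by rewrite -lee_fin /pU fineK ?probability_le1// fin.
Qed.

Definition cell_info k x : \bar R := nl (cyl (tau (mk x)) (bits (cont (tau (mk x))) k x)).

Lemma cell_info_meas k : measT (cell_info k).
Proof. by apply: dm_fun; exact: (cell_dm (k := k) (fun t a => nl (cyl t a))). Qed.

Lemma cell_info_ge0 k x : (0 <= cell_info k x)%E.
Proof. by apply: nl_ge0; exact: cyl_le1. Qed.

Lemma cell_info_mono k k' x : (k <= k')%N -> (cell_info k x <= cell_info k' x)%E.
Proof.
move=> kk'.
exact: (info_mono m (mkp (sch_U sch (tau (mk x)))) (cont_meas (tau (mk x))) x kk').
Qed.

Lemma integral_law (E : set (pats G)) (f : pats G -> \bar R) : measurable E ->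
  measT f -> (forall y, 0 <= f y)%E ->
  (\int[nu]_(y in E) f y = \int[m]_(x in mk @^-1` E) f (mk x))%E.
Proof.
move=> mE mf f0; rewrite -(@ge0_integral_pushforward _ _ _ _ _ _ mk_meas m E f)//.
- by apply: eq_measure_integral => A mA _; apply/esym; exact: nuE.
- exact: measurable_funTS.
Qed.

(** The surprisal of contents jointly with [U t] is the conditional surprisal plus that of [U t];
    averaging the former over the cells of type [t] gives [entl]. *)
Lemma cell_info_int k t : (\int[m]_(x in C t) cell_info k x =
  \int[m]_(x in C t) ((entl (@claw k) (tau (mk x)))%:E + nl (pU (tau (mk x)))))%E.
Proof.
rewrite (eq_integral (fun x => nl (cyl t (bits (cont t) k x)))); last first.
  by move=> x; rewrite inE /cell_info => -[_ /= ->].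
rewrite [RHS](eq_integral (fun=> (entl (@claw k) t)%:E + nl (pU t))%E); last first.
  by move=> x; rewrite inE => -[_ /= ->].
rewrite (integral_finE m (mC t) (bits_dm (k := k) (cont_meas t)) (h := fun a => nl (cyl t a))); last first.
  by move=> a; apply: nl_ge0; exact: cyl_le1.
rewrite [RHS](@integral_cst _ _ _ m _ (mC t)).
change (\sum_a nl (cyl t a) * m (C t `&` bits (cont t) k @^-1` [set a]) =
  ((entl (@claw k) t)%:E + nl (pU t)) * m (C t))%E.
have [C0|C0] := eqVneq (m (C t)) 0%E.
  rewrite C0 mule0 big1// => a _; rewrite (_ : m _ = 0%E) ?mule0//.
  apply/eqP; rewrite -measure_le0 -C0; apply: le_meas => //.
  by apply: measurableI => //; exact: (bits_dm (k := k) (cont_meas t) [set a]).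
have Cf := fin (mC t).
have p0 : pU t != 0.
  apply: contra C0 => /eqP E; rewrite -measure_le0 -[0%E]/(0%:E) -E /pU fineK; last first.
    by apply: fin; exact: mkp (sch_U sch t).
  by apply: le_meas => //; exact: mkp (sch_U sch t).
have pp : 0 < pU t by rewrite lt_neqAle eq_sym p0 pU_ge0.
have Ca a : m (C t `&` bits (cont t) k @^-1` [set a]) = (fine (m (C t)) * (cyl t a / pU t))%:E.
  have := cell_cond t a; set z := m _; have zf : z \is a fin_num.
    by apply: fin; apply: measurableI => //; exact: (bits_dm (k := k) (cont_meas t) [set a]).
  move=> h; have h' : fine z * pU t = fine (m (C t)) * cyl t a
    by apply: EFin_inj; rewrite !EFinM (fineK zf) (fineK Cf); exact: h.
  by rewrite -(fineK zf); congr _%:E; apply: (mulIf p0); rewrite h'; field.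
have P0 a : claw t a = cyl t a / pU t by rewrite /claw (negbTE p0).
have [_ P1] := claw_law k.
transitivity (\sum_(a : tup k) (fine (m (C t)) * (claw t a * (- ln (claw t a)) - claw t a * ln (pU t)))%:E)%E.
  apply: eq_bigr => a _; rewrite Ca -P0 /nl; have [c0|c0] := eqVneq (cyl t a) 0.
    by rewrite P0 c0 mul0r mulr0 mule0 !mul0r subr0 mulr0.
  have cp : 0 < cyl t a by rewrite lt_neqAle eq_sym c0 cyl_ge0.
  rewrite -EFinM; congr _%:E; rewrite [in ln (claw _ _)]P0 ln_div ?posrE//; ring.
rewrite sumEFin -mulr_sumr sumrB -mulr_suml P1 mul1r -/(entl _ t) /nl (negbTE p0) -EFinD.
by rewrite -{2}(fineK Cf) -EFinM mulrC.
Qed.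

Lemma cells_cover : mk @^-1` A0 = \bigcup_t C t.
Proof.
by seteq => x /=; [move=> Ax; exists (tau (mk x))|case=> t _ []].
Qed.

Lemma cells_trivial : trivIset setT C.
Proof. by move=> i j _ _ [x [[_ /= <-] [_ /= <-]]]. Qed.

Lemma tau_meas (f : nat -> \bar R) : measT (fun y => f (tau y)).
Proof. by apply: dm_fun; exact: dm_comp f (sch_tau sch). Qed.

Lemma ent_split k : (\int[m]_(x in mk @^-1` A0) cell_info k x =
  \int[nu]_(y in A0) (entl (@claw k) (tau y))%:E + \int[nu]_(y in A0) nl (pU (tau y)))%E.
Proof.
have mA := sch_A0 sch; have [P0 P1] := claw_law k.
have e0 t : (0 <= (entl (@claw k) t)%:E)%E by rewrite lee_fin entl_ge0.
have n0 t : (0 <= nl (pU t))%E by apply: nl_ge0; exact: pU_le1.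
have m1 := tau_meas (fun t => (entl (@claw k) t)%:E).
have m2 := tau_meas (fun t => nl (pU t)).
rewrite !integral_law// -ge0_integralD//; [|exact: mkp|exact: measurable_funTS (measurableT_comp m1 mk_meas)|
  exact: measurable_funTS (measurableT_comp m2 mk_meas)].
rewrite cells_cover !ge0_integral_bigcup//; last 6 first.
- apply: measurable_funTS; apply: emeasurable_funD; [exact: (measurableT_comp m1 mk_meas)|exact: (measurableT_comp m2 mk_meas)].
- by move=> x _; rewrite adde_ge0.
- exact: cells_trivial.
- by apply: measurable_funTS; exact: cell_info_meas.
- by move=> x _; exact: cell_info_ge0.
- exact: cells_trivial.
by apply: eq_eseriesr => t _; exact: cell_info_int.
Qed.

Definition linfo l : \bar R := nl (fine (la [set l])).

Lemma linfo_ge0 l : (0 <= linfo l)%E.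
Proof.
apply: nl_ge0; rewrite -lee_fin fineK ?probability_le1//; first exact: singleton_meas.
by apply: fin_num_measure; exact: singleton_meas.
Qed.

Lemma linfo_meas : measT linfo.
Proof.
apply: (@emeasurable_fun_cvg _ _ _ setT (fun k l => nl (fine (la (setT `&` [set l' | bits b k l' = bits b k l]))))).
  move=> k; apply: dm_fun.
  exact: (dm_comp (fun a => nl (fine (la (setT `&` [set l' | bits b k l' = a])))) (bits_dm (k := k) (cb_meas cb))).
move=> l _; have := info_lim (mu := la) measurableT (cb_meas cb) (x := l).
rewrite (_ : _ `&` [set l' | b l' = b l] = [set l])//; seteq => l' /=; last by move=> ->.
by move=> [_ E]; rewrite -(cb_can cb l') E cb_can.
Qed.

(** All bits together determine the letters of the cell, which imply [U]; the mass of that cylinder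
    is the product of the masses of the letters. *)
Lemma cell_info_lim x : A0 (mk x) ->
  cell_info ^~ x @ \oo --> (\sum_(w <- D (tau (mk x))) linfo (x w))%E.
Proof.
move=> Ax; set t := tau (mk x); have mU := mkp (sch_U sch t).
have := info_lim (mu := m) mU (cont_meas t) (x := x).
rewrite (_ : mk @^-1` U t `&` [set x' | cont t x' = cont t x] = cylinder (D t) (fun w => [set x w])).
  rewrite (mP (sch_uniq sch t) (fun w => singleton_meas (x w))) [fine _%:E]/= nl_prod//.
  by move=> w; exact: fine_ge0.
seteq => x' /=; first by move=> [_ /cont_inj h] w wD; exact: h.
move=> h; split; last by apply: cont_dep.
have xx' w : w \in D t -> x w = x' w by move=> wD; apply/esym; exact: h.
by apply: (dep xx'); exact: (sch_type sch).
Qed.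

(** Mass transport: almost every site lies in exactly one cell, so collecting letters cell by cell
    counts each site once. *)
Lemma cell_transport :
  (\int[m]_(x in mk @^-1` A0) \sum_(w <- D (tau (mk x))) linfo (x w) =
   \int[la]_l linfo l)%E.
Proof.
have [e' eK e'K] := eb; have l0 := linfo_ge0.
have ml g : measT (fun x : X => linfo (x g)).
  exact: (measurableT_comp linfo_meas (@cmeas G _ L g)).
pose B n : set X := mk @^-1` (tau @^-1` [set t | e n \in D t]).
have mB n : measurable (B n) by apply: mkp; exact: (sch_tau sch).
have mA := mkp (sch_A0 sch).
have mcov g : measurable (mk @^-1` covers g) by apply: mkp; exact: covers_meas.
(* The finite sum over the cell is spread over the enumeration of [G], so that sum and integral can
   be exchanged. *)
transitivity (\int[m]_(x in mk @^-1` A0) \sum_(n <oo) ((fun x => linfo (x (e n))) \_ (B n)) x)%E.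
  apply: eq_integral => x _; set s := D _.
  transitivity (\esum_(w in [set` s]) linfo (x w))%E.
    by rewrite fsbig_seq; [apply/esym; apply: esum_fset; [exact: finite_seq|]|exact: sch_uniq sch _].
  rewrite (@reindex_esum _ _ _ [set n | e n \in s] _ e); last first.
    split => //; first by move=> i j _ _; exact: (can_inj eK).
    by move=> w ws; exists (e' w); rewrite /= e'K.
  rewrite -(nneseries_esum (P := fun n => e n \in s))// eseries_mkcond.
  apply: eq_eseriesr => n _; rewrite patchE; case: ifPn => h; first by rewrite mem_set.
  by rewrite memNset//; exact/negP.
rewrite integral_nneseries//; last 2 first.
- move=> n; apply/(measurable_restrict _ (mB n) mA); exact: measurable_funTS (ml (e n)).
- by move=> n x _; rewrite patchE; case: ifP.
transitivity (\sum_(n <oo) \int[m]_(x in mk @^-1` covers (e n)) linfo (x 1%g))%E.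
  apply: eq_eseriesr => n _; rewrite -integral_mkcondr -(integral_view va (e n) (mcov (e n)) (ml 1%g))//.
  rewrite (_ : vshift (e n) @^-1` _ = mk @^-1` A0 `&` B n); last first.
    by seteq => x /=; rewrite mk_view /covers /= (viewVK vaY).
  by apply: eq_integral => x _; rewrite /vshift mulg1.
rewrite -(integral_bigcupG eb (F := fun g => mk @^-1` covers g) _ mcov _ (ml 1%g))//; last first.
  move=> g h x [Ag gD] [Ah hD]; apply: invg_inj; apply: (sch_disj sch Ag Ah gD hD).
  by rewrite !mulVg.
have mU := mkp uncovered_meas.
have -> : \bigcup_g (mk @^-1` covers g) = setT `\` (mk @^-1` uncovered).
  seteq => x; first by move=> [g _ cg]; split => //; apply; exists g.
  by move=> [_ /contrapT[g _ cg]]; exists g.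
rewrite -(ge0_negligible_integral mU measurableT (ml 1%g))//; last exact: (etrans (nuE uncovered_meas) cover0).
rewrite -(@ge0_integral_pushforward _ _ _ _ _ _ (@cmeas G _ L 1%g) m setT linfo)//; last first.
  exact: linfo_meas.
apply: eq_measure_integral => [|mv E mE _]; first exact: cmeas.
have := mP (s := [:: 1%g]) (A := fun=> E) isT (fun=> mE).
rewrite big_seq1 fineK ?fin_num_measure// => h; apply: (etrans _ h); congr (m _).
by seteq => x /=; [move=> Ex i; rewrite inE => /eqP ->|apply; rewrite mem_head].
Qed.

Lemma entE k : ((ent nu A0 tau claw k)%:E = \int[nu]_(y in A0) (entl (@claw k) (tau y))%:E)%E.
Proof.
have mA := sch_A0 sch; have [P0 P1] := claw_law k.
have h0 t : 0 <= entl (@claw k) t <= 2 * #|tup k|%:R by rewrite entl_ge0//= entl_le.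
rewrite /ent fineK// ge0_fin_numE; last by apply: integral_ge0 => y _; rewrite lee_fin; case/andP: (h0 (tau y)).
apply: (@le_lt_trans _ _ (\int[nu]_(y in A0) (2 * #|tup k|%:R)%:E)%E).
  apply: ge0_le_integral => //.
  - by move=> y _; rewrite lee_fin; case/andP: (h0 (tau y)).
  - exact: measurable_funTS (tau_meas (fun t => (entl (@claw k) t)%:E)).
  - by move=> y _; rewrite lee_fin; case/andP: (h0 (tau y)).
rewrite (@integral_cst _ _ _ nu _ mA); apply: (@le_lt_trans _ _ ((2 * #|tup k|%:R)%:E * 1)%E).
  by apply: lee_wpmul2l; [rewrite lee_fin|exact: probability_le1].
by rewrite mule1 ltry.
Qed.

(** Content entropy plus a term fixed by the marker factor exhausts the base entropy. This is why
    bases of equal entropy over a common factor have contents of equal entropy, also in the infinite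
    case. *)
Lemma ent_cvg : (fun k => (ent nu A0 tau claw k)%:E + \int[nu]_(y in A0) nl (pU (tau y)))%E @ \oo -->
  (\int[la]_l linfo l)%E.
Proof.
have -> : (fun k => (ent nu A0 tau claw k)%:E + \int[nu]_(y in A0) nl (pU (tau y)))%E =
    (fun k => \int[m]_(x in mk @^-1` A0) cell_info k x)%E.
  by apply/funext => k; rewrite entE ent_split.
rewrite -cell_transport.
rewrite (eq_integral (fun x => limn (cell_info ^~ x))); last first.
  by move=> x; rewrite inE => Ax; apply/esym/cvg_lim => //; exact: cell_info_lim.
apply: cvg_monotone_convergence => //.
- exact: mkp (sch_A0 sch).
- by move=> k; apply: measurable_funTS; exact: cell_info_meas.
- by move=> k x _; exact: cell_info_ge0.
- by move=> x _ k k' kk'; exact: cell_info_mono.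
Qed.

Lemma ent_le k : ((ent nu A0 tau claw k)%:E + \int[nu]_(y in A0) nl (pU (tau y)) <=
  \int[la]_l linfo l)%E.
Proof.
have nd : nondecreasing_seq (fun k => (ent nu A0 tau claw k)%:E + \int[nu]_(y in A0) nl (pU (tau y)))%E.
  move=> i j ij; rewrite !entE -!ent_split; apply: ge0_le_integral => //.
  - exact: mkp (sch_A0 sch).
  - by move=> x _; exact: cell_info_ge0.
  - by apply: measurable_funTS; exact: cell_info_meas.
  - by apply: measurable_funTS; exact: cell_info_meas.
  - by move=> x _; exact: cell_info_mono.
rewrite -(cvg_lim _ ent_cvg)// (cvg_lim _ (ereal_nondecreasing_cvgn nd))//.
by apply: ereal_sup_ubound; exists k.
Qed.

End cells.

(** * Isomorphism of bases with equal marker probability *)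

Section marker_systems.
Variables (R : realType) (G : groupType) (e : nat -> G) (eb : bijective e).
Variable W : seq G.
Hypotheses (W1 : 1%g \notin W) (Wu : uniq W).
Hypothesis W_meets : forall t u, meets W t u -> t <> u -> u \in win W t \/ t \in win W u.

Record marked_base (dL : measure_display) (L : measurableType dL) (la : probability L R)
    (m : probability (power_space G dL L) R) (b : L -> nat -> bool) (dec : (nat -> bool) -> L)
    (S0 S1 : set L) : Prop := {
  mb_product : is_product_measure la m ;
  mb_coded : coded_base b dec ;
  mb_S0 : measurable S0 ;
  mb_S1 : measurable S1 ;
  mb_disj : S0 `&` S1 = set0 }.

Record marker_scheme (A0 : set (pats G)) (tau : pats G -> nat)
    (D : nat -> seq G) (U : nat -> set (pats G)) : Prop := {
  ms_cell : cell_scheme A0 tau D U ;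
  ms_dep : forall dL (L : measurableType dL) (S0 S1 : set L),
    S0 `&` S1 = set0 -> forall t,
    @depends G dL L (fun w => w \in D t) (mark W S0 S1 @^-1` U t) ;
  ms_resamp : forall dL (L : measurableType dL) (S0 S1 : set L),
    S0 `&` S1 = set0 -> forall x x' : power_space G dL L, A0 (mark W S0 S1 x) ->
    (forall t, t \notin D (tau (mark W S0 S1 x)) -> x t = x' t) ->
    U (tau (mark W S0 S1 x)) (mark W S0 S1 x') -> mark W S0 S1 x' = mark W S0 S1 x ;
  ms_cover : forall dL (L : measurableType dL) (la : probability L R)
    (m : probability (power_space G dL L) R) (S0 S1 : set L) (mS0 : measurable S0) (mS1 : measurable S1),
    is_product_measure la m -> S0 `&` S1 = set0 -> 0 < alpha W la S0 S1 < 1 ->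
    mark_law W1 m mS0 mS1 (uncovered A0 tau D) = 0%E }.

Variables (A0 : set (pats G)) (tau : pats G -> nat)
    (D : nat -> seq G) (U : nat -> set (pats G))
  (ms : marker_scheme A0 tau D U).

Let bent dL (L : measurableType dL) (la : probability L R) : \bar R :=
  (\int[la]_l linfo la l)%E.

Section one_system.
Variable nu : probability (pats G) R.
Hypotheses (vaY : vaction nu (@pview G)) (cover0 : nu (uncovered A0 tau D) = 0%E).

Definition type_ent : \bar R := (\int[nu]_(y in A0) nl (fine (nu (U (tau y)))))%E.

Lemma marked_system dL (L : measurableType dL) (la : probability L R)
    (m : probability (power_space G dL L) R) b dec S0 S1 : marked_base la m b dec S0 S1 ->
  (forall E, measurable E -> m (mark W S0 S1 @^-1` E) = nu E) ->
  exists (P : forall k, nat -> (k.-tuple bool : finType) -> R) (mu : probability (codes G) R) f f',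
  [/\ coded_system nu A0 tau mu P, ae_iso m mu (@vshift G dL L) (@cview G) f f',
   (forall k, ((ent nu A0 tau P k)%:E + type_ent <= bent la)%E) &
   (fun k => (ent nu A0 tau P k)%:E + type_ent)%E @ \oo --> bent la].
Proof.
move=> [mP cb mS0 mS1 S01] nuE; have sch := ms_cell ms.
have mm : measT (mark W S0 S1) := mark_meas W1 mS0 mS1.
have mv := mark_view W S0 S1.
have dep := ms_dep ms S01; have rs := ms_resamp ms S01.
have CE : type_ent = (\int[nu]_(y in A0) nl (pU U m (mark W S0 S1) (tau y)))%E.
  apply: eq_integral => y _; rewrite /pU; congr (nl (fine _)).
  by apply/esym; apply: nuE; exact: (sch_U sch).
exists (claw D U m b (mark W S0 S1)), (code_law sch mP cb mm),
  (code A0 tau D b (mark W S0 S1)), (decode A0 tau D dec); split.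
- exact: (code_law_coded eb sch mP cb mm mv nuE dep rs).
- exact: (code_ae_iso eb sch mP cb mm mv nuE vaY cover0).
- by move=> k; rewrite CE; exact: (ent_le eb sch mP cb mm mv nuE dep rs vaY cover0).
- by rewrite CE; exact: (ent_cvg eb sch mP cb mm mv nuE dep rs vaY cover0).
Qed.

Lemma roots_positive : nu A0 <> 0%E.
Proof.
move=> A00; have mc g : measurable (covers A0 tau D g) := covers_meas (ms_cell ms) vaY g.
have mA := sch_A0 (ms_cell ms).
have c0 : nu (\bigcup_g covers A0 tau D g) = 0%E.
  apply: (measure0_bigcupG eb) => // g; apply/eqP; rewrite -measure_le0.
  rewrite -A00 -(view_pres vaY g^-1%g mA); apply: le_meas => //.
    exact: (vpre vaY).
  by move=> y [].
have mU : measurable (\bigcup_g covers A0 tau D g) by apply: (bigcupG eb).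
have := probability_setC nu mU; rewrite c0 sube0 -/(uncovered A0 tau D) cover0 => /eqP.
by rewrite eqe eq_sym oner_eq0.
Qed.

End one_system.

(** The sequence [c] shows that the common term [C] is at most [h'' < h]. So [C] is finite and can
    be cancelled, and [b] must become positive. *)
Lemma lim_dominates (a b c : nat -> R) (C h h'' : \bar R) : (0 <= C)%E -> 0 <= c 0%N ->
  ((c 0%N)%:E + C <= h'')%E -> (h'' < h)%E ->
  (fun k => (b k)%:E + C)%E @ \oo --> h -> (forall k, ((a k)%:E + C <= h)%E) ->
  (forall k ep, 0 < ep -> exists k', a k - ep <= b k') /\ (exists k, 0 < b k).
Proof.
move=> C0 c0 cC hh bh ah.
have Ch : (C <= h'')%E by apply: le_trans cC; rewrite leeDr// lee_fin.
have Cf : C \is a fin_num by rewrite ge0_fin_numE// (le_lt_trans Ch)// (lt_le_trans hh)// leey.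
have up x : (forall k, b k <= x) -> (h <= x%:E + C)%E.
  move=> bx; rewrite -(cvg_lim _ bh)//; apply: lime_le; first by apply/cvg_ex; exists h.
  by apply: nearW => k; rewrite leeD2r// lee_fin.
split => [k ep ep0|]; apply: contrapT => nx.
  have : (h <= (a k - ep)%:E + C)%E.
    by apply: up => k'; rewrite leNgt; apply/negP => h'; apply: nx; exists k'; exact: ltW.
  move=> /(le_trans (ah k)); rewrite -(fineK Cf) -!EFinD lee_fin lerD2r lerBDr.
  by rewrite gerDl leNgt ep0.
have : (h <= 0%:E + C)%E.
  by apply: up => k'; rewrite leNgt; apply/negP => h'; apply: nx; exists k'.
by rewrite add0e => /(le_trans)/(_ Ch); rewrite leNgt hh.
Qed.

(** The third base has the same marker probability and smaller entropy: it certifies that positive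
    content entropy remains over the marker factor, as [code_iso] requires. *)
Lemma marker_iso dL dK dM (L : measurableType dL) (K : measurableType dK)
    (M : measurableType dM) (la : probability L R) (kappa : probability K R) (rho : probability M R)
    m n r bL decL bK decK bM decM (S0 S1 : set L) (T0 T1 : set K) (V0 V1 : set M) :
  marked_base la m bL decL S0 S1 -> marked_base kappa n bK decK T0 T1 ->
  marked_base rho r bM decM V0 V1 -> 0 < alpha W la S0 S1 < 1 ->
  alpha W la S0 S1 = alpha W kappa T0 T1 -> alpha W la S0 S1 = alpha W rho V0 V1 ->
  bent la = bent kappa -> (bent rho < bent la)%E ->
  exists f f', ae_iso m n (@vshift G dL L) (@vshift G dK K) f f'.
Proof.
move=> bl bk bm a01 alk alm hlk hml.
have [mP _ mS0 mS1 S01] := bl; have [nP _ mT0 mT1 T01] := bk; have [rP _ mV0 mV1 V01] := bm.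
pose nu := mark_law W1 m mS0 mS1.
have vaY : vaction nu (@pview G) := mark_law_action W1 mP mS0 mS1.
have cover0 : nu (uncovered A0 tau D) = 0%E := ms_cover ms mS0 mS1 mP S01 a01.
have nuL E : measurable E -> m (mark W S0 S1 @^-1` E) = nu E by [].
have nuK E : measurable E -> n (mark W T0 T1 @^-1` E) = nu E.
  by move=> mE; apply/esym; exact: (marks_same_law W1 Wu W_meets mP nP mS0 mS1 S01 mT0 mT1 T01 alk mE).
have nuM E : measurable E -> r (mark W V0 V1 @^-1` E) = nu E.
  by move=> mE; apply/esym; exact: (marks_same_law W1 Wu W_meets mP rP mS0 mS1 S01 mV0 mV1 V01 alm mE).
have [P [mu [f [f' [CP isoP leP cvP]]]]] := marked_system vaY cover0 bl nuL.
have [Q [mu' [h [h' [CQ isoQ leQ cvQ]]]]] := marked_system vaY cover0 bk nuK.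
have [S [mu1 [f1 [f1' [CS _ leS _]]]]] := marked_system vaY cover0 bm nuM.
have C0 : (0 <= type_ent nu)%E.
  apply: integral_ge0 => y _; apply: nl_ge0.
  have mU := sch_U (ms_cell ms) (tau y).
  by rewrite -lee_fin fineK ?probability_le1// fin_num_measure.
have S0' : 0 <= ent nu A0 tau S 0.
  rewrite /ent fine_ge0// integral_ge0// => y _; rewrite lee_fin.
  by have [h0 h1] := cs_law CS 0; exact: entl_ge0.
have hmk : (bent rho < bent kappa)%E by rewrite -hlk.
have leP' k : ((ent nu A0 tau P k)%:E + type_ent nu <= bent kappa)%E by rewrite -hlk.
have leQ' k : ((ent nu A0 tau Q k)%:E + type_ent nu <= bent la)%E by rewrite hlk.
have [PQ Qp] := lim_dominates C0 S0' (leS 0%N) hmk cvQ leP'.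
have [QP Pp] := lim_dominates C0 S0' (leS 0%N) hml cvP leQ'.
have [f2 [f2' iso1]] := code_iso eb vaY (periodic_meas eb) (periodic_null eb W1 Wu W_meets mP mS0 mS1 S01 a01)
  (@free_off_periodic G) (fun A B mA mB => mark_law_ergodic eb mP mA mB)
  (sch_A0 (ms_cell ms)) (roots_positive vaY cover0) (sch_tau (ms_cell ms)) CP CQ PQ QP Pp.
have := ae_iso_trans isoP (ae_iso_trans iso1 (ae_iso_sym isoQ)).
by move=> iso; eexists; eexists; exact: iso.
Qed.

End marker_systems.

(** * Lexicographic comparison of views *)

Section lexicographic.
Variables (G : groupType) (e : nat -> G) (eb : bijective e).
Implicit Types y z w : pats G.

Definition lexlt y z :=
  exists n, [/\ forall i, (i < n)%N -> y (e i) = z (e i), ~~ y (e n) & z (e n)].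

Lemma lexlt_asym y z : lexlt y z -> lexlt z y -> False.
Proof.
move=> [n [h1 h2 h3]] [k [k1 k2 k3]]; case: (ltngtP n k) => [nk|kn|E].
- by move: h2; rewrite -(k1 _ nk) h3.
- by move: k2; rewrite -(h1 _ kn) k3.
- by move: k3; rewrite -E (negbTE h2).
Qed.

Lemma lexlt_trans y z w : lexlt y z -> lexlt z w -> lexlt y w.
Proof.
move=> [n [h1 h2 h3]] [k [k1 k2 k3]]; case: (ltngtP n k) => [nk|kn|E].
- by exists n; split => // [i ik|]; [rewrite h1// k1// (ltn_trans ik)|rewrite -k1].
- by exists k; split => // [i ik|]; [rewrite h1 ?k1// (ltn_trans ik)|rewrite h1].
- by move: k2; rewrite -E h3.
Qed.

Lemma lexlt_total y z : y <> z -> lexlt y z \/ lexlt z y.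
Proof.
move=> yz; have ex : exists n, y (e n) != z (e n).
  apply: contrapT => nx; apply: yz; apply/funext => t; have [e' _ e'K] := eb.
  rewrite -(e'K t); apply/eqP; apply: contrapT => h; apply: nx; exists (e' t); exact/negP.
case: (ex_minnP ex) => n yzn nmin.
have lt i : (i < n)%N -> y (e i) = z (e i).
  by move=> ni; apply/eqP; apply: contraTT ni => /nmin; rewrite -leqNgt.
case yn : (y (e n)) yzn => zn; [right|left]; exists n; split => //.
- by move=> i /lt.
- by rewrite yn.
- by move: zn; case: (z (e n)).
Qed.

Lemma lex_max (s : seq G) y : (forall g h, g \in s -> h \in s -> pview g y = pview h y -> g = h) ->
  s <> [::] -> exists2 k, k \in s & forall g, g \in s -> g <> k -> lexlt (pview g y) (pview k y).
Proof.
elim: s => [//|a s IH] inj _; have [->|/eqP sn] := eqVneq s [::].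
  by exists a; rewrite ?mem_head// => g; rewrite inE => /eqP.
have [g h gs hs|k ks kmax] := IH _ sn; first by apply: inj; rewrite inE ?gs ?hs orbT.
have [ak|ak] := eqVneq a k.
  exists k; first by rewrite inE ks orbT.
  by move=> g; rewrite inE ak => /orP[/eqP -> //|]; exact: kmax.
have [|lak|lka] := @lexlt_total (pview a y) (pview k y).
- by move=> E; move/eqP: ak; apply; apply: inj => //; rewrite inE ?eqxx ?ks ?orbT.
- exists k; first by rewrite inE ks orbT.
  by move=> g; rewrite inE => /orP[/eqP -> //|]; exact: kmax.
exists a; first exact: mem_head.
move=> g; rewrite inE => /orP[/eqP -> //|gs] _; have [->//|/eqP gk] := eqVneq g k.
by apply: lexlt_trans lka; exact: kmax.
Qed.

Lemma bits_at_dm (s : seq G) : dm (fun y : pats G => [seq y t | t <- s]).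
Proof.
elim: s => [|a s IH] /=.
  move=> B; have [B0|B0] := pselect (B [::]).
    by rewrite (_ : _ @^-1` B = setT)//; seteq.
  by rewrite (_ : _ @^-1` B = set0)//; seteq.
have da : dm (fun y : pats G => y a).
  move=> B; rewrite (_ : _ @^-1` B = ([set y : pats G | y a] `&` [set _ | B true]) `|`
      (~` [set y : pats G | y a] `&` [set _ | B false])).
    have mc Q := @cst_meas _ (pats G) Q.
    by apply: measurableU; apply: measurableI => //; [|apply: measurableC]; exact: bit_meas.
  seteq => y /=; case: (y a) => //.
  - by left.
  - by right.
  - by case=> -[].
  - by case=> -[].
have h : dm (fun y : pats G => (y a, [seq y t | t <- s])).
  by apply: (dm_pair (n1 := fun n => n == 0%N)) => // -[]; [exists 0%N|exists 1%N].
exact: (dm_comp (fun p : bool * seq bool => p.1 :: p.2) h).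
Qed.

End lexicographic.

(** * Marker schemes from finite subgroups *)

Section finite_subgroup.
Variables (R : realType) (G : groupType) (e : nat -> G) (eb : bijective e).
Variable W : seq G.
Hypotheses (W1 : 1%g \notin W) (Wu : uniq W).
Let H := 1%g :: W.
Hypotheses (HM : forall g h, g \in H -> h \in H -> (g * h)%g \in H)
  (HV : forall g, g \in H -> (g^-1)%g \in H).

Let H1 : 1%g \in H. Proof. exact: mem_head. Qed.

Lemma coset_mem t u : (u \in win W t) = ((t^-1 * u)%g \in H).
Proof.
apply/mapP/idP => [[w wH ->]|h]; first by rewrite mulKg.
by exists (t^-1 * u)%g => //; rewrite mulVKg.
Qed.

Lemma coset_meets t u : meets W t u -> t <> u -> u \in win W t \/ t \in win W u.
Proof.
move=> /hasP[g]; rewrite !coset_mem => gt gu _; left.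
by have := HM gt (HV gu); rewrite invgM invgK -mulgA mulVKg.
Qed.

(** One root per coset of [H]: the site with the lexicographically greatest view. The choice has to
    be made from the marks, because no site of a coset is distinguished. *)
Definition coset_root : set (pats G) :=
  [set y | forall h, h \in W -> lexlt e (pview h y) y].
(** The position, relative to the origin, of the first mark in the coset, or the size of [H] if
    there is none. *)
Definition coset_type (y : pats G) : nat := find id [seq y t | t <- H].

Lemma lexlt_view_meas g : measurable [set y | lexlt e (pview g y) y].
Proof.
have m1 t := @bit_meas G t.
rewrite (_ : [set y | _] = \bigcup_n ((\bigcap_i [set y : pats G | (i < n)%N -> y (g * e i)%g = y (e i)]) `&`
    (~` [set y : pats G | y (g * e n)%g] `&` [set y : pats G | y (e n)]))).
  apply: bigcupT_measurable => n; apply: measurableI; last first.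
    by apply: measurableI => //; apply: measurableC.
  apply: bigcapT_measurable => i; case: (ltnP i n) => ni; last first.
    by rewrite (_ : [set y | _] = setT)//; seteq.
  have := bits_at_dm [:: (g * e i)%g; e i] [set s | nth true s 0 = nth true s 1].
  by congr measurable; seteq => y //= /(_ isT).
seteq => y.
  by move=> [n [h1 h2 h3]]; exists n => //; split; [move=> i _ /= /h1|split => //=; exact/negP].
by move=> [n _ [h1 [/= /negP h2 h3]]]; exists n; split => // i ni; exact: h1.
Qed.

Lemma coset_root_meas : measurable coset_root.
Proof.
rewrite /coset_root; elim: (W) => [|a s IH].
  by rewrite (_ : [set y | _] = setT)//; seteq.
rewrite (_ : [set y | _] = [set y | lexlt e (pview a y) y] `&`
    [set y | forall h, h \in s -> lexlt e (pview h y) y]).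
  by apply: measurableI => //; exact: lexlt_view_meas.
seteq => y /=.
  by move=> h; split => [|g gs]; apply: h; rewrite inE ?eqxx ?gs ?orbT.
by move=> [ha hs] h; rewrite inE => /orP[/eqP -> //|]; exact: hs.
Qed.

Lemma coset_type_dm : dm coset_type.
Proof. exact: (dm_comp (find id) (bits_at_dm H)). Qed.

Lemma coset_cells : cell_scheme coset_root coset_type (fun=> H) (fun t => coset_type @^-1` [set t]).
Proof.
split => //.
- exact: coset_root_meas.
- exact: coset_type_dm.
- by move=> t; exact: coset_type_dm.
- by move=> _ /=; rewrite W1.
move=> y g g' w w' Ag Ag' wH w'H E.
have E' : g' = (g * (w * w'^-1))%g by rewrite mulgA E mulgK.
set k := (w * w'^-1)%g in E'; have kH : k \in H by apply: HM => //; exact: HV.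
have [k1|k1] := eqVneq k 1%g; first by rewrite E' k1 mulg1.
have kW : k \in W by move: kH; rewrite inE (negbTE k1).
have kVW : (k^-1)%g \in W by have := HV kH; rewrite inE (inv_eq invgK) invg1 (negbTE k1).
have vM a b z : pview b (pview a z) = pview (a * b)%g z.
  by apply/funext => t; rewrite /pview mulgA.
have := Ag _ kW; have := Ag' _ kVW; rewrite !vM E' -mulgA mulgV mulg1.
by move=> h1 h2; case: (lexlt_asym h1 h2).
Qed.

Section marks.
Variables (dL : measure_display) (L : measurableType dL) (S0 S1 : set L)
  (S01 : S0 `&` S1 = set0).
Notation mk := (mark W S0 S1 : power_space G dL L -> pats G).

Lemma mark_local t (x x' : power_space G dL L) : (forall u, u \in win W t -> x u = x' u) -> mk x t = mk x' t.
Proof.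
move=> h; rewrite /mark; congr asbool; apply/propext; rewrite (h t) ?win_self//.
by split => -[h0 h1]; split => // w wW; have := h1 w wW; rewrite h// win_mem.
Qed.

Lemma mark_coset (x x' : power_space G dL L) : (forall u, u \in H -> x u = x' u) ->
  forall t, t \in H -> mk x t = mk x' t.
Proof.
move=> h t tH; apply: mark_local => u; rewrite coset_mem => uH; apply: h.
by have := HM tH uH; rewrite mulVKg.
Qed.

Lemma coset_type_mark (x : power_space G dL L) t : t \in H -> mk x t = (coset_type (mk x) == index t H).
Proof.
move=> tH; rewrite /coset_type find_map; set p := preim _ _.
have pE u : p u = mk x u by [].
apply/idP/eqP => [xt|E]; last first.
  have hp : has p H by rewrite has_find E index_mem.
  by have := nth_find 1%g hp; rewrite E nth_index.
have hp : has p H by apply/hasP; exists t.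
set u := nth 1%g H (find p H); have xu : mk x u by exact: (nth_find 1%g hp).
have uH : u \in H by rewrite mem_nth// -has_find.
have ut : u = t.
  apply/eqP; apply: contraT => /eqP nut.
  have := mark_excl coset_meets S01 x (t := u) (u := t); rewrite xu xt => /(_ _ nut); apply.
  apply/hasP; exists t; first by rewrite coset_mem; apply: HM => //; exact: HV.
  exact: win_self.
by rewrite -ut /u index_uniq -?has_find//= W1.
Qed.

End marks.

(** A coset carries at most one mark and each window fills one coset, so the type describes exactly
    the marks on the cell. Off the periodic points the views from a coset are distinct, so one of
    them is greatest. *)
Lemma coset_scheme : marker_scheme R W1 coset_root coset_type (fun=> H) (fun t => coset_type @^-1` [set t]).
Proof.
split.
- exact: coset_cells.
- move=> dL L S0 S1 S01 t x x' xx' /= <-; rewrite /coset_type; congr (find _ _).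
  by apply/eq_in_map => u uH; apply/esym; exact: mark_coset.
- move=> dL L S0 S1 S01 x x' _ xx' /= E; apply/funext => t.
  have [tH|tH] := boolP (t \in H); first by rewrite !coset_type_mark// E.
  apply/esym; apply: mark_local => u; rewrite coset_mem => uH; apply: xx'.
  by apply: contra tH => uH'; have := HM uH' (HV uH); rewrite invgM invgK mulgA mulgV mul1g.
move=> dL L la m S0 S1 mS0 mS1 mP S01 a01.
have vaY := mark_law_action W1 mP mS0 mS1.
have mU := uncovered_meas eb coset_cells vaY.
apply/eqP; rewrite -measure_le0.
rewrite -(periodic_null eb W1 Wu coset_meets mP mS0 mS1 S01 a01); apply: le_meas => //.
  exact: (periodic_meas eb).
move=> y uy; apply: contrapT => /free_off_periodic fy; apply: uy.
have vM a b : pview b (pview a y) = pview (a * b)%g y.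
  by apply/funext => t; rewrite /pview mulgA.
have v1 : pview 1%g y = y by apply/funext => t; rewrite /pview mul1g.
have [g h gH hH E|//|k kH kmax] := @lex_max _ _ eb H y.
  have : pview (g * h^-1)%g y = y by rewrite -vM E vM mulgV v1.
  by move=> /fy E'; rewrite -[g](mulgVK h) E' mul1g.
exists (k^-1)%g => //; split; last exact: HV.
rewrite invgK => h hW; rewrite vM; apply: kmax; first by apply: HM => //; rewrite inE hW orbT.
by move=> /(canRL (mulKg k)); rewrite mulVg => E; have := W1; rewrite -E hW.
Qed.

End finite_subgroup.

(** * Marker schemes from an element of infinite order *)

Section infinite_order.
Variables (R : realType) (G : groupType) (e : nat -> G) (eb : bijective e).

Section recurrence.
Variable W : seq G.
Hypotheses (W1 : 1%g \notin W) (Wu : uniq W).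
Hypothesis W_meets : forall t u, meets W t u -> t <> u -> u \in win W t \/ t \in win W u.
Variables (dL : measure_display) (L : measurableType dL) (la : probability L R).
Notation X := (power_space G dL L).
Variables (m : probability X R) (mP : is_product_measure la m).
Variables S0 S1 : set L.
Hypotheses (mS0 : measurable S0) (mS1 : measurable S1) (S01 : S0 `&` S1 = set0).
Hypothesis a01 : 0 < alpha W la S0 S1 < 1.

(** Disjoint windows make the marks independent, each present with probability [al]. *)
Lemma unmarked_null (t : nat -> G) : (forall i j, (i < j)%N -> ~~ meets W (t i) (t j)) ->
  m [set x : X | forall i, ~~ mark W S0 S1 x (t i)] = 0%E.
Proof.
move=> tij; set al := alpha W la S0 S1.
pose M i := [set x : X | mark W S0 S1 x (t i)].
have mM i : measurable (M i) := mark_meas1 W1 mS0 mS1 (t i).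
pose E n := [set x : X | forall i, (i < n)%N -> ~~ mark W S0 S1 x (t i)].
have ES n : E n.+1 = ~` M n `&` E n.
  seteq => x /=.
    by move=> h; split; [apply/negP; exact: h|move=> i ni; apply: h; exact: ltnW].
  by move=> [/negP h1 h2] i; rewrite ltnS leq_eqVlt => /orP[/eqP -> //|]; exact: h2.
have mE n : measurable (E n).
  elim: n => [|n IH]; first by rewrite (_ : E 0%N = setT)//; seteq.
  by rewrite ES; apply: measurableI => //; exact: measurableC.
have Mal n : m (M n) = al%:E.
  have := marks_measure W1 Wu W_meets mP mS0 mS1 S01 (s := [:: t n]) isT.
  rewrite /apart /= eqxx /= expr1 => <-; congr (m _).
  by seteq => x /=; [move=> h u; rewrite inE => /eqP ->|apply; exact: mem_head].
have Eq n : m (E n) = ((1 - al) ^+ n)%:E.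
  elim: n => [|n IH].
    rewrite expr0 (_ : E 0%N = setT) ?probability_setT//; seteq => x //.
  rewrite ES (indep_sets mP (S := fun u => u \in win W (t n)) (measurableC (mM n)) (mE n)).
  - by rewrite (probability_setC m (mM n)) Mal IH -EFinB -EFinM exprS.
  - move=> x x' xx' /= h h'; apply: h; apply: (@mark_finitary _ _ _ _ S0 S1 (t n) x') => // u uw.
    by apply/esym; exact: xx'.
  - move=> x x' xx' /= h i ni; apply: contra (h i ni) => h'.
    apply: (@mark_finitary _ _ _ _ S0 S1 (t i) x') => // u uw; apply/esym; apply: xx'.
    apply/negP => uw'; have := tij i n ni; apply/negP; rewrite negbK.
    by apply/hasP; exists u.
set E0 := [set x | _]; have mE0 : measurable E0.
  rewrite (_ : E0 = \bigcap_i ~` M i); first by apply: bigcapT_measurable => i; exact: measurableC.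
  by seteq => x h i; [move=> _; apply/negP; exact: h|apply/negP; exact: h].
have E0n n : (fine (m E0) <= (1 - al) ^+ n).
  rewrite -lee_fin -Eq fineK ?fin_num_measure//; apply: le_meas => //.
  by move=> x h i _; exact: h.
have := cvg_expr (R := R) (z := 1 - al); move: a01 => /andP[h0 h1].
rewrite ger0_norm ?subr_ge0 ?ltW// gtrBl h0 => /(_ isT) cv.
rewrite -[LHS](fineK (fin_num_measure m _ mE0)); congr _%:E; apply/eqP.
rewrite eq_le fine_ge0 ?measure_ge0// andbT -(cvg_lim _ cv)//.
by apply: limr_ge; [apply/cvg_ex; exists 0|exact: nearW].
Qed.

End recurrence.

Variables (a : G) (a_inf : forall n, (0 < n)%N -> (a ^+ n)%g <> 1%g).
Let W := [:: a; (a ^+ 2)%g].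

Lemma pow_inj i j : (a ^+ i)%g = (a ^+ j)%g -> i = j.
Proof.
wlog ij : i j / (i <= j)%N => [h E|].
  by case: (leqP i j) => [/h ->//|/ltnW/h ->].
move=> E; apply/eqP; rewrite eqn_leq ij leqNgt -subn_gt0; apply/negP => /a_inf; apply.
by rewrite expgnFr// E mulgV.
Qed.

Lemma pow_inv_inj p q k l : (p <= q)%N -> ((a ^+ p)^-1 * a ^+ k = (a ^+ q)^-1 * a ^+ l)%g ->
  (q - p + k)%N = l.
Proof.
move=> pq E; apply: pow_inj; apply: (mulgI ((a ^+ q)^-1)%g); rewrite -E expgnDr.
by rewrite -{1}(subnK pq) expgnDr invgM -mulgA mulKg.
Qed.

Lemma tri_uniq : 1%g \notin W /\ uniq W.
Proof.
rewrite /W !inE /= inE andbT; split; last by apply/eqP; rewrite -{1}[a]expg1 => /pow_inj.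
by apply/norP; split; apply/eqP => E; [apply: (a_inf (n := 1)) => //|apply: (a_inf (n := 2)) => //]; rewrite ?expg1.
Qed.
Let W1 : 1%g \notin W := tri_uniq.1.
Let Wu : uniq W := tri_uniq.2.

Lemma tri_window t u : reflect (exists2 i, (i < 3)%N & u = (t * a ^+ i)%g) (u \in win W t).
Proof.
apply: (iffP mapP) => [[w + ->]|[i i3 ->]].
  rewrite !inE => /or3P[] /eqP ->; [exists 0%N|exists 1%N|exists 2%N] => //.
exists (a ^+ i)%g => //; rewrite !inE; case: i i3 => [|[|[|//]]] _.
- by rewrite expg0 eqxx.
- by rewrite expg1 eqxx orbT.
- by rewrite eqxx !orbT.
Qed.

Lemma tri_shift t u i j : (t * a ^+ i)%g = (u * a ^+ j)%g -> (i <= j)%N -> t = (u * a ^+ (j - i))%g.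
Proof.
by move=> E ij; apply: (mulIg (a ^+ i)%g); rewrite E -mulgA -expgnDr subnK.
Qed.

Lemma tri_meets t u : meets W t u -> t <> u -> u \in win W t \/ t \in win W u.
Proof.
move=> /hasP[g /tri_window[i i3 ->] /tri_window[j j3 E]] _.
have [ij|/ltnW ji] := leqP i j; [right|left]; apply/tri_window.
  by exists (j - i)%N; [lia|exact: tri_shift E ij].
by exists (i - j)%N; [lia|exact: tri_shift (esym E) ji].
Qed.

Implicit Type y : pats G.

(** Distance to the next mark along the powers of [a]; zero stands for none. *)
Definition nmark y : nat :=
  if pselect (exists n, (0 < n)%N && y (a ^+ n)%g) is left ex then ex_minn ex else 0%N.

Lemma next_markP y n : nmark y = n.+1 <-> y (a ^+ n.+1)%g /\ forall i, (0 < i < n.+1)%N -> ~~ y (a ^+ i)%g.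
Proof.
rewrite /nmark; case: pselect => [ex|nx]; last first.
  by split => // -[h _]; exfalso; apply: nx; exists n.+1.
case: ex_minnP => k /andP[k0 yk] kmin; split => [<-|[yn nmin]].
  split => // i /andP[i0 ik]; apply: contraTN ik => yi; rewrite -leqNgt; apply: kmin.
  by rewrite i0.
apply/eqP; rewrite eqn_leq kmin ?yn//= leqNgt; apply/negP => kn.
by have := nmin k; rewrite k0 kn yk => /(_ isT).
Qed.

Lemma next_mark0 y : nmark y = 0%N <-> forall i, ~~ y (a ^+ i.+1)%g.
Proof.
rewrite /nmark; case: pselect => [ex|nx].
  case: ex_minnP => k /andP[k0 yk] _; split => [E|h]; first by rewrite E in k0.
  by have := h k.-1; rewrite prednK// yk.
by split => // _ i; apply/negP => yi; apply: nx; exists i.+1.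
Qed.

Definition tri_root : set (pats G) := [set y | y 1%g].
Definition tri_cell n : seq G := [seq (a ^+ i)%g | i <- iota 0 n].
(** What the letters of the cell decide: a mark at the origin, and no later mark whose window of
    exponents [i], [i + 1], [i + 2] lies inside the cell. Successive marks are at least three apart,
    so for [n <= 2] nothing is imposed. *)
Definition tri_part n : set (pats G) :=
  [set y : pats G | (2 < n)%N -> y 1%g /\ forall i, (0 < i)%N -> (i + 2 < n)%N -> ~~ y (a ^+ i)%g].

Lemma tri_cellP n g : reflect (exists2 i, (i < n)%N & g = (a ^+ i)%g) (g \in tri_cell n).
Proof.
apply: (iffP mapP) => [[i]|[i i_n ->]]; last by exists i => //; rewrite mem_iota.
by rewrite mem_iota => /andP[_ i_n ->]; exists i.
Qed.

Let unmarked_meas (P : nat -> bool) : measurable [set y : pats G | forall i, P i -> ~~ y (a ^+ i)%g].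
Proof.
rewrite (_ : [set y | _] = \bigcap_i [set y : pats G | P i -> ~~ y (a ^+ i)%g]).
  apply: bigcapT_measurable => i; case: (P i).
    have := measurableC (@bit_meas G (a ^+ i)%g); congr measurable.
    by seteq => y /=; [move=> /negP|move=> /(_ isT)/negP].
  by rewrite (_ : [set y | _] = setT)//; seteq.
by seteq => y h i; [move=> _|]; exact: h.
Qed.

Lemma nmark_dm : dm nmark.
Proof.
have mn n : measurable [set y : pats G | nmark y = n].
  case: n => [|n].
    have := unmarked_meas (fun i => 0 < i)%N; congr measurable; seteq => y /=.
      by move=> h; apply/next_mark0 => i; exact: h.
    by move=> /next_mark0 h [//|i] _; exact: h.
  have := measurableI _ _ (@bit_meas G (a ^+ n.+1)%g) (unmarked_meas (fun i => 0 < i < n.+1)%N).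
  congr measurable; seteq => y /=; first by move=> h; apply/next_markP.
  by move=> /next_markP.
move=> B; rewrite (_ : _ @^-1` B = \bigcup_n ([set y | nmark y = n] `&` [set _ | B n])); last first.
  by seteq => y /=; [move=> h; exists (nmark y)|case=> n _ [/= <-]].
apply: bigcupT_measurable => n; have [Bn|Bn] := pselect (B n).
  by rewrite (_ : [set _ | B n] = setT) ?setIT//; seteq.
by rewrite (_ : [set _ | B n] = set0) ?setI0//; seteq.
Qed.

Lemma tri_cells : cell_scheme tri_root nmark tri_cell tri_part.
Proof.
split.
- exact: bit_meas.
- exact: nmark_dm.
- move=> n; case: (ltnP 2 n) => n2; last first.
    by rewrite (_ : tri_part n = setT)//; seteq => // y _; rewrite /tri_part /= ltnNge n2.
  have := measurableI _ _ (@bit_meas G 1%g) (unmarked_meas (fun i => (0 < i) && (i + 2 < n))%N).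
  congr measurable; seteq => y /=; rewrite /tri_part /=.
    by move=> [h1 h2] _; split => // i i0 i_n; apply: h2; rewrite i0.
  by move=> /(_ n2)[h1 h2]; split => // i /andP[i0 i_n]; exact: h2.
- by move=> n; rewrite map_inj_uniq ?iota_uniq// => i j; exact: pow_inj.
- move=> y y1; rewrite /tri_part; case E: (nmark y) => [//|n] /= _; split => // i i0 i_n.
  by have [_ h] := (next_markP _ _).1 E; apply: h; rewrite i0; lia.
have key y g g' w w' i j : tri_root (pview g' y) -> (i < nmark (pview g y))%N ->
    (j <= i)%N -> w = (a ^+ i)%g -> w' = (a ^+ j)%g -> (g * w = g' * w')%g -> g = g'.
  move=> yg' i_n ji -> -> E; have gE := tri_shift (esym E) ji.
  have [ij|ij] := posnP (i - j); first by rewrite gE ij expg0 mulg1.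
  case En: (nmark (pview g y)) i_n => [//|n] i_n.
  have [_ h] := (next_markP _ _).1 En; have := h (i - j)%N.
  rewrite ij /= => /(_ (leq_ltn_trans (leq_subr _ _) i_n)).
  by move: yg'; rewrite /tri_root /pview /= mulg1 -gE => ->.
move=> y g g' w w' yg yg' /tri_cellP[i i_n wE] /tri_cellP[j j_n wE'] E.
have [ji|/ltnW ij] := leqP j i; first exact: (key y g g' w w' i j).
by apply/esym; apply: (key y g' g w' w j i).
Qed.

Section tri_marks.
Variables (dL : measure_display) (L : measurableType dL) (S0 S1 : set L)
  (S01 : S0 `&` S1 = set0).
Notation X := (power_space G dL L).
Notation mk := (mark W S0 S1 : X -> pats G).

Lemma tri_mark_local t (x x' : X) : (forall i, (i < 3)%N -> x (t * a ^+ i)%g = x' (t * a ^+ i)%g) -> mk x t = mk x' t.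
Proof.
move=> h; rewrite /mark; congr asbool; apply/propext.
have h0 := h 0%N isT; have h1 := h 1%N isT; have h2 := h 2%N isT.
rewrite expg0 mulg1 in h0; rewrite expg1 in h1; rewrite h0.
by split => -[z0 z1]; split => // w wW; have := z1 w wW; move: wW; rewrite !inE => /orP[] /eqP ->; rewrite ?h1 ?h2.
Qed.

Lemma tri_excl (x : X) t i : mk x t -> (0 < i < 3)%N -> ~~ mk x (t * a ^+ i)%g /\
  forall u, t = (u * a ^+ i)%g -> ~~ mk x u.
Proof.
move=> xt i3; have key u : mk x u -> mk x (u * a ^+ i)%g -> False.
  move=> xu xui; have := mark_excl tri_meets S01 x (t := u) (u := (u * a ^+ i)%g).
  rewrite xu xui => h; have : ~~ true; last by [].
  apply: h; first by apply/hasP; exists (u * a ^+ i)%g; [apply/tri_window; exists i => //; lia|exact: win_self].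
  by rewrite -{1}[u]mulg1 => /mulgI; rewrite -[X in X = _](expg0 a) => /pow_inj; lia.
split; first by apply/negP; exact: key.
by move=> u tu; apply/negP => xu; apply: (key u) => //; rewrite -tu.
Qed.

Lemma tri_dep n : depends (fun w => w \in tri_cell n) (mk @^-1` tri_part n).
Proof.
move=> x x' xx' h n2; have [h1 h2] := h n2.
have xa i : (i < n)%N -> x (a ^+ i)%g = x' (a ^+ i)%g.
  by move=> i_n; apply: xx'; apply/tri_cellP; exists i.
have loc i : (i + 2 < n)%N -> mk x' (a ^+ i)%g = mk x (a ^+ i)%g.
  by move=> i_n; apply: tri_mark_local => j j3; rewrite -expgnDr xa//; lia.
split; first by have := loc 0%N n2; rewrite expg0 => ->.
by move=> i i0 i_n; rewrite loc//; exact: h2.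
Qed.

(** Marks whose window crosses an end of the cell are excluded by the marks at [1] and at
    [a ^+ n.+1], before and after the change; later marks with window inside are excluded by
    [tri_part]; the remaining windows avoid the cell. *)
Lemma tri_resamp (x x' : X) : tri_root (mk x) ->
  (forall t, t \notin tri_cell (nmark (mk x)) -> x t = x' t) ->
  tri_part (nmark (mk x)) (mk x') -> mk x' = mk x.
Proof.
move=> x1; case En: (nmark (mk x)) => [|n] xx' Ux'.
  by congr mk; apply/funext => t; apply/esym; exact: xx'.
have [xn nmin] := (next_markP _ _).1 En; have x1' : mk x 1%g by [].
have n2 : (2 < n.+1)%N.
  rewrite ltnNge; apply/negP => n3; have i3 : (0 < n.+1 < 3)%N by [].
  by have [h _] := tri_excl x1' i3; move: h; rewrite mul1g xn.
have [x'1 x'u] := Ux' n2.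
have off i : (n < i)%N -> x (a ^+ i)%g = x' (a ^+ i)%g.
  by move=> ni; apply: xx'; apply/tri_cellP => -[j jn /pow_inj E]; lia.
have x'n : mk x' (a ^+ n.+1)%g.
  rewrite -(@tri_mark_local _ x)// => i _; rewrite -expgnDr; apply: off; lia.
apply/funext => t.
have [[k kn tk]|nt] := pselect (exists2 k, (k < n.+1)%N & t = (a ^+ k)%g).
  have [k0|k0] := posnP k; first by rewrite tk k0 expg0 x1' x'1.
  have xk : mk x t = false by apply/negbTE; rewrite tk; apply: nmin; rewrite k0.
  rewrite xk; apply/negbTE; have [kn2|kn2] := ltnP (k + 2) n.+1; first by rewrite tk; exact: x'u.
  have i3 : (0 < n.+1 - k < 3)%N by lia.
  have [_ h] := tri_excl x'n i3; apply: h; rewrite tk -expgnDr; congr (_ ^+ _)%g; lia.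
have [[i /andP[i0 i3] ti]|nti] := pselect (exists2 i, (0 < i < 3)%N & 1%g = (t * a ^+ i)%g).
  have i03 : (0 < i < 3)%N by rewrite i0.
  have [_ h] := tri_excl x1' i03; have [_ h'] := tri_excl x'1 i03.
  by rewrite (negbTE (h _ ti)) (negbTE (h' _ ti)).
apply/esym; apply: tri_mark_local => i i3; apply: xx'; apply/tri_cellP => -[j jn E].
have [ij|ji] := leqP i j.
  have := tri_shift (u := 1%g) (j := j); rewrite mul1g => /(_ _ _ E ij); rewrite mul1g => tE.
  by apply: nt; exists (j - i)%N => //; lia.
apply: nti; exists (i - j)%N; first by lia.
by apply: (tri_shift (i := j)); [rewrite mul1g E|exact: ltnW].
Qed.

End tri_marks.

(** Almost surely there is a mark at some positive and at some nonpositive power of [a], so the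
    origin lies between two successive marks. *)
Lemma tri_scheme : marker_scheme R W1 tri_root nmark tri_cell tri_part.
Proof.
split.
- exact: tri_cells.
- by move=> dL L S0 S1 _ n; exact: tri_dep.
- by move=> dL L S0 S1 S01 x x'; exact: tri_resamp.
move=> dL L la m S0 S1 mS0 mS1 mP S01 a01.
have vaY := mark_law_action W1 mP mS0 mS1.
have mU := uncovered_meas eb tri_cells vaY.
(* Exponents three apart keep the windows of three sites disjoint. *)
pose F i := (a ^+ (3 * i).+1)%g; pose B i := ((a ^+ (3 * i))^-1)%g.
have nmF i j : (i < j)%N -> ~~ meets W (F i) (F j).
  move=> ij; apply/hasP => -[g /tri_window[k k3 ->] /tri_window[l l3]].
  by rewrite -!expgnDr => /pow_inj; lia.
have nmB i j : (i < j)%N -> ~~ meets W (B i) (B j).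
  move=> ij; apply/hasP => -[g /tri_window[k k3 ->] /tri_window[l l3 E]].
  have ij3 : (3 * i <= 3 * j)%N by lia.
  by have := pow_inv_inj ij3 E; lia.
have n1 := unmarked_null W1 Wu tri_meets mP mS0 mS1 S01 a01 nmF.
have n2 := unmarked_null W1 Wu tri_meets mP mS0 mS1 S01 a01 nmB.
set E1 := [set x | _] in n1; set E2 := [set x | _] in n2.
have mE (t : nat -> G) : measurable [set x : power_space G dL L | forall i, ~~ mark W S0 S1 x (t i)].
  rewrite (_ : [set x | _] = \bigcap_i ~` [set x : power_space G dL L | mark W S0 S1 x (t i)]).
    by apply: bigcapT_measurable => i; apply: measurableC; exact: mark_meas1.
  by seteq => x h i; [move=> _; apply/negP; exact: h|apply/negP; exact: h].
have n12 : m (E1 `|` E2) = 0%E by apply: null_setU => //; exact: mE.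
rewrite mark_lawE; apply/eqP; rewrite -measure_le0 -n12; apply: le_meas.
- exact: (mark_preimage W1 mS0 mS1 mU).
- by apply: measurableU; exact: mE.
move=> x ux; apply: contrapT => nE; apply: ux; set y := mark W S0 S1 x.
have [i yi] : exists i, y (F i).
  by apply: contrapT => h; apply: nE; left => i; apply/negP => yi; apply: h; exists i.
have exB : exists i, y ((a ^+ i)^-1)%g.
  apply: contrapT => h; apply: nE; right => j; apply/negP => yj; apply: h; by exists (3 * j)%N.
(* The last mark at or before the origin roots the cell that contains the origin. *)
case: (ex_minnP exB) => j yj jmin.
exists (a ^+ j)%g => //; split; first by rewrite /tri_root /pview /= mulg1.
set z := pview _ y.
have zE k : z (a ^+ (j + k))%g = y (a ^+ k)%g by rewrite /z /pview expgnDr mulKg.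
apply/tri_cellP; exists j => //; rewrite ltnNge; apply/negP.
case En : (nmark z) => [|n] nj.
  by have := (next_mark0 _).1 En (j + (3 * i))%N; rewrite -addnS zE => /negP; apply.
have [zn _] := (next_markP _ _).1 En; have := jmin (j - n.+1)%N; rewrite leqNgt ltn_subrL.
have -> : y (a ^+ (j - n.+1))^-1%g.
  move: zn; rewrite /z /pview; congr (is_true (y _)).
  by rewrite -{1}(subnKC nj) expgnDr invgM mulgVK.
by move=> /(_ isT); rewrite /= (leq_trans _ nj).
Qed.

End infinite_order.

(** * Standard bases coded by bits, and their Shannon entropy *)

Section bases.

Definition first_bit (t : nat -> bool) : nat :=
  if pselect (exists n, t n) is left ex then ex_minn ex else 0%N.

Lemma first_bitP (t : nat -> bool) n : t n -> t (first_bit t) /\ (first_bit t <= n)%N.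
Proof.
move=> tn; rewrite /first_bit; case: pselect => [ex|[]]; last by exists n.
by case: ex_minnP => k tk kmin; split => //; exact: kmin.
Qed.

Lemma first_bitE (t : nat -> bool) n : t n -> (forall i, (i < n)%N -> ~~ t i) -> first_bit t = n.
Proof.
move=> tn nmin; have [h1 h2] := first_bitP tn; apply/eqP; rewrite eqn_leq h2 leqNgt.
by apply/negP => /nmin; rewrite h1.
Qed.

Lemma first_bit_dm d (X : measurableType d) (F : X -> nat -> bool) :
  mbits F -> dm (fun x => first_bit (F x)).
Proof.
move=> mF B.
have mc Q := @cst_meas _ (X) Q.
pose E n := [set x | F x n] `&` \bigcap_i [set x | (i < n)%N -> ~~ F x i].
have mE n : measurable (E n).
  apply: measurableI => //; apply: bigcapT_measurable => i; case: (ltnP i n) => ni.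
    by have := measurableC (mF i); congr measurable; seteq => x /=; [move=> /negP|move=> /(_ isT)/negP].
  by rewrite (_ : [set x | _] = setT)//; seteq.
have EP x : F x (first_bit (F x)) -> E (first_bit (F x)) x.
  move=> h; split => // i _ /= ni; apply/negP => /first_bitP[_].
  by rewrite leqNgt ni.
rewrite (_ : _ @^-1` B = (\bigcup_n (E n `&` [set _ | B n])) `|`
    ((\bigcap_n ~` [set x | F x n]) `&` [set _ | B 0%N])).
  apply: measurableU; first by apply: bigcupT_measurable => n; exact: measurableI.
  by apply: measurableI => //; apply: bigcapT_measurable => n; exact: measurableC.
seteq => x /=.
  move=> h; have [[n tn]|nx] := pselect (exists n, F x n).
    by left; exists (first_bit (F x)) => //; split => //; apply: EP; case: (first_bitP tn).
  right; split; first by move=> n _ tn; apply: nx; exists n.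
  by move: h; rewrite /first_bit; case: pselect.
move=> [[n _ [[h1 h2] Bn]]|[h Bn]].
  by rewrite (@first_bitE _ n)// => i; exact: h2.
by rewrite /first_bit; case: pselect => // -[n tn]; case: (h n I).
Qed.

Lemma nat_base : coded_base (fun n i : nat => n == i) first_bit.
Proof.
split => //.
- by move=> d X F mF; apply: dm_fun; exact: first_bit_dm.
- by move=> n; apply: first_bitE => // i ni; rewrite gt_eqF.
Qed.

Section standard.
Variables (R : realType) (d : measure_display) (L : measurableType d)
  (sL : standard_borel R L).

(** The bit with index [(n, j)] tells whether the point lies within [r n] of the term [j] of a dense
    sequence. Decoding picks the first such [j] for each [n] and takes the limit of these centres,
    which completeness provides. *)
Lemma standard_base : exists b dec, @coded_base d L b dec.
Proof.
have [M [f [[compl [D cD dD]] [_ finj fsurj] mE]]] := sL.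
have fi : injective f by move=> x y; apply: finj; rewrite inE.
have fs y : exists x, f x = y by have [x _ <-] := fsurj y I; exists x.
pose fv y := projT1 (cid (fs y)); have fvK y : f (fv y) = y := projT2 (cid (fs y)).
have [q qD] : exists q : nat -> M, forall y, D y -> exists j, q j = y.
  have /countable_injP[g gi] := cD.
  exists (fun j => if pselect (exists2 y, D y & g y = j) is left ex then projT1 (cid2 ex) else f point) => y Dy.
  exists (g y); case: pselect => [ex|[]]; last by exists y.
  by case: (cid2 ex) => z Dz /= gz; apply: gi; rewrite ?inE.
pose r n : R := n.+1%:R^-1; have r0 n : 0 < r n by rewrite invr_gt0 ltr0n.
have rle n k : (n <= k)%N -> r k <= r n by move=> nk; rewrite lef_pV2 ?posrE ?ltr0n// ler_nat.
have rsmall (ep : R) : 0 < ep -> exists n, r n < ep.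
  by move=> e0; have [n _ h] := near_infty_natSinv_lt (PosNum e0); exists n; exact: (h n (leqnn n)).
have dense_q y n : exists j, ball (q j) (r n) y.
  have ne : (ball y (r n))^° !=set0 by exists y; exact: nbhsx_ballx.
  have [z [/interior_subset yz Dz]] := dD _ ne (@open_interior _ _). have [j jz] := qD _ Dz; exists j; rewrite jz; exact: ball_sym.
pose b l i := asbool (ball (q (dec2 i).2) (r (dec2 i).1) (f l)).
pose jj (s : nat -> bool) (n : nat) := first_bit (fun j => s (pickle (n, j))).
pose u s n := q (jj s n).
(* An explicit Cauchy condition involving countably many choices of centres; sequences that violate
   it are decoded to a default point. *)
pose good s := forall n k, (n <= k)%N -> ball (u s n) (r n + r n) (u s k).
pose lim s := if pselect (exists y, u s @ \oo --> y) is left ex then projT1 (cid ex) else f point.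
have limP s : good s -> u s @ \oo --> lim s.
  move=> gs; rewrite /lim; case: pselect => [ex|[]]; first exact: (projT2 (cid ex)).
  apply: compl; apply: cauchy_exP => ep ep0; have [n rn] := rsmall (ep / 2) (divr_gt0 ep0 (ltr0Sn _ 1)).
  exists (u s n); exists n => // k /= nk; apply: le_ball (gs _ _ nk).
  by rewrite [leRHS](splitr ep) lerD// ltW.
have limB s n : good s -> ball (u s n) (r n + r n + r n) (lim s).
  move=> gs; have := limP s gs _ (nbhsx_ballx _ _ (r0 n)) => -[N _ hN].
  have := hN (maxn n N) (leq_maxr _ _) => /= /ball_sym h.
  by apply: ball_triangle h; apply: gs; exact: leq_maxl.
have ub l n : ball (u (b l) n) (r n) (f l).
  have [j hj] := dense_q (f l) n.
  have [] := @first_bitP (fun j => b l (pickle (n, j))) j; first by rewrite /b dec_pairK; exact/asboolP.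
  by rewrite /b dec_pairK /= => /asboolP.
have goodb l : good (b l).
  move=> n k nk; apply: (le_ball (lerD (lexx (r n)) (rle _ _ nk))).
  by apply: ball_triangle (ub l n) _; apply: ball_sym; exact: ub.
have limb l : lim (b l) = f l.
  apply: (@cvg_unique _ (@metric_hausdorff _ M) (u (b l) @ \oo)); first exact: limP.
  move=> A /nbhs_ballP[ep /= ep0 epA]; have [n rn] := rsmall ep ep0.
  exists n => // k /= nk; apply: epA; apply: ball_sym; apply: le_ball (ub l k).
  by rewrite (le_trans (rle _ _ nk))// ltW.
pose dec s := if asbool (good s) then fv (lim s) else point.
exists b, dec; split => [i|d' X F mF|l].
- rewrite mE; exists (ball (q (dec2 i).2) (r (dec2 i).1)).
    have -> : ball (q (dec2 i).2) (r (dec2 i).1) = (ball (q (dec2 i).2) (r (dec2 i).1))^°.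
      apply/esym/interior_id; rewrite openE => y.
      rewrite ballEmdist /= => hy; apply/nbhs_ballP.
      exists (r (dec2 i).1 - mdist (q (dec2 i).2) y); first by rewrite /= subr_gt0.
      move=> z; rewrite ballEmdist /= => hz.
      by rewrite (le_lt_trans (metric_triangle _ y _))// -ltrBrDl.
    by apply: sub_sigma_algebra; exact: open_interior.
  by seteq => l /=; [move=> h; exact/asboolP|move=> /asboolP].
- have mj n : dm (fun x => jj (F x) n).
    by apply: (first_bit_dm (F := fun x j => F x (pickle (n, j)))) => j; exact: mF.
  have mgood : measurable [set x | good (F x)].
    rewrite (_ : [set x | _] = \bigcap_n \bigcap_k [set x | (n <= k)%N -> ball (u (F x) n) (r n + r n) (u (F x) k)]).
      apply: bigcapT_measurable => n; apply: bigcapT_measurable => k.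
      have mp : dm (fun x => (jj (F x) n, jj (F x) k)) by apply: (dm_pair (n1 := id)) => // x; exists x.
      exact: (mp (fun p => (n <= k)%N -> ball (q p.1) (r n + r n) (q p.2))).
    by seteq => x h; [move=> n _ k _; exact: h|move=> n k; exact: h].
  pose CC : set (set M) := [set B | measurable [set x | good (F x) /\ B (lim (F x))]].
  have CCB B : <<s (@open M) >> B -> CC B.
    move: B; apply: smallest_sub; first split.
    + by rewrite /CC /= (_ : [set x | _] = set0)//; seteq => // x [].
    + move=> B mB; rewrite /CC /= (_ : [set x | _] = [set x | good (F x)] `\` [set x | good (F x) /\ B (lim (F x))]).
        exact: measurableD.
      seteq => x /=; first by move=> [g [_ nB]]; split => // -[].
      by move=> [g nB]; split => //; split => // hB; apply: nB.
    + move=> A mA; rewrite /CC /= (_ : [set x | _] = \bigcup_n [set x | good (F x) /\ A n (lim (F x))]).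
        exact: bigcupT_measurable.
      by seteq => x /=; [move=> [g [n _ An]]; exists n|move=> [n _ [g An]]; split => //; exists n].
    move=> O oO; rewrite /CC /=.
    (* The limit lies within [3 * r n] of the centre of index [n], so it belongs to [O] exactly when
       such a ball around some centre is contained in [O]; finding that ball takes
       [6 * r n < ep]. *)
    rewrite (_ : [set x | _] = [set x | good (F x)] `&`
        \bigcup_n ((fun x => jj (F x) n) @^-1` [set j | ball (q j) (r n + r n + r n) `<=` O])).
      by apply: measurableI => //; apply: bigcupT_measurable => n; exact: mj.
    seteq => x /=; last first.
      by move=> [g [n _ /= h]]; split => //; apply: h; exact: limB.
    move=> [g Ol]; split => //; have := oO; rewrite openE => /(_ _ Ol)/nbhs_ballP[ep /= ep0 epO].
    have [n rn] := rsmall (ep / 6) (divr_gt0 ep0 (ltr0Sn _ 5)); exists n => //= y hy.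
    apply: epO; apply: le_ball (ball_triangle (ball_sym (limB _ n g)) hy).
    move: rn; lra.
  move=> _ A mA; rewrite setTI; move: mA; rewrite mE => -[B mB <-].
  rewrite (_ : _ @^-1` _ = [set x | good (F x) /\ B (lim (F x))] `|` (~` [set x | good (F x)] `&` [set _ | B (f point)])).
    apply: measurableU; first exact: CCB.
    apply: measurableI; first exact: measurableC.
    have [h|h] := pselect (B (f point)); first by rewrite (_ : [set _ | _] = setT)//; seteq.
    by rewrite (_ : [set _ | _] = set0)//; seteq.
  seteq => x /=; rewrite /dec; case: asboolP => g; rewrite ?fvK.
  + by move=> h; left.
  + by move=> h; right.
  + by case=> -[].
  + by case=> -[].
- by rewrite /dec (asboolT (goodb l)) limb; apply: fi; rewrite fvK.
Qed.

End standard.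

Section entropy.
Variables (R : realType) (d : measure_display) (L : measurableType d) (la : probability L R).
Variables (b : L -> nat -> bool) (dec : (nat -> bool) -> L)
  (cb : coded_base b dec).

Let m1 l : measurable [set l : L]. Proof. exact: (singleton_meas cb). Qed.
Let info_meas := linfo_meas la cb.
Let info0 l := linfo_ge0 la cb l.
Let fin (A : set L) : measurable A -> la A \is a fin_num.
Proof. by move=> mA; exact: fin_num_measure. Qed.

(** If the points of mass zero form a null set, the atoms are a countable support; so without such a
    support the integral is infinite. With one, the integral splits into a sum over its points. *)
Lemma info_shannon : (\int[la]_l linfo la l)%E = shannon_entropy la.
Proof.
rewrite /shannon_entropy; case: asboolP => [[C [cC mC C1]]|nC]; last first.
  have mA : measurable [set l | linfo la l = +oo%E].
    by have := info_meas measurableT (emeasurable_set1 +oo%E); rewrite setTI.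
  have [A0|A0] := eqVneq (la [set l | linfo la l = +oo%E]) 0%E; last first.
    apply/eqP; rewrite -leye_eq.
    apply: (via (\int[la]_(l in [set l | linfo la l = +oo%E]) linfo la l)%E).
      rewrite (eq_integral (cst +oo%E)); last by move=> l; rewrite inE.
      by rewrite integral_cst// gt0_mulye// lt0e A0 measure_ge0.
    by apply: ge0_subset_integral.
  case: nC; exists (~` [set l | linfo la l = +oo%E]); split.
  - pose c k (a : seq bool) := la (setT `&` [set z | bits b k z = a :> seq bool]).
    (* An atom has more than half of the mass of some cylinder of bits around it, and two atoms
       cannot both do so; cylinders, which are countably many, therefore name all atoms. *)
    pose Q (p : nat * seq bool) l := bits b p.1 l = p.2 :> seq bool /\ fine (c p.1 p.2) < fine (la [set l]) *+ 2.
    pose f n := if pselect (exists l, Q (odflt (0%N, [::]) (unpickle n)) l) is left ex then projT1 (cid ex) else point.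
    apply: (card_le_trans (subset_card_le (B := f @` [set: nat]) _) (card_image_le f [set: nat])) => l /= h.
    set s := fine (la [set l]); have s0 : 0 < s.
      rewrite lt_neqAle fine_ge0// andbT eq_sym; apply/eqP => E; apply: h.
      by rewrite /linfo -/s E /nl eqxx.
    have cE k z : c k (bits b k z) = la (setT `&` [set l' | bits b k l' = bits b k z]).
      by congr (la _); seteq => l' [_ /= E]; split => //; [exact: val_inj|exact: (congr1 val E)].
    have [k Qk] : exists k, Q (k, bits b k l : seq bool) l.
      apply: contrapT => nk; have lim := info_lim (mu := la) measurableT (cb_meas cb) (x := l).
      have : (nl s <= (- ln (s *+ 2))%:E)%E.
        have -> : nl s = nl (fine (la (setT `&` [set x' | b x' = b l]))).
          rewrite setTI /s; congr (nl (fine (la _))); seteq => z /= E; first by rewrite E.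
          by rewrite -(cb_can cb z) E cb_can.
        rewrite -(cvg_lim _ lim)//; apply: lime_le; first by apply/cvg_ex; eexists; exact: lim.
        apply: nearW => k; rewrite -cE /nl; have lec : s *+ 2 <= fine (c k (bits b k l)).
          by rewrite leNgt; apply/negP => h'; apply: nk; exists k.
        have s2 : 0 < s *+ 2 by rewrite mulrn_wgt0.
        have cp := lt_le_trans s2 lec.
        by rewrite gt_eqF// lee_fin lerN2 ler_ln ?posrE.
      rewrite /nl gt_eqF// lee_fin lerN2 ler_ln ?posrE ?mulrn_wgt0// mulr2n gerDr leNgt s0//.
    exists (pickle (k, bits b k l : seq bool)) => //; rewrite /f pickleK /=.
    case: pselect => [ex|[]]; last by exists l.
    case: (cid ex) => l' [/= E Ql'] /=; apply: contrapT => /eqP ll'; have [_ /= Ql] := Qk.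
    have mc : measurable [set z | bits b k z = bits b k l] := bits_dm (k := k) (cb_meas cb) [set bits b k l].
    have : (la ([set l'] `|` [set l]) <= c k (bits b k l))%E.
      rewrite cE setTI; apply: le_meas => //; first exact: measurableU.
      by move=> z [|] -> //=; exact: val_inj.
    have -> : la ([set l'] `|` [set l]) = (la [set l'] + la [set l])%E.
      by apply: measureU => //; seteq => // z [/= -> E']; move: ll'; rewrite E' eqxx.
    rewrite -(fineK (fin (m1 l'))) -(fineK (fin (m1 l))) -EFinD.
    rewrite -[X in (_ <= X)%E]fineK; last by rewrite cE setTI fin.
    by rewrite lee_fin leNgt; move: Ql Ql'; rewrite !mulr2n; lra.
  - exact: measurableC.
  - by rewrite (probability_setC la mA) A0 sube0.
have /countable_injP[g gi] := cC.
pose F k := C `&` g @^-1` [set k].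
have FE k l : F k l -> F k = [set l].
  move=> [Cl gl]; seteq => [l' [Cl' gl']|l' ->]; last by [].
  by apply: gi; rewrite ?inE// gl gl'.
have mF k : measurable (F k).
  by have [->|/set0P[l /FE ->]] := eqVneq (F k) set0.
have C0 : la (~` C) = 0%E by rewrite (probability_setC la mC) C1 subee.
pose a l := (- (fine (la [set l]) * ln (fine (la [set l]))))%:E.
have le1 l : fine (la [set l]) <= 1 by rewrite -lee_fin fineK ?probability_le1// fin.
have a0 l : (0 <= a l)%E by rewrite lee_fin oppr_ge0 mulr_ge0_le0 ?fine_ge0// ln_le0.
have aE l : (\int[la]_(z in [set l]) linfo la z = a l)%E.
  rewrite (eq_integral (cst (linfo la l))); last by move=> z; rewrite inE => ->.
  rewrite integral_cst//; transitivity (nl (fine (la [set l])) * (fine (la [set l]))%:E)%E.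
    by congr (_ * _)%E; apply/esym; apply: fineK; exact: fin.
  rewrite /nl /a; move: (fine _) => s.
  by case: eqVneq => [->|_]; rewrite ?mule0 ?mul0r ?oppr0// -EFinM mulNr mulrC.
transitivity (\int[la]_(l in C) linfo la l)%E.
  rewrite (ge0_negligible_integral (measurableC mC) measurableT info_meas)//.
  by congr (integral _ _ _); rewrite setTD setCK.
have -> : C = \bigcup_k F k by seteq => l /=; [move=> Cl; exists (g l)|case=> k _ []].
rewrite ge0_integral_bigcup//; last 2 first.
- exact: measurable_funTS info_meas.
- by move=> i j _ _ [l [[_ /= <-] [_ /= <-]]].
pose A k := (\int[la]_(l in F k) linfo la l)%E.
have A0 k : (0 <= A k)%E by exact: integral_ge0.
rewrite nneseries_esumT//.
transitivity (\esum_(k in g @` C) A k)%E.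
  rewrite [RHS]esum_mkcond; apply: eq_esum => k _; case: ifPn => //; rewrite notin_setE => nk.
  rewrite /A (_ : F k = set0) ?integral_set0//; seteq => // l [Cl gl].
  by apply: nk; exists l.
rewrite (@reindex_esum _ _ _ C _ g); last by split => [l Cl|l l' ? ? ?|_ [l Cl <-]]; [exists l|exact: gi|exists l].
rewrite [LHS]esum_mkcond; apply: eq_esum => l _; case: ifPn => [|].
  by rewrite inE => Cl; rewrite /A (@FE (g l) l).
rewrite notin_setE => nC; rewrite (_ : la [set l] = 0%E) /= ?mul0r ?oppr0//.
apply/eqP; rewrite -measure_le0 -C0; apply: le_meas => //; first exact: measurableC.
by move=> z ->.
Qed.

(** Each point of a set has at least the surprisal of the set. *)
Lemma info_split (S : set L) : measurable S ->
  (la S * nl (fine (la S)) + la (~` S) * nl (fine (la (~` S))) <=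
   \int[la]_l linfo la l)%E.
Proof.
move=> mS; have mSC := measurableC mS.
have le (T : set L) : measurable T ->
    (la T * nl (fine (la T)) <= \int[la]_(l in T) linfo la l)%E.
  move=> mT; rewrite muleC -integral_cst//; apply: ge0_le_integral => //.
  - by move=> l _; apply: nl_ge0; rewrite -lee_fin fineK ?probability_le1// fin.
  - exact: measurable_funTS info_meas.
  - move=> l Tl; apply: le_nl; first exact: fine_ge0.
    by apply: fine_le; rewrite ?fin//; apply: le_meas => // z ->.
rewrite -(setUv S) ge0_integral_setU//; first by apply: leeD; exact: le.
- by rewrite setUv.
- by rewrite disj_set2E setICr.
Qed.

(** Each bit is almost surely constant, and the constants decode to the point. *)
Lemma point_mass : (forall S : set L, measurable S -> la S = 0%E \/ la S = 1%E) ->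
  exists l, la [set l] = 1%E.
Proof.
move=> h01; pose s i := la [set l | b l i] == 1%E.
pose B i := [set l | b l i = s i].
have mB i : measurable (B i) /\ la (~` B i) = 0%E.
  have mb := cb_meas cb i; rewrite /B /s; case: eqVneq => [E|/eqP E].
    rewrite (_ : [set l | b l i = true] = [set l | b l i])//; split => //.
    by rewrite probability_setC// E subee.
  have -> : [set l | b l i = false] = ~` [set l | b l i].
    by seteq => l /=; case: (b l i).
  by split; [exact: measurableC|rewrite setCK; case: (h01 _ mb)].
have n0 : la (\bigcup_i ~` B i) = 0%E.
  apply/eqP; rewrite -measure_le0.
  have mU : measurable (\bigcup_i ~` B i) by apply: bigcupT_measurable => i; apply: measurableC; exact: (mB i).1.
  have := @measure_sigma_subadditive _ R L la (\bigcup_i ~` B i) (fun i => ~` B i) _ mU (@subset_refl _ _).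
  move=> h; apply: le_trans (h _) _; first by move=> i; apply: measurableC; exact: (mB i).1.
  by rewrite eseries0// => i _ _; exact: (mB i).2.
have mI : measurable (\bigcap_i B i) by apply: bigcapT_measurable => i; exact: (mB i).1.
have I1 : la (\bigcap_i B i) = 1%E.
  by rewrite -[X in la X]setCK setC_bigcap probability_setC ?n0 ?sube0//; rewrite -setC_bigcap; exact: measurableC.
exists (dec s); rewrite -I1; congr (la _); seteq => [l ->|l h] /=.
  have : \bigcap_i B i !=set0.
    by apply/set0P; apply/eqP => E; move: I1; rewrite E measure0 => /eqP; rewrite eqe eq_sym oner_eq0.
  move=> [z Iz]; suff -> : dec s = z by [].
  by rewrite -(cb_can cb z); congr dec; apply/funext => i; rewrite (Iz i I).
by rewrite -(cb_can cb l); congr dec; apply/funext => i; rewrite (h i I).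
Qed.

End entropy.
End bases.

(** * Product measures over a countable alphabet, from Lebesgue measure *)

Section iid.
Variables (R : realType) (p : nat -> R).
Hypotheses (p0 : forall n, 0 <= p n) (p1 : (\sum_(n <oo) (p n)%:E = 1)%E).

Local Notation RR := (measurableTypeR R).
Let D : set RR := `[0, 1[%classic.
Let mD : measurable D. Proof. exact: measurable_itv. Qed.
Definition unit_prob : probability RR R := uniform_prob (@ltr01 R).
Local Notation mu := unit_prob.

Let mu_itv (x y : R) : 0 <= x -> x <= y -> y <= 1 -> mu `[x, y[%classic = (y - x)%:E.
Proof.
move=> x0 xy y1; rewrite -[LHS]/(\int[lebesgue_measure]_(z in `[x, y[%classic) (uniform_pdf 0 1 z)%:E)%E.
rewrite (eq_integral (cst 1%E)); last first.
  move=> z; rewrite inE /= in_itv /= => /andP[xz zy]; rewrite /uniform_pdf (le_trans x0 xz) (le_trans (ltW zy) y1) /=.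
  by rewrite subr0 invr1.
rewrite integral_cst//= mul1e; apply: (etrans (lebesgue_measure_itv _)); rewrite /= lte_fin; case: ltP => [_|yx]; first by rewrite -EFinD.
by rewrite (_ : y = x) ?subrr//; apply/eqP; rewrite eq_le yx xy.
Qed.

Let c n := \sum_(0 <= i < n) p i.

Let cS n : c n.+1 = c n + p n. Proof. by rewrite /c big_nat_recr. Qed.

Let c_le i j : (i <= j)%N -> c i <= c j.
Proof. elim: j => [|j IH]; first by rewrite leqn0 => /eqP ->.
by rewrite leq_eqVlt => /orP[/eqP -> //|/IH h]; rewrite cS (le_trans h)// lerDl. Qed.

Let c_sup x : x < 1 -> exists n, x < c n.
Proof.
move=> x1; apply: contrapT => nx; have : (1 <= x%:E)%E.
  rewrite -p1; apply: lime_le; first by apply: is_cvg_nneseries => n _ _; rewrite lee_fin.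
  apply: nearW => n; rewrite sumEFin lee_fin leNgt; apply/negP => h; apply: nx; by exists n.
by rewrite lee_fin leNgt x1.
Qed.

Let c_le1 n : c n <= 1.
Proof.
rewrite -lee_fin -p1 /c -sumEFin; apply: nneseries_lim_ge => k _ _; by rewrite lee_fin.
Qed.

(* A word [w] owns the interval [lo, lo + len[, which its one-letter extensions
   cut into pieces of relative lengths [p 0, p 1, ...]. *)
Definition step (s : R * R) n : R * R := (s.1 + s.2 * c n, s.2 * p n).
Definition piece (w : seq nat) : R * R := foldl step (0, 1) w.
Definition digit (s : R * R) (u : R) : nat := first_bit (fun n => u < s.1 + s.2 * c n.+1).
Fixpoint locus i (u : R) : R * R := if i is j.+1 then step (locus j u) (digit (locus j u) u) else (0, 1).
Definition dig i u := digit (locus i u) u.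

Let piece_rcons w n : piece (rcons w n) = step (piece w) n. Proof. exact: foldl_rcons. Qed.

Lemma piece_ge0 w : 0 <= (piece w).1 /\ 0 <= (piece w).2.
Proof.
elim/last_ind: w => [|w n [h1 h2]]; first by split => //=; exact: ler01.
by rewrite piece_rcons /=; split; rewrite ?addr_ge0 ?mulr_ge0// sumr_ge0.
Qed.

Lemma piece_le1 w : (piece w).1 + (piece w).2 <= 1.
Proof.
elim/last_ind: w => [|w n h]; first by rewrite /= add0r.
rewrite piece_rcons /= -addrA -mulrDr -cS; apply: le_trans h.
by rewrite lerD2l ler_piMr//; exact: (piece_ge0 w).2.
Qed.

Lemma digit_step s u n : 0 <= s.2 -> s.1 <= u < s.1 + s.2 -> (digit s u = n <->
  (step s n).1 <= u < (step s n).1 + (step s n).2).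
Proof.
move=> s0 /andP[su us]; have s2 : 0 < s.2 by rewrite -(ltrD2l s.1) addr0 (le_lt_trans su).
have ltc x : (u < s.1 + s.2 * x) = ((u - s.1) / s.2 < x) by rewrite ltr_pdivrMr// ltrBlDl [x * _]mulrC.
have [k uk] : exists k, u < s.1 + s.2 * c k.+1.
  have h1 : (u - s.1) / s.2 < 1 by rewrite ltr_pdivrMr// mul1r ltrBlDl.
  have [k hk] := c_sup h1.
  by exists k; rewrite ltc (lt_le_trans hk)// c_le.
rewrite /= -addrA -mulrDr -cS; split => [<-|/andP[h1 h2]].
  have [h1 h2] := @first_bitP (fun n => u < s.1 + s.2 * c n.+1) k uk; rewrite h1 andbT -/(digit s u).
  case E : (digit s u) => [|j]; first by rewrite /c big_geq// mulr0 addr0.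
  rewrite leNgt; apply/negP => h; have [_] := @first_bitP (fun n => u < s.1 + s.2 * c n.+1) j h.
  by rewrite -/(digit s u) E ltnn.
apply: first_bitE => // i ni; rewrite -leNgt; apply: le_trans h1.
by rewrite lerD2l ler_pM2l// c_le.
Qed.

Definition word_cell w : set RR := [set u | D u /\ forall i, (i < size w)%N -> dig i u = nth 0%N w i].

Lemma word_cellE w : word_cell w = `[(piece w).1, (piece w).1 + (piece w).2[%classic /\
  (forall u, word_cell w u -> locus (size w) u = piece w).
Proof.
elim/last_ind: w => [|w n [IH1 IH2]].
  split; last by [].
  by rewrite /= add0r; seteq => u; [case|].
have [g1 g2] := piece_ge0 w.
have E u : word_cell (rcons w n) u <-> word_cell w u /\ digit (piece w) u = n.
  rewrite /word_cell /= size_rcons; split => [[Du h]|[[Du h] dn]].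
    have wu : word_cell w u.
      by split => // i iw; rewrite h ?ltnS ?(ltnW iw)// nth_rcons iw.
    split => //; have := h _ (ltnSn _); rewrite nth_rcons ltnn eqxx => <-.
    by rewrite /dig IH2.
  split => // i; rewrite ltnS leq_eqVlt nth_rcons => /orP[/eqP ->|iw]; last by rewrite iw h.
  by rewrite ltnn eqxx /dig IH2.
split; last by move=> u /E[wu dn]; rewrite size_rcons /= (IH2 u wu) dn piece_rcons.
rewrite piece_rcons; seteq => u.
  move=> /E[]; rewrite IH1 /= in_itv /= => hu /(digit_step _ g2 hu) h; by rewrite in_itv.
rewrite /= in_itv /= => hu; have hu' : (piece w).1 <= u < (piece w).1 + (piece w).2.
  move: hu => /andP[h1 h2]; apply/andP; split; first by apply: le_trans h1; rewrite lerDl mulr_ge0// sumr_ge0.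
  by apply: (lt_le_trans h2); rewrite -addrA -mulrDr -cS lerD2l ler_piMr.
by apply/E; split; [rewrite IH1 /= in_itv|exact/(digit_step _ g2 hu')].
Qed.

Lemma word_cell_meas w : measurable (word_cell w).
Proof. by rewrite (word_cellE w).1; exact: measurable_itv. Qed.

Lemma word_cell_prob w : mu (word_cell w) = (piece w).2%:E.
Proof.
have [g1 g2] := piece_ge0 w; rewrite (word_cellE w).1 mu_itv//; first by rewrite addrAC subrr add0r.
  by rewrite lerDl.
exact: piece_le1.
Qed.

Lemma dig_dm i : dm (dig i : RR -> nat).
Proof.
suff ms : measT (fun u : RR => (locus i u).1) /\ measT (fun u : RR => (locus i u).2).
  apply: (first_bit_dm (F := fun (u : RR) n => (u : R) < (locus i u).1 + (locus i u).2 * c n.+1)) => n.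
  have m : measT (fun u : RR => (u : R) < (locus i u).1 + (locus i u).2 * c n.+1).
    apply: measurable_fun_ltr => //; apply: measurable_funD; first exact: ms.1.
    by apply: measurable_funM; [exact: ms.2|exact: measurable_cst].
  by have := m measurableT [set true] I; rewrite setTI; congr measurable; seteq.
elim: i => [|i [m1 m2]] /=; first by split; exact: measurable_cst.
have md : dm (dig i : RR -> nat).
  apply: (first_bit_dm (F := fun (u : RR) n => (u : R) < (locus i u).1 + (locus i u).2 * c n.+1)) => n.
  have m : measT (fun u : RR => (u : R) < (locus i u).1 + (locus i u).2 * c n.+1).
    apply: measurable_fun_ltr => //; apply: measurable_funD; first exact: m1.
    by apply: measurable_funM; [exact: m2|exact: measurable_cst].
  by have := m measurableT [set true] I; rewrite setTI; congr measurable; seteq.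
split; first by apply: measurable_funD => //; apply: measurable_funM => //; apply: dm_fun; exact: (dm_comp c md).
by apply: measurable_funM => //; apply: dm_fun; exact: (dm_comp p md).
Qed.

Definition dig0_mfun : {mfun RR >-> nat} := HB.pack (dig 0) (isMeasurableFun.Build _ _ _ _ _ (dm_fun (dig_dm 0))).
Definition pmf_law : probability nat R := distribution mu dig0_mfun.

Let Dnull (A : set RR) : measurable A -> mu (A `&` D) = mu A.
Proof.
move=> mA; have D1 : mu D = 1%E by rewrite /D mu_itv// subr0.
have mDC := measurableC mD; have D0 : mu (A `&` ~` D) = 0%E.
  apply/eqP; rewrite -measure_le0.
  apply: (via (mu (~` D))); first by apply: le_meas => //; exact: measurableI.
  by rewrite (probability_setC mu mD) D1 subee.
apply: (etrans (esym (measureU0 (measurableI _ _ mA mD) (measurableI _ _ mA mDC) D0))).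
by rewrite -setIUr setUv setIT.
Qed.

Lemma pmf_law1 n : pmf_law [set n] = (p n)%:E.
Proof.
rewrite -[LHS]/(mu (dig 0 @^-1` [set n])) -(Dnull (dig_dm 0 _)).
have -> : dig 0 @^-1` [set n] `&` D = word_cell [:: n].
  by seteq => u; [move=> [h Du]; split => // -[|//]|move=> [Du h]; split => //; exact: (h 0%N)].
by rewrite word_cell_prob /= mul1r.
Qed.

Definition fiber (B : nat -> set nat) w k : set RR :=
  word_cell w `&` [set u | forall j, (size w <= j < size w + k)%N -> B j (dig j u)].

(** Induction on [k] for arbitrary [w]: the next digit [n] refines the word to [rcons w n], and
    relative lengths multiply. *)
Lemma fiber_prob B w k : measurable (fiber B w k) /\
  mu (fiber B w k) = ((piece w).2 * \prod_(size w <= j < size w + k) fine (pmf_law (B j)))%:E.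
Proof.
elim: k w => [|k IH] w.
  rewrite (_ : fiber B w 0 = word_cell w); last first.
    seteq => u; first by case.
    by move=> wu; split => // j; rewrite addn0 => /andP[h1]; rewrite ltnNge h1.
  by rewrite addn0 big_geq// mulr1; split; [exact: word_cell_meas|exact: word_cell_prob].
pose F n := if n \in B (size w) then fiber B (rcons w n) k else set0.
have mF n : measurable (F n) by rewrite /F; case: ifP => // _; exact: (IH _).1.
have FE : fiber B w k.+1 = \bigcup_n F n.
  seteq => u.
    move=> [[Du h] hB]; exists (dig (size w) u) => //; rewrite /F mem_set; last by apply: hB; lia.
    split; first split => // i.
      by rewrite size_rcons ltnS leq_eqVlt nth_rcons => /orP[/eqP ->|iw]; rewrite ?ltnn ?eqxx// iw h.
    by move=> j; rewrite size_rcons => hj; apply: hB; lia.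
  move=> [n _]; rewrite /F; case: ifPn => //; rewrite inE => Bn [[Du h] hB].
  have dn : dig (size w) u = n by rewrite h ?size_rcons// nth_rcons ltnn eqxx.
  split; first by split => // i iw; rewrite h ?size_rcons ?nth_rcons ?iw// (ltn_trans iw).
  move=> j; have [-> _|nj hj] := eqVneq j (size w); first by rewrite dn.
  by apply: hB; rewrite size_rcons; move: nj hj; lia.
split; first by rewrite FE; exact: bigcupT_measurable.
have tF : trivIset setT F.
  move=> i j _ _ [u []]; rewrite /F; case: ifP => // _ [[_ hi] _]; case: ifP => // _ [[_ hj] _].
  have := hi (size w); have := hj (size w); rewrite !size_rcons !nth_rcons ltnn eqxx.
  by move=> <- // <-.
have mB : pmf_law (B (size w)) = (\sum_(n <oo) pmf_law (B (size w) `&` [set n]))%E.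
  transitivity (pmf_law (\bigcup_n (B (size w) `&` [set n]))).
    by congr (pmf_law _); seteq => n; [move=> h; exists n|case=> ? _ []].
  apply/esym/cvg_lim => //; apply: measure_semi_sigma_additive => //.
  by move=> i j _ _ [n [[_ /= <-] [_ /= <-]]].
have -> : mu (fiber B w k.+1) = (\sum_(n <oo) mu (F n))%E.
  rewrite FE; apply/esym/cvg_lim => //; apply: measure_semi_sigma_additive => //.
  exact: bigcupT_measurable.
pose Q := \prod_((size w).+1 <= j < (size w).+1 + k) fine (pmf_law (B j)).
have Q0 : 0 <= Q by apply: prodr_ge0 => j _; exact: fine_ge0.
have [_ g2] := piece_ge0 w.
transitivity (\sum_(n <oo) ((piece w).2 * Q)%:E * pmf_law (B (size w) `&` [set n]))%E.
  apply: eq_eseriesr => n _; rewrite /F; case: ifPn => [|].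
    rewrite inE => Bn; rewrite (IH _).2 piece_rcons size_rcons -/Q.
    have -> : pmf_law (B (size w) `&` [set n]) = (p n)%:E.
      by rewrite -pmf_law1; congr (pmf_law _); seteq => z; [case|move=> /= ->].
    by rewrite -EFinM; congr EFin; rewrite /step /=; ring.
  rewrite notin_setE => Bn; rewrite measure0 (_ : B _ `&` [set n] = set0) ?measure0 ?mule0//.
  by seteq => z // [Bz /= E]; apply: Bn; rewrite -E.
rewrite nneseriesZl// -mB big_ltn; last by rewrite addnS ltnS leq_addr.
rewrite addnS -addSn -/Q.
have := @fin_num_measure _ _ _ pmf_law (B (size w)) I.
move=> /fineK {1}<-; rewrite -EFinM; congr _%:E; ring.
Qed.

Variables (G : groupType) (e : nat -> G) (eb : bijective e).

(** The digits of a uniform point are independent with law [p]; an enumeration of [G] distributes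
    them over the group. *)
Theorem iid_exists : exists m : probability (power_space G _ nat) R, is_product_measure pmf_law m.
Proof.
have [e' eK e'K] := eb.
pose f (u : RR) : power_space G _ nat := fun t => dig (e' t) u.
have mf : measT f by apply: power_meas => t; apply: dm_fun; exact: dig_dm.
pose F : {mfun RR >-> power_space G _ nat} := HB.pack f (isMeasurableFun.Build _ _ _ _ _ mf).
exists (distribution mu F) => s A us mA.
have mc := measurable_cylinder s mA.
have mfc : measurable (f @^-1` cylinder s A) by rewrite -[_ @^-1` _]setTI; exact: (mf measurableT _ mc).
rewrite -[LHS]/(mu (f @^-1` cylinder s A)) -(Dnull mfc).
pose N := \max_(t <- s) (e' t).+1; pose B j := if e j \in s then A (e j) else setT.
have -> : f @^-1` cylinder s A `&` D = fiber B [::] N.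
  seteq => u.
    by move=> [h Du]; split => // j _; rewrite /B; case: ifP => // js; have := h _ js; rewrite /f eK.
  move=> [[Du _] h]; split => // t ts; have := h (e' t); rewrite /B e'K ts; apply => /=.
  by rewrite add0n /N (big_rem t)//= leq_max leqnn.
rewrite (fiber_prob B [::] N).2 /= mul1r add0n; congr _%:E.
transitivity (\prod_(0 <= j < N | e j \in s) fine (pmf_law (A (e j)))).
  rewrite [RHS]big_mkcond; apply: eq_bigr => j _; rewrite /B; case: ifP => // _.
  by rewrite probability_setT.
rewrite -(big_map e (fun t => t \in s) (fun t => fine (pmf_law (A t)))) -big_filter.
apply: perm_big; apply: uniq_perm => //.
  by rewrite filter_uniq// map_inj_uniq ?iota_uniq//; exact: (can_inj eK).
move=> t; rewrite mem_filter; case: (boolP (t \in s)) => //= ts.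
apply/mapP; exists (e' t); rewrite ?e'K// mem_index_iota /=.
by rewrite /N (big_rem t)//= leq_max leqnn.
Qed.

End iid.

(** * Probability vectors with prescribed atoms and entropy *)

Section pmfs.
Variable R : realType.
Implicit Types x y r u v : R.

Definition eta x : R := - (x * ln x).
Definition H2 x : R := eta x + eta (1 - x).

Lemma eta_ge0 x : 0 <= x <= 1 -> 0 <= eta x.
Proof. by move=> /andP[x0 x1]; rewrite oppr_ge0 mulr_ge0_le0 ?ln_le0. Qed.

Lemma etaM x y : 0 <= x -> 0 <= y -> eta (x * y) = x * eta y + y * eta x.
Proof.
rewrite /eta le_eqVlt => /orP[/eqP <-|x0]; first by rewrite !mul0r oppr0 mulr0 addr0.
rewrite le_eqVlt => /orP[/eqP <-|y0]; first by rewrite mulr0 !mul0r oppr0 mulr0 addr0.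
by rewrite lnM ?posrE//; ring.
Qed.

Lemma ln_lt1 x : 0 < x -> x != 1 -> ln x < x - 1.
Proof.
move=> x0 x1; rewrite -ltr_expR lnK ?posrE//.
by have := @expR_gt1Dx R (x - 1); rewrite subr_eq0 [1 + _]addrC subrK; apply.
Qed.

Lemma ln_le1 x : 0 < x -> ln x <= x - 1.
Proof. by move=> x0; have [->|/ln_lt1/ltW] := eqVneq x 1; rewrite ?ln1 ?subrr//; apply. Qed.

(** Gibbs' inequality bounds [H2 y] by the cross entropy of [y] relative to [x], which is [H2 x]
    minus the nonnegative [(y - x) * (ln x - ln (1 - x))]. *)
Lemma H2_decr x y : 2^-1 <= x -> x < y -> y < 1 -> H2 y < H2 x.
Proof.
move=> x2 xy y1; have x0 : 0 < x by apply: lt_le_trans x2; rewrite invr_gt0.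
have y0 := lt_trans x0 xy; have x1 := lt_trans xy y1.
have [dx dy] : 0 < 1 - x /\ 0 < 1 - y by rewrite !subr_gt0.
have g1 : y * (ln x - ln y) < x - y.
  rewrite -ln_div ?posrE// -(ltr_pdivlMl _ _ y0); apply: lt_le_trans (ln_lt1 _ _) _.
  - exact: divr_gt0.
  - by rewrite lt_eqF// ltr_pdivrMr// mul1r.
  - by rewrite mulrBr mulVf ?lt0r_neq0// mulrC.
have g2 : (1 - y) * (ln (1 - x) - ln (1 - y)) <= y - x.
  rewrite -ln_div ?posrE// -(ler_pdivlMl _ _ dy); apply: le_trans (ln_le1 _) _; first exact: divr_gt0.
  have -> : y - x = (1 - x) - (1 - y) by ring.
  by rewrite mulrBr mulVf ?lt0r_neq0// [leLHS]addrC [leRHS]addrC mulrC.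
have lx : ln (1 - x) <= ln x by rewrite ler_ln ?posrE//; lra.
have g3 : 0 <= (y - x) * (ln x - ln (1 - x)) by rewrite mulr_ge0// subr_ge0// ltW.
rewrite /H2 /eta; nra.
Qed.

Lemma eta_split u r : 0 < u -> 0 < r -> u + r <= 1 -> eta u <= eta (u + r) + r.
Proof.
move=> u0 r0 ur; have ur0 : 0 < u + r by exact: addr_gt0.
have g : u * (ln (u + r) - ln u) <= r.
  rewrite -ln_div ?posrE// -(ler_pdivlMl _ _ u0); apply: le_trans (ln_le1 _) _; first exact: divr_gt0.
  by rewrite mulrDl divff ?lt0r_neq0// addrAC subrr add0r mulrC.
have l0 : ln (u + r) <= 0 by exact: ln_le0.
have : r * ln (u + r) <= 0 by rewrite mulr_ge0_le0 // ltW.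
rewrite /eta; nra.
Qed.

(** Take [r = s * s]: then [eta r] is [2 * s * (s * - ln s)], and [- ln s < 1 / s]. *)
Lemma small_eta (gap delta : R) : 0 < gap -> 0 < delta -> exists r, [/\ 0 < r, r < delta & r + eta r < gap].
Proof.
move=> g0 d0; pose s := Num.min (gap / 4) (Num.min delta 2^-1).
have s0 : 0 < s by rewrite !lt_min !divr_gt0//= d0 invr_gt0 ltr0n.
have [s1 s2 s3] : [/\ s <= gap / 4, s <= delta & s <= 2^-1].
  by rewrite /s; split; rewrite !ge_min lexx ?orbT.
exists (s * s); split; [exact: mulr_gt0| |].
  apply: lt_le_trans s2; rewrite gtr_pMl//; apply: le_lt_trans s3 _; rewrite invf_lt1 ?ltr1n//.
have : - ln s < s^-1 by rewrite -lnV ?posrE//; apply: ln_sublinear; rewrite invr_gt0.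
rewrite -(ltr_pM2l s0) mulfV ?lt0r_neq0// => h.
have -> : s * s + eta (s * s) = s * s + 2 * s * (s * - ln s) by rewrite /eta lnM ?posrE//; ring.
have : 2 * s * (s * - ln s) <= 2 * s by rewrite ler_piMr ?mulr_ge0 ?ltW.
have : s * s <= s * 2^-1 by rewrite ler_pM2l.
move=> h1 h2; lra.
Qed.

(** The marker probability [(1 - v) * v ^+ k] of a two-atom base takes its value at [v = 1 - p] once
    more beyond [p], where the entropy is smaller. A third atom [r] is split off there, so small
    that its entropy does not use up the gain. *)
Lemma two_atom_triple (k : nat) (p : R) : (1 < k)%N -> 2^-1 <= p -> p < 1 ->
  exists u v r, [/\ 0 < u, 0 < v, 0 < r, u + v + r = 1 &
    u * v ^+ k = p * (1 - p) ^+ k /\ eta u + eta v + eta r < H2 p].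
Proof.
move=> k1 p2 p1; set al := p * (1 - p) ^+ k.
have p0 : 0 < p by apply: lt_le_trans p2; rewrite invr_gt0.
have q0 : 0 < 1 - p by rewrite subr_gt0.
pose F (v : R^o) : R^o := (1 - v) * v ^+ k.
have cF r : continuous (fun v : R^o => (1 - v - r) * v ^+ k - al : R^o).
  move=> v; apply: cvgB; last exact: cvg_cst.
  apply: cvgM; last exact: exprn_continuous.
  by apply: cvgB; [apply: cvgB; [exact: cvg_cst|exact: cvg_id]|exact: cvg_cst].
have [c [pc c1 Fc]] : exists c, [/\ p < c, c < 1 & al < F c].
  (* For [p > 1/2] the value of [F] at [p] exceeds [al] because [k > 1], and [c] is taken slightly
     larger. At [p = 1/2] the two are equal, and [2 / 3] works because [(4 / 3) ^ 2 / 3 > 1 / 2]. *)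
  have [pE|pn] := eqVneq p 2^-1.
    exists (2 / 3); split; [by rewrite pE; lra|by lra|].
    rewrite /al /F pE; have -> : 1 - 2^-1 = 2^-1 :> R by lra.
    have -> : (1 - 2 / 3) * (2 / 3) ^+ k = (2^-1) ^+ k * ((4 / 3) ^+ k * 3^-1) :> R.
      have -> : (2 / 3) ^+ k = (2^-1) ^+ k * (4 / 3) ^+ k :> R.
        by rewrite -exprMn; congr (_ ^+ _); lra.
      have -> : 1 - 2 / 3 = 3^-1 :> R by lra.
      ring.
    rewrite mulrC ltr_pM2l ?exprn_gt0 ?invr_gt0//.
    have : (4 / 3) ^+ 2 <= (4 / 3) ^+ k :> R by rewrite ler_eXn2l//; lra.
    rewrite expr2; lra.
  have pp : 2^-1 < p by rewrite lt_neqAle eq_sym pn.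
  have Fp : 0 < (1 - p - 0) * p ^+ k - al.
    rewrite subr0 subr_gt0 /al -(prednK (ltnW k1)) !exprS.
    have -> : p * ((1 - p) * (1 - p) ^+ k.-1) = ((1 - p) * p) * (1 - p) ^+ k.-1 by ring.
    have kp : (0 < k.-1)%N by lia.
    have pq : 1 - p < p by lra.
    by rewrite mulrA ltr_pM2l ?mulr_gt0// ltr_pXn2r ?nnegrE// ltW.
  have nb : \forall v \near (p : R^o), 0 < (1 - v - 0) * v ^+ k - al by apply: cvgr_gt (cF 0 p) _ _.
  have /nbhs_ballP[ep /= ep0 epF] := nb.
  exists (p + Num.min ep (1 - p) / 2).
  have m0 : 0 < Num.min ep (1 - p) by rewrite lt_min ep0.
  have [m1 m2] : Num.min ep (1 - p) <= ep /\ Num.min ep (1 - p) <= 1 - p by rewrite !ge_min !lexx orbT.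
  split; [by lra|by lra|].
  have := epF (p + Num.min ep (1 - p) / 2); rewrite /= subr0 subr_gt0; apply.
  rewrite /ball /= opprD addNKr normrN ger0_norm ?divr_ge0// ?ltW//; lra.
have c0 : 0 < c := lt_trans p0 pc.
have dH : 0 < H2 p - H2 c by rewrite subr_gt0 H2_decr.
have d0 : 0 < Num.min (F c - al) (1 - c) by rewrite lt_min !subr_gt0 Fc.
have [r [r0 rd rg]] := small_eta dH d0.
move: rd; rewrite lt_min => /andP[rF rc].
have [v] : exists2 v, v \in `[c, 1 - r] & (1 - v - r) * v ^+ k - al = 0.
  apply: IVT; first by lra.
    exact/continuous_subspaceT/cF.
  have al0 : 0 < al by rewrite mulr_gt0// exprn_gt0.
  have hc : 0 <= (1 - c - r) * c ^+ k - al.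
    have ck1 : c ^+ k <= 1 by rewrite exprn_ile1// ltW.
    have ck0 : 0 < c ^+ k by rewrite exprn_gt0.
    have : r * c ^+ k <= r by rewrite ler_piMr// ltW.
    by move: rF; rewrite /F mulrBl; lra.
  have h1 : (1 - (1 - r) - r) * (1 - r) ^+ k - al <= 0.
    have -> : 1 - (1 - r) - r = 0 by ring.
    by rewrite mul0r sub0r oppr_le0 ltW.
  by rewrite ge_min le_max hc h1 !orbT.
rewrite in_itv /= => /andP[cv vr] /eqP; rewrite subr_eq0 => /eqP E.
have v0 : 0 < v by exact: lt_le_trans cv.
have u0 : 0 < 1 - v - r.
  have : 0 < (1 - v - r) * v ^+ k by rewrite E mulr_gt0// exprn_gt0.
  by rewrite pmulr_lgt0// exprn_gt0.
exists (1 - v - r), v, r; split => //; first by ring.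
split => //; have h1 := @eta_split (1 - v - r) r u0 r0; rewrite subrK in h1.
have h2 : H2 v <= H2 c.
  have [->//|vc] := eqVneq v c; apply: ltW; apply: H2_decr; [by lra|by rewrite lt_neqAle eq_sym vc|by lra].
have h3 : eta (1 - v - r) <= eta (1 - v) + r by apply: h1; lra.
by move: h2 h3 rg; rewrite /H2; lra.
Qed.

Definition pmf_ent (p : nat -> R) : \bar R := (\sum_(n <oo) (eta (p n))%:E)%E.
Definition is_pmf (p : nat -> R) := (forall n, 0 <= p n) /\ (\sum_(n <oo) (p n)%:E = 1)%E.

Lemma pmf_le1 p : is_pmf p -> forall n, p n <= 1.
Proof.
move=> [p0 p1] n; rewrite -lee_fin -p1; apply: le_trans (nneseries_lim_ge n.+1 _) => [|k _ _]; last by rewrite lee_fin.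
by rewrite big_nat_recr//= leeDr// sume_ge0 => [//|k _]; rewrite lee_fin.
Qed.

Lemma pmf_eta0 p : is_pmf p -> forall n, (0 <= (eta (p n))%:E)%E.
Proof. by move=> hp n; rewrite lee_fin eta_ge0// hp.1 pmf_le1. Qed.

Lemma fin_series N (f : nat -> R) : (forall n, (N <= n)%N -> f n = 0) ->
  (\sum_(n <oo) (f n)%:E = (\sum_(0 <= n < N) f n)%:E)%E.
Proof.
move=> f0; apply: cvg_lim => //; apply: cvg_near_cst; exists N => // M /= NM.
rewrite (big_cat_nat (leq0n N) NM) /= [X in (_ + X)%E]big_nat_cond [X in (_ + X)%E]big1 ?adde0 ?sumEFin//.
by move=> n /andP[/andP[Nn _] _]; rewrite f0.
Qed.

(** One atom [1 - x] and [N] atoms [x / N], where [ln N > 2 * H]: the entropy is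
    [eta (1 - x) + eta x + x * ln N], at least [H] for [x = 1/2] and at most [H] for small [x]. *)
Lemma pmf_finite_ent (H : R) : 0 < H -> exists q, is_pmf q /\ pmf_ent q = H%:E.
Proof.
move=> H0; have [N0 _ hN] := near_infty_natSinv_lt (PosNum (expR_gt0 (- (2 * H)))).
pose N := N0.+1; have NH : (N%:R : R)^-1 < expR (- (2 * H)) by exact: (hN N0 (leqnn _)).
have Np : 0 < N%:R :> R by rewrite ltr0n.
have lnN : 2 * H < ln (N%:R : R).
  by rewrite -ltrN2 -lnV ?posrE// -ltr_expR lnK// posrE invr_gt0.
pose f (x : R^o) : R^o := eta (1 - x) + eta x + x * ln N%:R.
have d0 : 0 < Num.min 2^-1 (H / (4 * ln (N%:R : R))).
  by rewrite lt_min invr_gt0 ltr0n divr_gt0// mulr_gt0//; lra.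
have [r [r0 r1 rH]] := small_eta (divr_gt0 H0 (ltr0Sn _ 1)) d0.
move: r1; rewrite lt_min => /andP[r2 rN].
have lN0 : 0 < ln (N%:R : R) by lra.
have rlN : r * ln (N%:R : R) <= H / 4.
  move: rN; rewrite invfM mulrA => /ltW; rewrite ler_pdivlMr// => h; exact: h.
have er : eta (1 - r) <= r.
  have := @ln_le1 (1 - r)^-1; rewrite invr_gt0 lnV ?posrE ?subr_gt0; last by lra.
  have q0 : 0 < 1 - r by lra.
  have r1 : r < 1 by lra.
  move=> /(_ r1); rewrite -(ler_pM2l q0) mulrBr mulfV ?lt0r_neq0// mulr1 /eta; lra.
have [x] : exists2 x, x \in `[r, 2^-1] & f x = H.
  apply: IVT; first exact: ltW.
    apply: continuous_in_subspaceT => x; rewrite inE /= in_itv /= => /andP[rx x2].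
    apply: cvgD; last by apply: cvgM; [exact: cvg_id|exact: cvg_cst].
    have cid : (fun x : R^o => x : R^o) y @[y --> x] --> (x : R^o) by exact: cvg_id.
    have c1 : (1 - y : R^o) @[y --> x] --> (1 - x : R^o) by apply: cvgB; [exact: cvg_cst|exact: cid].
    apply: cvgD; apply: cvgN; apply: cvgM => //.
      by apply: (cvg_comp _ _ c1); apply: continuous_ln; lra.
    by apply: continuous_ln; lra.
  have lo : f r <= H by rewrite /f; move: rH er rlN; lra.
  have hi : H <= f 2^-1.
    have : 0 <= eta (1 - 2^-1) /\ 0 <= eta 2^-1 by split; apply: eta_ge0; lra.
    by move=> [h1 h2]; rewrite /f; lra.
  by rewrite ge_min le_max lo hi !orbT.
rewrite in_itv /= => /andP[rx x2] fx; have x0 : 0 < x by exact: lt_le_trans rx.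
pose q (n : nat) : R := if n == 0%N then 1 - x else if (n <= N)%N then x / N%:R else 0.
have q0 n : 0 <= q n by rewrite /q; case: ifP => // _; [lra|case: ifP => // _; rewrite divr_ge0// ltW].
have sumq (g : R -> R) : g 0 = 0 -> (\sum_(n <oo) (g (q n))%:E = (g (1 - x) + N%:R * g (x / N%:R))%:E)%E.
  move=> g0; rewrite (@fin_series N.+1) => [|n Nn]; last by case: n Nn => // n Nn; rewrite /q /= leqNgt Nn /= g0.
  congr EFin; rewrite big_nat_recl//; congr (_ + _).
  rewrite (eq_big_nat _ _ (F2 := fun=> g (x / N%:R))); last by move=> i /andP[_ iN]; rewrite /q /= iN.
  by rewrite sumr_const_nat subn0 mulr_natl.
exists q; split; first split => //.
  by rewrite (sumq id)//; congr EFin; rewrite mulrCA divff ?lt0r_neq0// mulr1 subrK.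
rewrite /pmf_ent sumq; last by rewrite /eta mul0r oppr0.
have eN : eta (N%:R^-1) = N%:R^-1 * ln N%:R by rewrite /eta lnV ?posrE// mulrN opprK.
congr EFin; rewrite -fx /f etaM ?invr_ge0 ?(ltW x0) ?(ltW Np)// eN.
by field; rewrite lt0r_neq0.
Qed.

(** The differences of [1 / (1 + ln (n + 1))]. Since [q n <= 1 / (n + 1)], the tail of the entropy
    series from [N] on is at least [L N * t N / 2], hence at least [1 / 4], whereas a convergent
    series has vanishing tails. *)
Lemma pmf_infinite_ent : exists q, is_pmf q /\ pmf_ent q = +oo%E.
Proof.
pose L n : R := ln n.+1%:R; pose t n : R := (1 + L n)^-1.
have L0 n : 0 <= L n by rewrite ln_ge0// ler1n.
have Lp n : 0 < 1 + L n by rewrite ltr_pwDl.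
have LS n : L n.+1 - L n <= n.+1%:R^-1.
  rewrite /L -ln_div ?posrE ?ltr0n//; apply: le_trans (ln_le1 _) _; first by rewrite divr_gt0 ?ltr0n.
  by rewrite -[n.+2]addn1 natrD mulrDl divff ?pnatr_eq0// addrAC subrr add0r mul1r.
have Llt n : L n < L n.+1 by rewrite ltr_ln ?posrE ?ltr0n// ltr_nat.
have Lmono m n : (m <= n)%N -> L m <= L n by move=> mn; rewrite ler_ln ?posrE ?ltr0n// ler_nat.
pose q n := t n - t n.+1.
have qE n : q n = (L n.+1 - L n) * (t n * t n.+1).
  by rewrite /q /t; field; rewrite !lt0r_neq0.
have t1 n : 0 < t n <= 1 by rewrite /t invr_gt0 Lp /= invf_le1 ?Lp// lerDl.
have qp n : 0 < q n.
  by rewrite qE mulr_gt0 ?subr_gt0// mulr_gt0; [|case/andP: (t1 n)|case/andP: (t1 n.+1)].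
have qle n : q n <= n.+1%:R^-1.
  have tt : t n * t n.+1 <= 1.
    by case/andP: (t1 n) => a1 a2; case/andP: (t1 n.+1) => b1 b2; rewrite mulr_ile1// ltW.
  by rewrite qE; apply: le_trans (LS n); rewrite ler_piMr// subr_ge0 ltW.
have sumq m n : (m <= n)%N -> \sum_(m <= i < n) q i = t m - t n.
  move=> mn; rewrite /q -[RHS]opprB -(telescope_sumr t mn) -sumrN.
  by apply: eq_bigr => i _; rewrite opprB.
have t0 ep : 0 < ep -> exists N0, forall n, (N0 <= n)%N -> t n < ep.
  move=> ep0; have [N0 _ hN] := near_infty_natSinv_lt (PosNum (expR_gt0 (- ep^-1))).
  exists N0 => n nN; have h := hN n nN; rewrite /= in h.
  have : ep^-1 < L n by rewrite -ltrN2 -lnV ?posrE ?ltr0n// -ltr_expR lnK// posrE invr_gt0 ltr0n.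
  by rewrite /t => h'; rewrite -[ep]invrK ltf_pV2 ?posrE ?invr_gt0//; lra.
have qpmf : is_pmf q.
  split => [n|]; first exact: ltW.
  have t00 : t 0%N = 1 by rewrite /t (_ : L 0%N = 0) ?addr0 ?invr1//; exact: ln1.
  apply: cvg_lim => //; rewrite (_ : (fun n => _) = (fun n => (1 - t n)%:E)); last first.
    by apply/funext => n; rewrite sumEFin sumq// t00.
  apply: cvg_EFin; first exact: nearW.
  rewrite -[X in _ --> X]subr0; apply: (@cvgB _ R^o); first exact: cvg_cst.
  apply/cvgr0Pnorm_lt => ep ep0; have [N0 h] := t0 ep ep0; exists N0 => // n /= nN.
  by rewrite ger0_norm ?h// ltW//; case/andP: (t1 n).
exists q; split => //; apply/eqP; apply: contraT => nfin.
have fin : (pmf_ent q < +oo)%E by rewrite ltey.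
have e0 := pmf_eta0 qpmf.
have tail := nneseries_tail_cvg fin (fun k _ => e0 k).
have [N2 _ h2] := near_infty_natSinv_lt (PosNum (expR_gt0 (- 1 : R))).
suff : ((4^-1 : R)%:E <= 0)%E by rewrite lee_fin; lra.
rewrite -(cvg_lim _ tail)//; apply: lime_ge; first by apply/cvg_ex; exists 0%E.
exists N2 => // N /= N2N; have LN : 1 <= L N.
  have := h2 N N2N => /= h; apply: ltW.
  by rewrite -ltrN2 -lnV ?posrE ?ltr0n// -ltr_expR lnK// posrE invr_gt0 ltr0n.
have [M0 hM] := t0 (t N / 2) (divr_gt0 (andP (t1 N)).1 (ltr0Sn _ 1)).
pose M := maxn N M0; have NM : (N <= M)%N := leq_maxl _ _.
apply: (via (\sum_(N <= k < M) (eta (q k))%:E)%E); last exact: nneseries_lim_ge.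
rewrite sumEFin lee_fin; apply: (via (\sum_(N <= k < M) q k * L N)).
  rewrite -mulr_suml sumq//; have := hM M (leq_maxr _ _).
  have tN : t N * (1 + L N) = 1 by rewrite /t mulVf// lt0r_neq0.
  have tp : 0 < t N by case/andP: (t1 N).
  nra.
rewrite big_nat_cond [leRHS]big_nat_cond; apply: ler_sum => k /andP[/andP[Nk _] _].
rewrite /eta -mulrN ler_pM2l//; apply: le_trans (Lmono _ _ Nk) _.
by rewrite lerNr -lnV ?posrE ?ltr0n// ler_ln ?posrE ?invr_gt0 ?ltr0n.
Qed.

Lemma pmf_with_ent (H : \bar R) : (0 <= H)%E -> exists q, is_pmf q /\ pmf_ent q = H.
Proof.
case: H => [H|_|//]; last exact: pmf_infinite_ent.
rewrite lee_fin le_eqVlt => /orP[/eqP <-|/pmf_finite_ent//].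
exists (fun n => (n == 0%N)%:R); split; first split => [n|]; first exact: ler0n.
  by rewrite (@fin_series 1) ?big_nat1// => -[].
rewrite /pmf_ent (@fin_series 1) ?big_nat1 /eta ?ln1 ?mulr0 ?oppr0//.
by move=> [|n] // _; rewrite mul0r oppr0.
Qed.

(** The mass [r] is distributed by a law [q] of entropy [(h - s) / r]; by [etaM] it contributes
    [eta r + r * pmf_ent q]. *)
Lemma pmf_extend u v r (h : \bar R) : 0 < u -> 0 < v -> 0 < r -> u + v + r = 1 ->
  ((eta u + eta v + eta r)%:E <= h)%E ->
  exists p, [/\ is_pmf p, pmf_ent p = h, p 0%N = u & p 1%N = v].
Proof.
move=> u0 v0 r0 uvr; set s := _ + eta r => sh.
have h0 : (0 <= (h - s%:E) * (r^-1)%:E)%E by rewrite mule_ge0 ?lee_fin ?invr_ge0 ?(ltW r0)// sube_ge0.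
have [q [[q0 q1] qH]] := pmf_with_ent h0.
pose p n := if n is n'.+1 then if n' is n''.+1 then r * q n'' else v else u.
have split2 (g : R -> R) : (forall n, 0 <= g (p n)) ->
    (\sum_(n <oo) (g (p n))%:E = (g u + g v)%:E + \sum_(n <oo) (g (r * q n))%:E)%E.
  move=> g0; have g0' n : (0 <= (g (p n))%:E)%E by rewrite lee_fin.
  rewrite (nneseries_split 0 2) => [|k _]; last exact: g0'.
  rewrite add0n big_ltn// big_nat1 -EFinD; congr (_ + _)%E.
  by rewrite -nneseries_addn//; [apply: eq_eseriesr => k _; rewrite addn2].
have p0 n : 0 <= p n by case: n => [|[|n]] /=; [exact: ltW|exact: ltW|rewrite mulr_ge0// ltW].
have pm : is_pmf p.
  split => //; rewrite (split2 id)//; under eq_eseriesr do rewrite EFinM.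
  rewrite nneseriesZl; last by move=> n _; rewrite lee_fin.
  by rewrite q1 mule1 -EFinD uvr.
exists p; split => //; rewrite /pmf_ent (split2 eta); last by move=> n; rewrite eta_ge0// p0 pmf_le1.
have qm : is_pmf q by split.
have qe n : (0 <= (eta (q n))%:E)%E := pmf_eta0 qm n.
have re : 0 <= eta r by rewrite eta_ge0// (ltW r0) /= ; lra.
have -> : (\sum_(n <oo) (eta (r * q n))%:E = \sum_(n <oo) (r%:E * (eta (q n))%:E + (eta r)%:E * (q n)%:E))%E.
  by apply: eq_eseriesr => n _; rewrite etaM ?(ltW r0)// EFinD !EFinM [((q n)%:E * _)%E]muleC.
rewrite nneseriesD; [|by move=> *; apply: mule_ge0; [rewrite lee_fin ltW|exact: qe]|by move=> *; apply: mule_ge0; rewrite lee_fin].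
rewrite !nneseriesZl; [|by move=> n _; rewrite lee_fin|by move=> n _; exact: qe].
rewrite q1 mule1 -/(pmf_ent q) qH muleCA -EFinM divff ?lt0r_neq0// mule1.
by rewrite addeCA -EFinD -/s subeK.
Qed.

End pmfs.

(** * Windows available in an arbitrary infinite group *)

Section subgroups.
Local Open Scope group_scope.
Variables (R : realType) (G : groupType) (e : nat -> G) (eb : bijective e).

Definition scheme_on (W : seq G) := exists W1 : 1 \notin W,
  [/\ uniq W, forall t u, meets W t u -> t <> u -> u \in win W t \/ t \in win W u &
   exists A0 tau D U, marker_scheme R W1 A0 tau D U].

Lemma subgroup_scheme (W : seq G) : 1 \notin W -> uniq W ->
  (forall g h, g \in 1 :: W -> h \in 1 :: W -> g * h \in 1 :: W) ->
  (forall g, g \in 1 :: W -> g^-1 \in 1 :: W) -> scheme_on W.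
Proof.
move=> W1 Wu HM HV; exists W1; split => //; first exact: (coset_meets HM HV).
by do 4 eexists; exact: (coset_scheme R eb W1 Wu HM HV).
Qed.

Lemma pow_mod (a : G) n m : a ^+ n = 1 -> a ^+ m = a ^+ (m %% n).
Proof. by move=> an; rewrite {1}(divn_eq m n) expgnDr mulnC expgnA an expg1n mul1g. Qed.

(** Two further window sites are what [two_atom_triple] asks for. An element [a] of infinite order
    gives [a] and [a ^+ 2]. Otherwise an element with nontrivial square generates a cyclic group of
    order at least three. Otherwise all squares are trivial, [G] is abelian, and two distinct
    nontrivial elements generate a Klein four-group. *)
Lemma large_scheme : exists2 W : seq G, (1 < size W)%N & scheme_on W.
Proof.
have [[a a_inf]|tor] := pselect (exists a : G, forall n, (0 < n)%N -> a ^+ n <> 1).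
  exists [:: a; a ^+ 2] => //; exists (tri_uniq a_inf).1; split; [exact: (tri_uniq a_inf).2|exact: (tri_meets (a := a))|].
  by do 4 eexists; exact: (tri_scheme R eb a_inf).
have {}tor (a : G) : exists n, (0 < n)%N && (a ^+ n == 1).
  apply: contrapT => h; apply: tor; exists a => n n0 an; apply: h; exists n; by rewrite n0 an eqxx.
have [[a [a1 a2]]|sq] := pselect (exists a : G, a <> 1 /\ a * a <> 1).
  case: (ex_minnP (tor a)) => n /andP[n0 /eqP an] nmin.
  have n3 : (2 < n)%N.
    case: n n0 an {nmin} => [//|[|[|//]]] _; first by rewrite expg1.
    by rewrite expg2.
  have inj i j : (i < n)%N -> (j < n)%N -> a ^+ i = a ^+ j -> i = j.
    wlog ij : i j / (i <= j)%N => [h i_n j_n E|i_n j_n E].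
      by case: (leqP i j) => [/h ->//|/ltnW/h ->].
    apply/eqP; rewrite eqn_leq ij leqNgt -subn_gt0; apply/negP => d0.
    have := nmin (j - i)%N; rewrite d0 expgnFr// E mulgV eqxx => /(_ isT).
    by rewrite leqNgt (leq_ltn_trans (leq_subr _ _) j_n).
  have HE : 1 :: [seq a ^+ i.+1 | i <- iota 0 n.-1] = [seq a ^+ i | i <- iota 0 n].
    by rewrite -{2}(prednK n0) /= expg0 (iotaDl 1) -map_comp; congr (_ :: _); apply: eq_map.
  have HP g : g \in [seq a ^+ i | i <- iota 0 n] <-> exists i, g = a ^+ i.
    split => [/mapP[i _ ->]|[i ->]]; first by exists i.
    by rewrite (pow_mod i an) map_f// mem_iota ltn_mod.
  have Hu : uniq [seq a ^+ i | i <- iota 0 n].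
    by rewrite map_inj_in_uniq ?iota_uniq// => i j; rewrite !mem_iota /= => i_n j_n; exact: inj.
  exists [seq a ^+ i.+1 | i <- iota 0 n.-1]; first by rewrite size_map size_iota; lia.
  have [W1 Wu] : 1 \notin [seq a ^+ i.+1 | i <- iota 0 n.-1] /\ uniq [seq a ^+ i.+1 | i <- iota 0 n.-1].
    by move: Hu; rewrite -HE /= => /andP[].
  apply: subgroup_scheme => // [g h|g]; rewrite HE.
    by move=> /HP[i ->] /HP[j ->]; apply/HP; exists (i + j)%N; rewrite expgnDr.
  move=> /HP[i ->]; apply/HP; exists (n * i - i)%N; rewrite expgnFr ?leq_pmull//.
  by rewrite expgnA an expg1n mul1g.
have {}sq (g : G) : g * g = 1.
  have [->|/eqP g1] := eqVneq g 1; first by rewrite mulg1.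
  by apply: contrapT => h; apply: sq; exists g.
have inv (g : G) : g^-1 = g by apply: (mulgI g); rewrite mulgV sq.
have com (g h : G) : g * h = h * g by rewrite -[LHS]inv invgM !inv.
have einj : injective e := bij_inj eb.
have [a a1] : exists a : G, a != 1.
  have [E0|] := eqVneq (e 0%N) 1; last by exists (e 0%N).
  by exists (e 1%N); rewrite -E0 (inj_eq einj).
have [b [b1 ba]] : exists b : G, b != 1 /\ b != a.
  apply: contrapT => h; have h' n : (e n == 1) || (e n == a).
    by apply: contrapT => /negP; rewrite negb_or => /andP[h1 h2]; apply: h; exists (e n).
  have d i j : (i < j)%N -> e i != e j by move=> ij; rewrite (inj_eq einj) ltn_eqF.
  have := d 0%N 1%N isT; have := d 1%N 2%N isT; have := d 0%N 2%N isT.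
  by case/orP: (h' 0%N) => /eqP ->; case/orP: (h' 1%N) => /eqP ->; case/orP: (h' 2%N) => /eqP ->; rewrite ?eqxx.
pose W := [:: a; b; a * b].
have HP g : g \in 1 :: W <-> exists i j, g = a ^+ i * b ^+ j.
  split => [|[i [j ->]]].
    rewrite !inE => /or4P[] /eqP ->; [exists 0%N, 0%N|exists 1%N, 0%N|exists 0%N, 1%N|exists 1%N, 1%N];
      by rewrite ?expg0 ?expg1 ?mul1g ?mulg1.
  rewrite (@pow_mod a 2 i) ?expg2// (@pow_mod b 2 j) ?expg2// !modn2.
  by case: (odd i); case: (odd j); rewrite ?expg0 ?expg1 ?mul1g ?mulg1 !inE eqxx ?orbT.
exists W => //; apply: subgroup_scheme => [|| g h /HP[i [j ->]] /HP[k [l ->]]|g]; last by rewrite inv.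
- rewrite !inE !negb_or ![1 == _]eq_sym a1 b1 /=; apply/eqP => E; move/eqP: ba; apply.
  by rewrite -[b]mul1g -(sq a) -mulgA E mulg1.
- rewrite /= !inE !negb_or eq_sym ba /= andbT; apply/andP; split.
    by rewrite -{1}[a]mulg1 (inj_eq (mulgI a)) eq_sym.
  by rewrite -{1}[b]mul1g (inj_eq (mulIg b)) eq_sym.
- apply/HP; exists (i + k)%N, (j + l)%N; rewrite !expgnDr -!mulgA; congr (_ * _).
  by rewrite !mulgA; congr (_ * _); rewrite com.
Qed.

Lemma single_scheme : scheme_on [::].
Proof.
apply: subgroup_scheme => // [g h|g]; rewrite !inE; first by move=> /eqP -> /eqP ->; rewrite mulg1.
by move=> /eqP ->; rewrite invg1.
Qed.

End subgroups.

(** * The chain of bases *)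

Section chain.
Variables (R : realType) (G : groupType) (e : nat -> G) (eb : bijective e).

Let bent dL (L : measurableType dL) (la : probability L R) : \bar R :=
  (\int[la]_l linfo la l)%E.
Notation nat_space := (power_space G _ nat).

Record nat_system (p : nat -> R) (rho : probability nat R) (m : probability nat_space R) : Prop := {
  ns_product : is_product_measure rho m ;
  ns_atom : forall n, rho [set n] = (p n)%:E ;
  ns_ent : bent rho = pmf_ent p }.

Lemma nat_system_exists p : is_pmf p -> exists rho m, nat_system p rho m.
Proof.
move=> [p0 p1]; have [m mP] := iid_exists p0 p1 eb.
exists (pmf_law p), m; split => //; first exact: (pmf_law1 p0 p1).
rewrite /bent (info_shannon _ nat_base) /shannon_entropy asboolT; last first.
  by exists setT; split; [exact: countableP|exact: measurableT|exact: probability_setT].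
have e0 n : (0 <= (eta (p n))%:E)%E := pmf_eta0 (conj p0 p1) n.
rewrite /pmf_ent nneseries_esumT//; apply: eq_esum => n _; by rewrite (pmf_law1 p0 p1).
Qed.

Lemma nat_marked p rho m i j : i != j -> nat_system p rho m ->
  marked_base rho m (fun n k : nat => n == k) first_bit [set i] [set j].
Proof.
move=> /eqP ij [mP _ _]; split => //; first exact: nat_base.
by seteq => // n [/= -> E]; apply: ij.
Qed.

(** Windows with a single site are used here, so that a marker is one letter and its probability is
    the shared atom [p i]. *)
Lemma nat_iso p p' p'' rho rho' rho'' m m' m'' i j : i != j ->
  nat_system p rho m -> nat_system p' rho' m' -> nat_system p'' rho'' m'' ->
  0 < p i < 1 -> p i = p' i -> p i = p'' i -> pmf_ent p = pmf_ent p' -> (pmf_ent p'' < pmf_ent p)%E ->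
  exists f f', ae_iso m m' (@vshift G _ nat) (@vshift G _ nat) f f'.
Proof.
move=> ij s s' s'' pi p1 p2 h1 h2; have [W1 [Wu Wm [A0 [tau [D [U ms]]]]]] := single_scheme R eb.
have al q r (n : probability nat_space R) : nat_system q r n -> alpha ([::] : seq G) r [set i] [set j] = q i.
  by move=> sq; rewrite /alpha expr0 mulr1 (ns_atom sq).
apply: (marker_iso eb Wu Wm ms (nat_marked ij s) (nat_marked ij s') (nat_marked ij s'')).
- by rewrite (al _ _ _ s).
- by rewrite (al _ _ _ s) (al _ _ _ s').
- by rewrite (al _ _ _ s) (al _ _ _ s'').
- by rewrite -/(bent rho) -/(bent rho') (ns_ent s) (ns_ent s').
- by rewrite -/(bent rho) -/(bent rho'') (ns_ent s) (ns_ent s'').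
Qed.

Section base.
Variables (dL : measure_display) (L : measurableType dL) (la : probability L R).
Variables (b : L -> nat -> bool) (dec : (nat -> bool) -> L)
  (cb : coded_base b dec).
Variables (m : probability (power_space G dL L) R) (mP : is_product_measure la m).

Lemma event_ent (S : set L) : measurable S -> 0 < fine (la S) < 1 ->
  ((H2 (fine (la S)))%:E <= bent la)%E.
Proof.
move=> mS /andP[s0 s1]; apply: le_trans (info_split la cb mS).
have sE : la S = (fine (la S))%:E by rewrite fineK ?fin_num_measure.
have cE : la (~` S) = (1 - fine (la S))%:E.
  by apply: (etrans (probability_setC la mS)); rewrite EFinB -sE.
have cE' : fine (la (~` S)) = 1 - fine (la S) by rewrite cE.
rewrite cE' cE [in (la S * _)%E]sE /nl !gt_eqF ?subr_gt0// -!EFinM -EFinD lee_fin /H2 /eta !mulrN.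
exact: lexx.
Qed.

(** [two_atom_triple] matches the marker probability of [S] by atoms [u] and [v] at smaller entropy.
    Spreading the remaining mass [r] up to the full entropy gives the base linked to [L]; the law
    [q], of entropy just that of the triple, gives the third base of [marker_iso]. *)
Lemma link_nat (S : set L) : measurable S -> 0 < fine (la S) < 1 ->
  exists p rho n u v r, [/\ nat_system p rho n, pmf_ent p = bent la, p 0%N = u,
    [/\ 0 < u, 0 < v, 0 < r, u + v + r = 1 & ((eta u + eta v + eta r)%:E < bent la)%E] &
    exists f f', ae_iso m n (@vshift G dL L) (@vshift G _ nat) f f'].
Proof.
move=> mS s01.
(* [two_atom_triple] asks for a set of mass at least one half, so [S] may be replaced by its
   complement. *)
wlog s2 : S mS s01 / 2^-1 <= fine (la S) => [wl|].
  have [h|h] := leP 2^-1 (fine (la S)); first exact: (wl S mS s01 h).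
  have cE : fine (la (~` S)) = 1 - fine (la S).
    have -> : la (~` S) = (1 - la S)%E := probability_setC la mS.
    by rewrite -{1}(fineK (fin_num_measure la S mS)).
  by apply: (wl (~` S)); [exact: measurableC|rewrite cE; lra|rewrite cE; lra].
have [W k1 [W1 [Wu Wm [A0 [tau [D [U ms]]]]]]] := large_scheme R eb.
have [s0 s1] := andP s01.
have [u [v [r [u0 v0 r0 uvr [uv ulH]]]]] := two_atom_triple k1 s2 s1.
have hl := event_ent mS s01.
have lt : ((eta u + eta v + eta r)%:E < bent la)%E by apply: lt_le_trans hl; rewrite lte_fin.
have [p [pp ph p0 p1]] := pmf_extend u0 v0 r0 uvr (ltW lt).
have [q [qp qh q0 q1]] := pmf_extend u0 v0 r0 uvr (lexx _).
have [rho [n sn]] := nat_system_exists pp; have [rho' [n' sn']] := nat_system_exists qp.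
exists p, rho, n, u, v, r; split => //.
have cE : fine (la (~` S)) = 1 - fine (la S).
  have -> : la (~` S) = (1 - la S)%E := probability_setC la mS.
  by rewrite -{1}(fineK (fin_num_measure la S mS)).
have bl : marked_base la m b dec S (~` S) by split => //; [exact: measurableC|exact: setICr].
have alN q' r' n0 : nat_system q' r' n0 -> q' 0%N = u -> q' 1%N = v ->
    alpha W la S (~` S) = alpha W r' [set 0%N] [set 1%N].
  by move=> sq e0 e1; rewrite /alpha !(ns_atom sq) e0 e1 cE -uv.
have a01 : 0 < alpha W la S (~` S) < 1.
  have d0 : 0 < 1 - fine (la S) by lra.
  rewrite /alpha cE mulr_gt0 ?exprn_gt0//=; apply: le_lt_trans s1.
  by rewrite ler_piMr ?exprn_ile1// ltW//; lra.
apply: (marker_iso eb Wu Wm ms bl (nat_marked (i := 0%N) (j := 1%N) isT sn) (nat_marked (i := 0%N) (j := 1%N) isT sn') a01).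
- exact: (alN _ _ _ sn).
- exact: (alN _ _ _ sn').
- by rewrite -/(bent la) -/(bent rho) (ns_ent sn) ph.
- by rewrite -/(bent la) -/(bent rho') (ns_ent sn') qh.
Qed.

Lemma point_law (l : L) : la [set l] = 1%E -> forall B, measurable B ->
  m B = (if asbool (B (fun=> l)) then 1 else 0)%E.
Proof.
move=> l1; have ml := singleton_meas cb l.
pose N := \bigcup_t ~` [set x : power_space G dL L | x t = l].
have mN t : measurable [set x : power_space G dL L | x t = l] := coord_preimage t ml.
have N0 : m N = 0%E.
  apply: (measure0_bigcupG eb) => t; first by apply: measurableC.
  rewrite (probability_setC m (mN t)).
  have := mP (s := [:: t]) (A := fun=> [set l]) isT (fun=> ml); rewrite big_seq1 l1 => <-.
  rewrite (_ : cylinder _ _ = [set x : power_space G dL L | x t = l]) ?subee ?fin_num_measure//.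
  by seteq => x /=; [apply; exact: mem_head|move=> E u; rewrite inE => /eqP ->].
have mN' : measurable N by apply: (bigcupG eb) => t; exact: measurableC.
have NP x : ~ N x -> x = fun=> l.
  by move=> nx; apply/funext => t; apply: contrapT => h; apply: nx; exists t.
have null B : measurable B -> B `<=` N -> m B = 0%E.
  by move=> mB BN; apply/eqP; rewrite -measure_le0 -N0; apply: le_meas.
move=> B mB; case: asboolP => Bl; last first.
  by apply: null => // x Bx; apply: contrapT => /NP E; apply: Bl; rewrite -E.
have : m (~` B) = 0%E.
  by apply: null; [exact: measurableC|move=> x nB; apply: contrapT => /NP E; apply: nB; rewrite E].
rewrite (probability_setC m mB) -(fineK (fin_num_measure m B mB)) -EFinB => -[/eqP].
by rewrite subr_eq0 => /eqP <-.
Qed.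

Lemma point_ent (l : L) : la [set l] = 1%E -> bent la = 0%E.
Proof.
move=> l1; have ml := singleton_meas cb l.
have l0 : la (~` [set l]) = 0%E by rewrite (probability_setC la ml) l1 subee.
rewrite /bent (ge0_negligible_integral (measurableC ml) measurableT (linfo_meas la cb) _ l0); last first.
  by move=> x _; exact: (linfo_ge0 la cb).
rewrite setTD setCK (eq_integral (cst 0%E)) ?integral0// => x; rewrite inE => ->.
by rewrite /linfo l1 /nl /= oner_eq0 ln1 oppr0.
Qed.

Lemma event_or_point : (exists2 S : set L, measurable S & 0 < fine (la S) < 1) \/
  exists l, la [set l] = 1%E.
Proof.
have [h|nh] := pselect (exists2 S : set L, measurable S & 0 < fine (la S) < 1); [by left|right].
apply: (point_mass cb) => S mS; apply: contrapT => /not_orP[n0 n1]; apply: nh; exists S => //.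
have fS := fin_num_measure la S mS.
rewrite !lt_neqAle fine_ge0//= -lee_fin fineK// probability_le1// andbT eq_sym.
by apply/and3P; split => //; apply/eqP => E; [apply: n0|apply: n1]; rewrite -(fineK fS) E.
Qed.

End base.

Lemma H2_gt0 (s : R) : 0 < s < 1 -> 0 < H2 s.
Proof.
move=> /andP[s0 s1]; have : 0 < eta s by rewrite oppr_gt0 pmulr_rlt0// ln_lt0// s0.
have h : 0 <= eta (1 - s) by apply: eta_ge0; lra.
by move=> h'; rewrite /H2; lra.
Qed.

Lemma gap (x : R) (h : \bar R) : (x%:E < h)%E -> exists2 g, 0 < g & ((x + g)%:E <= h)%E.
Proof.
case: h => [h| |]//; last by exists 1; rewrite ?leey.
by rewrite lte_fin => xh; exists (h - x); rewrite ?subr_gt0// lee_fin addrC subrK.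
Qed.

Lemma eta_merge (v r : R) : 0 < v -> 0 < r -> eta (v + r) <= eta v + eta r.
Proof.
move=> v0 r0; have h1 : ln v <= ln (v + r) by rewrite ler_ln ?posrE ?addr_gt0// lerDl ltW.
have h2 : ln r <= ln (v + r) by rewrite ler_ln ?posrE ?addr_gt0// lerDr ltW.
have := ler_wpM2l (ltW v0) h1; have := ler_wpM2l (ltW r0) h2; rewrite /eta; lra.
Qed.

(** Each base is linked to one over [nat], with an atom [u], respectively [u']. Two intermediate
    laws of the same entropy, with atoms [u], [ep] and [u'], [ep], join these: neighbours in the
    chain share [u], then [ep], then [u']. Bases without an event of intermediate mass are point
    masses and are isomorphic by constant maps. *)
Lemma bernoulli_iso dL dK (L : measurableType dL) (K : measurableType dK)
    (la : probability L R) (kappa : probability K R) (sL : standard_borel R L) (sK : standard_borel R K)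
    (m : probability (power_space G dL L) R) (n : probability (power_space G dK K) R) :
  is_product_measure la m -> is_product_measure kappa n ->
  shannon_entropy la = shannon_entropy kappa ->
  exists f f', ae_iso m n (@vshift G dL L) (@vshift G dK K) f f'.
Proof.
move=> mP nP; have [bL [decL cbL]] := standard_base sL; have [bK [decK cbK]] := standard_base sK.
rewrite -(info_shannon la cbL) -(info_shannon kappa cbK) -/(bent la) -/(bent kappa) => hh.
have pos d (T : measurableType d) (mu : probability T R) (b : T -> nat -> bool) dec (S : set T) : coded_base b dec ->
    measurable S -> 0 < fine (mu S) < 1 -> bent mu <> 0%E.
  by move=> cb mS s01 E; have := event_ent cb mS s01; rewrite E lee_fin leNgt H2_gt0.
have [[S mS s01]|[l l1]] := event_or_point la cbL; have [[T mT t01]|[k k1]] := event_or_point kappa cbK; last 3 first.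
- by case: (pos _ _ _ _ _ _ cbL mS s01); rewrite hh (point_ent cbK k1).
- by case: (pos _ _ _ _ _ _ cbK mT t01); rewrite -hh (point_ent cbL l1).
- have lm := point_law cbL mP l1; have kn := point_law cbK nP k1.
  have cst_null d (X : measurableType d) (c : X) (mu : probability X R) : measurable [set c] -> mu [set c] = 1%E ->
      mu.-negligible [set x | c <> x].
    move=> mc c1; exists (~` [set c]); split; [exact: measurableC|by rewrite probability_setC// c1 subee|].
    by move=> x /= h E; apply: h.
  have pt d (X : measurableType d) (b : X -> nat -> bool) dec (cb : coded_base b dec) (x : X) : measurable [set ((fun=> x) : power_space G d X)].
    rewrite (_ : [set _] = ~` \bigcup_t ~` [set z : power_space G d X | z t = x]).
      apply: measurableC; apply: (bigcupG eb) => t; apply: measurableC.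
      exact: (coord_preimage t (singleton_meas cb x)).
    seteq => z /=; first by move=> -> [t _]; apply.
    by move=> h; apply/funext => t; apply: contrapT => h'; apply: h; exists t.
  exists (fun=> (fun=> k)), (fun=> (fun=> l)); split => //.
  + move=> B mB; rewrite kn// lm; last by rewrite preimage_cst; case: ifP.
    by [].
  + move=> B mB; rewrite lm// kn; last by rewrite preimage_cst; case: ifP.
    by [].
  + by apply: cst_null; [exact: pt cbL _|rewrite lm ?asboolT//; exact: pt cbL _].
  + by apply: cst_null; [exact: pt cbK _|rewrite kn ?asboolT//; exact: pt cbK _].
have [p [rho [q [u [v [r [sp ph pu [u0 v0 r0 uvr ult]]]]]]]] := link_nat cbL mP mS s01.
have [p' [rho' [q' [u' [v' [r' [sp' ph' pu' [u0' v0' r0' uvr' ult']]]]]]]] := link_nat cbK nP mT t01.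
move=> [f' [g' iso']] [f [g iso]].
have [g1 g10 hg1] := gap ult; have [g2 g20 hg2] := gap ult'.
have d0 : 0 < Num.min (1 - u) (1 - u') by rewrite lt_min; apply/andP; split; lra.
have gg : 0 < Num.min g1 g2 by rewrite lt_min g10.
(* So small that the laws with atoms [u], [ep] and [u'], [ep] and one further atom still have
   entropy strictly below the common one; [c] and [c'] have exactly these smaller entropies and
   serve as third bases. *)
have [ep [ep0 epd epg]] := small_eta gg d0.
move: epd epg; rewrite !lt_min => /andP[eu eu'] /andP[eg1 eg2].
have small w v1 r1 gp : 0 < w -> 0 < v1 -> 0 < r1 -> w + v1 + r1 = 1 -> ep < 1 - w -> ep + eta ep < gp ->
    eta w + eta ep + eta (1 - w - ep) < eta w + eta v1 + eta r1 + gp.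
  move=> w0 v10 r10 E ew egp; have x0 : 0 < 1 - w - ep by lra.
  have h1 := @eta_split _ (1 - w - ep) ep x0 ep0; rewrite subrK in h1.
  have h2 : eta (1 - w - ep) <= eta (1 - w) + ep by apply: h1; lra.
  have := eta_merge v10 r10; have -> : v1 + r1 = 1 - w by lra.
  lra.
have lt1 : ((eta u + eta ep + eta (1 - u - ep))%:E < bent la)%E.
  by apply: lt_le_trans hg1; rewrite lte_fin small.
have lt2 : ((eta u' + eta ep + eta (1 - u' - ep))%:E < bent la)%E.
  by rewrite hh; apply: lt_le_trans hg2; rewrite lte_fin small.
have w0 : 0 < 1 - u - ep by lra.
have w0' : 0 < 1 - u' - ep by lra.
have s1 : u + ep + (1 - u - ep) = 1 by ring.
have s1' : u' + ep + (1 - u' - ep) = 1 by ring.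
have [a [ap ah a0 a1]] := pmf_extend u0 ep0 w0 s1 (ltW lt1).
have [a' [ap' ah' a0' a1']] := pmf_extend u0' ep0 w0' s1' (ltW lt2).
have [c [cp ch c0 c1]] := pmf_extend u0 ep0 w0 s1 (lexx _).
have [c' [cp' ch' c0' c1']] := pmf_extend u0' ep0 w0' s1' (lexx _).
have [ra [ma sa]] := nat_system_exists ap; have [ra' [ma' sa']] := nat_system_exists ap'.
have [rc [mc sc]] := nat_system_exists cp; have [rc' [mc' sc']] := nat_system_exists cp'.
have [f1 [g1' iso1]] : exists f1 f1', ae_iso q ma (@vshift G _ nat) (@vshift G _ nat) f1 f1'.
  apply: (nat_iso (i := 0%N) (j := 1%N) isT sp sa sc); rewrite ?pu ?a0 ?c0 ?ph ?ah ?ch//.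
  by apply/andP; split => //; lra.
have [f2 [g2' iso2]] : exists f2 f2', ae_iso ma ma' (@vshift G _ nat) (@vshift G _ nat) f2 f2'.
  apply: (nat_iso (i := 1%N) (j := 0%N) isT sa sa' sc); rewrite ?a1 ?a1' ?c1 ?ah ?ah' ?ch//.
  by apply/andP; split => //; lra.
have [f3 [g3' iso3]] : exists f3 f3', ae_iso q' ma' (@vshift G _ nat) (@vshift G _ nat) f3 f3'.
  apply: (nat_iso (i := 0%N) (j := 1%N) isT sp' sa' sc'); rewrite ?pu' ?a0' ?c0' ?ph' -?hh ?ah' ?ch'//.
  by apply/andP; split => //; lra.
have := ae_iso_trans (ae_iso_trans iso iso1) (ae_iso_trans iso2 (ae_iso_trans (ae_iso_sym iso3) (ae_iso_sym iso'))).
by move=> h; eexists; eexists; exact: h.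
Qed.

End chain.

Local Close Scope ring_scope.

Theorem theorem1p1 (R : realType) (G : groupType)
    (G_countably_infinite : ([set: G] #= [set: nat])%card)
    (dL dK : measure_display) (L : measurableType dL) (K : measurableType dK)
    (lambda : probability L R) (kappa : probability K R)
    (L_standard : standard_borel R L) (K_standard : standard_borel R K)
    (lambdaG : probability (power_space G dL L) R)
    (kappaG : probability (power_space G dK K) R)
    (lambdaG_product : is_product_measure lambda lambdaG)
    (kappaG_product : is_product_measure kappa kappaG) :
  shannon_entropy lambda = shannon_entropy kappa ->
  pmp_isomorphic lambdaG kappaG
    (bernoulli_shift G dL L) (bernoulli_shift G dK K).
Proof.
move=> entLK; have [e eb] : exists e : nat -> G, bijective e.
  have /card_set_bijP[f] := G_countably_infinite.
  by rewrite setTT_bijective => -[g fK gK]; exists g; exists f.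
have [f [f' iso]] := bernoulli_iso eb L_standard K_standard lambdaG_product kappaG_product entLK.
by apply: (ae_iso_pmp eb (shift_action lambdaG_product) (shift_action kappaG_product) _ _ iso) => g x;
  apply/funext => t; rewrite /vshift /bernoulli_shift.
Qed.
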